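(* Let $A$ be a connected homotopy Segal shuffle dg (pre-)cooperad. The collection $B^c(A)=\{B^c(A)(r),\,r>0\}$, where $$B^c(A)(r)=\bigoplus_{T\in\mathrm{Tree}(r)}\Sigma^{-\sharp V(T)}A(T),$$ equipped with the total differential $\delta+\partial$ (the internal differential plus the cobar twisting map $\partial$) and with the composition products $\circ_{i_p}$ induced by the Segal maps of $A$ (all described in the context), forms a shuffle operad in dg modules, the cobar construction of $A$.
   Context: **Dg modules.** Fix a commutative ground ring $\mathbb k$. Dg modules are $\mathbb Z$-graded $\mathbb k$-modules with a differential $\delta$ lowering the (lower) degree by one; upper gradings are converted by $M_n=M^{-n}$. Tensor products follow the Koszul sign rule. **Cubical cochains.** $I=N^*(\Delta^1)=\mathbb k\underline 0^\sharp\oplus\mathbb k\underline 1^\sharp\oplus\mathbb k\underline{01}^\sharp$ with $\delta\underline 0^\sharp=-\underline{01}^\sharp$, $\delta\underline 1^\sharp=\underline{01}^\sharp$, and the usual cup product; $I^k=I^{\otimes k}$ (a dg algebra), with factors numbered from right to left. Let $d_0,d_1:I\to\mathbb k$ with $d_0(\underline 1^\sharp)=1$, $d_1(\underline 0^\sharp)=1$ and zero on the other basis elements, $s_0:\mathbb k\to I$, $s_0(1)=\underline 0^\sharp+\underline 1^\sharp$, and $\nabla^*:I\to I\otimes I$, $\nabla^*(\underline 0^\sharp)=\underline 0^\sharp\otimes\underline 0^\sharp+\underline 1^\sharp\otimes\underline 0^\sharp+\underline 0^\sharp\otimes\underline 1^\sharp$, $\nabla^*(\underline 1^\sharp)=\underline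 1^\sharp\otimes\underline 1^\sharp$, $\nabla^*(\underline{01}^\sharp)=\underline{01}^\sharp\otimes\underline 1^\sharp+\underline 1^\sharp\otimes\underline{01}^\sharp$. Put $d^i_\epsilon=\mathrm{id}^{\otimes k-i}\otimes d_\epsilon\otimes\mathrm{id}^{\otimes i-1}:I^k\to I^{k-1}$ ($1\le i\le k$), and $s^j:I^{k-1}\to I^k$ by $s^0=\mathrm{id}^{\otimes k-1}\otimes s_0$, $s^j=\mathrm{id}^{\otimes k-j-1}\otimes\nabla^*\otimes\mathrm{id}^{\otimes j-1}$ ($1\le j\le k-1$), $s^k=s_0\otimes\mathrm{id}^{\otimes k-1}$. **Trees.** $\mathrm{Tree}(r)$, $r>0$, is the category of rooted trees with leaves numbered $1,\dots,r$, one root edge, at least one vertex, and such that every vertex has exactly one outgoing edge and at least one ingoing edge; morphisms are composites of isomorphisms (preserving leaf numbers) and contractions of inner edges. Trees have no non-trivial automorphisms and one representative per isomorphism class is chosen; leaves may also be labelled by any finite totally ordered set. $V(T)$ and $\mathring E(T)$ are the sets of vertices and inner edges; inner edges are oriented towards the root (from source to target). A subtree $\Sigma\subset S$ is a connected subtree with at least one vertex, containing all edges adjacent to its vertices; its leaves are ordered by the minimal label of the leaves of $S$ above them. For $f:T\to S$, $\Sigma\subset S$, $f^{-1}\Sigma\subset T$ is the subtree with $V(f^{-1}\Sigma)=f^{-1}V(\Sigma)$. A decomposition $T=\lambda_S(\Sigma_v,v\in V(S))$ expresses $T$ as the result of substituting trees $\Sigma_v\subset T$ for the vertices of $S$. A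 tree is reduced if each vertex has at least two ingoing edges. Vertices are ordered using the canonical planar embedding (ingoing edges of a vertex ordered by minimal leaf label above), the root vertex first. **Homotopy Segal shuffle dg (pre-)cooperads.** A homotopy Segal shuffle dg pre-cooperad is a collection of dg modules $A(T)$, $T\in\mathrm{Tree}(r)$, $r>0$, with dg module morphisms $\rho_{T\to T_k\to\dots\to T_1\to S}:A(S)\to A(T)\otimes I^k$ for all composable sequences $T\xrightarrow{f_k}T_k\to\dots\to T_1\xrightarrow{f_0}S$, $k\ge0$, with $\rho_{S=S}=\mathrm{id}$, and (0-faces) $(\mathrm{id}\otimes d^i_0)\rho_{T\to T_k\to\dots\to S}=\rho_{T\to\cdots\widehat{T_i}\cdots\to S}$, $1\le i\le k$; (1-faces) $(\mathrm{id}\otimes d^i_1)\rho_{T\to T_k\to\dots\to S}=(\rho_{T\to T_k\to\dots\to T_i}\otimes\mathrm{id}_{I^{i-1}})\circ\rho_{T_i\to\dots\to T_1\to S}$, $1\le i\le k$; (degeneracies) $(\mathrm{id}\otimes s^j)\rho_{T\to T_{k-1}\to\dots\to T_1\to S}=\rho_{T\to\cdots T_j=T_j\cdots\to S}$, $0\le j\le k$ ($T_0=S$, $T_k=T$); together with dg module morphisms (Segal maps) $i_{\lambda_S(\Sigma_* )}:\bigotimes_{v\in V(S)}A(\Sigma_v)\to A(T)$ for all decompositions $T=\lambda_S(\Sigma_v)$, equal to the identity for the trivial decomposition over a corolla, satisfying $i_{\lambda_U(\Theta_* )}\circ\bigotimes_u i_{\lambda_{S_u}(\Sigma_* )}=i_{\lambda_S(\Sigma_*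 )}$ for nested decompositions $T=\lambda_U(\Theta_u)$, $\Theta_u=\lambda_{S_u}(\Sigma_v)$, $S=\lambda_U(S_u)$, and compatible with coproducts: for $S=\lambda_U(\Sigma_v,v\in V(U))$ and a composable sequence of tree morphisms $T\xrightarrow{f_k}T_k\to\dots\to T_1\xrightarrow{f_0}S$, $k\ge0$, with composite $f:T\to S$, $\rho_{T\to\dots\to S}\circ i_{\lambda_U(\Sigma_* )}=(i_{\lambda_U(f^{-1}\Sigma_* )}\otimes\mu)\circ\tau\circ\bigotimes_v\rho_{f^{-1}\Sigma_v\to\dots\to f_0^{-1}\Sigma_v\to\Sigma_v}$, where $\tau$ is the evident tensor permutation and $\mu:\bigotimes_v I^k\to I^k$ is the product. It is a homotopy Segal shuffle dg cooperad if all Segal maps are quasi-isomorphisms. It is connected if $A(T)=0$ for all non-reduced $T$. **Cobar construction.** Write $\rho_{T\to T_k\to\dots\to S}(x)=(-1)^{k\deg x}\rho^\square_{T\to T_k\to\dots\to S}(x)\otimes(\underline{01}^\sharp)^{\otimes k}+(\text{tensors with a factor of dimension}<k\text{ in }I^k)$; $\rho^\square$ is a homomorphism of degree $k$. Write $\Sigma^{-\sharp V(T)}A(T)=\bigl(\bigotimes_{v\in V(T)}\underline{01}^\sharp_v\bigr)\otimes A(T)$ with each $\underline{01}^\sharp_v$ of lower degree $-1$ (permutations of factors produce signs). $\delta$ is induced by the internal differentials of the $A(T)$. For a tree $T$ and $e\in\mathring E(T)$ with source $u$ and target $v$, let $b_e$ be the degree $-1$ blow-up map $\underline{01}^\sharp_{u\equiv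 v}\mapsto\underline{01}^\sharp_u\otimes\underline{01}^\sharp_v$ from the vertex tensor of $T/e$ to that of $T$, applied with Koszul signs, $u\equiv v$ being the merged vertex. For an ordered sequence $\underline e=(e_1,\dots,e_m)$, $m\ge1$, of pairwise distinct inner edges of $T$, put $\sigma(T,\underline e)=\{T\to T/e_1\to T/\{e_1,e_2\}\to\dots\to T/\{e_1,\dots,e_m\}\}$ and let $\partial_{(T,\underline e)}=(-1)^{m-1}(b_{e_1}\circ\dots\circ b_{e_m})\otimes\rho^\square_{\sigma(T,\underline e)}:\Sigma^{-\sharp V(T)+m}A(T/\{e_1,\dots,e_m\})\to\Sigma^{-\sharp V(T)}A(T)$ (Koszul sign rule for tensor products of homomorphisms). Then $\partial=\sum_{m\ge1}\sum_{(T,(e_1,\dots,e_m))}\partial_{(T,(e_1,\dots,e_m))}$, a finite sum on each summand since $A$ is connected. **Composition products and shuffle operads.** A (non-unital) shuffle operad in dg modules is a collection $P(r)$, $r>0$ (extended to finite totally ordered index sets by order-preserving bijections), with dg module morphisms $\circ_{i_p}:P(\{i_1<\dots<i_k\})\otimes P(\{j_1<\dots<j_l\})\to P(\{1<\dots<r\})$ for all $\{1<\dots<r\}=\{i_1<\dots<\widehat{i_p}<\dots<i_k\}\amalg\{j_1<\dots<j_l\}$ with $i_{p-1}<j_1<i_{p+1}$, satisfying the usual (sequential and parallel) associativity relations of operadic partial composition products. On $B^c(A)$, $\circ_{i_p}$ is the sum over $S\in\mathrm{Tree}(\{i_1<\dots<i_k\})$, $T\in\mathrm{Tree}(\{j_1<\dots<j_l\})$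 of the maps $\Sigma^{-\sharp V(S)}A(S)\otimes\Sigma^{-\sharp V(T)}A(T)\to\Sigma^{-\sharp V(S\circ_{i_p}T)}A(S\circ_{i_p}T)$ given by the Segal map $A(S)\otimes A(T)\to A(S\circ_{i_p}T)$ of the grafting $S\circ_{i_p}T$ (root of $T$ glued to leaf $i_p$ of $S$) and the concatenation of vertex tensors, with Koszul signs. *)

(* Defs.v *)
(* The development is in MathComp; [boolp] (MathComp-Analysis) is only used to
   give the direct sums below their eqType/choiceType structure. *)
From HB Require Import structures.
From mathcomp Require Import all_boot all_order all_algebra.
From mathcomp Require Import boolp.

Set Implicit Arguments.
Unset Strict Implicit.
Unset Printing Implicit Defensive.

Import GRing.Theory.

(** * Rooted trees *)

(* A rooted tree with vertices 'I_(nvp + 1), root vertex ord0, and leaves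
   0, ..., size att - 1 (the leaf numbered j + 1 on paper is j here).
   [par v] is the target of the outgoing edge of v (and [par root = root] by
   convention, as the root edge has no target); [nth _ att j] is the target of
   the edge of leaf j. An inner edge is identified with its source, so that the
   inner edges are the vertices v != root. *)
Record rawtree := RawTree {
  nvp : nat;
  par : {ffun 'I_nvp.+1 -> 'I_nvp.+1};
  att : seq 'I_nvp.+1 }.

Definition V (T : rawtree) : finType := 'I_(nvp T).+1.
Definition troot (T : rawtree) : V T := ord0.
Definition nv (T : rawtree) : nat := (nvp T).+1.
Definition nl (T : rawtree) : nat := size (att T).

Definition rawtree_code (T : rawtree) :
    {n : nat & ({ffun 'I_n.+1 -> 'I_n.+1} * seq 'I_n.+1)%type} :=
  existT _ (nvp T) (par T, att T).
Definition rawtree_decode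
    (u : {n : nat & ({ffun 'I_n.+1 -> 'I_n.+1} * seq 'I_n.+1)%type}) : rawtree :=
  RawTree (tagged u).1 (tagged u).2.
Lemma rawtree_codeK : cancel rawtree_code rawtree_decode.
Proof. by case. Qed.
HB.instance Definition _ := Countable.copy rawtree (can_type rawtree_codeK).

(* The third clause says that every vertex has at least one ingoing edge (a leaf
   or an inner edge). *)
Definition valid (T : rawtree) : bool :=
  [&& par T (troot T) == troot T,
      [forall v : V T, fconnect (par T) v (troot T)] &
      [forall v : V T,
         (v \in att T) || [exists w : V T, (w != troot T) && (par T w == v)]]].

(* f exhibits S as the tree T / E obtained from T by contracting the inner edges
   in E (i.e. the outgoing edges of the vertices in E): each class of merged
   vertices is represented by its unique vertex outside E, the one closest to
   the root. *)
Definition is_contr (T S : rawtree) (E : {set V T}) (f : {ffun V T -> V S}) : bool :=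
  [&& (troot T \notin E) && (f (troot T) == troot S),
      [seq f v | v <- att T] == att S,
      [forall v in E, f v == f (par T v)],
      [forall v in ~: E, par S (f v) == f (par T v)] &
      [forall w : V S, #|[set v in ~: E | f v == w]| == 1]].

(* Contractions of inner edges followed by an isomorphism; this class contains
   the isomorphisms and the contractions of one inner edge, and is closed under
   composition ([contr_comp] below). *)
Definition is_mor (T S : rawtree) (f : {ffun V T -> V S}) : bool :=
  [exists E : {set V T}, is_contr E f].

Definition iso (T S : rawtree) : bool :=
  [exists f : {ffun V T -> V S}, is_contr set0 f].

(* The chosen representative of the isomorphism class of T. *)
Definition canon (T : rawtree) : rawtree := choose (iso T) T.

(* The objects of all the categories Tree(r): Tree(r) is [{T : tree | nl T = r}].
   A tree with leaves labelled by a finite totally ordered set is replaced by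
   the tree obtained by numbering the labels increasingly. *)
Record tree := Tree {
  tree_val :> rawtree;
  treeP : valid tree_val && (canon tree_val == tree_val) }.
HB.instance Definition _ := [isSub for tree_val].
HB.instance Definition _ := [Countable of tree by <:].

Lemma contr_id (T : rawtree) : is_contr set0 [ffun v : V T => v].
Proof.
rewrite /is_contr inE ffunE eqxx /=; apply/and4P; split.
- by apply/eqP; rewrite -[RHS]map_id; apply: eq_map => v; rewrite ffunE.
- by apply/forallP => v; rewrite inE.
- by apply/forallP => v; rewrite !ffunE eqxx implybT.
- apply/forallP => w; rewrite (_ : [set v in _ | _] = [set w]) ?cards1 //.
  by apply/setP => v; rewrite !inE ffunE.
Qed.

Lemma contr_comp (T S U : rawtree) E F (f : {ffun V T -> V S}) (g : {ffun V S -> V U}) :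
  is_contr E f -> is_contr F g ->
  is_contr (E :|: [set v in ~: E | f v \in F]) [ffun v => g (f v)].
Proof.
case/and5P => /andP[rE /eqP fr] /eqP fatt /forall_inP fE /forall_inP fN /forallP fb.
case/and5P => /andP[rF /eqP gr] /eqP gatt /forall_inP gF /forall_inP gN /forallP gb.
have fE' v : v \in E -> f v = f (par T v) by move/fE/eqP.
have gF' v : v \in F -> g v = g (par S v) by move/gF/eqP.
have fN' v : v \notin E -> par S (f v) = f (par T v).
  by move=> h; apply/eqP/fN; rewrite inE.
have gN' v : v \notin F -> par U (g v) = g (par S v).
  by move=> h; apply/eqP/gN; rewrite inE.
apply/and5P; split.
- by rewrite !inE ffunE fr gr eqxx (negPf rE) (negPf rF).
- by rewrite -gatt -fatt -map_comp; apply/eqP/eq_map => v; rewrite ffunE.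
- apply/forall_inP => v; rewrite !inE !ffunE.
  case: (boolP (v \in E)) => [/fE' -> // | vE] /= vF.
  by rewrite gF' // fN'.
- apply/forall_inP => v; rewrite !inE !ffunE negb_or => /andP[vE].
  by rewrite vE /= => vF; rewrite gN' // fN'.
- apply/forallP => w.
  have /cards1P[u eu] := gb w; have /cards1P[v ev] := fb u.
  have : u \in [set u] by rewrite inE.
  rewrite -eu !inE => /andP[uF /eqP gu].
  have : v \in [set v] by rewrite inE.
  rewrite -ev !inE => /andP[vE /eqP fv].
  rewrite (_ : [set x in _ | _] = [set v]) ?cards1 //.
  apply/setP => x; rewrite !inE ffunE negb_or.
  apply/idP/eqP => [/andP[/andP[xE]] | ->]; last first.
    by rewrite vE fv uF gu eqxx.
  rewrite xE /= => xF gx.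
  have : f x \in [set u] by rewrite -eu !inE xF gx.
  rewrite inE => /eqP fx.
  by apply/set1P; rewrite -ev !inE xE fx eqxx.
Qed.

Lemma iso_refl T : iso T T.
Proof. by apply/existsP; exists [ffun v => v]; apply: contr_id. Qed.

Lemma iso_trans T S U : iso T S -> iso S U -> iso T U.
Proof.
case/existsP => f hf /existsP[g hg]; apply/existsP; exists [ffun v => g (f v)].
have := contr_comp hf hg; congr is_contr.
by apply/setP => v; rewrite !inE.
Qed.

Lemma iso_sym T S : iso T S -> iso S T.
Proof.
case/existsP => f /and5P[/andP[_ /eqP fr] /eqP fatt _ /forall_inP fN /forallP fb].
have inj : injective f.
  move=> x y fxy; have /cards1P[z ez] := fb (f y).
  have hx : x \in [set z] by rewrite -ez !inE fxy eqxx.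
  have hy : y \in [set z] by rewrite -ez !inE eqxx.
  by rewrite (set1P hx) (set1P hy).
have sur w : exists v, f v = w.
  have /cards1P[z ez] := fb w; exists z.
  by have := set11 z; rewrite -ez !inE => /eqP.
pose g : {ffun V S -> V T} := [ffun w => odflt (troot T) [pick v | f v == w]].
have gf v : g (f v) = v.
  rewrite ffunE; case: pickP => [u /eqP/inj // | /(_ v)]; by rewrite eqxx.
have fg w : f (g w) = w by case: (sur w) => v <-; rewrite gf.
apply/existsP; exists g; apply/and5P; split.
- by rewrite inE -fr gf eqxx.
- by rewrite -fatt -map_comp; apply/eqP; rewrite -[RHS]map_id; apply: eq_map => v /=; rewrite gf.
- by apply/forall_inP => v; rewrite inE.
- apply/forall_inP => w _; apply/eqP/inj.
  by rewrite fg -(eqP (fN _ _)) ?fg // !inE.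
- apply/forallP => v; apply/cards1P; exists (f v); apply/setP => w; rewrite !inE /=.
  by apply/eqP/eqP => [<- | ->]; rewrite ?fg ?gf.
Qed.

Lemma canon_iso T : iso T (canon T).
Proof. exact/chooseP/iso_refl. Qed.

Lemma canon_eq T S : iso T S -> canon T = canon S.
Proof.
move=> h; have e : iso T =1 iso S.
  by move=> U; apply/idP/idP; apply: iso_trans => //; apply: iso_sym.
by rewrite /canon (eq_choose e); apply: choose_id; [apply: iso_sym | apply: iso_refl].
Qed.

Lemma canonK T : canon (canon T) = canon T.
Proof. by rewrite -(canon_eq (canon_iso T)). Qed.

Lemma valid_iso T S : iso T S -> valid T -> valid S.
Proof.
case/existsP => f /and5P[/andP[_ /eqP fr] /eqP fatt _ /forall_inP fN /forallP fb].
case/and3P => /eqP rT /forallP cT /forallP iT.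
have fN' v : par S (f v) = f (par T v) by apply/eqP/fN; rewrite !inE.
have sur w : exists v, f v = w.
  have /cards1P[z ez] := fb w; exists z.
  by have := set11 z; rewrite -ez !inE => /eqP.
have inj : injective f.
  move=> x y fxy; have /cards1P[z ez] := fb (f y).
  have hx : x \in [set z] by rewrite -ez !inE fxy eqxx.
  have hy : y \in [set z] by rewrite -ez !inE eqxx.
  by rewrite (set1P hx) (set1P hy).
apply/and3P; split.
- by rewrite -fr fN' rT.
- apply/forallP => w; have [v <-] := sur w; rewrite -fr.
  have /iter_findex <- := cT v.
  suff -> n : f (iter n (par T) v) = iter n (par S) (f v) by apply: fconnect_iter.
  by elim: n => //= n <-; rewrite fN'.
- apply/forallP => w; have [v <-] := sur w.
  case/orP: (iT v) => [h | /existsP[u /andP[ur /eqP uv]]].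
    by rewrite -fatt map_f.
  apply/orP; right; apply/existsP; exists (f u).
  by rewrite fN' uv eqxx -fr (inj_eq inj) ur.
Qed.

Section Contraction.
Variables (T : rawtree) (e : V T).

(* Contraction of the outgoing edge of e: the vertex e is removed and merged
   with its parent. *)
Definition cparent (v : V T) : V T := if v == e then par T v else v.

Definition cproj : V T -> 'I_(nvp T).-1.+1 :=
  fun v => inord (unbump e (cparent v)).

Definition rcontr : rawtree :=
  @RawTree (nvp T).-1 [ffun i : 'I_(nvp T).-1.+1 => cproj (par T (inord (bump e i)))]
    [seq cproj v | v <- att T].

Hypotheses (vT : valid T) (er : e != troot T).

Lemma par_neq : par T e != e.
Proof.
apply/eqP => h; case/and3P: vT => _ /forallP /(_ e) /iter_findex.
have -> n : iter n (par T) e = e by elim: n => //= n ->.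
by move/eqP; rewrite (negPf er).
Qed.

Lemma nvp_gt0 : 0 < nvp T.
Proof.
rewrite lt0n; apply/eqP => n0; move/negP: er; apply; apply/eqP/val_inj => /=.
by have := ltn_ord e; rewrite [X in _ < X.+1]n0 ltnS leqn0 => /eqP.
Qed.

Lemma cparent_neq v : cparent v != e.
Proof. by rewrite /cparent; case: (eqVneq v e) => [-> | //]; exact: par_neq. Qed.

Lemma cprojE v : val (cproj v) = unbump e (cparent v).
Proof.
rewrite /cproj /= inordK // prednK ?nvp_gt0 // /unbump.
have := ltn_ord (cparent v); have := cparent_neq v; rewrite -val_eqE /=.
have := ltn_ord e; move: (nat_of_ord e) (nat_of_ord (cparent v)) => a b.
case: (ltngtP a b) => //= ab a_lt _ b_lt; rewrite ?subn0 ?subn1.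
  by case: b ab b_lt.
by apply: leq_trans ab _; rewrite -ltnS.
Qed.

Lemma bump_lt (i : 'I_(nvp T).-1.+1) : bump e i < (nvp T).+1.
Proof.
have h : i < nvp T by case: i => i /=; rewrite prednK ?nvp_gt0.
by rewrite ltnS /bump; case: (e <= i); [exact: h | exact: (ltnW h)].
Qed.

Lemma csecK (i : 'I_(nvp T).-1.+1) : cproj (inord (bump e i)) = i.
Proof.
have lt := bump_lt i.
apply: val_inj; rewrite cprojE /cparent -val_eqE /= inordK //.
by rewrite (negPf (_ : bump e i != e)) ?inordK ?bumpK // eq_sym neq_bump.
Qed.

Lemma cprojK v : v != e -> inord (bump e (cproj v)) = v :> V T.
Proof.
by move=> ve; rewrite cprojE /cparent (negPf ve) unbumpK ?inord_val.
Qed.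

Lemma cproj_root : cproj (troot T) = ord0.
Proof.
apply: val_inj; rewrite cprojE /cparent eq_sym (negPf er) /= /unbump.
by rewrite ltn0 subn0.
Qed.

Lemma cproj_e : cproj e = cproj (par T e).
Proof. by rewrite /cproj /cparent eqxx (negPf par_neq). Qed.

Lemma csec_neq (i : 'I_(nvp T).-1.+1) : (inord (bump e i) : V T) != e.
Proof.
have lt := bump_lt i.
by rewrite -val_eqE /= inordK // eq_sym neq_bump.
Qed.

Lemma rcontrP : is_contr [set e] ([ffun v => cproj v] : {ffun V T -> V rcontr}).
Proof.
apply/and5P; split.
- by rewrite inE eq_sym er ffunE cproj_root.
- by apply/eqP; apply: eq_map => v; rewrite ffunE.
- by apply/forall_inP => v /set1P ->; rewrite !ffunE cproj_e.
- by apply/forall_inP => v; rewrite !inE => ve; rewrite !ffunE cprojK.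
- apply/forallP => w; apply/cards1P; exists (inord (bump e w)).
  apply/setP => v; rewrite !inE ffunE; apply/andP/eqP => [[ve /eqP <-] | ->].
    by rewrite cprojK.
  by rewrite csec_neq csecK.
Qed.

Lemma rcontr_valid : valid rcontr.
Proof.
have /and3P[/eqP pr /forallP cT /forallP iT] := vT.
have pE v : v != e -> par rcontr (cproj v) = cproj (par T v).
  by move=> ve; rewrite /= ffunE cprojK.
have cr v : v != troot T -> v != e -> cproj v != troot rcontr.
  move=> vr ve; apply/eqP => h; move/eqP: vr; apply.
  by rewrite -(cprojK ve) h -[troot rcontr]cproj_root cprojK // eq_sym.
apply/and3P; split.
- by rewrite /= ffunE -[troot rcontr]cproj_root cprojK ?pr // eq_sym.
- apply/forallP => w; rewrite -(csecK w) -[troot rcontr]cproj_root.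
  move: (inord _) => v; have /iter_findex <- := cT v.
  elim: (findex _ _ _) => //= n IHn.
  case: (eqVneq (iter n (par T) v) e) => [E | ne].
    by rewrite E -cproj_e; rewrite E in IHn.
  by rewrite -pE //; apply: connect_trans IHn (fconnect1 _ _).
- apply/forallP => w; rewrite -(csecK w).
  move: (inord _) (csec_neq w) => v ve.
  case/orP: (iT v) => [h | /existsP[u /andP[ur /eqP uv]]].
    by rewrite /= map_f.
  case: (eqVneq u e) => [ue | ue]; last first.
    apply/orP; right; apply/existsP; exists (cproj u).
    by rewrite cr // pE // uv eqxx.
  have -> : cproj v = cproj e by rewrite cproj_e -ue uv.
  case/orP: (iT e) => [h | /existsP[t /andP[tr /eqP te]]].
    by rewrite /= map_f.
  apply/orP; right; apply/existsP; exists (cproj t).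
  have nte : t != e by apply/eqP => E; move: par_neq; rewrite -{1}E te eqxx.
  by rewrite cr // pE // te eqxx.
Qed.

End Contraction.

Record mor (T S : tree) := Mor {
  mfun :> {ffun V T -> V S};
  morP : is_mor mfun }.

Lemma mor_id_subproof (T : tree) : is_mor [ffun v : V T => v].
Proof. by apply/existsP; exists set0; apply: contr_id. Qed.

Definition mor_id (T : tree) : mor T T := Mor (mor_id_subproof T).

Lemma mor_comp_subproof (T S U : tree) (f : mor T S) (g : mor S U) :
  is_mor [ffun v => g (f v)].
Proof.
case/existsP: (morP f) => E hf; case/existsP: (morP g) => F hg.
by apply/existsP; exists (E :|: [set v in ~: E | f v \in F]); apply: contr_comp.
Qed.

(* The composite T -f-> S -g-> U. *)
Definition mor_comp (T S U : tree) (f : mor T S) (g : mor S U) : mor T U :=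
  Mor (mor_comp_subproof f g).

Lemma contract_tree_subproof (T : tree) (e : V T) : e != troot T ->
  valid (canon (rcontr e)) && (canon (canon (rcontr e)) == canon (rcontr e)).
Proof.
move=> er; have /andP[vT _] := treeP T.
by rewrite canonK eqxx andbT (valid_iso (canon_iso _)) // rcontr_valid.
Qed.

Definition iso_map (T S : rawtree) : {ffun V T -> V S} :=
  odflt [ffun=> troot S] [pick f : {ffun V T -> V S} | is_contr set0 f].

Lemma contract_map_subproof (T : tree) (e : V T) (er : e != troot T) :
  is_contr [set e]
    [ffun v => iso_map (rcontr e) (Tree (contract_tree_subproof er)) (cproj e v)].
Proof.
have /andP[vT _] := treeP T.
have hg : is_contr set0 (iso_map (rcontr e) (canon (rcontr e))).
  rewrite /iso_map; case: pickP => // h.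
  by case/existsP: (canon_iso (rcontr e)) => g; rewrite h.
have := contr_comp (rcontrP vT er) hg; congr is_contr.
  by apply/setP => v; rewrite !inE andbF orbF.
by apply/ffunP => v; rewrite !ffunE.
Qed.

Lemma contract_mor_subproof (T : tree) (e : V T) (er : e != troot T) :
  is_mor
    [ffun v => iso_map (rcontr e) (Tree (contract_tree_subproof er)) (cproj e v)].
Proof. by apply/existsP; exists [set e]; apply: contract_map_subproof. Qed.

(* T / e with the contraction T -> T / e; the dummy value for e = root, which is
   not an inner edge, is the identity of T. *)
Definition contract (T : tree) (e : V T) : {S : tree & mor T S} :=
  match boolP (e != troot T) with
  | AltTrue er => existT _ (Tree (contract_tree_subproof er))
                           (Mor (contract_mor_subproof er))
  | AltFalse _ => existT _ T (mor_id T)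
  end.

Definition quot1 (T : tree) (e : V T) : tree := tag (contract e).
Definition quot1_mor (T : tree) (e : V T) : mor T (quot1 e) := tagged (contract e).

Definition reduced (T : tree) : bool :=
  [forall v : V T,
     2 <= count_mem v (att T) + #|[set w : V T | (w != troot T) && (par T w == v)]|].

(** ** The canonical order of the vertices *)

(* The smallest label of a leaf above v (above the outgoing edge of v). *)
Definition minlabel (T : rawtree) (v : V T) : nat :=
  find (fun a => fconnect (par T) a v) (att T).

(* The sequence of minimal labels along the path from the root to v. The
   depth-first order of the canonical planar embedding (root vertex first,
   ingoing edges ordered by minimal leaf label) is the lexicographic order of
   these sequences. *)
Definition vkey (T : rawtree) (v : V T) : seq nat :=
  [seq minlabel u | u <- rev (orbit (par T) v)].

Fixpoint lexlt (s t : seq nat) : bool :=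
  match s, t with
  | _, [::] => false
  | [::], _ :: _ => true
  | x :: s', y :: t' => (x < y) || ((x == y) && lexlt s' t')
  end.

Definition vlt (T : rawtree) (u v : V T) : bool := lexlt (vkey u) (vkey v).

Definition vseq (T : rawtree) : seq (V T) :=
  sort (fun u v => ~~ vlt v u) (enum (V T)).

(* The exponent of the Koszul sign of the permutation which takes a tensor
   product indexed by the vertices listed in w, with factors of degree n, to the
   tensor product in the canonical order. *)
Fixpoint koszul (T : rawtree) (n : V T -> nat) (w : seq (V T)) : nat :=
  match w with
  | [::] => 0
  | a :: w' => \sum_(b <- w' | vlt b a) n a * n b + koszul n w'
  end.

(** ** Subtrees and decompositions *)

(* The ingoing edges of a set X of vertices that do not come from X, as pairs
   (minimal label of a leaf above the edge, target of the edge). *)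
Definition in_edges (T : rawtree) (X : {set V T}) : seq (nat * V T) :=
  [seq (j, nth (troot T) (att T) j) | j <- iota 0 (nl T)
                                   & nth (troot T) (att T) j \in X] ++
  [seq (minlabel w, par T w) | w <- enum (V T)
     & [&& w != troot T, w \notin X & par T w \in X]].

(* i identifies F with (the representative of) a subtree of T. *)
Definition is_subtree (F T : rawtree) (i : {ffun V F -> V T}) : bool :=
  [&& injectiveb i,
      [forall v : V F, (v != troot F) ==> (par T (i v) == i (par F v))] &
      [seq i v | v <- att F] ==
      [seq p.2 | p <- sort (fun p q => p.1 <= q.1) (in_edges [set v in codom i])]].

Record subtree (F T : tree) := Subtree {
  sfun :> {ffun V F -> V T};
  subtreeP : is_subtree sfun }.

(* A decomposition T = lambda_S(F v, v in V(S)): a morphism T -> S, whose fibre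
   over the vertex v is the subtree F v. *)
Record decomp (T S : tree) (F : V S -> tree) := Decomp {
  dmor : mor T S;
  demb : forall v, subtree (F v) T;
  dembP : forall v u, (u \in codom (demb v)) = (dmor u == v) }.
Arguments decomp : clear implicits.

(** ** Composable sequences of tree morphisms *)

(* [mseq T S] is the type of the sequences T -> T_k -> ... -> T_1 -> S, k >= 0,
   listed from T to S; [mdim] is k. *)
Inductive mseq : tree -> tree -> Type :=
| MLast T S of mor T S : mseq T S
| MCons T U S of mor T U & mseq U S : mseq T S.

Fixpoint mdim T S (c : mseq T S) : nat :=
  match c with MLast _ _ _ => 0 | MCons _ _ _ _ c' => (mdim c').+1 end.

(* T -> ... -> U -> ... -> S, keeping U. *)
Fixpoint mcat T U (c : mseq T U) : forall S, mseq U S -> mseq T S :=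
  match c in mseq T U return forall S, mseq U S -> mseq T S with
  | MLast _ _ f => fun S d => MCons f d
  | MCons _ _ _ f c' => fun S d => MCons f (mcat c' d)
  end.

Definition mprecomp T U S (f : mor T U) (c : mseq U S) : mseq T S :=
  match c in mseq U S return mor T U -> mseq T S with
  | MLast _ _ g => fun f => MLast (mor_comp f g)
  | MCons _ _ _ g c' => fun f => MCons (mor_comp f g) c'
  end f.

(* T -> ... -> U -> ... -> S, with U omitted. *)
Fixpoint mglue T U (c : mseq T U) : forall S, mseq U S -> mseq T S :=
  match c in mseq T U return forall S, mseq U S -> mseq T S with
  | MLast _ _ f => fun S d => mprecomp f d
  | MCons _ _ _ f c' => fun S d => MCons f (mglue c' d)
  end.

(* For f : T -> S, g is the restriction F' = f^-1 F -> F of f to the subtree F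
   of S. *)
Definition restr1 (T S F' F : tree) (i' : subtree F' T) (i : subtree F S)
    (f : mor T S) (g : mor F' F) : Prop :=
  (forall v, (v \in codom i') = (f v \in codom i)) /\
  (forall v, i (g v) = f (i' v)).

(* The restriction f^-1 F -> ... -> f_0^-1 F -> F of a composable sequence. *)
Inductive restr (S F : tree) (i : subtree F S) :
    forall T F', subtree F' T -> mseq T S -> mseq F' F -> Prop :=
| RLast T F' (i' : subtree F' T) f g :
    restr1 i' i f g -> restr i i' (MLast f) (MLast g)
| RCons T F' (i' : subtree F' T) U G (j : subtree G U) f g c d :
    restr1 i' j f g -> restr i j c d -> restr i i' (MCons f c) (MCons g d).

(** * Dg modules *)

Local Open Scope ring_scope.

(* A Z-graded module is the direct sum of its homogeneous components, which are
   encoded by the projections [gm_proj n] onto them. Degrees are lower degrees. *)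
Record gradedModule (R : comPzRingType) := GradedModule {
  gm_car :> lmodType R;
  gm_proj : int -> {linear gm_car -> gm_car};
  gm_proj_proj : forall m n x,
    gm_proj m (gm_proj n x) = if m == n then gm_proj n x else 0;
  gm_fin : forall x, exists2 s : seq int,
    uniq s & x = \sum_(n <- s) gm_proj n x }.

Definition homog (R : comPzRingType) (M : gradedModule R) (n : int) (x : M) : Prop :=
  gm_proj M n x = x.

Record dgStructure (R : comPzRingType) (M : gradedModule R) := DgStructure {
  dg_diff :> {linear M -> M};
  dg_diff_deg : forall n x, homog n x -> homog (n - 1) (dg_diff x);
  dg_diff_sq : forall x, dg_diff (dg_diff x) = 0 }.

Record dgModule (R : comPzRingType) := DgModule {
  dg_gm :> gradedModule R;
  dg_str : dgStructure dg_gm }.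

Definition dg (R : comPzRingType) (M : dgModule R) : {linear M -> M} := dg_str M.

(** * Cubical cochains *)

(* The basis 0^#, 1^#, 01^# of I. *)
Inductive cell := C0 | C1 | C01.

Definition cell_code (x : cell) : 'I_3 :=
  match x with C0 => inord 0 | C1 => inord 1 | C01 => inord 2 end.
Definition cell_decode (i : 'I_3) : cell := nth C0 [:: C0; C1; C01] i.
Lemma cell_codeK : cancel cell_code cell_decode.
Proof. by case; rewrite /cell_decode inordK. Qed.
HB.instance Definition _ := Finite.copy cell (can_type cell_codeK).

(* A basis element of I^k is a word of length k, written as on paper: its last
   letter is the factor number 1. An element of M (x) I^k is a function
   [seq cell -> M] supported on the words of length k, the function z standing
   for the sum of the z w (x) w. *)

(* Cochain dimension; the lower degree of w is the opposite. *)
Definition wdim (w : seq cell) : nat := count_mem C01 w.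

Section Cochains.
Variable R : comPzRingType.

(* Structure constants of I. *)
Definition delta1 (x y : cell) : R :=
  match x, y with C0, C01 => -1 | C1, C01 => 1 | _, _ => 0 end.

Definition cup1 (x y z : cell) : R :=
  match x, y, z with
  | C0, C0, C0 | C1, C1, C1 | C0, C01, C01 | C01, C1, C01 => 1
  | _, _, _ => 0
  end.

(* d_0 for eps = false, d_1 for eps = true *)
Definition d1 (eps : bool) (x : cell) : R :=
  match x with C0 => eps%:R | C1 => (~~ eps)%:R | C01 => 0 end.

Definition s1 (y : cell) : R :=
  match y with C0 | C1 => 1 | C01 => 0 end.

Definition nabla1 (x y z : cell) : R :=
  match x, y, z with
  | C0, C0, C0 | C0, C1, C0 | C0, C0, C1
  | C1, C1, C1
  | C01, C01, C1 | C01, C1, C01 => 1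
  | _, _, _ => 0
  end.

(* Matrices in the bases of words of the operators on the I^k: for an operator
   phi, [phi b w] is the coefficient of w in phi(b). *)

Fixpoint deltaw (b w : seq cell) : R :=
  match b, w with
  | x :: b', y :: w' =>
      delta1 x y * (b' == w')%:R + (-1) ^+ wdim [:: x] * (x == y)%:R * deltaw b' w'
  | _, _ => 0
  end.

(* d^i_eps on I^k *)
Definition dface (eps : bool) (k i : nat) (b w : seq cell) : R :=
  d1 eps (nth C0 b (k - i)) * (w == take (k - i) b ++ drop (k - i).+1 b)%:R.

(* s^j : I^(k-1) -> I^k *)
Definition sdeg (k j : nat) (b w : seq cell) : R :=
  if j == 0 then \sum_(y : cell) s1 y * (w == rcons b y)%:R
  else if j == k then \sum_(y : cell) s1 y * (w == y :: b)%:R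
  else \sum_(y : cell) \sum_(z : cell) nabla1 (nth C0 b (k - j - 1)) y z *
         (w == take (k - j - 1) b ++ [:: y; z] ++ drop (k - j) b)%:R.

(* The coefficient of w in the product a * b in I^k = I^(x)k, with the Koszul
   sign of the permutation of the first letter of b with the rest of a. *)
Fixpoint cupw (a b w : seq cell) : R :=
  match a, b, w with
  | [::], [::], [::] => 1
  | x :: a', y :: b', z :: w' =>
      (-1) ^+ (wdim [:: y] * wdim a') * cup1 x y z * cupw a' b' w'
  | _, _, _ => 0
  end.

(* Elements of I^k as functions on words, and the k-fold operations on them. *)
Definition cupI (k : nat) (f g : seq cell -> R) (w : seq cell) : R :=
  \sum_(a : k.-tuple cell) \sum_(b : k.-tuple cell) f a * g b * cupw a b w.

Definition unitI (k : nat) (w : seq cell) : R :=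
  ((size w == k) && (C01 \notin w))%:R.

(* The coefficient of w in mu(b_1 (x) ... (x) b_n), for a list of words of I^k. *)
Definition muI (k : nat) (bs : seq (k.-tuple cell)) : seq cell -> R :=
  foldr (fun b : k.-tuple cell => cupI k (fun a => (a == b :> seq cell)%:R)) (unitI k) bs.

(* id (x) phi on M (x) I^k *)
Definition actI (M : lmodType R) (k : nat) (phi : seq cell -> seq cell -> R)
    (z : seq cell -> M) (w : seq cell) : M :=
  \sum_(b : k.-tuple cell) phi b w *: z b.

(* The differential of M (x) I^k, for an element z of total degree n. *)
Definition tens_diff (M : dgModule R) (k : nat) (n : int) (z : seq cell -> M)
    (w : seq cell) : M :=
  dg M (z w) +
  \sum_(b : k.-tuple cell)
     ((-1) ^+ absz (n + (wdim b)%:Z) * deltaw b w) *: z b.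

End Cochains.

(** * Homotopy Segal shuffle dg pre-cooperads *)

(* Elements of tensor products are only considered through (multi)linear maps:
   a morphism out of a tensor product of A(F v), v in V(S), is a multilinear map
   on the families x of elements x v of A(F v), and tensor products over V(S)
   are taken in the canonical order [vseq S]. *)
Record preCooperad (R : comPzRingType) := PreCooperad {
  obj :> tree -> dgModule R;

  (* [rho c w x] is the coefficient in A(T) of the basis element w of I^k in
     rho_c(x). *)
  rho : forall T S : tree, mseq T S -> seq cell -> {linear obj S -> obj T};
  rho_supp : forall T S (c : mseq T S) w x, size w != mdim c -> rho c w x = 0;
  rho_deg : forall T S (c : mseq T S) w n x,
    homog n x -> homog (n + (wdim w)%:Z) (rho c w x);
  rho_dg : forall T S (c : mseq T S) w n x, homog n x ->
    rho c w (dg (obj S) x) = tens_diff (mdim c) n (fun b => rho c b x) w;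
  rho_id : forall T x, rho (MLast (mor_id T)) [::] x = x;

  (* T_i is the middle tree U of the sequence T -> ... -> U -> ... -> S. *)
  rho_face0 : forall T U S (c : mseq T U) (d : mseq U S) x w,
    let k := (mdim c + mdim d).+1 in let i := (mdim d).+1 in
    actI k (dface R false k i) (fun b => rho (mcat c d) b x) w =
    rho (mglue c d) w x;
  rho_face1 : forall T U S (c : mseq T U) (d : mseq U S) x w,
    let k := (mdim c + mdim d).+1 in let i := (mdim d).+1 in
    actI k (dface R true k i) (fun b => rho (mcat c d) b x) w =
    rho c (take (k - i) w) (rho d (drop (k - i) w) x);

  rho_degen_first : forall T S (c : mseq T S) x w,
    let k := (mdim c).+1 in
    actI (mdim c) (sdeg R k 0) (fun b => rho c b x) w =
    rho (mcat c (MLast (mor_id S))) w x;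
  rho_degen_last : forall T S (c : mseq T S) x w,
    let k := (mdim c).+1 in
    actI (mdim c) (sdeg R k k) (fun b => rho c b x) w =
    rho (MCons (mor_id T) c) w x;
  rho_degen_mid : forall T U S (c : mseq T U) (d : mseq U S) x w,
    let k := (mdim c + mdim d).+2 in let j := (mdim d).+1 in
    actI k.-1 (sdeg R k j) (fun b => rho (mcat c d) b x) w =
    rho (mcat c (MCons (mor_id U) d)) w x;

  segal : forall (T S : tree) (F : V S -> tree), decomp T S F ->
    (forall v, obj (F v)) -> obj T;
  segal_linear : forall (T S : tree) (F : V S -> tree) (D : decomp T S F) x v a
      (y z : obj (F v)),
    segal D (@dfwith _ (fun u => obj (F u)) x v (a *: y + z)) =
    a *: segal D (@dfwith _ (fun u => obj (F u)) x v y) +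
    segal D (@dfwith _ (fun u => obj (F u)) x v z);
  segal_deg : forall (T S : tree) (F : V S -> tree) (D : decomp T S F) x n,
    (forall v, homog (n v) (x v)) -> homog (\sum_v n v) (segal D x);
  segal_dg : forall (T S : tree) (F : V S -> tree) (D : decomp T S F) x n,
    (forall v, homog (n v) (x v)) ->
    dg (obj T) (segal D x) =
    \sum_v (-1) ^+ (\sum_(u | vlt u v) absz (n u))%N *:
      segal D (@dfwith _ (fun u => obj (F u)) x v (dg (obj (F v)) (x v)));
  segal_id : forall (T S : tree) (D : decomp T S (fun=> T)) x,
    nv S = 1%N -> segal D x = x (troot S);
  segal_assoc : forall (T S U : tree) (F : V S -> tree) (G : V U -> tree)
      (W : V U -> tree)
      (D : decomp T S F) (E : decomp S U W) (D' : decomp T U G)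
      (Du : forall u, decomp (G u) (W u) (fun v => F (demb E u v)))
      (x : forall v, obj (F v)) (n : V S -> int),
    (forall u t, demb E u (dmor (Du u) t) = dmor D (demb D' u t)) ->
    (forall v, homog (n v) (x v)) ->
    segal D' (fun u => segal (Du u) (fun v => x (demb E u v))) =
    (-1) ^+ koszul (fun v => absz (n v))
              [seq demb E u v | u <- vseq U, v <- vseq (W u)] *:
      segal D x;

  (* The sign is that of tau, which moves the factors b u in I^k to the right of
     the factors rho (cc v) (b v) (x v), u before v. *)
  segal_rho : forall (T S U : tree) (F G : V U -> tree)
      (D : decomp S U F) (D' : decomp T U G) (c : mseq T S)
      (cc : forall v, mseq (G v) (F v)) (x : forall v, obj (F v)) (n : V U -> int) w,
    (forall v, restr (demb D v) (demb D' v) c (cc v)) ->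
    (forall v, homog (n v) (x v)) ->
    rho c w (segal D x) =
    \sum_(b : {ffun V U -> (mdim c).-tuple cell})
      ((-1) ^+ (\sum_u \sum_(v | vlt u v)
                  wdim (b u) * absz (n v + (wdim (b v))%:Z)%R)%N *
       muI R [seq b v | v <- vseq U] w) *:
      segal D' (fun v => rho (cc v) (b v) (x v)) }.

Definition connected (R : comPzRingType) (A : preCooperad R) : Prop :=
  forall T : tree, ~~ reduced T -> forall x : A T, x = 0.

(** * Shuffle operads *)

Section ShuffleIndices.
Variable r : nat.
Implicit Types X Y J : {set 'I_r}.

(* The position (from 0) of j in X. *)
Definition rank X (j : 'I_r) : nat := #|[set i in X | (i < j)%N]|.

(* The image in 'I_s of Y (a subset of X) under the order-preserving numbering
   of the elements of X, for s = #|X|. *)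
Definition renumber X Y (s : nat) : {set 'I_s} :=
  [set a : 'I_s | [exists y in Y :&: X, rank X y == a]].

(* The index set {i_1 < ... < i_k} of a partial composition with
   {j_1 < ... < j_l} = J. Since i_(p-1) < j_1 < i_(p+1), the label i_p, which is
   not an element of {1 < ... < r}, can be taken to be j_1 = min J. *)
Definition slots J : {set 'I_r} :=
  [set i | (i \notin J) || [forall j in J, (i <= j)%N]].

Definition shuffle (k l : nat) J : bool :=
  [&& (0 < l)%N, #|J| == l & k + l == r.+1]%N.

End ShuffleIndices.

(* A collection P(r), r > 0: P(0) does not occur in the composition products, as
   [shuffle k l J] implies that k, l and r are positive (and B^c(A)(0) = 0 below,
   since every tree has a leaf). P(X) = P(#|X|) for a finite totally ordered
   set X. [scomp h] is the composition product o_{i_p} with {j_1 < ... < j_l} = J. *)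
Record shuffleOperad (R : comPzRingType) (P : nat -> dgModule R) := ShuffleOperad {
  scomp : forall (k l r : nat) (J : {set 'I_r}), shuffle k l J -> P k -> P l -> P r;
  scomp_linearl : forall k l r (J : {set 'I_r}) (h : shuffle k l J) a x x' y,
    scomp h (a *: x + x') y = a *: scomp h x y + scomp h x' y;
  scomp_linearr : forall k l r (J : {set 'I_r}) (h : shuffle k l J) a x y y',
    scomp h x (a *: y + y') = a *: scomp h x y + scomp h x y';
  scomp_deg : forall k l r (J : {set 'I_r}) (h : shuffle k l J) m n x y,
    homog m x -> homog n y -> homog (m + n) (scomp h x y);
  scomp_dg : forall k l r (J : {set 'I_r}) (h : shuffle k l J) m x y,
    homog m x ->
    dg (P r) (scomp h x y) =
    scomp h (dg (P k) x) y + (-1) ^+ absz m *: scomp h x (dg (P l) y);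
  (* (x o y) o z = x o (y o z), with z on the labels K, y o z on J *)
  scomp_seq : forall k l m q s r (J K : {set 'I_r})
      (hK : shuffle s m K) (hJ' : shuffle k l (renumber (slots K) J s))
      (hJ : shuffle k q J) (hK' : shuffle l m (renumber J K q)) x y z,
    K \subset J ->
    scomp hK (scomp hJ' x y) z = scomp hJ x (scomp hK' y z);
  (* (x o y) o z = +- (x o z) o y, with y on the labels J and z on K *)
  scomp_par : forall k l m s t r (J K : {set 'I_r})
      (hK : shuffle s m K) (hJ' : shuffle k l (renumber (slots K) J s))
      (hJ : shuffle t l J) (hK' : shuffle k m (renumber (slots J) K t))
      i j x y z,
    [disjoint J & K] -> homog i y -> homog j z ->
    scomp hK (scomp hJ' x y) z =
    (-1) ^+ (absz i * absz j) *: scomp hJ (scomp hK' x z) y }.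

(** * The cobar construction *)

(* The direct sum of the A(T), T in Tree(r): families with finite support. *)
Record dsum (R : comPzRingType) (A : preCooperad R) (r : nat) := Dsum {
  dfun :> forall T : tree, A T;
  dfunP : (exists s : seq tree, forall T, T \notin s -> dfun T = 0) /\
          (forall T : tree, nl T <> r -> dfun T = 0) }.

Section DirectSum.
Variables (R : comPzRingType) (A : preCooperad R) (r : nat).
Implicit Types x y z : dsum A r.

HB.instance Definition _ := gen_eqMixin (dsum A r).
HB.instance Definition _ := gen_choiceMixin (dsum A r).

Lemma dsum_ext x y : (forall T, x T = y T) -> x = y.
Proof.
case: x y => [f hf] [g hg] /= fg.
have e : f = g by apply: functional_extensionality_dep.
by subst g; congr Dsum; apply: Prop_irrelevance.
Qed.

Lemma dsum_zero_subproof :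
  (exists s : seq tree, forall T : tree, T \notin s -> 0 = 0 :> A T) /\
  (forall T : tree, nl T <> r -> 0 = 0 :> A T).
Proof. by split=> //; exists [::]. Qed.
Definition dsum_zero : dsum A r := @Dsum R A r (fun T => 0) dsum_zero_subproof.

Lemma dsum_opp_subproof x :
  (exists s : seq tree, forall T : tree, T \notin s -> - x T = 0) /\
  (forall T : tree, nl T <> r -> - x T = 0).
Proof.
case: (dfunP x) => [[s hs] hr]; split=> [|T h]; last by rewrite hr // oppr0.
by exists s => T h; rewrite hs // oppr0.
Qed.
Definition dsum_opp x : dsum A r := Dsum (dsum_opp_subproof x).

Lemma dsum_add_subproof x y :
  (exists s : seq tree, forall T : tree, T \notin s -> x T + y T = 0) /\
  (forall T : tree, nl T <> r -> x T + y T = 0).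
Proof.
case: (dfunP x) (dfunP y) => [[s hs] hr] [[t ht] hr'].
split=> [|T h]; last by rewrite hr // hr' // addr0.
by exists (s ++ t) => T; rewrite mem_cat negb_or => /andP[/hs -> /ht ->]; rewrite addr0.
Qed.
Definition dsum_add x y : dsum A r := Dsum (dsum_add_subproof x y).

Lemma dsum_scale_subproof a x :
  (exists s : seq tree, forall T : tree, T \notin s -> a *: x T = 0) /\
  (forall T : tree, nl T <> r -> a *: x T = 0).
Proof.
case: (dfunP x) => [[s hs] hr]; split=> [|T h]; last by rewrite hr // scaler0.
by exists s => T h; rewrite hs // scaler0.
Qed.
Definition dsum_scale a x : dsum A r := Dsum (dsum_scale_subproof a x).

Lemma dsum_addA : associative dsum_add.
Proof. by move=> x y z; apply: dsum_ext => T /=; rewrite addrA. Qed.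
Lemma dsum_addC : commutative dsum_add.
Proof. by move=> x y; apply: dsum_ext => T /=; rewrite addrC. Qed.
Lemma dsum_add0 : left_id dsum_zero dsum_add.
Proof. by move=> x; apply: dsum_ext => T /=; rewrite add0r. Qed.
Lemma dsum_addN : left_inverse dsum_zero dsum_opp dsum_add.
Proof. by move=> x; apply: dsum_ext => T /=; rewrite addNr. Qed.
HB.instance Definition _ :=
  GRing.isZmodule.Build (dsum A r) dsum_addA dsum_addC dsum_add0 dsum_addN.

Lemma dsum_scaleA a b x : dsum_scale a (dsum_scale b x) = dsum_scale (a * b) x.
Proof. by apply: dsum_ext => T /=; rewrite scalerA. Qed.
Lemma dsum_scale1 : left_id 1 dsum_scale.
Proof. by move=> x; apply: dsum_ext => T /=; rewrite scale1r. Qed.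
Lemma dsum_scaleDr : right_distributive dsum_scale +%R.
Proof. by move=> a x y; apply: dsum_ext => T /=; rewrite scalerDr. Qed.
Lemma dsum_scaleDl x : {morph dsum_scale^~ x : a b / a + b}.
Proof. by move=> a b; apply: dsum_ext => T /=; rewrite scalerDl. Qed.
HB.instance Definition _ := GRing.Zmodule_isLmodule.Build R (dsum A r)
  dsum_scaleA dsum_scale1 dsum_scaleDr dsum_scaleDl.

(* The grading of Sigma^(- # V(T)) A(T): the element x T of A(T) stands for
   01^#_{v_1} (x) ... (x) 01^#_{v_n} (x) x T, with v_1, ..., v_n the vertices of
   T in the canonical order. *)
Lemma bproj_subproof (n : int) x :
  (exists s : seq tree, forall T : tree, T \notin s ->
     gm_proj (A T) (n + (nv T)%:Z) (x T) = 0) /\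
  (forall T : tree, nl T <> r -> gm_proj (A T) (n + (nv T)%:Z) (x T) = 0).
Proof.
case: (dfunP x) => [[s hs] hr]; split=> [|T h]; last by rewrite hr // linear0.
by exists s => T h; rewrite hs // linear0.
Qed.
Definition bproj (n : int) x : dsum A r := Dsum (bproj_subproof n x).

Lemma bproj_linear n : linear (bproj n).
Proof. by move=> a x y; apply: dsum_ext => T /=; rewrite linearP. Qed.
HB.instance Definition _ n :=
  GRing.isLinear.Build R (dsum A r) (dsum A r) *:%R (bproj n) (bproj_linear n).

Lemma bproj_proj m n x : bproj m (bproj n x) = if m == n then bproj n x else 0.
Proof.
apply: dsum_ext => T /=; rewrite gm_proj_proj (inj_eq (addIr _)).
by case: eqP.
Qed.

Lemma dsum_sumE (I : Type) (s : seq I) (F : I -> dsum A r) T :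
  (\sum_(i <- s) F i) T = \sum_(i <- s) F i T.
Proof. by elim: s => [|i s IHs]; rewrite ?big_nil // !big_cons -IHs. Qed.

Lemma gm_fin_sub (M : gradedModule R) (x : M) (s t : seq int) :
  uniq s -> uniq t -> {subset s <= t} -> x = \sum_(n <- s) gm_proj M n x ->
  x = \sum_(n <- t) gm_proj M n x.
Proof.
move=> us ut st xs.
have out n : n \notin s -> gm_proj M n x = 0.
  move=> ns; rewrite xs linear_sum big1_seq // => m /andP[_ ms].
  by rewrite gm_proj_proj; case: eqP => // nm; rewrite nm ms in ns.
rewrite [RHS](bigID (mem s)) /= [X in _ + X]big1 => [|n]; last exact: out.
rewrite {1}xs addr0 -[in RHS]big_filter; apply: perm_big.
apply: uniq_perm => //; first exact: filter_uniq.
by move=> n; rewrite mem_filter /=; apply/idP/andP => [h | []//]; split=> //; apply: st.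
Qed.

Lemma bproj_fin x : exists2 s : seq int, uniq s & x = \sum_(n <- s) bproj n x.
Proof.
case: (dfunP x) => [[ts hts] _].
have [s us hs] : exists2 s : seq int, uniq s & forall T, T \in ts ->
    x T = \sum_(n <- s) gm_proj (A T) (n + (nv T)%:Z) (x T).
  elim: ts {hts} => [|T ts [s us hs]]; first by exists [::].
  have [t ut ht] := gm_fin (x T).
  pose t' := [seq n - (nv T)%:Z | n <- t].
  pose st := undup (s ++ t').
  have e U : x U = \sum_(n <- [seq n + (nv U)%:Z | n <- st]) gm_proj (A U) n (x U) ->
      x U = \sum_(n <- st) gm_proj (A U) (n + (nv U)%:Z) (x U).
    by rewrite big_map.
  have ust (U : tree) : uniq [seq n + (nv U)%:Z | n <- st].
    by rewrite map_inj_uniq ?undup_uniq //; apply: addIr.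
  exists st; first exact: undup_uniq.
  move=> U; rewrite inE => /orP[/eqP -> | Uts]; apply: e.
    apply: gm_fin_sub ut (ust T) _ ht => n nt; apply/mapP.
    exists (n - (nv T)%:Z); last by rewrite subrK.
    by rewrite mem_undup mem_cat /t' (map_f (fun m : int => m - (nv T)%:Z) nt) orbT.
  have us' : uniq [seq n + (nv U)%:Z | n <- s] by rewrite map_inj_uniq //; apply: addIr.
  apply: gm_fin_sub us' (ust U) _ _; last by rewrite big_map -hs.
  move=> _ /mapP[n ns ->]; apply: map_f.
  by rewrite mem_undup mem_cat ns.
exists s => //; apply: dsum_ext => T; rewrite dsum_sumE.
case: (boolP (T \in ts)) => [/hs // | /hts xT].
by rewrite xT big1 //= => n _; rewrite xT linear0.
Qed.

(* B^c(A)(r) *)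
Definition Bc : gradedModule R :=
  @GradedModule R (dsum A r) (fun n => bproj n) bproj_proj bproj_fin.

End DirectSum.

(** ** The twisting map *)

(* For T0 with a map f : V(T0) -> V(T) (in practice, T is a quotient of T0 by
   inner edges) and inner edges e1, es of T0: the tree T / {e1, es}, and the
   sequence T -> T / e1 -> ... -> T / {e1, es}. *)
Fixpoint quots_from (T0 T : tree) (f : V T0 -> V T) (e1 : V T0) (es : seq (V T0)) :
    tree :=
  match es with
  | [::] => quot1 (f e1)
  | e2 :: es' => quots_from (fun v => quot1_mor (f e1) (f v)) e2 es'
  end.

Fixpoint sigma_from (T0 T : tree) (f : V T0 -> V T) (e1 : V T0) (es : seq (V T0)) :
    mseq T (quots_from f e1 es) :=
  match es with
  | [::] => MLast (quot1_mor (f e1))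
  | e2 :: es' =>
      MCons (quot1_mor (f e1))
            (sigma_from (fun v => quot1_mor (f e1) (f v)) e2 es')
  end.

(* T / {e_1, ..., e_m} and sigma(T, (e_1, ..., e_m)), m = size es + 1 *)
Definition quots (T : tree) (e1 : V T) (es : seq (V T)) : tree :=
  quots_from id e1 es.
Definition sigma (T : tree) (e1 : V T) (es : seq (V T)) : mseq T (quots e1 es) :=
  sigma_from id e1 es.

(* The blow-up map b_e for the contraction f : T -> T / e of one inner edge e,
   on vertex tensors (-1)^(t.1) 01^#_{x_1} (x) ... (x) 01^#_{x_n} given by t.1
   and the word t.2 = x_1 ... x_n: the merged vertex is replaced by the source
   and the target of e, with the sign given by the number of factors on its
   left. *)
Definition blowup (T S : tree) (f : mor T S) (t : nat * seq (V S)) :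
    nat * seq (V T) :=
  let e := odflt (troot T) [pick u | (u != troot T) && (f u == f (par T u))] in
  (t.1 + index (f e) t.2,
   flatten [seq if x == f e then [:: e; par T e]
                else [seq y <- enum (V T) | f y == x] | x <- t.2])%N.

(* b_{e_1} o ... o b_{e_m} for a sequence of contractions of one inner edge *)
Fixpoint blowups (T S : tree) (c : mseq T S) : nat * seq (V S) -> nat * seq (V T) :=
  match c in mseq T S return nat * seq (V S) -> nat * seq (V T) with
  | MLast _ _ f => fun t => blowup f t
  | MCons _ _ _ f c' => fun t => blowup f (blowups c' t)
  end.

(* The exponent of the sign relating the image under b_{e_1} o ... o b_{e_m} of
   the canonically ordered vertex tensor of S to that of T; permutations of the
   factors 01^#_v, of odd degree, produce signs. *)
Definition blowup_sign (T S : tree) (c : mseq T S) : nat :=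
  let t := blowups c (0%N, vseq S) in (t.1 + koszul (fun=> 1%N) t.2)%N.

Section Cobar.
Variables (R : comPzRingType) (A : preCooperad R).

(* rho^square_c(x), for x homogeneous of degree n *)
Definition rho_square (T S : tree) (c : mseq T S) (n : int) (x : A S) : A T :=
  (-1) ^+ (mdim c * absz n) *: rho A c (nseq (mdim c) C01) x.

(* The component in A(T) of the twisting map applied to x of degree n in
   B^c(A)(r), for the sequence of edges e_1, es; x (quots e1 es) has degree
   n + nv (quots e1 es) in A(quots e1 es). The second sign comes from the
   permutation of rho^square, of degree m - 1 = size es, with the vertex
   tensor. *)
Definition twist_term (r : nat) (n : int) (x : dsum A r) (T : tree)
    (e1 : V T) (es : seq (V T)) : A T :=
  let S := quots e1 es in
  (-1) ^+ (size es + size es * nv S + blowup_sign (sigma e1 es)) *: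
    rho_square (sigma e1 es) (n + (nv S)%:Z) (x S).

Definition twist (r : nat) (n : int) (x : dsum A r) (T : tree) : A T :=
  \sum_(m < nv T)
    \sum_(e : m.+1.-tuple (V T) | uniq e && (troot T \notin e))
      twist_term n x (thead e) (behead e).

(* d is delta + the twisting map; delta goes through the nv T factors 01^#_v. *)
Definition is_cobar_diff (r : nat) (d : Bc A r -> Bc A r) : Prop :=
  forall (n : int) (x : Bc A r), homog n x -> forall T : tree,
    (d x : dsum A r) T =
    (-1) ^+ nv T *: dg (A T) ((x : dsum A r) T) + twist n x T.

End Cobar.

(** ** The composition products *)

(* R is the grafting of T on S: f and g identify the vertices of R with those of
   S and T, the root of T is glued to the leaf i_p = min J of S (see [slots]),
   the other leaves of S are labelled by the complement of J and those of T by
   J. *)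
Definition is_graft (r : nat) (J : {set 'I_r}) (S T R : tree)
    (f : V S -> V R) (g : V T -> V R) : Prop :=
  [/\ injective f, injective g & forall w, (w \in codom g) = (w \notin codom f)] /\
  [/\ f (troot S) = troot R,
      forall v, v != troot S -> par R (f v) = f (par S v),
      forall j, j \in J :&: slots J ->
        par R (g (troot T)) = f (nth (troot S) (att S) (rank (slots J) j)),
      forall v, v != troot T -> par R (g v) = g (par T v) &
      att R = [seq if j \in J then g (nth (troot T) (att T) (rank J j))
                   else f (nth (troot S) (att S) (rank (slots J) j))
              | j <- enum 'I_r]].

Definition pairF (U S T : tree) (u : V U) : tree := if u == troot U then S else T.

(* The decomposition R = lambda_U(S, T) of a grafting over a tree U with two
   vertices. *)
Record grafting (r : nat) (J : {set 'I_r}) (S T R : tree) := Grafting {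
  gr_base : tree;
  gr_dec : decomp R gr_base (pairF S T);
  gr_bot : V S -> V R;
  gr_top : V T -> V R;
  gr_base_nv : nv gr_base = 2;
  gr_graft : is_graft J gr_bot gr_top;
  gr_botP : forall v, dmor gr_dec (gr_bot v) = troot gr_base;
  gr_topP : forall v, dmor gr_dec (gr_top v) <> troot gr_base }.

Section CobarComp.
Variables (R : comPzRingType) (A : preCooperad R).

Definition pairx (U S T : tree) (x : A S) (y : A T) :
    forall u : V U, A (pairF S T u) :=
  fun u => if u == troot U as b return A (if b then S else T) then x else y.

(* The Segal map A(S) (x) A(T) -> A(S o T) *)
Definition segal2 (r : nat) (J : {set 'I_r}) (S T Q : tree) (G : grafting J S T Q)
    (x : A S) (y : A T) : A Q :=
  segal (gr_dec G) (pairx x y).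

(* The exponent of the sign relating the concatenation of the vertex tensors of
   S and T to the vertex tensor of the grafting *)
Definition concat_sign (r : nat) (J : {set 'I_r}) (S T Q : tree)
    (G : grafting J S T Q) : nat :=
  koszul (fun=> 1%N) ([seq gr_bot G v | v <- vseq S] ++ [seq gr_top G v | v <- vseq T]).

Definition supported (r : nat) (x : dsum A r) (T : tree) : Prop :=
  forall Q : tree, Q <> T -> x Q = 0.

(* The composition products on the summands of S and T; x S has degree
   n + nv S in A(S), and is permuted with the nv T factors 01^#_v of T. *)
Definition is_cobar_comp (k l r : nat) (J : {set 'I_r})
    (comp : Bc A k -> Bc A l -> Bc A r) : Prop :=
  forall (S T : tree) (n : int) (x : dsum A k) (y : dsum A l),
    nl S = k -> nl T = l -> supported x S -> supported y T ->
    homog (n : int) (x : Bc A k) ->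
    exists (Q : tree) (G : grafting J S T Q),
      supported (comp x y) Q /\
      (comp x y : dsum A r) Q =
      (-1) ^+ (absz (n + (nv S)%:Z)%R * nv T + concat_sign G) *:
        segal2 G (x S) (y T).

End CobarComp.

(* Main.v *)
From HB Require Import structures.
From mathcomp Require Import boolp zify.
Require Import Defs.
From mathcomp Require Import all_boot all_order all_algebra.

Set Implicit Arguments.
Unset Strict Implicit.
Unset Printing Implicit Defensive.

Import GRing.Theory.

(** Why the cobar construction is a shuffle operad.

    Trees, contractions and signs. A contraction of T is determined by the set
    of the inner edges that it contracts ([mor_packed]), a subtree by its set of
    vertices ([sub_packed]), and a sequence of tree morphisms out of T by the
    increasing list of the sets of edges contracted by its composites
    ([kers_inj]). Trees have no automorphisms, so identities between sequences,
    restrictions and nested decompositions reduce to identities between sets of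
    vertices. The sign of a permutation of a vertex tensor is the parity of the
    number of inversions of a word of vertices; the iterated blow-up along
    e_1, ..., e_m puts these letters in front of the word of the remaining
    vertices ([blowups_sign]). Hence this sign is alternating in the edges
    ([blowup_parity_swap]) and multiplicative under splitting the sequence
    ([blowup_parity_split]).

    The differential squares to zero. The coproduct on the top cell of the cube
    commutes with the internal differentials up to the faces of the cube
    ([rho_boundary]). The 0-faces omit a tree of the sequence
    T -> T/e_1 -> ... ; two orders of the same two consecutive edges give the
    same omitted sequence with opposite signs, so these faces cancel
    ([square_omit]). The 1-faces cut the sequence in two and give the square of
    the twisting map ([edge_face_split]).

    The products. In a reduced tree, a vertex is determined by its cluster, the
    set of the labels of the leaves above it ([reduced_cluster_inj]). A
    reduced tree Q is therefore in at most one way a grafting along J: it is cut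
    below the vertex c with cluster J, and the product at Q is the Segal map of
    this cut ([comp_funE], [comp_is_cobar]). Non-reduced trees carry the zero
    module, and there are finitely many reduced ones with r leaves
    ([reduced_fin]). The Koszul sign is
    expressed by a power of the grading involution, so that the products are
    bilinear on all elements.

    The Leibniz rule. Since Segal maps are compatible with coproducts, the
    coproduct along e_1, ..., e_m of the image of the Segal map of a cut is a
    sum over pairs of words in the cubical cochains. A coproduct vanishes in
    dimensions that exceed the number of proper contractions of its sequence
    because of the degeneracies ([rho_degen]). So the sum is zero if edges of
    both parts are contracted, and has a single term if all the edges are in one
    part ([rho_cut_mixed], [rho_cut_bot], [rho_cut_top]); the term is the
    twisting map of the corresponding factor. If the edge below c is contracted,
    then the cluster J disappears and the product is zero ([comp_lost]).

    Associativity. Two cuts c and d of Q give a decomposition into three parts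
    over a tree with three vertices, which both iterated products compute
    ([nested_exists], [comp_bot], [comp_top]). The clusters of the vertices of
    the two parts of a cut are the traces of their clusters in Q on the index
    sets of the parts, so the same pairs (c, d) occur on the two sides
    ([cluster_bot_inv], [cluster_top_inv]). The signs agree because both are
    computed by the inversions of the concatenated words of the three parts
    ([parts_cut_sign], [swap_parts]). *)

(** * Ancestors and leaves in a rooted tree *)

Section ValidTree.
Variables (T : rawtree) (vT : valid T).
Implicit Types u v w x : V T.

Notation above u v := (fconnect (par T) u v).

Definition leafv (j : nat) : V T := nth (troot T) (att T) j.

Lemma par_root : par T (troot T) = troot T.
Proof. by case/and3P: vT => /eqP. Qed.

Lemma above_root v : above v (troot T).
Proof. by case/and3P: vT => _ /forallP /(_ v). Qed.

Lemma iter_root n : iter n (par T) (troot T) = troot T.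
Proof. by elim: n => //= n ->; rewrite par_root. Qed.

Lemma aboveP u v : reflect (exists n, iter n (par T) u = v) (above u v).
Proof.
apply: (iffP idP) => [/iter_findex e | [n <-]]; last exact: fconnect_iter.
by exists (findex (par T) u v).
Qed.

Lemma root_ind (P : V T -> Prop) :
  P (troot T) -> (forall v, v != troot T -> P (par T v) -> P v) -> forall v, P v.
Proof.
move=> Pr Pp v; have /aboveP[n] := above_root v.
elim: n v => [|n IHn] v; first by move=> /= ->.
rewrite iterSr => e; case: (eqVneq v (troot T)) => [-> // | vr].
by apply: Pp => //; apply: IHn.
Qed.

Lemma above_anti u v : above u v -> above v u -> u = v.
Proof.
case/aboveP=> [a ea] /aboveP[b eb].
have cyc : iter (b + a) (par T) u = u by rewrite iterD ea eb.
have cycn n : iter (n * (b + a)) (par T) u = u.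
  by elim: n => // n IHn; rewrite mulSn iterD IHn cyc.
have /aboveP[N eN] := above_root u.
case: (posnP (b + a)) => [/eqP | ba].
  by rewrite addn_eq0 => /andP[_ /eqP a0]; rewrite -ea a0.
have ur : u = troot T.
  have le : N <= N * (b + a) by rewrite leq_pmulr.
  by rewrite -(cycn N) -(subnK le) iterD eN iter_root.
by rewrite -ea ur iter_root.
Qed.

Lemma root_above v : above (troot T) v -> v = troot T.
Proof. by case/aboveP=> n <-; rewrite iter_root. Qed.

Lemma par_fix v : par T v = v -> v = troot T.
Proof.
move=> e; have /aboveP[n <-] := above_root v.
by elim: n => //= n {1}<-; rewrite e.
Qed.

Lemma above_par u v : u != v -> above u v -> above (par T u) v.
Proof.
move=> uv /aboveP[[|n] e]; first by rewrite -e eqxx in uv.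
by apply/aboveP; exists n; rewrite -e iterSr.
Qed.

Lemma above1 u : above u (par T u).
Proof. exact: fconnect1. Qed.

Lemma above_trans u v w : above u v -> above v w -> above u w.
Proof. exact: connect_trans. Qed.

Lemma above_comp w u v : above w u -> above w v -> above u v \/ above v u.
Proof.
case/aboveP=> [a ea] /aboveP[b eb]; case: (leqP a b) => [ab | /ltnW ab].
  by left; apply/aboveP; exists (b - a); rewrite -ea -iterD subnK.
by right; apply/aboveP; exists (a - b); rewrite -eb -iterD subnK.
Qed.

Lemma par_not_above v : v != troot T -> ~~ above (par T v) v.
Proof.
move=> vr; apply/negP => h.
by case/eqP: vr; apply: par_fix; apply: above_anti (above1 v).
Qed.

Lemma leafv_mem j : j < nl T -> leafv j \in att T.
Proof. exact: mem_nth. Qed.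

Lemma leaf_above v : exists2 j, j < nl T & above (leafv j) v.
Proof.
have [n] := ubnP #|[set u | above u v]|; elim: n v => // n IHn v.
rewrite ltnS => le.
case/and3P: vT => _ _ /forallP /(_ v) /orP[/nthP h | /existsP[w /andP[wr /eqP wv]]].
  by have [j jn e] := h (troot T); exists j => //; rewrite /leafv e.
have lt : #|[set u | above u w]| < #|[set u | above u v]|.
  apply: proper_card; apply/properP; split.
    apply/subsetP => u; rewrite !inE => h; apply: above_trans h _.
    by rewrite -wv above1.
  exists v; rewrite !inE // -wv; exact: par_not_above.
have [j jn h] := IHn w (leq_trans lt le).
by exists j => //; apply: above_trans h _; rewrite -wv above1.
Qed.

(** Induction from the leaves down to the root: every vertex has a leaf above
    it. *)
Lemma leaf_ind (P : V T -> Prop) :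
  (forall v, v \in att T -> P v) ->
  (forall v, v != troot T -> P v -> P (par T v)) -> forall v, P v.
Proof.
move=> Pl Pp v; have [j jn /aboveP[n <-]] := leaf_above v.
elim: n => [|n IHn] /=; first exact/Pl/leafv_mem.
case: (eqVneq (iter n (par T) (leafv j)) (troot T)) => [e | ne].
  by rewrite e par_root -e.
exact: Pp.
Qed.

(** On a path towards the root, a predicate that fails at the start and holds at
    the end becomes true at some edge. *)
Lemma first_entry (P : pred (V T)) u v : above u v -> ~~ P u -> P v ->
  exists w, [/\ above u w, ~~ P w & P (par T w)].
Proof.
move=> /aboveP[n <-] nPu; elim: n => [|n IHn] /=; first by rewrite (negPf nPu).
case: (boolP (P (iter n (par T) u))) => [/IHn // | ne Pn].
by exists (iter n (par T) u); split=> //; apply: fconnect_iter.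
Qed.

(** ** Minimal leaf labels *)

Lemma minlabel_lt v : minlabel v < nl T.
Proof.
rewrite -has_find; have [j jn h] := leaf_above v.
by apply/hasP; exists (leafv j) => //; apply: leafv_mem.
Qed.

Lemma minlabel_above v : above (leafv (minlabel v)) v.
Proof. by apply: (@nth_find _ _ (fun a => above a v)); rewrite has_find minlabel_lt. Qed.

Lemma minlabel_le v j : above (leafv j) v -> minlabel v <= j.
Proof. by move=> h; rewrite leqNgt; apply/negP => /(before_find (troot T)); rewrite -/(leafv j) h. Qed.

Lemma minlabelP v j :
  above (leafv j) v -> (forall i, above (leafv i) v -> j <= i) -> minlabel v = j.
Proof.
move=> h hmin; apply/eqP; rewrite eqn_leq minlabel_le //=.
exact/hmin/minlabel_above.
Qed.

(** ** The canonical order of the vertices *)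

Lemma orbit_par v : v != troot T -> orbit (par T) v = v :: orbit (par T) (par T v).
Proof.
move=> vr; rewrite /orbit.
suff -> : order (par T) v = (order (par T) (par T v)).+1 by rewrite trajectS.
rewrite /order.
rewrite (@eq_card _ (fconnect (par T) v) (predU1 v (fconnect (par T) (par T v)))); last first.
  move=> u; rewrite !inE; apply/idP/orP => [h | [/eqP -> | h]].
  - by case: (eqVneq u v) => [| uv]; [left | right; apply: above_par => //; rewrite eq_sym].
  - exact: connect0.
  - exact: above_trans (above1 v) h.
by rewrite cardU1 (_ : (v \notin _) = true) //; apply: par_not_above.
Qed.

Lemma orbit_root : orbit (par T) (troot T) = [:: troot T].
Proof.
rewrite /orbit; suff -> : order (par T) (troot T) = 1 by [].
rewrite /order (@eq_card _ _ (pred1 (troot T))) ?card1 // => u.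
by rewrite !inE; apply/idP/eqP => [/root_above | ->].
Qed.

Lemma vkey_par v : v != troot T -> vkey v = rcons (vkey (par T v)) (minlabel v).
Proof. by move=> vr; rewrite /vkey orbit_par // rev_cons map_rcons. Qed.

Lemma vkey_root : vkey (troot T) = [:: minlabel (troot T)].
Proof. by rewrite /vkey orbit_root. Qed.

(** Two vertices with the same key have parents with the same key, hence the same
    parent. Their minimal labels agree, so the same leaf lies above both, and
    two vertices above a common parent and below a common leaf are equal. *)
Lemma vkey_inj : injective (@vkey T).
Proof.
have sz v : 0 < size (vkey v).
  case: (eqVneq v (troot T)) => [-> | vr]; first by rewrite vkey_root.
  by rewrite vkey_par // size_rcons.
move=> u; elim/root_ind: u => [| u ur IHu] v.
  rewrite vkey_root; case: (eqVneq v (troot T)) => [-> // | vr].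
  by rewrite vkey_par //; have := sz (par T v); case: (vkey _) => // a [|].
rewrite vkey_par //; case: (eqVneq v (troot T)) => [-> | vr].
  by rewrite vkey_root; have := sz (par T u); case: (vkey _) => // a [|].
rewrite [in RHS]vkey_par // => /rcons_inj[/IHu e m].
(* Both vertices lie on the path from the same leaf, and have the same parent. *)
have h := minlabel_above u; have h' := minlabel_above v; rewrite -m in h'.
apply/eqP; apply: contraT => uv; case: (above_comp h h') => k.
  by have := above_par uv k; rewrite e (negPf (par_not_above vr)).
have := above_par _ k; rewrite eq_sym => /(_ uv).
by rewrite -e (negPf (par_not_above ur)).
Qed.

Lemma lexlt_irr s : lexlt s s = false.
Proof. by elim: s => //= x s ->; rewrite ltnn eqxx. Qed.

Lemma lexlt_trans : transitive lexlt.
Proof.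
elim=> [|y t IHt] [|x s] [|z u] //=.
case/orP=> [xy | /andP[/eqP -> st]] /orP[yz | /andP[/eqP <- tu]].
- by rewrite (ltn_trans xy yz).
- by rewrite xy.
- by rewrite yz.
- by rewrite eqxx (IHt _ _ st tu) orbT.
Qed.

Lemma lexlt_total s t : s != t -> lexlt s t = ~~ lexlt t s.
Proof.
elim: s t => [|x s IHs] [|y t] //=; rewrite eqseq_cons.
by case: (ltngtP x y) => //= _ /IHs ->.
Qed.

Lemma lexlt_prefix s t : t != [::] -> lexlt s (s ++ t).
Proof. by elim: s => [|x s IHs] /=; [case: t | move=> h; rewrite eqxx IHs ?orbT]. Qed.

Lemma vlt_total u v : u != v -> vlt u v = ~~ vlt v u.
Proof. by move=> uv; apply: lexlt_total; rewrite (inj_eq vkey_inj). Qed.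

Lemma vlt_irr u : vlt u u = false.
Proof. exact: lexlt_irr. Qed.

Lemma vlt_trans : transitive (@vlt T).
Proof. by move=> v u w; apply: lexlt_trans. Qed.

Lemma vlt_above u v : above v u -> v != u -> vlt u v.
Proof.
move=> h vu; rewrite /vlt; suff [s -> ] : exists2 s, vkey v = vkey u ++ s & s != [::].
  exact: lexlt_prefix.
elim/root_ind: v h vu => [/root_above -> | v vr IHv h vu]; first by rewrite eqxx.
rewrite vkey_par //; case: (eqVneq (par T v) u) => [-> | pu].
  by exists [:: minlabel v]; rewrite ?cats1.
have [s -> ns] := IHv (above_par vu h) pu.
by exists (rcons s (minlabel v)); rewrite ?rcons_cat //; case: (s).
Qed.

Lemma vseq_perm : perm_eq (vseq T) (enum (V T)).
Proof. by rewrite perm_sort. Qed.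

Lemma vseq_uniq : uniq (vseq T).
Proof. by rewrite sort_uniq enum_uniq. Qed.

Lemma mem_vseq v : v \in vseq T.
Proof. by rewrite mem_sort mem_enum. Qed.

Lemma vseq_pairwise : pairwise (fun u v => ~~ vlt v u) (vseq T).
Proof.
rewrite -sorted_pairwise; last first.
  move=> v u w h1 h2; case: (eqVneq u v) => [-> // | uv].
  case: (eqVneq v w) => [<- // | vw].
  apply/negP => wu; move: h1 h2; rewrite -!vlt_total // => uv' vw'.
    by have := vlt_trans uv' (vlt_trans vw' wu); rewrite vlt_irr.
apply: sort_sorted => u v; case: (eqVneq u v) => [-> | uv]; first by rewrite vlt_irr.
by rewrite (vlt_total uv) negbK orbC orbN.
Qed.

Lemma koszul_vseq n : koszul n (vseq T) = 0.
Proof.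
have := vseq_pairwise; elim: (vseq T) => //= a w IHw /andP[h /IHw ->].
rewrite addn0 big_seq_cond big1 // => b /andP[bw ba].
by have /allP/(_ b bw) := h; rewrite ba.
Qed.

End ValidTree.

Lemma tree_valid (T : tree) : valid T.
Proof. by case/andP: (treeP T). Qed.
#[global] Hint Resolve tree_valid : core.

Notation above T u v := (fconnect (par T) u v).

(** * Contractions *)

(** Edges are identified with their sources: an inner edge is contracted when its
    source and its target are merged. *)
Definition kerm (T S : rawtree) (f : V T -> V S) : {set V T} :=
  [set v | (v != troot T) && (f v == f (par T v))].

Lemma is_contr_ker T S (vT : valid T) E (f : {ffun V T -> V S}) : is_contr E f -> kerm f = E.
Proof.
case/and5P => /andP[rE /eqP fr] /eqP fatt /forall_inP fE /forall_inP fN /forallP fb.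
have inj u v : u \notin E -> v \notin E -> f u = f v -> u = v.
  move=> uE vE uv; have /cards1P[z ez] := fb (f v).
  have hu : u \in [set z] by rewrite -ez !inE uE uv eqxx.
  have hv : v \in [set z] by rewrite -ez !inE vE eqxx.
  by rewrite (set1P hu) (set1P hv).
have repE u : exists2 v, v \notin E & f u = f v /\ above T u v.
  elim/(root_ind vT): u => [|u ur [v vE [fv uv]]]; first by exists (troot T).
  case: (boolP (u \in E)) => uE; last by exists u.
  exists v => //; split; first by rewrite (eqP (fE _ uE)).
  exact: above_trans (above1 u) uv.
apply/setP => v; rewrite !inE; apply/andP/idP => [[vr /eqP e] | vE]; last first.
  split; last exact: fE.
  by apply: contraTneq vE => ->.
apply: contraT => vE; have [w wE [fw vw]] := repE (par T v).
have ev : v = w by apply: inj => //; rewrite -fw.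
by have := par_not_above vT vr; rewrite {2}ev vw.
Qed.

Section Contr.
Variables (T S : tree) (f : mor T S).
Implicit Types u v w : V T.

Lemma mor_contr : is_contr (kerm f) f.
Proof. by case/existsP: (morP f) => E h; rewrite (is_contr_ker _ h). Qed.

Lemma root_ker : troot T \notin kerm f.
Proof. by case/and5P: mor_contr => /andP[]. Qed.

Lemma mor_root : f (troot T) = troot S.
Proof. by case/and5P: mor_contr => /andP[_ /eqP]. Qed.

Lemma mor_att : att S = [seq f v | v <- att T].
Proof. by case/and5P: mor_contr => _ /eqP. Qed.

Lemma mor_nl : nl S = nl T.
Proof. by rewrite /nl mor_att size_map. Qed.

Lemma mor_leafv j : leafv S j = f (leafv T j).
Proof.
rewrite /leafv mor_att; case: (ltnP j (size (att T))) => jn.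
  by rewrite (nth_map (troot T)).
by rewrite !nth_default ?size_map // mor_root.
Qed.

Lemma ker_par v : v \in kerm f -> f v = f (par T v).
Proof. by rewrite inE => /andP[_ /eqP]. Qed.

Lemma mor_par v : v \notin kerm f -> par S (f v) = f (par T v).
Proof.
case/and5P: mor_contr => _ _ _ /forall_inP fN _ vE.
by apply/eqP/fN; rewrite inE.
Qed.

Lemma mor_inj u v : u \notin kerm f -> v \notin kerm f -> f u = f v -> u = v.
Proof.
case/and5P: mor_contr => _ _ _ _ /forallP fb uE vE uv.
have /cards1P[z ez] := fb (f v).
have hu : u \in [set z] by rewrite -ez in_set in_setC uE uv eqxx.
have hv : v \in [set z] by rewrite -ez in_set in_setC vE eqxx.
by rewrite (set1P hu) (set1P hv).
Qed.

Lemma msec_subproof w : exists v, (v \notin kerm f) && (f v == f w).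
Proof.
elim/(root_ind (tree_valid T)): w => [|w wr [v]]; first by exists (troot T); rewrite root_ker eqxx.
case: (boolP (w \in kerm f)) => wE; last by exists w; rewrite wE eqxx.
by exists v; rewrite (ker_par wE).
Qed.

Definition mrep w : V T := xchoose (msec_subproof w).

Lemma mrepN w : mrep w \notin kerm f.
Proof. by have /andP[] := xchooseP (msec_subproof w). Qed.

Lemma mrepK w : f (mrep w) = f w.
Proof. by have /andP[_ /eqP] := xchooseP (msec_subproof w). Qed.

Lemma mrep_id v : v \notin kerm f -> mrep v = v.
Proof. by move=> vE; apply: mor_inj => //; rewrite ?mrepN ?mrepK. Qed.

Lemma mrep_eq u v : f u = f v -> mrep u = mrep v.
Proof. by move=> uv; apply: mor_inj; rewrite ?mrepN // !mrepK. Qed.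

Lemma mrep_par v : v \in kerm f -> mrep v = mrep (par T v).
Proof. by move/ker_par/mrep_eq. Qed.

Lemma mor_sur (x : V S) : exists v, f v == x.
Proof.
case/and5P: mor_contr => _ _ _ _ /forallP /(_ x) /cards1P[z ez].
by exists z; have := set11 z; rewrite -ez !inE => /andP[].
Qed.

(** The representative, among the vertices that are not contracted, of a
    vertex of the target: the vertex of the fibre which is closest to the
    root. *)
Definition msec (x : V S) : V T := mrep (xchoose (mor_sur x)).

Lemma msecK x : f (msec x) = x.
Proof. by rewrite /msec mrepK (eqP (xchooseP (mor_sur x))). Qed.

Lemma msecN x : msec x \notin kerm f.
Proof. exact: mrepN. Qed.

Lemma msec_mor v : msec (f v) = mrep v.
Proof. by apply: mrep_eq; rewrite (eqP (xchooseP (mor_sur _))). Qed.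

Lemma msec_id v : v \notin kerm f -> msec (f v) = v.
Proof. by move=> h; rewrite msec_mor mrep_id. Qed.

Lemma msec_inj : injective msec.
Proof. exact: can_inj msecK. Qed.

Lemma msec_root : msec (troot S) = troot T.
Proof. by rewrite -mor_root msec_id ?root_ker. Qed.

Lemma mor_above u v : above T u v -> above S (f u) (f v).
Proof.
case/aboveP=> [n <-] {v}; elim: n => [|n IHn] /=; first exact: connect0.
apply: above_trans IHn _; set w := iter n _ u.
case: (boolP (w \in kerm f)) => wE; first by rewrite (ker_par wE) connect0.
by rewrite -mor_par // above1.
Qed.

Lemma mor_above_inv u v : v \notin kerm f -> above S (f u) (f v) -> above T u v.
Proof.
move=> vE; elim/(root_ind (tree_valid T)): u => [|u ur IHu].
  rewrite mor_root => /(root_above (tree_valid S)); rewrite -mor_root => e.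
  by rewrite (mor_inj vE root_ker e) connect0.
case: (boolP (u \in kerm f)) => uE.
  by rewrite (ker_par uE) => /IHu; apply: above_trans (above1 u).
case: (eqVneq (f u) (f v)) => [e _ | uv h].
  by rewrite (mor_inj uE vE e) connect0.
have := above_par uv h; rewrite mor_par // => /IHu.
exact: above_trans (above1 u).
Qed.

(** The representative of x is the lowest vertex of its fibre, so a vertex is
    above it as soon as its image is above x. *)
Lemma above_msec v x : above T v (msec x) = above S (f v) x.
Proof.
apply/idP/idP => [/mor_above | h]; first by rewrite msecK.
by apply: mor_above_inv; rewrite ?msecN ?msecK.
Qed.

Lemma minlabel_msec x : minlabel (msec x) = minlabel x.
Proof.
apply: (minlabelP (tree_valid T)).
  rewrite above_msec -mor_leafv; exact/minlabel_above/tree_valid.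
by move=> i; rewrite above_msec -mor_leafv; apply: minlabel_le.
Qed.

End Contr.

(** E is a set of inner edges, and every fibre of f contains exactly one vertex
    outside E, the one closest to the root. *)
Lemma contrI (T S : tree) (E : {set V T}) (f : V T -> V S) :
  troot T \notin E -> f (troot T) = troot S -> [seq f v | v <- att T] = att S ->
  (forall v, v \in E -> f v = f (par T v)) ->
  (forall v, v \notin E -> par S (f v) = f (par T v)) ->
  (forall w, exists2 v, v \notin E & f v = w) ->
  (forall u v, u \notin E -> v \notin E -> f u = f v -> u = v) ->
  exists g : mor T S, f =1 g /\ kerm g = E.
Proof.
move=> rE fr fatt fE fN fs fi.
have h : is_contr E [ffun v => f v].
  apply/and5P; split.
  - by rewrite rE ffunE fr eqxx.
  - by rewrite -fatt; apply/eqP/eq_map => v; rewrite ffunE.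
  - by apply/forall_inP => v /fE; rewrite !ffunE => ->.
  - by apply/forall_inP => v; rewrite !inE !ffunE => /fN ->.
  - apply/forallP => w; apply/cards1P; have [v vE fv] := fs w; exists v.
    apply/setP => u; rewrite !inE ffunE; apply/andP/eqP => [[uE /eqP fu] | ->].
      by apply: fi; rewrite // fu.
    by rewrite vE fv.
have m : is_mor [ffun v => f v] by apply/existsP; exists E.
exists (Mor m); split; first by move=> v /=; rewrite ffunE.
exact: is_contr_ker h.
Qed.

Lemma mor_eq (T S : tree) (f g : mor T S) : f =1 g -> f = g.
Proof.
case: f g => [f hf] [g hg] /= fg; have e : f = g by apply/ffunP.
by subst g; congr Mor; apply: bool_irrelevance.
Qed.

(** * Construction and rigidity of trees *)

Section MkTree.
Variables (K : finType) (k0 : K) (p : K -> K) (a : seq K).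
Hypotheses (pk0 : p k0 = k0) (pc : forall k, fconnect p k k0)
  (pl : forall k, k \in a \/ exists2 k', k' != k0 & p k' = k).

Lemma mkrawtree : exists (T : rawtree) (h : K -> V T) (g : V T -> K),
  [/\ cancel h g, cancel g h, valid T, h k0 = troot T &
      (forall k, par T (h k) = h (p k)) /\ att T = [seq h k | k <- a]].
Proof.
pose s := k0 :: rem k0 (enum K).
have sp : perm_eq s (enum K) by rewrite perm_sym perm_to_rem ?mem_enum.
have su : uniq s by rewrite (perm_uniq sp) enum_uniq.
have sm k : k \in s by rewrite (perm_mem sp) mem_enum.
have ss : size s = (#|K|.-1).+1.
  by rewrite (perm_size sp) -cardE prednK //; apply/card_gt0P; exists k0.
pose h k : 'I_(#|K|.-1).+1 := inord (index k s).
pose g (i : 'I_(#|K|.-1).+1) : K := nth k0 s i.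
have hg : cancel h g by move=> k; rewrite /g inordK ?nth_index // -ss index_mem.
have gh : cancel g h.
  by move=> i; rewrite /h /g index_uniq ?inord_val ?ss.
pose T := @RawTree (#|K|.-1) [ffun i => h (p (g i))] [seq h k | k <- a].
have hp k : par T (h k) = h (p k) by rewrite ffunE hg.
have h0 : h k0 = troot T by apply: val_inj; rewrite /h /= /s /= eqxx inordK.
exists T, h, g; split=> //; apply/and3P; split.
- by rewrite -h0 hp pk0.
- apply/forallP => v; rewrite -(gh v) -h0; have /iter_findex <- := pc (g v).
  elim: (findex _ _ _) => [|n IHn] /=; first exact: connect0.
  by rewrite -hp; apply: connect_trans IHn (fconnect1 _ _).
- apply/forallP => v; rewrite -(gh v); case: (pl (g v)) => [ka | [k kk0 e]].
    by rewrite map_f.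
  apply/orP; right; apply/existsP; exists (h k).
  by rewrite -h0 (inj_eq (can_inj hg)) kk0 hp e eqxx.
Qed.

(** The chosen representatives of the isomorphism classes of trees contain a tree
    with the given set of vertices, parent map and list of leaf targets. *)
Lemma mktree : exists (T : tree) (h : K -> V T) (g : V T -> K),
  [/\ cancel h g, cancel g h, h k0 = troot T,
      (forall k, par T (h k) = h (p k)) & att T = [seq h k | k <- a]].
Proof.
have [T [h [g [hg gh vT h0 [hp ha]]]]] := mkrawtree.
have vC : valid (canon T) && (canon (canon T) == canon T).
  by rewrite (valid_iso (canon_iso T)) // canonK eqxx.
have /existsP[f hf] := canon_iso T.
case/and5P: (hf) => /andP[_ /eqP fr] /eqP fatt _ /forall_inP fN /forallP fb.
have fi : injective f.
  move=> x y fxy; have /cards1P[z ez] := fb (f y).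
  have hx : x \in [set z] by rewrite -ez !inE fxy eqxx.
  have hy : y \in [set z] by rewrite -ez !inE eqxx.
  by rewrite (set1P hx) (set1P hy).
have fs w : exists v, f v == w.
  have /cards1P[z ez] := fb w; exists z.
  by have := set11 z; rewrite -ez !inE.
exists (Tree vC), (fun k => f (h k)), (fun w => g (xchoose (fs w))); split.
- move=> k /=; rewrite -[RHS]hg; congr g; apply: fi.
  exact/eqP/(xchooseP (fs (f (h k)))).
- by move=> w /=; rewrite gh; apply/eqP/(xchooseP (fs w)).
- by rewrite /= h0 fr.
- by move=> k /=; rewrite -hp; apply/eqP/fN; rewrite !inE.
- by rewrite /= -fatt ha -map_comp.
Qed.

End MkTree.

(** An endomorphism that fixes the targets of the leaves fixes everything below
    them. *)
Lemma iso_id (T : tree) (h : V T -> V T) :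
  (forall v, v != troot T -> par T (h v) = h (par T v)) ->
  [seq h v | v <- att T] = att T -> h =1 id.
Proof.
move=> hp ha; elim/(leaf_ind (tree_valid T)) => [v /nthP h'| v vr e].
  have [j jn <-] := h' (troot T).
  by rewrite -(nth_map _ (troot T)) // ha.
by rewrite -hp // e.
Qed.

(** Isomorphic objects are equal, being chosen representatives, and the
    isomorphism is then the identity. The conclusion is an equality of dependent
    pairs, so that it can be used to identify the two trees. *)
Lemma tree_rigid (T T' : tree) (h : V T -> V T') : bijective h ->
  h (troot T) = troot T' -> (forall v, v != troot T -> par T' (h v) = h (par T v)) ->
  [seq h v | v <- att T] = att T' ->
  existT (fun X : tree => V T -> V X) T' h = existT (fun X : tree => V T -> V X) T id.
Proof.
move=> hb h0 hp ha.
have e : T' = T.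
  have : iso T T'.
    apply/existsP; exists [ffun v => h v]; apply/and5P; split.
    - by rewrite inE ffunE h0 eqxx.
    - by rewrite -ha; apply/eqP/eq_map => v; rewrite ffunE.
    - by apply/forall_inP => v; rewrite inE.
    - apply/forall_inP => v _; rewrite !ffunE; case: (eqVneq v (troot T)) => [-> | /hp -> //].
      by rewrite h0 (par_root (tree_valid T)) h0 (par_root (tree_valid T')).
    - case: hb => g hg gh; apply/forallP => w; apply/cards1P; exists (g w).
      by apply/setP => v; rewrite !inE ffunE /=; apply/eqP/eqP => [<- | ->]; rewrite ?hg ?gh.
  move/canon_eq => c; apply: val_inj => /=.
  have /andP[_ /eqP <-] := treeP T'; have /andP[_ /eqP <-] := treeP T.
  by rewrite c.
subst T'; congr existT; apply: functional_extensionality_dep.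
exact: iso_id hp ha.
Qed.

(** * Quotients *)

(** A contraction is determined by the set of the edges that it contracts. *)
Lemma mor_packed (T S S' : tree) (f : mor T S) (f' : mor T S') :
  kerm f = kerm f' ->
  existT (fun X : tree => mor T X) S f = existT (fun X : tree => mor T X) S' f'.
Proof.
move=> E; pose h x := f' (msec f x).
have hf v : h (f v) = f' v.
  rewrite /h msec_mor; have := mrepK f v => e.
  elim/(root_ind (tree_valid T)): v {e} => [|v vr IHv]; first by rewrite mrep_id ?root_ker.
  case: (boolP (v \in kerm f)) => vE; last by rewrite mrep_id.
  by rewrite mrep_par // IHv; apply/esym/ker_par; rewrite -E.
have hr : h (troot S) = troot S' by rewrite -(mor_root f) hf mor_root.
have hb : bijective h.
  exists (fun y => f (msec f' y)) => [x | y]; last by rewrite hf msecK.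
  by rewrite /h msec_id ?msecK // -E msecN.
have hp x : par S' (h x) = h (par S x).
  by rewrite -(msecK f x) hf !mor_par ?hf // -?E msecN.
have ha : [seq h x | x <- att S] = att S'.
  by rewrite (mor_att f) (mor_att f') -map_comp; apply: eq_map => v /=; rewrite hf.
have := tree_rigid hb hr (fun v _ => hp v) ha.
move=> /esym e; have eS : S = S' by case: e.
subst S'; congr existT; apply: mor_eq => v.
by rewrite -hf; apply/esym/(iso_id (fun v _ => hp v) ha).
Qed.

(** The quotient has the vertices outside E; the parent of such a vertex is the
    representative of its parent in T. *)
Lemma quotient_exists (T : tree) (E : {set V T}) : troot T \notin E ->
  exists S (f : mor T S), kerm f = E.
Proof.
move=> rE.
have repP (v : V T) : exists u, [&& u \notin E, above T v u &
    [forall w, (above T v w && (w \notin E)) ==> above T u w]].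
  elim/(root_ind (tree_valid T)): v => [|v vr [u /and3P[uE vu /forallP h]]].
    exists (troot T); rewrite rE connect0 /=; apply/forallP => w.
    by apply/implyP => /andP[].
  case: (boolP (v \in E)) => vE; last first.
    exists v; rewrite vE connect0 /=; apply/forallP => w.
    by apply/implyP => /andP[].
  exists u; rewrite uE (above_trans (above1 v) vu) /=.
  apply/forallP => w; apply/implyP => /andP[vw wE]; apply: (implyP (h w)).
  rewrite wE andbT; apply: above_par vw; by apply: contraTneq vE => ->.
pose rep v := xchoose (repP v).
have repN v : rep v \notin E by have /and3P[] := xchooseP (repP v).
have rep_id v : v \notin E -> rep v = v.
  move=> vE; have /and3P[h1 h2 /forallP /(_ v)] := xchooseP (repP v).
  rewrite vE connect0 /= => h3; exact: (above_anti (tree_valid T)) h3 h2.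
have rep_par v : v \in E -> rep v = rep (par T v).
  move=> vE; have /and3P[h1 h2 /forallP h3] := xchooseP (repP v).
  have /and3P[k1 k2 /forallP k3] := xchooseP (repP (par T v)).
  apply: (above_anti (tree_valid T)).
    by apply: (implyP (h3 _)); rewrite k1 andbT (above_trans (above1 v) k2).
  apply: (implyP (k3 _)); rewrite h1 andbT; apply: above_par h2.
  by apply: contraNneq h1 => <-.
pose K := {v : V T | v \notin E}.
pose k0 : K := exist _ (troot T) rE.
pose q v : K := exist _ (rep v) (repN v).
have qv (k : K) : q (val k) = k by apply: val_inj; rewrite /= rep_id // (valP k).
pose p (k : K) := q (par T (val k)).
have q_par v : v \in E -> q v = q (par T v) by move=> vE; apply: val_inj; rewrite /= rep_par.
have qr : q (troot T) = k0 by apply: val_inj; rewrite /= rep_id.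
have pq v : v \notin E -> p (q v) = q (par T v) by move=> vE; rewrite /p /= rep_id.
have pk0 : p k0 = k0 by rewrite /p /= par_root.
have pc k : fconnect p k k0.
  rewrite -(qv k); move: (val k) => v {k}.
  elim/(root_ind (tree_valid T)): v => [|v vr IHv]; first by rewrite qr connect0.
  case: (boolP (v \in E)) => vE; first by rewrite q_par.
  by apply: connect_trans (fconnect1 _ _) _; rewrite pq.
have pl k : k \in [seq q v | v <- att T] \/ exists2 k', k' != k0 & p k' = k.
  rewrite -(qv k); move: (val k) (valP k) => v vE {k}.
  have [j jn ja] := leaf_above (tree_valid T) v.
  case: (eqVneq (rep (leafv T j)) v) => [e | ne].
    left; apply/mapP; exists (leafv T j); first exact: leafv_mem.
    by apply: val_inj; rewrite /= e rep_id.
  have [|w [_ nw /eqP pw]] := first_entry (P := fun w => rep w == v) ja ne.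
    by rewrite rep_id.
  have wE : w \notin E by apply/negP => /rep_par e; rewrite e pw eqxx in nw.
  have wr : w != troot T.
    by apply/eqP => e; move: nw pw; rewrite e par_root // => /eqP.
  right; exists (q w); last by rewrite pq //; apply: val_inj; rewrite /= pw rep_id.
  by apply/eqP => /(congr1 val) /=; rewrite rep_id //; apply/eqP.
have [S [h [g [hg gh h0 hp ha]]]] := mktree pk0 pc pl.
have := @contrI T S E (fun v => h (q v)); case.
- by [].
- by rewrite qr h0.
- by rewrite ha -map_comp.
- by move=> v /q_par ->.
- by move=> v vE; rewrite hp pq.
- by move=> w; exists (val (g w)); rewrite ?qv ?gh // (valP (g w)).
- move=> u v uE vE /(can_inj hg) /(congr1 val) /=.
  by rewrite !rep_id.
by move=> f [_ fE]; exists S, f.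
Qed.

(** The contraction g factors through f as soon as it contracts more. *)
Lemma mor_factor (T S U : tree) (f : mor T S) (g : mor T U) :
  kerm f \subset kerm g -> exists h : mor S U, forall v, h (f v) = g v.
Proof.
move=> /subsetP fg; pose h x := g (msec f x).
have hf v : h (f v) = g v.
  rewrite /h msec_mor; elim/(root_ind (tree_valid T)): v => [|v vr IHv].
    by rewrite mrep_id ?root_ker.
  case: (boolP (v \in kerm f)) => vE; last by rewrite mrep_id.
  by rewrite mrep_par // IHv; apply/esym/ker_par/fg.
have := @contrI S U [set x | msec f x \in kerm g] h; case.
- by rewrite inE msec_root root_ker.
- by rewrite -(mor_root f) hf mor_root.
- by rewrite (mor_att f) (mor_att g) -map_comp; apply: eq_map => v /=; rewrite hf.
- move=> x; rewrite inE => xg; have ex := esym (msecK f x).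
  move: (msec f x) ex (msecN f x) xg => y -> yf yg.
  by rewrite mor_par // !hf; apply: ker_par.
- move=> x; rewrite inE => xg; have ex := esym (msecK f x).
  move: (msec f x) ex (msecN f x) xg => y -> yf yg.
  by rewrite mor_par // !hf mor_par.
- move=> w; exists (f (msec g w)); last by rewrite hf msecK.
  by rewrite inE msec_id ?msecN //; apply: contraNN (msecN g w) => /fg.
- move=> x y; rewrite in_set => xE; rewrite in_set => yE e; apply: (@msec_inj _ _ f).
  exact: (mor_inj xE yE e).
by move=> k [kh _]; exists k => v; rewrite -kh hf.
Qed.

(** * Subtrees *)

(** The list that orders the leaves of the subtree with vertex set X *)
Definition ins (T : rawtree) (X : {set V T}) : seq (nat * V T) :=
  sort (fun p q => p.1 <= q.1) (in_edges X).

(** X is connected, with x0 the vertex closest to the root. *)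
Definition conn (T : rawtree) (X : {set V T}) (x0 : V T) : Prop :=
  x0 \in X /\
  forall u, u \in X -> above T u x0 /\ (u != x0 -> par T u \in X).

Section InEdges.
Variables (T : tree) (X : {set V T}).
Let vT := tree_valid T.

Lemma mem_in_edges j t : (j, t) \in in_edges X <->
  t \in X /\ (j < nl T /\ leafv T j = t \/
    exists w, [/\ w != troot T, w \notin X, par T w = t & minlabel w = j]).
Proof.
rewrite /in_edges mem_cat; split.
  case/orP=> /mapP[x]; rewrite mem_filter.
    rewrite mem_iota add0n => /andP[xX /= xn] [-> ->].
    by split=> //; left.
  case/andP=> /and3P[xr xX px] _ [-> ->]; split=> //; right.
  by exists x.
case=> tX [[jn e] | [w [wr wX e <-]]]; apply/orP.
  left; apply/mapP; exists j; last by rewrite -e.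
  by rewrite mem_filter -/(leafv T j) e tX mem_iota add0n.
right; apply/mapP; exists w; last by rewrite e.
by rewrite mem_filter wr wX e tX mem_enum.
Qed.

Lemma mem_ins j t : (j, t) \in ins X <->
  t \in X /\ (j < nl T /\ leafv T j = t \/
    exists w, [/\ w != troot T, w \notin X, par T w = t & minlabel w = j]).
Proof. by rewrite mem_sort; exact: mem_in_edges. Qed.

Lemma in_edges_above j t : (j, t) \in in_edges X -> above T (leafv T j) t.
Proof.
case/mem_in_edges => _ [[_ ->] | [w [_ _ <- <-]]]; first exact: connect0.
exact: above_trans (minlabel_above vT w) (above1 w).
Qed.

Lemma in_edges_lt j t : (j, t) \in in_edges X -> j < nl T.
Proof. by case/mem_in_edges => _ [[] // | [w [_ _ _ <-]]]; apply: minlabel_lt. Qed.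

Variables (x0 : V T) (cX : conn X x0).

Lemma conn_above u : u \in X -> above T u x0.
Proof. by case: cX => _ h /h[]. Qed.

Lemma conn_par u : u \in X -> u != x0 -> par T u \in X.
Proof. by case: cX => _ h /h[]. Qed.

Lemma conn_root : x0 \in X.
Proof. by case: cX. Qed.

Lemma conn_neq u : u \in X -> u != x0 -> u != troot T.
Proof.
move=> uX; apply: contraNneq => ur; apply/eqP.
by move: (conn_above uX); rewrite ur => /(root_above vT) ->.
Qed.

Lemma conn_convex u w : u \in X -> above T u w -> above T w x0 -> w \in X.
Proof.
move=> uX /aboveP[n <-]; elim: n u uX => [|n IHn] u uX //; rewrite iterSr => h.
case: (eqVneq u x0) => [e | ux]; last by apply: IHn => //; apply: conn_par.
have h2 : above T x0 (iter n (par T) (par T u)).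
  by rewrite -e; apply: above_trans (above1 u) _; apply: fconnect_iter.
by rewrite (above_anti vT h h2) conn_root.
Qed.

(** A path towards the root cannot leave X and come back, by convexity, so it
    enters X through a unique edge. *)
Lemma entry_uniq u w w' : above T u w -> above T u w' -> w \notin X -> w' \notin X ->
  par T w \in X -> par T w' \in X -> w = w'.
Proof.
move=> uw uw' wX wX' pw pw'; apply/eqP; apply: contraT => ww.
case: (above_comp uw uw') => h.
  have := conn_convex pw (above_par ww h) (above_trans (above1 w') (conn_above pw')).
  by rewrite (negPf wX').
have := conn_convex pw' (above_par _ h) (above_trans (above1 w) (conn_above pw)).
by rewrite eq_sym (negPf wX) => /(_ ww).
Qed.

(** Two ingoing edges of X with the same minimal label are on the path from one
    leaf, and such a path enters X only once. *)
Lemma in_edges_uniq : uniq [seq p.1 | p <- in_edges X].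
Proof.
rewrite /in_edges map_cat -!map_comp cat_uniq; apply/and3P; split.
- by rewrite map_inj_uniq ?filter_uniq ?iota_uniq.
- apply/hasPn => j /mapP[w]; rewrite mem_filter => /andP[/and3P[wr wX pw] _] /= ->.
  apply/negP => /mapP[i]; rewrite mem_filter => /andP[iX _] /= e.
  have h := minlabel_above vT w; rewrite e in h.
  have := conn_convex iX h (above_trans (above1 w) (conn_above pw)).
  by rewrite (negPf wX).
- rewrite map_inj_in_uniq ?(filter_uniq _ (enum_uniq _)) // => w w'.
  rewrite !mem_filter => /andP[/and3P[wr wX pw] _] /andP[/and3P[wr' wX' pw'] _] /= e.
  have h := minlabel_above vT w; have h' := minlabel_above vT w'; rewrite -e in h'.
  exact: entry_uniq h h' wX wX' pw pw'.
Qed.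

Lemma ins_sorted : sorted ltn [seq p.1 | p <- ins X].
Proof.
rewrite ltn_sorted_uniq_leq; apply/andP; split.
  by rewrite (perm_uniq (perm_map _ (permEl (perm_sort _ _)))) in_edges_uniq.
rewrite sorted_map; apply: sort_sorted => p q; exact: leq_total.
Qed.

(** A strictly increasing list is determined by its elements, so [ins X] can be
    computed without sorting. *)
Lemma ins_eq (l : seq (nat * V T)) : sorted ltn [seq p.1 | p <- l] ->
  (forall p, p \in l <-> p \in in_edges X) -> l = ins X.
Proof.
move=> sl ml; have ul : uniq [seq p.1 | p <- l].
  by move: sl; rewrite ltn_sorted_uniq_leq => /andP[].
have pl : perm_eq l (ins X).
  apply: uniq_perm; first exact: map_uniq ul.
    by rewrite sort_uniq; exact: map_uniq in_edges_uniq.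
  by move=> p; rewrite mem_sort; apply/idP/idP => /ml.
have sl' : sorted (fun p q : nat * V T => p.1 <= q.1) l.
  by move: sl; rewrite ltn_sorted_uniq_leq sorted_map => /andP[].
rewrite -[LHS](sorted_sort _ sl') => [|p q r]; last exact: leq_trans.
apply/perm_sort_inP.
- by move=> p q _ _; apply: leq_total.
- by move=> p q r _ _ _; apply: leq_trans.
- move=> p q pX qX; rewrite -eqn_leq => /eqP e; apply/eqP.
  have := ul; move: pX qX; elim: (l) => //= a l' IH.
  rewrite !inE => /orP[/eqP pa | pl'] /orP[/eqP qa | ql'] /andP[al ul'].
  + by rewrite pa qa.
  + by case/negP: al; rewrite -pa e map_f.
  + by case/negP: al; rewrite -qa -e map_f.
  + exact: IH.
- apply: uniq_perm; [exact: map_uniq ul | exact: map_uniq in_edges_uniq |].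
  by move=> p; apply/idP/idP => /ml.
Qed.

End InEdges.

Section Subtree.
Variables (F T : tree) (i : subtree F T).
Let vT := tree_valid T.
Let vF := tree_valid F.

Definition simg : {set V T} := [set v in codom i].

Lemma sub_inj : injective i.
Proof. by case/and3P: (subtreeP i) => /injectiveP. Qed.

Lemma sub_par v : v != troot F -> par T (i v) = i (par F v).
Proof. by case/and3P: (subtreeP i) => _ /forallP /(_ v) /implyP h _ /h/eqP. Qed.

Lemma sub_att : [seq i v | v <- att F] = [seq p.2 | p <- ins simg].
Proof. by case/and3P: (subtreeP i) => _ _ /eqP. Qed.

Lemma mem_simg x : (x \in simg) = (x \in codom i).
Proof. by rewrite inE. Qed.

Lemma simg_f v : i v \in simg.
Proof. by rewrite inE codom_f. Qed.

Lemma simgP x : reflect (exists v, x = i v) (x \in simg).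
Proof. by rewrite inE; apply: (iffP codomP). Qed.

Lemma sub_above u v : above F u v -> above T (i u) (i v).
Proof.
case/aboveP=> [n <-] {v}; elim: n => [|n IHn] /=; first exact: connect0.
case: (eqVneq (iter n (par F) u) (troot F)) => [e | ne].
  by rewrite e par_root // -e.
by apply: above_trans IHn _; rewrite -sub_par // above1.
Qed.

Lemma sub_root_above v : above T (i v) (i (troot F)).
Proof. exact/sub_above/above_root. Qed.

Lemma sub_above_inv u v : above T (i u) (i v) -> above F u v.
Proof.
elim/(root_ind vF): u => [|u ur IHu] h.
  by rewrite (sub_inj (above_anti vT h (sub_root_above v))) connect0.
case: (eqVneq u v) => [-> | uv]; first exact: connect0.
have := above_par (u := i u) (v := i v); rewrite (inj_eq sub_inj) sub_par // => k.
exact: above_trans (above1 u) (IHu (k uv h)).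
Qed.

Lemma sub_conn : conn simg (i (troot F)).
Proof.
split=> [|u]; first exact: simg_f.
case/simgP=> v ->; split; first exact: sub_root_above.
by rewrite (inj_eq sub_inj) => vr; rewrite sub_par // simg_f.
Qed.

Lemma sub_neq_root v : v != troot F -> i v != troot T.
Proof.
move=> vr; apply: (conn_neq sub_conn); first exact: simg_f.
by rewrite (inj_eq sub_inj).
Qed.

(** The minimal label in T of the leaves above the a-th leaf of F *)
Definition skey (a : nat) : nat := nth 0 [seq p.1 | p <- ins simg] a.

Lemma size_ins : size (ins simg) = nl F.
Proof. by rewrite -(size_map (fun p => p.2)) -sub_att size_map. Qed.

Lemma skey_mem a : a < nl F -> (skey a, i (leafv F a)) \in in_edges simg.
Proof.
move=> an; have an' : a < size (ins simg) by rewrite size_ins.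
have -> : (skey a, i (leafv F a)) = nth (0, troot T) (ins simg) a.
  rewrite /skey (nth_map (0, troot T)) // /leafv -(nth_map _ (troot T)) // sub_att.
  by rewrite (nth_map (0, troot T)) //; case: (nth _ _ _).
by rewrite -(mem_sort (fun p q => p.1 <= q.1)) mem_nth.
Qed.

Lemma in_edges_skey j t : (j, t) \in in_edges simg ->
  exists a, [/\ a < nl F, skey a = j & i (leafv F a) = t].
Proof.
rewrite -(mem_sort (fun p q => p.1 <= q.1)) => /(nthP (0, troot T))[a].
rewrite -/(ins _) => an e; exists a; rewrite -size_ins; split=> //.
  by rewrite /skey (nth_map (0, troot T)) // e.
rewrite /leafv -(nth_map _ (troot T)) -?/(nl F) -?size_ins // sub_att.
by rewrite (nth_map (0, troot T)) // e.
Qed.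

Lemma skey_lt a b : a < b -> b < nl F -> skey a < skey b.
Proof.
move=> ab bn; have := ins_sorted sub_conn; rewrite /skey.
move/(sorted_ltn_nth ltn_trans 0) => h; apply: h => //; rewrite inE size_map size_ins //.
exact: ltn_trans ab bn.
Qed.

Lemma skey_le a b : a <= b -> b < nl F -> skey a <= skey b.
Proof. by rewrite leq_eqVlt => /orP[/eqP -> // | ab] bn; apply/ltnW/skey_lt. Qed.

(** The leaves of F above w correspond to the leaves of T above the image of w:
    the leaf of T with the minimal label above the a-th leaf of F stands for the
    latter. *)
Lemma above_skey a w : a < nl F -> above T (leafv T (skey a)) (i w) = above F (leafv F a) w.
Proof.
move=> an; have ma := skey_mem an; have la := in_edges_above ma.
apply/idP/idP => [h | /sub_above]; last exact: above_trans la.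
apply: sub_above_inv; case/mem_in_edges: ma => tX [[_ <- //] | [u [ur uX pu um]]].
have hu := minlabel_above vT u; rewrite um in hu.
case: (above_comp hu h) => k.
  rewrite -pu; apply: above_par k; apply: contraNneq uX => ->; exact: simg_f.
case/negP: uX; apply: (conn_convex sub_conn (simg_f w) k).
by apply: above_trans (above1 u) _; rewrite pu; apply: sub_root_above.
Qed.

Lemma leaf_skey l w : l < nl T -> above T (leafv T l) (i w) ->
  exists a, [/\ a < nl F, skey a <= l & above F (leafv F a) w].
Proof.
move=> ln h; case: (boolP (leafv T l \in simg)) => lX.
  have [|a [an ka ta]] := @in_edges_skey l (leafv T l).
    by apply/mem_in_edges; split=> //; left.
  by exists a; rewrite ka -above_skey // ka.
have [|u [lu uX pu]] := first_entry (P := mem simg) h lX; first exact: simg_f.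
have ur : u != troot T.
  by apply: contraNneq uX => e; move: pu; rewrite e par_root.
have [|a [an ka ta]] := @in_edges_skey (minlabel u) (par T u).
  by apply/mem_in_edges; split=> //; right; exists u.
exists a; split=> //; first by rewrite ka; apply: minlabel_le.
apply: sub_above_inv; rewrite ta; apply: above_par.
  by apply: contraNneq uX => ->; apply: simg_f.
case: (above_comp lu h) => // k; case/negP: uX.
apply: (conn_convex sub_conn (simg_f w) k).
exact: above_trans (above1 u) (conn_above sub_conn pu).
Qed.

(** Minimal labels of F and T correspond to each other by an increasing map, so
    the order of the leaves of a subtree of F can be computed in T. *)
Lemma minlabel_sub w : minlabel (i w) = skey (minlabel w).
Proof.
have mn := minlabel_lt vF w.
apply: (minlabelP vT); first by rewrite above_skey // minlabel_above.
move=> l h; case: (ltnP l (nl T)) => [ln | le].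
  have [a [an ka aw]] := leaf_skey ln h.
  by apply: leq_trans ka; apply: skey_le => //; apply: minlabel_le.
by apply: leq_trans le; exact: ltnW (in_edges_lt (skey_mem mn)).
Qed.

End Subtree.

Lemma subtree_eq (F T : tree) (i j : subtree F T) : i =1 j -> i = j.
Proof.
case: i j => [f hf] [g hg] /= fg; have e : f = g by apply/ffunP.
by subst g; congr Subtree; apply: bool_irrelevance.
Qed.

(** Dependent pairs allow one to state that two subtrees of T given by different
    trees are equal. *)
Definition psub (T : tree) := {F : tree & subtree F T}.

(** The set of vertices determines the tree and its leaves up to isomorphism, and
    isomorphic trees are equal. *)
Lemma sub_packed (T F F' : tree) (i : subtree F T) (i' : subtree F' T) :
  simg i = simg i' -> existT _ F i = existT _ F' i' :> psub T.
Proof.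
move=> E; have ex v : exists u, i' u == i v.
  have : i v \in simg i' by rewrite -E simg_f.
  by case/simgP=> u ->; exists u.
pose h v := xchoose (ex v); have hi v : i' (h v) = i v by apply/eqP/(xchooseP (ex v)).
have ex' u : exists v, i v == i' u.
  have : i' u \in simg i by rewrite E simg_f.
  by case/simgP=> v ->; exists v.
pose g u := xchoose (ex' u); have gi u : i (g u) = i' u by apply/eqP/(xchooseP (ex' u)).
have hb : bijective h.
  exists g => v; first by apply: (@sub_inj _ _ i); rewrite gi hi.
  by apply: (@sub_inj _ _ i'); rewrite hi gi.
have h0 : h (troot F) = troot F'.
  apply: (@sub_inj _ _ i'); apply: (above_anti (tree_valid T)); first exact: sub_root_above.
  by rewrite hi -gi; apply: sub_root_above.
have hp v : v != troot F -> par F' (h v) = h (par F v).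
  move=> vr; apply: (@sub_inj _ _ i'); rewrite -sub_par ?hi ?sub_par //.
  by rewrite -h0 (inj_eq (bij_inj hb)).
have ha : [seq h v | v <- att F] = att F'.
  apply: (inj_map (@sub_inj _ _ i')); rewrite sub_att -E -sub_att -map_comp.
  by apply: eq_map => v /=.
have := tree_rigid hb h0 hp ha.
move=> /esym e; have eF : F = F' by case: e.
subst F'; congr existT; apply: subtree_eq => v.
by rewrite -hi; congr (i' _); exact: (iso_id hp ha).
Qed.

Lemma subtreeI (F T : tree) (i : V F -> V T) : injective i ->
  (forall v, v != troot F -> par T (i v) = i (par F v)) ->
  [seq i v | v <- att F] = [seq p.2 | p <- ins [set v in codom i]] ->
  exists j : subtree F T, i =1 j.
Proof.
move=> ii ip ia; have h : is_subtree [ffun v => i v].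
  have E : (fun v => [ffun v => i v] v) =1 i by move=> v; rewrite ffunE.
  have C : [set v in codom [ffun v => i v]] = [set v in codom i].
    by apply/setP => v; rewrite !inE (eq_codom (g := i)).
  apply/and3P; split.
  - by apply/injectiveP => u v; rewrite !ffunE; apply: ii.
  - by apply/forallP => v; apply/implyP => vr; rewrite !ffunE ip.
  - by rewrite C -/(ins _) (eq_map E) ia.
by exists (Subtree h) => v; rewrite /= ffunE.
Qed.

(** The parent map of T restricts to X apart from the root vertex x0, and the
    leaves are the ingoing edges of X. *)
Lemma subtree_exists (T : tree) (X : {set V T}) x0 : conn X x0 ->
  exists F (i : subtree F T), simg i = X.
Proof.
move=> cX; have [x0X _] := cX.
pose K := {v : V T | v \in X}.
pose k0 : K := exist _ x0 x0X.
pose p (k : K) : K := if val k == x0 then k0 else insubd k0 (par T (val k)).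
have pE k : val (p k) = if val k == x0 then x0 else par T (val k).
  by rewrite /p; case: eqP => // /eqP h; rewrite val_insubd (conn_par cX) ?(valP k).
pose a := [seq insubd k0 q.2 | q <- ins X].
have aE : [seq val k | k <- a] = [seq q.2 | q <- ins X].
  rewrite -map_comp; apply/eq_in_map => -[j t] /mem_ins[tX _] /=.
  by rewrite val_insubd tX.
have pk0 : p k0 = k0 by apply: val_inj; rewrite pE /= eqxx.
have pc k : fconnect p k k0.
  have /aboveP[n] := conn_above cX (valP k).
  elim: n k => [|n IHn] k; first by move=> /= e; rewrite (_ : k = k0) ?connect0 //; apply: val_inj.
  rewrite iterSr => e; case: (eqVneq (val k) x0) => [ek | kx].
    by rewrite (_ : k = k0) ?connect0 //; apply: val_inj.
  apply: connect_trans (fconnect1 _ _) _; apply: IHn.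
  by rewrite pE (negPf kx).
have pl k : k \in a \/ exists2 k', k' != k0 & p k' = k.
  case/and3P: (tree_valid T) => _ _ /forallP /(_ (val k)).
  have ka j : (j, val k) \in ins X -> k \in a.
    by move=> h; apply/mapP; exists (j, val k); rewrite //= valKd.
  case/orP=> [/(nthP (troot T))[j jn e] | /existsP[w /andP[wr /eqP pw]]].
    by left; apply: (ka j); apply/mem_ins; rewrite (valP k); split=> //; left.
  case: (boolP (w \in X)) => wX; last first.
    left; apply: (ka (minlabel w)); apply/mem_ins; rewrite (valP k); split=> //.
    by right; exists w.
  right; exists (exist _ w wX).
    apply/eqP => /(congr1 val) /= e; have := par_not_above (tree_valid T) wr.
    by rewrite {2}e pw (conn_above cX (valP k)).
  apply: val_inj; rewrite pE /= pw; case: eqP => // e.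
  have := par_not_above (tree_valid T) wr.
  by rewrite {2}e pw (conn_above cX (valP k)).
have [F [h [g [hg gh h0 hp ha]]]] := mktree pk0 pc pl.
have gi : injective (fun v => val (g v)) by move=> u v /val_inj /(can_inj gh).
have [||i iE] := @subtreeI F T (fun v => val (g v)) gi.
- move=> v vr; have e : par F v = h (p (g v)) by rewrite -hp gh.
  rewrite e hg pE ifN //; apply: contra vr => /eqP vx.
  by rewrite -(gh v) -h0; apply/eqP; congr h; apply: val_inj.
- rewrite ha -map_comp (_ : [set v in _] = X); first by rewrite -aE; apply: eq_map => k /=; rewrite hg.
  apply/setP => v; rewrite inE; apply/codomP/idP => [[u ->] | vX]; first exact: valP.
  by exists (h (exist _ v vX)); rewrite hg.
exists F, i; apply/setP => v; rewrite inE; apply/codomP/idP => [[u ->] | vX].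
  by rewrite -iE (valP (g u)).
by exists (h (exist _ v vX)); rewrite -iE hg.
Qed.

(** ** Subtrees of subtrees *)
Section SubSub.
Variables (F G T : tree) (i : subtree F G) (j : subtree G T).

Let X := simg i.
Let jX := [set v in codom (fun v => j (i v))].

Lemma subsub_mem x : (x \in jX) = [exists u in X, x == j u].
Proof.
rewrite inE; apply/codomP/existsP => [[v ->] | [u /andP[/simgP[v ->] /eqP ->]]].
  by exists (i v); rewrite simg_f eqxx.
by exists v.
Qed.

Lemma subsub_f u : (j u \in jX) = (u \in X).
Proof.
rewrite subsub_mem; apply/existsP/idP => [[v /andP[vX /eqP /sub_inj -> //]] | uX].
by exists u; rewrite uX eqxx.
Qed.

Lemma subsub_conn : conn jX (j (i (troot F))).
Proof.
split=> [|x]; first by rewrite subsub_f simg_f.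
rewrite subsub_mem => /existsP[u /andP[/simgP[v ->] /eqP ->]]; split.
  exact/sub_above/sub_root_above.
rewrite (inj_eq (@sub_inj _ _ j)) (inj_eq (@sub_inj _ _ i)) => vr.
by rewrite sub_par ?sub_neq_root // subsub_f sub_par // simg_f.
Qed.

(** The ingoing edges of a subtree of G are the same in G and in T; only their
    minimal labels are renumbered, increasingly. *)
Lemma subsub_ins : [seq (skey j p.1, j p.2) | p <- ins X] = ins jX.
Proof.
have lt p : p \in ins X -> p.1 < nl G.
  by case: p => a t; rewrite mem_sort => /in_edges_lt.
apply: (ins_eq subsub_conn).
  have := ins_sorted (sub_conn i); rewrite -/X.
  have -> : [seq q.1 | q <- [seq (skey j p.1, j p.2) | p <- ins X]] =
            [seq skey j a | a <- [seq p.1 | p <- ins X]] by rewrite -!map_comp.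
  have : {in [seq p.1 | p <- ins X], forall a, a < nl G} by move=> a /mapP[p /lt ? ->].
  elim: [seq p.1 | p <- ins X] => //= a l; case: l => //= b l IH al /andP[ab sl].
  rewrite IH // => [|c cluster]; last by apply: al; rewrite inE cluster orbT.
  by rewrite skey_lt // al // !inE eqxx orbT.
case=> b t; split.
  case/mapP=> -[a s] /=; rewrite mem_sort => m [-> ->].
  case/mem_in_edges: (m) => sX [[an e] | [w [wr wX pw mw]]].
    case/mem_in_edges: (skey_mem j an) => tX h; apply/mem_in_edges.
    rewrite subsub_f sX; split=> //; rewrite -e.
    case: h => [|[u [ur uX pu mu]]]; [by left | right; exists u; split=> //].
    apply: contra uX; rewrite subsub_mem => /existsP[v /andP[_ /eqP ->]]; exact: simg_f.
  apply/mem_in_edges; rewrite subsub_f sX; split=> //; right; exists (j w).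
  by rewrite sub_neq_root // subsub_f wX sub_par // pw minlabel_sub mw.
case/mem_in_edges; rewrite subsub_mem => /existsP[s /andP[sX /eqP ->]] h.
suff [a [m ->]] : exists a, (a, s) \in in_edges X /\ b = skey j a.
  by apply/mapP; exists (a, s); rewrite // mem_sort.
case: h => [[bn e] | [w [wr wX pw <-]]].
  have [|a [an <- /sub_inj ea]] := @in_edges_skey _ _ j b (j s).
    by apply/mem_in_edges; split; [exact: simg_f | left].
  by exists a; split=> //; apply/mem_in_edges; split=> //; left.
case: (boolP (w \in simg j)) => [/simgP[w' ew] | wj]; last first.
  have [|a [an <- /sub_inj ea]] := @in_edges_skey _ _ j (minlabel w) (j s).
    by apply/mem_in_edges; split; [exact: simg_f | right; exists w].
  by exists a; split=> //; apply/mem_in_edges; split=> //; left.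
have wr' : w' != troot G.
  apply: contraNneq wr => e; have := sub_root_above j s.
  rewrite -pw ew e => h; apply/eqP/(par_fix (tree_valid T)).
  by apply: (above_anti (tree_valid T) h (above1 _)).
exists (minlabel w'); split; last by rewrite ew minlabel_sub.
apply/mem_in_edges; split=> //; right; exists w'; split=> //.
  by rewrite -subsub_f -ew.
by apply: (@sub_inj _ _ j); rewrite -pw ew sub_par.
Qed.

Lemma subcomp_exists : exists k : subtree F T, forall v, k v = j (i v).
Proof.
have [|||k kE] := @subtreeI F T (fun v => j (i v)).
- by move=> u v /sub_inj/sub_inj.
- by move=> v vr; rewrite sub_par ?sub_neq_root // sub_par.
- rewrite -/jX -subsub_ins -map_comp [LHS](map_comp j i) sub_att -map_comp.
  by apply: eq_map.
by exists k => v; rewrite -kE.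
Qed.

Definition subcomp : subtree F T := sval (cid subcomp_exists).

Lemma subcompE v : subcomp v = j (i v).
Proof. exact: (svalP (cid subcomp_exists)). Qed.

End SubSub.


Lemma idsub_exists (T : tree) : exists k : subtree T T, forall v, k v = v.
Proof.
have [//|v vr //||k kE] := @subtreeI T T id; last by exists k => v; rewrite -kE.
rewrite map_id (_ : ins _ = [seq (j, leafv T j) | j <- iota 0 (nl T)]); last first.
  have cT : conn [set v in codom (@id (V T))] (troot T).
    split=> [|u _]; first by rewrite inE (codom_f id).
    by split=> [|_]; rewrite ?above_root // inE (codom_f id).
  apply/esym/(ins_eq cT).
    by rewrite -map_comp (@eq_map _ _ _ id) // map_id iota_ltn_sorted.
  case=> j t; split.
    case/mapP=> k; rewrite mem_iota => /andP[_ kn] [-> ->].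
    by apply/mem_in_edges; rewrite inE (codom_f id); split=> //; left.
  case/mem_in_edges => _ [[jn <-] | [w [_ + _ _]]]; last by rewrite inE (codom_f id).
  by apply/mapP; exists j; rewrite // mem_iota.
rewrite -map_comp; apply: (@eq_from_nth _ (troot T)) => [|j jn]; first by rewrite size_map size_iota.
by rewrite (nth_map 0) ?size_iota //= nth_iota.
Qed.

Definition idsub (T : tree) : subtree T T := sval (cid (idsub_exists T)).

Lemma idsubE (T : tree) v : idsub T v = v.
Proof. exact: (svalP (cid (idsub_exists T))). Qed.

(** Being a subtree is a condition on vertex sets, so it can be checked in the
    smallest tree that contains them. *)
Lemma sub_factor (F G T : tree) (i : subtree F T) (j : subtree G T) :
  simg i \subset simg j -> exists k : subtree F G, forall v, j (k v) = i v.
Proof.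
move=> /subsetP ij; pose X := [set u | j u \in simg i].
have [u0 e0] : exists u, i (troot F) = j u by apply/simgP/ij/simg_f.
have cX : conn X u0.
  split=> [|u]; first by rewrite inE -e0 simg_f.
  rewrite inE => ui; split; first by apply: (@sub_above_inv _ _ j); rewrite -e0 (conn_above (sub_conn i)).
  move=> uu; rewrite inE -sub_par; first by rewrite (conn_par (sub_conn i)) // e0 (inj_eq (@sub_inj _ _ j)).
  apply: contra uu => /eqP ur; apply/eqP/(@sub_inj _ _ j)/(above_anti (tree_valid T)).
    by rewrite -e0 (conn_above (sub_conn i)).
  by rewrite ur; apply: sub_root_above.
have [F' [k kX]] := subtree_exists cX.
have e : simg i = simg (subcomp k j).
  apply/setP => x; apply/idP/simgP => [xi | [v ->]].
    have /simgP[u eu] := ij _ xi; have /simgP[v ev] : u \in simg k by rewrite kX inE -eu.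
    by exists v; rewrite subcompE -ev.
  by rewrite subcompE; have := simg_f k v; rewrite kX inE.
have p := sub_packed e; have eF := existT_inj1 p.
by subst F'; exists k => v; rewrite (existT_inj2 p) subcompE.
Qed.

(** * Restriction of contractions to subtrees *)

Section Restriction.
Variables (T S : tree) (f : mor T S).

Lemma preim_conn (X : {set V S}) x0 : conn X x0 -> conn [set v | f v \in X] (msec f x0).
Proof.
move=> cX; split=> [|u]; first by rewrite inE msecK (conn_root cX).
rewrite inE => uX; split; first by rewrite above_msec (conn_above cX).
move=> ux; rewrite inE; case: (boolP (u \in kerm f)) => uE; first by rewrite -ker_par.
rewrite -mor_par // (conn_par cX) //; apply: contra ux => /eqP <-.
by rewrite msec_id.
Qed.

(** Contracting edges inside the preimage of X changes neither its ingoing edges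
    nor their minimal labels. *)
Lemma preim_ins (X : {set V S}) x0 : conn X x0 ->
  [seq (p.1, f p.2) | p <- ins [set v | f v \in X]] = ins X.
Proof.
move=> cX; apply: (ins_eq cX).
  by rewrite -map_comp; apply: (ins_sorted (preim_conn cX)).
case=> j t; split.
  case/mapP=> -[a s] /= + [-> ->]; rewrite mem_sort => /mem_in_edges[].
  rewrite inE => sX h; apply/mem_in_edges; split=> //.
  case: h => [[jn <-] | [w [wr wX pw mw]]].
    by left; rewrite (mor_nl f) (mor_leafv f).
  have wE : w \notin kerm f.
    by rewrite inE in wX; apply: contra wX => /ker_par ->; rewrite pw.
  right; exists (f w); split.
  - by apply: contra wr => /eqP e; rewrite -(msec_id wE) e msec_root.
  - by rewrite inE in wX.
  - by rewrite mor_par // pw.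
  - by rewrite -(minlabel_msec f) msec_id.
case/mem_in_edges => tX [[jn e] | [w [wr wX pw mw]]]; apply/mapP.
  move: tX; rewrite -e => tX; exists (j, leafv T j); last by rewrite /= (mor_leafv f).
  rewrite mem_sort; apply/mem_in_edges; rewrite inE -(mor_leafv f).
  by split=> //; left; rewrite -(mor_nl f).
exists (j, par T (msec f w)); last by rewrite /= -mor_par ?msecN // msecK pw.
rewrite mem_sort; apply/mem_in_edges; rewrite inE -mor_par ?msecN // msecK pw.
split=> //; right; exists (msec f w); split=> //.
- by apply: contra wr => /eqP e; rewrite -(msecK f w) e mor_root.
- by rewrite inE msecK.
- by rewrite minlabel_msec.
Qed.

Variables (F F' : tree) (i : subtree F S) (i' : subtree F' T).
Hypothesis ii : simg i' = [set v | f v \in simg i].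

Lemma restr_root : i' (troot F') = msec f (i (troot F)).
Proof.
have c1 := sub_conn i'; have := preim_conn (sub_conn i); rewrite -ii => c2.
apply: (above_anti (tree_valid T)).
  exact: (conn_above c2 (simg_f i' _)).
exact: (conn_above c1 (conn_root c2)).
Qed.

(** The map on vertices is forced by f; contracted edges of the restriction are
    those of f. *)
Lemma restr1_exists : exists g : mor F' F,
  restr1 i' i f g /\ kerm g = [set v | i' v \in kerm f].
Proof.
have ex v : exists u, i u == f (i' v).
  have : i' v \in simg i' by rewrite simg_f.
  by rewrite ii inE => /simgP[u ->]; exists u.
pose h v := xchoose (ex v); have ih v : i (h v) = f (i' v) by apply/eqP/(xchooseP (ex v)).
have ri := @sub_inj _ _ i; have ri' := @sub_inj _ _ i'.
have hr : h (troot F') = troot F by apply: ri; rewrite ih restr_root msecK.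
have rE : troot F' \notin [set v | i' v \in kerm f] by rewrite inE restr_root msecN.
have [|||||g [gh gE]] := @contrI F' F [set v | i' v \in kerm f] h rE hr.
- apply: (inj_map ri); rewrite sub_att -(preim_ins (sub_conn i)) -ii.
  transitivity [seq f u | u <- [seq i' v | v <- att F']].
    by rewrite -!map_comp; apply: eq_map => v /=.
  by rewrite sub_att -!map_comp.
- move=> v vE; apply: ri; rewrite !ih.
  have vr : v != troot F' by apply: contraNneq rE => <-.
  by rewrite inE in vE; rewrite ker_par // sub_par.
- move=> v vE; case: (eqVneq v (troot F')) => [-> | vr].
    by rewrite (par_root (tree_valid F')) hr par_root.
  rewrite inE in vE; apply: ri; rewrite -sub_par; first by rewrite !ih mor_par // sub_par.
  apply: contra vr => /eqP e; apply/eqP/ri'; rewrite restr_root -e ih msec_id //.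
- move=> w; have : msec f (i w) \in simg i' by rewrite ii inE msecK simg_f.
  case/simgP=> v ev; exists v; first by rewrite inE -ev msecN.
  by apply: ri; rewrite ih -ev msecK.
- move=> u v; rewrite in_set => uE; rewrite in_set => vE e; apply: ri'.
  by apply: (mor_inj uE vE); rewrite -!ih e.
exists g; split=> //; split=> v; last by rewrite -gh ih.
by have := mem_simg i' v; have := mem_simg i (f v); rewrite ii inE => -> <-.
Qed.

End Restriction.

(** * Decompositions *)

(** The fibres of a contraction are preimages of single vertices, hence
    connected. *)
Lemma decomp_exists (T S : tree) (f : mor T S) :
  exists (F : V S -> tree) (D : decomp T S F), dmor D = f.
Proof.
have ex v : exists Phi : psub T, simg (tagged Phi) = [set u | f u == v].
  have cv : conn [set v] v.
    by split=> [|u /set1P ->]; rewrite ?set11 ?connect0 // eqxx.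
  have [F [i iX]] := subtree_exists (preim_conn f cv).
  by exists (existT _ F i); rewrite iX; apply/setP => u; rewrite !inE.
have [Phi PhiE] := choice ex.
have h v u : (u \in codom (tagged (Phi v))) = (f u == v).
  by rewrite -mem_simg PhiE inE.
by exists (fun v => tag (Phi v)), (Decomp h).
Qed.

Section Decomp.
Variables (T S : tree) (F : V S -> tree) (D : decomp T S F).

Definition part (v : V S) : psub T := existT _ (F v) (demb D v).

Lemma demb_simg v : simg (demb D v) = [set u | dmor D u == v].
Proof. by apply/setP => u; rewrite !inE dembP. Qed.

Lemma dmor_emb v u : dmor D (demb D v u) = v.
Proof. by apply/eqP; rewrite -dembP codom_f. Qed.

Lemma demb_root v : demb D v (troot (F v)) = msec (dmor D) v.
Proof.
have cv : conn [set v] v.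
  by split=> [|u /set1P ->]; rewrite ?set11 ?connect0 // eqxx.
have := preim_conn (dmor D) cv; set X := [set u | _].
have -> : X = simg (demb D v) by rewrite demb_simg; apply/setP => u; rewrite !inE.
move=> c2; apply: (above_anti (tree_valid T)).
  exact: (conn_above c2 (simg_f (demb D v) _)).
exact: (conn_above (sub_conn _) (conn_root c2)).
Qed.

End Decomp.

(** * Sequences of tree morphisms *)

Definition pseq (T : tree) := {S : tree & mseq T S}.

Fixpoint mtot T S (c : mseq T S) : mor T S :=
  match c in mseq T S return mor T S with
  | MLast _ _ f => f
  | MCons _ _ _ f c' => mor_comp f (mtot c')
  end.

(** The edges contracted by a composite f, g, when E is the set of those that are
    contracted by g *)
Definition pull (T S : rawtree) (f : V T -> V S) (E : {set V S}) : {set V T} :=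
  kerm f :|: [set v in ~: kerm f | f v \in E].

(** The increasing sequence of sets of edges of T contracted by the composites
    T -> T_k, ..., T -> T_1, T -> S *)
Fixpoint kers T S (c : mseq T S) : seq {set V T} :=
  match c in mseq T S return seq {set V T} with
  | MLast _ _ f => [:: kerm f]
  | MCons _ _ _ f c' => kerm f :: [seq pull f E | E <- kers c']
  end.

Definition pkers T (s : pseq T) : seq {set V T} := kers (tagged s).

Definition pcons (T U : tree) (f : mor T U) (s : pseq U) : pseq T :=
  existT _ (tag s) (MCons f (tagged s)).

Lemma ker_comp (T S U : tree) (f : mor T S) (g : mor S U) :
  kerm (mor_comp f g) = pull f (kerm g).
Proof. exact: (is_contr_ker (tree_valid T) (contr_comp (mor_contr f) (mor_contr g))). Qed.

Lemma mem_pull (T S : tree) (f : mor T S) E v : v \notin kerm f ->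
  (v \in pull f E) = (f v \in E).
Proof. by move=> h; rewrite in_setU (negPf h) in_set in_setC h. Qed.

Lemma pullK (T S : tree) (f : mor T S) E v : v \in kerm f -> v \in pull f E.
Proof. by move=> h; rewrite in_setU h. Qed.

Lemma mem_pullE (T S : tree) (f : mor T S) E v :
  (v \in pull f E) = (v \in kerm f) || (f v \in E).
Proof.
case: (boolP (v \in kerm f)) => h; first by rewrite pullK.
by rewrite mem_pull.
Qed.

Lemma pull_inj (T S : tree) (f : mor T S) : injective (pull f).
Proof.
move=> E E' e; apply/setP => w; have := msecN f w; have := msecK f w.
by move: (msec f w) => v <- vE; rewrite -!mem_pull // e.
Qed.

Lemma pull_comp (T S U : tree) (f : mor T S) (g : mor S U) E :
  pull f (pull g E) = pull (mor_comp f g) E.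
Proof.
by apply/setP => v; rewrite !mem_pullE ker_comp mem_pullE /= ffunE orbA.
Qed.

Lemma size_kers T S (c : mseq T S) : size (kers c) = (mdim c).+1.
Proof. by elim: c => //= {T S} T U S f c IHc; rewrite size_map IHc. Qed.

Lemma kers_last T S (c : mseq T S) : last set0 (kers c) = kerm (mtot c).
Proof.
elim: c => //= {T S} T U S f c IHc; rewrite ker_comp -IHc.
by have := size_kers c; case: (kers c) => //= E l _; rewrite last_map.
Qed.

(** The sets [kers] determine all the quotients of T that occur, together with
    the maps between them. *)
Lemma kers_inj (T : tree) (s s' : pseq T) : pkers s = pkers s' -> s = s'.
Proof.
case: s s' => [S c] [S' c']; rewrite /pkers /=.
elim: c S' c' => {T S} [T S f | T U S f c IHc] S' c'.
  case: c' => [T' {}S' f' | T' U' {}S' f' c'] in f *; last first.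
    by case=> _ /(congr1 size); rewrite size_map size_kers.
  by case=> /mor_packed e; rewrite -(congr1 (fun x => existT _ (tag x) (MLast (tagged x))) e).
case: c' => [T' {}S' f' | T' U' {}S' f' c'] in f *.
  by case=> _ /(congr1 size); rewrite size_map size_kers.
case=> /mor_packed e; have eU := existT_inj1 e; subst U'.
rewrite -(existT_inj2 e) => /(inj_map (@pull_inj _ _ f)) /IHc {}e.
exact: (congr1 (fun s => pcons f s) e).
Qed.

Lemma kers_mcat T U S (c : mseq T U) (d : mseq U S) :
  kers (mcat c d) = kers c ++ [seq pull (mtot c) E | E <- kers d].
Proof.
elim: c d => //= {T U} T U W f c IHc d; rewrite IHc map_cat -map_comp.
by congr (_ :: _ ++ _); apply: eq_map => E /=; rewrite pull_comp.
Qed.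

Lemma kers_mglue T U S (c : mseq T U) (d : mseq U S) :
  kers (mglue c d) = take (mdim c) (kers c) ++ [seq pull (mtot c) E | E <- kers d].
Proof.
elim: c d => {T U} [T U f d | T U W f c IHc d] /=.
  case: d f => {U S} [U S g | U W S g d] f /=; rewrite ker_comp //.
  by congr (_ :: _); rewrite -map_comp; apply: eq_map => E /=; rewrite pull_comp.
rewrite IHc map_cat -map_comp map_take.
by congr (_ :: _ ++ _); apply: eq_map => E /=; rewrite pull_comp.
Qed.

Lemma mdim_mcat T U S (c : mseq T U) (d : mseq U S) :
  mdim (mcat c d) = (mdim c + mdim d).+1.
Proof. by elim: c d => //= {T U} T U W f c IHc d; rewrite IHc. Qed.

(** ** Restriction of a sequence of morphisms to a subtree *)

Lemma restr_mtot (S F : tree) (i : subtree F S) T F' (i' : subtree F' T) c cc :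
  restr i i' c cc -> restr1 i' i (mtot c) (mtot cc).
Proof.
elim=> {T F' i' c cc} // T F' i' U G j f g c d [h1 h2] _ [h3 h4]; split=> v /=.
  by rewrite h1 h3 ffunE.
by rewrite !ffunE h4 h2.
Qed.

Lemma restr_mdim (S F : tree) (i : subtree F S) T F' (i' : subtree F' T) c cc :
  restr i i' c cc -> mdim cc = mdim c.
Proof. by elim=> //= *; congr _.+1. Qed.

(** The restrictions of the successive morphisms have composable sources and
    targets because a subtree is determined by its vertices. *)
Lemma restr_exists (T S F F' : tree) (c : mseq T S) (i : subtree F S) (i' : subtree F' T) :
  simg i' = [set v | mtot c v \in simg i] ->
  exists cc : mseq F' F, restr i i' c cc /\
    kers cc = [seq [set v | i' v \in (E : {set V T})] | E <- kers c].
Proof.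
elim: c F F' i i' => {T S} [T S f | T U S f c IHc] F F' i i' /= ii.
  have [g [rg kg]] := restr1_exists ii.
  by exists (MLast g); rewrite /= kg; split=> //; constructor.
have [G [j jX]] := subtree_exists (preim_conn (mtot c) (sub_conn i)).
have [d [rd kd]] := IHc _ _ i j jX.
have ij : simg i' = [set v | f v \in simg j].
  by rewrite ii jX; apply/setP => v; rewrite !inE ffunE.
have [g [[g1 g2] kg]] := restr1_exists ij.
exists (MCons g d); split; first exact: (RCons (conj g1 g2) rd).
rewrite /= kg kd -!map_comp; congr (_ :: _); apply: eq_map => E /=.
apply/setP => v; rewrite mem_pullE [in RHS]in_set mem_pullE kg !in_set g2.
by [].
Qed.

(** * Sequences of edges *)

(** The sequence sigma(T, (e_1, ..., e_m)) bundled with its target, which depends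
    on the edges *)
Definition psigma_from (T0 T : tree) (f : V T0 -> V T) e1 es : pseq T :=
  existT _ (quots_from f e1 es) (sigma_from f e1 es).

Definition psigma (T : tree) (e1 : V T) (es : seq (V T)) : pseq T :=
  existT _ (quots e1 es) (sigma e1 es).

Lemma psigma_fromE (T0 T1 T : tree) (g : V T0 -> V T1) (f : V T1 -> V T) e1 es :
  psigma_from (fun v => f (g v)) e1 es = psigma_from f (g e1) [seq g e | e <- es].
Proof.
elim: es e1 T f => [|e2 es IHes] e1 T f //.
exact: (congr1 (pcons (quot1_mor (f (g e1))))
  (IHes e2 _ (fun v => quot1_mor (f (g e1)) (f v)))).
Qed.

Lemma psigma_cons (T : tree) (e1 e2 : V T) es :
  psigma e1 (e2 :: es) =
  pcons (quot1_mor e1) (psigma (quot1_mor e1 e2) [seq quot1_mor e1 e | e <- es]).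
Proof.
exact: (congr1 (pcons (quot1_mor e1)) (psigma_fromE (fun v => quot1_mor e1 v) id e2 es)).
Qed.

(** Sequences of pairwise distinct inner edges *)
Definition okseq (T : tree) (es : seq (V T)) : bool := uniq es && (troot T \notin es).

Lemma quot1_ker (T : tree) (e : V T) : e != troot T -> kerm (quot1_mor e) = [set e].
Proof.
move=> er; rewrite /quot1_mor /quot1 /contract.
pose G b (a : alt_spec (e != troot T) (e != troot T) b) : {S : tree & mor T S} :=
  match a with
  | AltTrue er' => existT _ (Tree (contract_tree_subproof er')) (Mor (contract_mor_subproof er'))
  | AltFalse _ => existT _ T (mor_id T)
  end.
suff h b (a : alt_spec (e != troot T) (e != troot T) b) : kerm (tagged (G b a)) = [set e] by exact: h.
case: a => [er' | h]; last by case/negP: (h).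
 exact: (is_contr_ker (tree_valid T) (contract_map_subproof er')).
Qed.

(** The sets {e_1}, {e_1, e_2}, ..., added to E *)
Fixpoint accs (T : finType) (E : {set T}) (es : seq T) : seq {set T} :=
  if es is e :: es' then (e |: E) :: accs (e |: E) es' else [::].

Lemma size_accs (T : finType) (E : {set T}) es : size (accs E es) = size es.
Proof. by elim: es E => //= e es IHes E; rewrite IHes. Qed.

Lemma accs_cat (T : finType) (E : {set T}) es es' :
  accs E (es ++ es') = accs E es ++ accs (E :|: [set e in es]) es'.
Proof.
elim: es E => [|e es IHes] E /=.
  by congr accs; apply/setP => x; rewrite !inE orbF.
rewrite IHes; congr (_ :: _ ++ accs _ _); apply/setP => x; rewrite !inE.
by case: (x == e); rewrite //= orbT.
Qed.

Lemma last_accs (T : finType) (E : {set T}) es : last E (accs E es) = E :|: [set e in es].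
Proof.
elim: es E => [|e es IHes] E /=; first by apply/setP => x; rewrite !inE orbF.
by rewrite IHes; apply/setP => x; rewrite !inE; case: (x == e); rewrite //= orbT.
Qed.

Lemma pull_accs (T S : tree) (f : mor T S) (E : {set V S}) es :
  {in es, forall e, e \notin kerm f} ->
  [seq pull f F | F <- accs E [seq f e | e <- es]] = accs (pull f E) es.
Proof.
elim: es E => //= e es IHes E h.
have he : pull f (f e |: E) = e |: pull f E.
  apply/setP => v; rewrite mem_pullE !in_setU1 mem_pullE.
  case: (boolP (v \in kerm f)) => vE /=; first by rewrite orbT.
  congr (_ || _); apply/eqP/eqP => [fe | -> //].
  by apply: (mor_inj vE) => //; apply: h; rewrite mem_head.
rewrite IHes => [|x xes]; last by apply: h; rewrite inE xes orbT.
congr (_ :: accs _ _); exact: he.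
Qed.

Lemma okseq_quot1 (T : tree) (e1 : V T) es : okseq (e1 :: es) ->
  okseq [seq quot1_mor e1 e | e <- es] /\ {in es, forall e, e \notin kerm (quot1_mor e1)}.
Proof.
case/andP=> /= /andP[e1es ues]; rewrite inE negb_or => /andP[e1r res].
have h : {in es, forall e, e \notin kerm (quot1_mor e1)}.
  by move=> e ees; rewrite quot1_ker 1?eq_sym // in_set1; apply: contraNneq e1es => <-.
split=> //; apply/andP; split.
  by rewrite map_inj_in_uniq // => x y xe ye; apply: mor_inj; apply: h.
apply/mapP => -[x xes e]; case/negP: res; rewrite -(mor_root (quot1_mor e1)) in e.
by rewrite (mor_inj (root_ker _) (h _ xes) e).
Qed.

Lemma pkers_pcons (T U : tree) (f : mor T U) s :
  pkers (pcons f s) = kerm f :: [seq pull f E | E <- pkers s].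
Proof. by []. Qed.

(** The edges of T / {e_1, ..., e_i} contracted later are the images of edges of
    T, so pulling back the sets for T / e_1 adds e_1 to them. *)
Lemma pkers_psigma (T : tree) (e1 : V T) es : okseq (e1 :: es) ->
  pkers (psigma e1 es) = accs set0 (e1 :: es).
Proof.
have [n] := ubnP (size es); elim: n T e1 es => // n IHn T e1 [|e2 es] /=.
  move=> _ ok; case/andP: ok => _; rewrite inE eq_sym => e1r.
  by rewrite /pkers /= quot1_ker // setU0.
rewrite ltnS => le ok; have [ok' h] := okseq_quot1 ok.
rewrite psigma_cons pkers_pcons IHn ?size_map //.
rewrite -[quot1_mor e1 e2 :: _]/[seq quot1_mor e1 e | e <- e2 :: es] pull_accs //.
have -> : kerm (quot1_mor e1) = [set e1].
  by case/andP: ok => _; rewrite inE negb_or eq_sym => /andP[e1r _]; rewrite quot1_ker.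
have -> : pull (quot1_mor e1) set0 = [set e1].
  apply/setP => v; rewrite mem_pullE in_set0 orbF quot1_ker //.
  by case/andP: ok => _; rewrite inE negb_or eq_sym => /andP[].
by rewrite [in RHS]/= setU0.
Qed.

Lemma ker_psigma (T : tree) (e1 : V T) es : okseq (e1 :: es) ->
  kerm (mtot (sigma e1 es)) = [set e in e1 :: es].
Proof.
move=> ok; rewrite -kers_last -/(pkers (psigma e1 es)) pkers_psigma // last_accs.
by rewrite set0U.
Qed.

Lemma mdim_psigma (T : tree) (e1 : V T) es : mdim (sigma e1 es) = size es.
Proof.
suff h (T0 : tree) (f : V T0 -> V T) e es' : mdim (sigma_from f e es') = size es' by exact: h.
by elim: es' T f e {e1 es} => //= e2 es' IH T f e; rewrite IH.
Qed.

Lemma nv_mor (T S : tree) (f : mor T S) : nv T = nv S + #|kerm f|.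
Proof.
have -> : nv S = #|~: kerm f|.
  rewrite -[LHS]card_ord -(card_imset _ (@msec_inj _ _ f)).
  apply: eq_card => v; rewrite in_setC; apply/imsetP/idP => [[x _ ->] | vE].
    exact: msecN.
  by exists (f v); rewrite // msec_id.
by rewrite addnC cardsC /nv card_ord.
Qed.

Lemma nv_psigma (T : tree) (e1 : V T) es : okseq (e1 :: es) ->
  nv T = nv (quots e1 es) + (size es).+1.
Proof.
move=> ok; rewrite (nv_mor (mtot (sigma e1 es))) ker_psigma //.
by case/andP: ok => u _; rewrite cardsE (card_uniqP u).
Qed.

Lemma ok_size (T : tree) (es : seq (V T)) : okseq es -> size es < nv T.
Proof.
case/andP=> u r; have u' : uniq (troot T :: es) by rewrite /= r.
by have := uniq_leq_size u' (s2 := enum (V T)) (fun x _ => mem_enum (V T) x); rewrite size_enum_ord.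
Qed.

(** * Signs of words of vertices *)

(** Comparisons of distinct letters, on which inversion numbers depend *)
Definition tour (K : eqType) (lt : rel K) := forall a b, a != b -> lt a b = ~~ lt b a.

(** The number of inversions, whose parity is the Koszul sign of odd letters *)
Fixpoint inv (K : eqType) (lt : rel K) (w : seq K) : nat :=
  if w is a :: w' then count (fun b => lt b a) w' + inv lt w' else 0.

Lemma tour_vlt (T : tree) : tour (@vlt T).
Proof. by move=> a b; apply: vlt_total. Qed.

Lemma koszul1 (T : rawtree) (w : seq (V T)) : koszul (fun=> 1) w = inv (@vlt T) w.
Proof. by elim: w => //= a w ->; rewrite sum1_count. Qed.

Section Inv.
Variables (K : eqType) (lt : rel K).
Hypothesis ltT : tour lt.

(** The number of inversions between the letters of s and those of t *)
Definition cross (s t : seq K) := sumn [seq count (fun b => lt b a) t | a <- s].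

Lemma inv_cat s t : inv lt (s ++ t) = inv lt s + cross s t + inv lt t.
Proof.
elim: s => //= a s ->; rewrite count_cat /cross /=.
by rewrite !addnA; congr (_ + _ + _); rewrite addnAC [in RHS]addnAC -!addnA; congr (_ + _); rewrite addnC.
Qed.

Lemma cross_perm s t t' : perm_eq t t' -> cross s t = cross s t'.
Proof. by move=> /permP h; rewrite /cross; congr sumn; apply: eq_map => a; apply: h. Qed.

Lemma cross_catr s t t' : cross s (t ++ t') = cross s t + cross s t'.
Proof.
elim: s => //= a s; rewrite /cross /= => ->.
by rewrite count_cat addnACA.
Qed.

Lemma cross_catl s s' t : cross (s ++ s') t = cross s t + cross s' t.
Proof. by rewrite /cross map_cat sumn_cat. Qed.

Lemma cross_sym s t : uniq (s ++ t) -> cross s t + cross t s = size s * size t.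
Proof.
elim: s => [|a s IHs]; first by rewrite /cross /= add0n mul0n => _; elim: t.
rewrite [_ ++ _]/= cons_uniq mem_cat negb_or => /andP[/andP[_ at_] /IHs IH].
rewrite -cat1s cross_catl cross_catr addnACA IH size_cat mulnDl mul1n; congr (_ + _).
rewrite /cross /= addn0; elim: t at_ {IH IHs} => //= b t IHt.
rewrite inE negb_or => /andP[ab /IHt <-]; rewrite addn0 (ltT ab).
by case: (lt b a) => /=; rewrite ?add0n ?addSn ?addnS.
Qed.

Lemma inv_swap s1 s2 s3 : uniq (s1 ++ s2 ++ s3) ->
  odd (inv lt (s2 ++ s1 ++ s3)) = odd (inv lt (s1 ++ s2 ++ s3)) (+) odd (size s1 * size s2).
Proof.
rewrite catA cat_uniq => /and3P[u _ _].
rewrite -(cross_sym u) !inv_cat !cross_catr !cross_catl !oddD.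
by case: (odd (inv lt s1)); case: (odd (inv lt s2)); case: (odd (inv lt s3));
   case: (odd (cross s1 s2)); case: (odd (cross s2 s1));
   case: (odd (cross s1 s3)); case: (odd (cross s2 s3)).
Qed.

End Inv.

Lemma inv_map (K K' : eqType) (lt : rel K') (h : K -> K') w :
  inv lt [seq h a | a <- w] = inv (relpre h lt) w.
Proof. by elim: w => //= a w ->; rewrite count_map. Qed.

Lemma tour_pre (K K' : eqType) (lt : rel K') (h : K -> K') :
  injective h -> tour lt -> tour (relpre h lt).
Proof. by move=> hi l a b ab /=; apply: l; rewrite (inj_eq hi). Qed.

(** Both sides are the parity of the permutation from w to w': it does not depend
    on the comparison with respect to which inversions are counted, nor on the
    letters around the two words. *)
Lemma inv_perm (K K' : eqType) (lt : rel K) (lt' : rel K') (h : K -> K') a b w w' :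
  tour lt -> tour lt' -> injective h -> uniq (a ++ [seq h x | x <- w] ++ b) -> perm_eq w w' ->
  odd (inv lt' (a ++ [seq h x | x <- w] ++ b)) (+) odd (inv lt' (a ++ [seq h x | x <- w'] ++ b)) =
  odd (inv lt w) (+) odd (inv lt w').
Proof.
move=> tl tl' hi u pw; have uw : uniq w.
  by move: u; rewrite !cat_uniq => /and3P[_ _ /andP[]]; rewrite map_inj_uniq.
have E v : odd (inv lt' (a ++ [seq h x | x <- v] ++ b)) =
    odd (inv lt' [seq h x | x <- v]) (+)
    odd (inv lt' a + cross lt' a [seq h x | x <- v] + cross lt' a b +
      cross lt' [seq h x | x <- v] b + inv lt' b).
  rewrite !inv_cat cross_catr !oddD.
  move: (odd (inv lt' a)) (odd (inv lt' b)) (odd (inv lt' (map _ v))) => x y z.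
  move: (odd (cross _ a b)) (odd (cross _ a (map _ v))) (odd (cross _ (map _ v) b)) => p q r.
  by case: x; case: y; case: z; case: p; case: q; case: r.
have cluster s s' t : perm_eq s s' -> cross lt' s t = cross lt' s' t.
  by move=> p; apply: perm_sumn; apply: perm_map.
have pm : perm_eq [seq h x | x <- w] [seq h x | x <- w'] by exact: perm_map.
rewrite !E (cross_perm _ _ pm) (cluster _ _ b pm) !inv_map addbACA addbb addbF.
have tp := tour_pre hi tl'.
pose P v := uniq v -> odd (inv (relpre h lt') v) (+) odd (inv lt v) =
  odd (inv (relpre h lt') w) (+) odd (inv lt w).
suff : P w'.
  rewrite /P -(perm_uniq pw) => /(_ uw).
  move: (odd _) (odd _) (odd _) (odd _) => x y z t.
  by case: x; case: y; case: z; case: t.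
apply: (catCA_perm_ind (P := P) _ pw) => // s1 s2 s3 IH.
rewrite /P uniq_catCA => u'; rewrite -(IH u') (inv_swap tp u') (inv_swap tl u').
move: (odd (_ * _)) (odd (inv (relpre _ _) _)) (odd (inv lt _)) => x y z.
by case: x; case: y; case: z.
Qed.

(** ** Signs of blow-ups *)

Lemma filter_pred1 (K : eqType) (P : pred K) (x : K) s :
  uniq s -> x \in s -> {in s, forall y, P y = (y == x)} -> [seq y <- s | P y] = [:: x].
Proof.
move=> us xs h; rewrite (eq_in_filter h).
by rewrite filter_pred1_uniq.
Qed.

Lemma msec_comp (T S U : tree) (f : mor T S) (g : mor S U) x :
  msec (mor_comp f g) x = msec f (msec g x).
Proof.
apply: (@mor_inj _ _ (mor_comp f g)); rewrite ?msecN //.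
  by rewrite ker_comp mem_pullE msecK negb_or !msecN.
by rewrite msecK /= ffunE !msecK.
Qed.

Lemma edges_word_perm (T S : tree) (f : mor T S) es w :
  uniq es -> kerm f = [set e in es] -> perm_eq w (enum (V S)) ->
  perm_eq (es ++ [seq msec f x | x <- w]) (enum (V T)).
Proof.
move=> ues ke pw; have me v : (v \in es) = (v \in kerm f) by rewrite ke in_set.
apply: uniq_perm; rewrite ?enum_uniq //.
  rewrite cat_uniq ues map_inj_uniq ?(perm_uniq pw) ?enum_uniq ?andbT /=; last exact: msec_inj.
  by apply/hasPn => _ /mapP[x _ ->]; rewrite me msecN.
move=> v; rewrite mem_cat mem_enum me; case: (boolP (v \in kerm f)) => //= vE.
by apply/mapP; exists (f v); rewrite ?msec_id // (perm_mem pw) mem_enum.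
Qed.

Section Blowup1.
Variables (T S : tree) (f : mor T S) (e : V T).
Hypothesis ke : kerm f = [set e].

Lemma blowup_edge :
  odflt (troot T) [pick u | (u != troot T) && (f u == f (par T u))] = e.
Proof.
have h u : (u != troot T) && (f u == f (par T u)) = (u == e).
  by have := in_set1 u e; rewrite -ke in_set.
rewrite (eq_pick h); case: pickP => [u /eqP -> // | /(_ e)]; by rewrite eqxx.
Qed.

Lemma blowup_par : msec f (f e) = par T e.
Proof.
have eE : e \in kerm f by rewrite ke set11.
rewrite ker_par // msec_id // ke in_set1.
have er : e != troot T by apply: contraTneq eE => ->; exact: root_ker.
by apply: contra er => /eqP /(par_fix (tree_valid T)) ->.
Qed.

Lemma blowup_other x : x != f e -> [seq y <- enum (V T) | f y == x] = [:: msec f x].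
Proof.
move=> xe; apply: filter_pred1; rewrite ?enum_uniq ?mem_enum // => y _.
apply/eqP/eqP => [yx | ->]; last exact: msecK.
rewrite -yx msec_id // ke in_set1; by apply: contra xe => /eqP <-; rewrite yx.
Qed.

(** The blow-up map replaces the merged vertex by e and its target p. Moving e to
    the front passes all the letters on the left of the merged vertex, whose
    number is the degree sign of the blow-up map; p is the representative of the
    merged vertex. *)
Lemma blowup1 n w : uniq w -> f e \in w -> let t := blowup f (n, w) in
  perm_eq t.2 (e :: [seq msec f x | x <- w]) /\
  (forall lt, tour lt -> odd (t.1 + inv lt t.2) = odd (n + inv lt (e :: [seq msec f x | x <- w]))).
Proof.
move=> uw ew; rewrite /blowup blowup_edge /=.
have uw' := uw; have [u [v [ew' fu fv]]] : exists u v, [/\ w = u ++ f e :: v, f e \notin u & f e \notin v].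
  case/splitPr: ew uw => u v; rewrite cat_uniq /= => /and3P[_ /norP[eu _] /andP[ev _]].
  by exists u, v.
rewrite ew' in uw' *.
have fl s : f e \notin s -> flatten [seq if x == f e then [:: e; par T e]
     else [seq y <- enum (V T) | f y == x] | x <- s] = [seq msec f x | x <- s].
  elim: s => //= x s IHs; rewrite inE negb_or eq_sym => /andP[xe /IHs ->].
  by rewrite (negPf xe) blowup_other.
rewrite map_cat flatten_cat /= eqxx !fl // map_cat /= blowup_par.
rewrite index_cat (negPf fu) index_head addn0.
set u' := map _ u; set v' := map _ v; rewrite -/u' -/v'.
have pe : perm_eq (u' ++ [:: e, par T e & v']) (e :: u' ++ par T e :: v').
  exact: (permEl (perm_catCA u' [:: e] (par T e :: v'))).
split=> // lt tl.
have ue : uniq (u' ++ [:: e] ++ par T e :: v').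
  rewrite (perm_uniq pe) /u' /v' -blowup_par -map_cons -map_cat /= map_inj_uniq; last exact: msec_inj.
  rewrite uw' andbT; apply/mapP => -[x _ ex]; have := msecN f x.
  by rewrite -ex ke set11.
have := inv_swap tl ue; rewrite /= muln1 size_map => h.
by rewrite oddD [in RHS]oddD h oddD; do 3!case: (odd _).
Qed.

End Blowup1.

Lemma blowup_step (T S U : tree) (q : mor T U) (f : mor U S) e1 es n n' w w' :
  kerm q = [set e1] -> {in es, forall e, e \notin kerm q} -> uniq [seq q e | e <- es] ->
  kerm f = [set e in [seq q e | e <- es]] -> perm_eq w (enum (V S)) ->
  let v := [seq q e | e <- es] ++ [seq msec f x | x <- w] in
  perm_eq w' v -> (forall lt, tour lt -> odd (n' + inv lt w') = odd (n + inv lt v)) ->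
  let t := blowup q (n', w') in
  let v' := (e1 :: es) ++ [seq msec (mor_comp q f) x | x <- w] in
  perm_eq t.2 v' /\ (forall lt, tour lt -> odd (t.1 + inv lt t.2) = odd (n + inv lt v')).
Proof.
move=> ke h ues kf pw v pw' par'.
have pall : perm_eq w' (enum (V U)).
  by apply: perm_trans pw' _; apply: edges_word_perm.
have [||p1 i1] := blowup1 ke n' (w := w').
- by rewrite (perm_uniq pall) enum_uniq.
- by rewrite (perm_mem pall) mem_enum.
have sE : [seq msec q x | x <- v] = es ++ [seq msec (mor_comp q f) x | x <- w].
  rewrite map_cat -!map_comp; congr (_ ++ _).
    by rewrite -[RHS]map_id; apply/eq_in_map => e ees /=; rewrite msec_id //; exact: h.
  by apply: eq_map => x /=; rewrite msec_comp.
split; first by apply: perm_trans p1 _; rewrite /= perm_cons -sE perm_map.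
move=> lt tl; rewrite i1 //= inv_map.
have tp : tour (relpre (msec q) lt) by apply: tour_pre tl; exact: msec_inj.
rewrite addnCA oddD par' // -oddD -sE -inv_map addnCA.
by congr (odd (_ + (_ + _))); apply/permP; rewrite perm_map.
Qed.

(** The degree signs of the blow-up maps make the iterated blow-up equal, up to
    even permutation, to the word e_1 ... e_m followed by the representatives of
    the vertices of the quotient. *)
Lemma blowups_sign (T : tree) e1 es : okseq (e1 :: es) -> forall n w,
  perm_eq w (enum (V (quots (T := T) e1 es))) ->
  let t := blowups (sigma e1 es) (n, w) in
  let w' := (e1 :: es) ++ [seq msec (mtot (sigma e1 es)) x | x <- w] in
  perm_eq t.2 w' /\ (forall lt, tour lt -> odd (t.1 + inv lt t.2) = odd (n + inv lt w')).
Proof.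
pose claim (T : tree) (es : seq (V T)) (s : pseq T) := forall n w, perm_eq w (enum (V (tag s))) ->
  let t := blowups (tagged s) (n, w) in
  let w' := es ++ [seq msec (mtot (tagged s)) x | x <- w] in
  perm_eq t.2 w' /\ (forall lt, tour lt -> odd (t.1 + inv lt t.2) = odd (n + inv lt w')).
suff h m (T' : tree) e1' (es' : seq (V T')) : size es' < m -> okseq (e1' :: es') ->
    claim T' (e1' :: es') (psigma e1' es').
  by move=> ok; apply: (h _ _ _ _ (ltnSn (size es))).
elim: m T' e1' es' => // m IHm {}T {}e1 {}es le ok.
have e1r : e1 != troot T by case/andP: ok => _; rewrite inE negb_or eq_sym => /andP[].
have ke := quot1_ker e1r.
case: es le ok => [|e2 es] le ok; last first.
  have [ok' h] := okseq_quot1 ok; have le' := le; rewrite /= ltnS in le'.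
  rewrite psigma_cons; move: h; set q := quot1_mor e1 => h.
  have := IHm _ (q e2) [seq q e | e <- es]; rewrite size_map => /(_ le' ok') IH.
  have ks : kerm (mtot (tagged (psigma (q e2) [seq q e | e <- es]))) =
      [set e in [seq q e | e <- e2 :: es]] := ker_psigma ok'.
  move: (psigma (q e2) _) IH ks => s IH ks n w pw.
  have key := IH n w pw.
  change (blowups (tagged (pcons q s)) (n, w)) with (blowup q (blowups (tagged s) (n, w))).
  move: key; case: (blowups (tagged s) (n, w)) => n' w' [pw' par'].
  have /andP[uq _] := ok'.
  exact: (@blowup_step T (tag s) _ q (mtot (tagged s)) e1 (e2 :: es) n n' w w' ke h uq ks pw pw' par').
move=> n w pw; apply: (blowup1 ke n); first by rewrite (perm_uniq pw) enum_uniq.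
by rewrite (perm_mem pw) mem_enum.
Qed.

Lemma sigma_sign (T : tree) e1 (es : seq (V T)) : okseq (e1 :: es) ->
  odd (blowup_sign (sigma e1 es)) =
  odd (inv (@vlt T) ((e1 :: es) ++ [seq msec (mtot (sigma e1 es)) x | x <- vseq (quots e1 es)])).
Proof.
move=> ok; have [_ /(_ _ (@tour_vlt T))] := blowups_sign ok 0 (vseq_perm _).
by rewrite /blowup_sign koszul1 add0n.
Qed.

(** * Clusters of leaves *)

(** The labels of the leaves above v *)
Definition cluster (r : nat) (T : rawtree) (v : V T) : {set 'I_r} :=
  [set j : 'I_r | above T (leafv T j) v].

(** The vertex sets of the two parts of the cut below c, c being in the top
    part *)
Definition tops (T : rawtree) (c : V T) : {set V T} := [set u | above T u c].
Definition bots (T : rawtree) (c : V T) : {set V T} := [set u | ~~ above T u c].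

Section Clusters.
Variables (r : nat) (T : tree).
Hypothesis nT : nl T = r.
Let vT := tree_valid T.
Implicit Types u v w : V T.

Lemma mem_cluster j v : (j \in cluster r v) = above T (leafv T j) v.
Proof. by rewrite inE. Qed.

Lemma cluster_mono u v : above T u v -> cluster r u \subset cluster r v.
Proof. by move=> uv; apply/subsetP => j; rewrite !mem_cluster => h; apply: above_trans uv. Qed.

Lemma cluster_ex v : exists j : 'I_r, j \in cluster r v.
Proof.
have [j jn h] := leaf_above vT v; rewrite nT in jn.
by exists (Ordinal jn); rewrite mem_cluster.
Qed.

(** Below a leaf, the vertices form a path. *)
Lemma cluster_comp j u v : j \in cluster r u -> j \in cluster r v -> above T u v \/ above T v u.
Proof. by rewrite !mem_cluster; apply: above_comp. Qed.

Lemma child_above u v : above T u v -> u != v ->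
  exists w, [/\ above T u w, w != troot T & par T w = v].
Proof.
move=> uv nuv; have [|w [uw wv /eqP pw]] := first_entry (P := pred1 v) uv nuv; first exact: eqxx.
exists w; split=> //; apply: contraNneq wv => e.
by apply/eqP; rewrite -pw e par_root.
Qed.

(** If two vertices have a common leaf above them, then one is above the other.
    If the lower one has a second ingoing edge, then there is a leaf above the
    latter that is not above the other vertex. *)
Lemma reduced_cluster_inj : reduced T -> injective (@cluster r T).
Proof.
move=> /forallP rT.
suff h u v : above T u v -> cluster r u = cluster r v -> u = v.
  move=> u v e; have [j ju] := cluster_ex u; have jv := ju; rewrite e in jv.
  by case: (cluster_comp ju jv) => [/h | /h k]; [exact | rewrite k].
move=> uv e; apply/eqP; apply: contraT => nuv.
have [w [uw wr wv]] := child_above uv nuv.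
have wu w' : w' != troot T -> par T w' = v -> w' != w -> forall j, above T j w' -> ~~ above T j u.
  move=> wr' wv' ww j jw; apply/negP => ju.
  case: (above_comp jw (above_trans ju uw)) => k.
    by have := above_par ww k; rewrite wv' -wv (negPf (par_not_above vT wr)).
  rewrite eq_sym in ww.
  by have := above_par ww k; rewrite wv -wv' (negPf (par_not_above vT wr')).
have nu j : j < nl T -> above T (leafv T j) v -> ~~ above T (leafv T j) u -> False.
  rewrite nT => jn h /negP; apply; have := mem_cluster (Ordinal jn) u.
  by rewrite e mem_cluster h => <-.
have := rT v; case: (posnP (count_mem v (att T))) => [-> | ]; last first.
  rewrite -has_count => /hasP[x /(nthP (troot T))[j jn <-] /eqP ev].
  case: (@nu j jn); first by rewrite /leafv ev connect0.
  apply/negP => h; rewrite /leafv ev in h.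
  by rewrite (above_anti vT uv h) eqxx in nuv.
rewrite add0n; set C := [set _ | _] => C2.
have [w' w'C ww] : exists2 w', w' \in C & w' != w.
  have : 0 < #|C :\ w|.
    have := cardsD1 w C; rewrite /C inE wr wv eqxx /= -/C => eC.
    by rewrite eC add1n in C2.
  by case/card_gt0P=> w'; rewrite in_setD1 => /andP[? ?]; exists w'.
move: w'C; rewrite inE => /andP[wr' /eqP wv'].
have [j jn jw] := leaf_above vT w'.
case: (@nu j jn); last exact: wu jw.
by rewrite -wv'; apply: above_trans jw (above1 w').
Qed.

Section Cut.
Variable (c : V T).
Hypothesis cr : c != troot T.

Lemma tops_conn : conn (tops c) c.
Proof.
split=> [|u]; first by rewrite inE connect0.
by rewrite inE => uc; split=> // nuc; rewrite inE above_par.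
Qed.

Lemma bots_conn : conn (bots c) (troot T).
Proof.
split=> [|u].
  by rewrite inE; apply: contra cr => /(root_above vT) ->.
rewrite !inE => uc; split=> [|_]; first exact: above_root.
by apply: contra uc; apply: above_trans (above1 u).
Qed.

Lemma sorted_enum_set (J : {set 'I_r}) : sorted ltn [seq val j | j <- enum J].
Proof.
have p : sorted ltn [seq val j | j <- enum 'I_r] by rewrite val_enum_ord iota_ltn_sorted.
rewrite sorted_map enumT in p; rewrite sorted_map /enum_mem.
by apply: (subseq_sorted _ (filter_subseq _ _) p) => a b d; apply: ltn_trans.
Qed.

(** All the vertices above a vertex of the top part belong to it, so its ingoing
    edges are the leaves in the cluster of c. *)
Lemma ins_tops : ins (tops c) = [seq (nat_of_ord j, leafv T j) | j <- enum (cluster r c)].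
Proof.
apply/esym/(ins_eq tops_conn); first by rewrite -map_comp; apply: sorted_enum_set.
case=> j t; split.
  case/mapP=> i; rewrite mem_enum mem_cluster => ic [-> ->].
  by apply/mem_in_edges; rewrite inE ic nT; split=> //; left.
case/mem_in_edges; rewrite inE => tc [[jn jt] | [w [wr + wt _]]].
  rewrite nT in jn; apply/mapP; exists (Ordinal jn); last by rewrite -jt.
  by rewrite mem_enum mem_cluster jt.
by rewrite inE -wt in tc *; rewrite (above_trans (above1 w) tc).
Qed.

End Cut.
End Clusters.

Section Slots.
Variables (r : nat) (J : {set 'I_r}) (j0 : 'I_r).
Hypotheses (j0J : j0 \in J) (j0min : forall j, j \in J -> j0 <= j).

Lemma mem_slots i : (i \in slots J) = (i \notin J) || (i == j0).
Proof.
rewrite inE; case: (boolP (i \in J)) => //= iJ.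
apply/forallP/eqP => [/(_ j0) | -> j]; last by apply/implyP; apply: j0min.
rewrite j0J /= => h; apply: val_inj; apply/eqP; rewrite eqn_leq h; exact: j0min.
Qed.

Lemma slots_meet : J :&: slots J = [set j0].
Proof.
apply/setP => i; rewrite in_setI mem_slots in_set1.
case: (eqVneq i j0) => [-> | ij]; first by rewrite j0J orbT.
by rewrite orbF andbN.
Qed.

(** The slots are the complement of J and the minimum of J. *)
Lemma card_slots : #|slots J| + #|J| = r.+1.
Proof.
have -> : slots J = j0 |: ~: J.
  by apply/setP => i; rewrite mem_slots !inE orbC.
rewrite cardsU1 in_setC j0J /= add1n addSn [_ + #|J|]addnC cardsC.
by rewrite card_ord.
Qed.

End Slots.

Lemma set_min r (J : {set 'I_r}) : 0 < #|J| ->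
  exists2 j0, j0 \in J & forall j, j \in J -> j0 <= j.
Proof.
case/card_gt0P=> i iJ; case: (arg_minnP val iJ) => j jJ h.
by exists j.
Qed.

(** ** Numbering of the elements of a set of labels *)

Lemma index_sorted s x : sorted ltn s -> x \in s -> index x s = count (fun y => y < x) s.
Proof.
elim: s => //= a s IHs pas; rewrite inE.
have /allP am : all (ltn a) s by apply: order_path_min pas; apply: ltn_trans.
case: (eqVneq x a) => [-> _ | xa /= xs].
  rewrite ltnn; apply/esym/eqP; rewrite add0n -leqn0 leqNgt -has_count.
  by apply/hasPn => y /am /= ay; rewrite -leqNgt ltnW.
have ax : a < x by exact: am.
by rewrite ax IHs ?(path_sorted pas).
Qed.

Lemma rank_index r (X : {set 'I_r}) j : j \in X -> rank X j = index j (enum X).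
Proof.
move=> jX; rewrite -(index_map val_inj) index_sorted.
- rewrite count_map /rank cardE -size_filter; apply: perm_size.
  apply: uniq_perm => [||i]; [exact: enum_uniq | exact/filter_uniq/enum_uniq |].
  by rewrite mem_enum inE [RHS]mem_filter mem_enum andbC.
- exact: sorted_enum_set.
- by rewrite map_f // mem_enum.
Qed.

Lemma rank_lt r (X : {set 'I_r}) j : j \in X -> rank X j < #|X|.
Proof. by move=> jX; rewrite rank_index // cardE index_mem mem_enum. Qed.

Lemma rank_inj r (X : {set 'I_r}) i j : i \in X -> j \in X -> rank X i = rank X j -> i = j.
Proof.
move=> iX jX; rewrite !rank_index // => e.
by rewrite -(nth_index i (s := enum X) (x := i)) ?mem_enum // e nth_index ?mem_enum.
Qed.

Lemma rank_ex r (X : {set 'I_r}) a : a < #|X| -> exists2 j, j \in X & rank X j = a.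
Proof.
rewrite cardE => an; have [j0 _] : exists2 j, j \in X & true.
  have : 0 < #|X| by rewrite cardE (leq_trans _ an).
  by case/card_gt0P=> j; exists j.
exists (nth j0 (enum X) a); first by rewrite -mem_enum mem_nth.
by rewrite rank_index ?index_uniq ?enum_uniq // -mem_enum mem_nth.
Qed.

Lemma nth_rank (K : Type) x0 (s : seq K) r (X : {set 'I_r}) : size s = #|X| ->
  [seq nth x0 s (rank X j) | j <- enum X] = s.
Proof.
move=> sX; apply: (@eq_from_nth _ x0); first by rewrite size_map -cardE.
move=> a; rewrite size_map -cardE => aX; have [j jX e] := rank_ex aX.
rewrite cardE in aX; rewrite (nth_map j) //; congr nth.
by rewrite rank_index ?index_uniq ?enum_uniq // -mem_enum mem_nth.
Qed.

Lemma renumber_inj r (X Y Z : {set 'I_r}) s : #|X| <= s ->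
  renumber X Y s = renumber X Z s -> Y :&: X = Z :&: X.
Proof.
suff h Y' Z' : #|X| <= s -> renumber X Y' s = renumber X Z' s -> Y' :&: X \subset Z' :&: X.
  by move=> hX e; apply/eqP; rewrite eqEsubset !h // e.
move=> hX e; apply/subsetP => j jY; have jX : j \in X by move: jY; rewrite in_setI => /andP[].
have lt := leq_trans (rank_lt jX) hX.
have : Ordinal lt \in renumber X Y' s.
  by rewrite inE; apply/existsP; exists j; rewrite jY eqxx.
rewrite e inE => /existsP[k /andP[kZ /eqP /= ek]].
suff -> : j = k by [].
by apply: rank_inj (esym ek) => //; move: kZ; rewrite in_setI => /andP[].
Qed.

(** A leaf of F stands for the leaf of T with the minimal label above it, and
    these labels are the elements of X in increasing order. *)
Lemma cluster_sub r s (F T : tree) (i : subtree F T) (X : {set 'I_r}) w :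
  nl F = s -> [seq p.1 | p <- ins (simg i)] = [seq val j | j <- enum X] ->
  cluster s w = renumber X (cluster r (i w)) s.
Proof.
move=> nF eX; have kE j : j \in X -> skey i (rank X j) = j.
  move=> jX; rewrite /skey eX (nth_map j) -?cardE ?rank_lt //.
  by rewrite rank_index // nth_index ?mem_enum.
have cX : #|X| = s by rewrite cardE -(size_map val) -eX size_map size_ins.
apply/setP => a; rewrite mem_cluster [RHS]inE; have an : a < nl F by rewrite nF.
rewrite -(above_skey i w an); have aX : a < #|X| by rewrite cX.
have [j jX ej] := rank_ex aX.
have -> : skey i a = j by rewrite -ej kE.
apply/idP/existsP => [h | [k /andP[]]].
  by exists j; rewrite in_setI mem_cluster h jX ej eqxx.
rewrite in_setI mem_cluster => /andP[h kX] /eqP ek.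
by rewrite -(rank_inj kX jX) // ek ej.
Qed.

(** * Cuts and graftings *)

Section CutDecomp.
Variables (Q : tree) (c : V Q).
Hypothesis cr : c != troot Q.

(** The edges that remain in the quotient by this set are the root edge and the
    edge below c, so the quotient has two vertices. *)
Definition cutker : {set V Q} := ~: [set troot Q; c].

Lemma mem_cutker v : (v \in cutker) = (v != troot Q) && (v != c).
Proof. by rewrite !inE negb_or. Qed.

Lemma cut_decomp : exists (U : tree) (F : V U -> tree) (D : decomp Q U F),
  kerm (dmor D) = cutker.
Proof.
have [|U [f fk]] := @quotient_exists Q cutker; first by rewrite mem_cutker eqxx.
by have [F [D Df]] := decomp_exists f; exists U, F, D; rewrite Df.
Qed.

Variables (U : tree) (F : V U -> tree) (D : decomp Q U F).
Hypothesis kD : kerm (dmor D) = cutker.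

Definition cutv : V U := dmor D c.

Lemma cutN : c \notin kerm (dmor D).
Proof. by rewrite kD mem_cutker eqxx andbF. Qed.

Lemma cutv_neq : cutv != troot U.
Proof.
apply: contra cr => /eqP e; apply/eqP.
by apply: (mor_inj cutN (root_ker _)); rewrite -/cutv e mor_root.
Qed.

Lemma msec_cutv : msec (dmor D) cutv = c.
Proof. by rewrite msec_id // cutN. Qed.

Lemma cut_vertices v : v = troot U \/ v = cutv.
Proof.
have := msecN (dmor D) v; rewrite kD mem_cutker negb_and !negbK.
have ev := msecK (dmor D) v.
by case/orP=> /eqP e; rewrite -ev e; [left; rewrite mor_root | right].
Qed.

Lemma cut_above v : above U v cutv = (v == cutv).
Proof.
apply/idP/eqP => [h | ->]; last exact: connect0.
case: (cut_vertices v) => // e; have := cutv_neq; rewrite e in h.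
by rewrite (root_above (tree_valid U) h) eqxx.
Qed.

Lemma simg_top : simg (demb D cutv) = tops c.
Proof. by rewrite demb_simg; apply/setP => v; rewrite !inE -[in RHS]msec_cutv above_msec cut_above. Qed.

Lemma simg_bot : simg (demb D (troot U)) = bots c.
Proof.
rewrite demb_simg; apply/setP => v; rewrite !inE -[in RHS]msec_cutv above_msec cut_above.
case: (cut_vertices (dmor D v)) => ->; rewrite ?eqxx; first by rewrite eq_sym cutv_neq.
by rewrite (negPf cutv_neq).
Qed.

(** Sums and products over the base of a cut have two terms, the first one for
    the root. *)
Lemma cut_big (R : Type) (idx : R) (op : Monoid.com_law idx) (H : V U -> R) :
  \big[op/idx]_v H v = op (H (troot U)) (H cutv).
Proof.
rewrite (bigD1 (troot U)) //= (big_pred1 cutv) // => v.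
apply/idP/eqP => [vr | ->]; last exact: cutv_neq.
by case: (cut_vertices v) vr => ->; rewrite ?eqxx.
Qed.

Lemma vlt_cut : vlt (troot U) cutv.
Proof.
apply: vlt_above => //; first exact: (above_root (tree_valid U)).
exact: cutv_neq.
Qed.

Lemma vseq_cut : vseq U = [:: troot U; cutv].
Proof.
have p := vseq_perm U; have pw := vseq_pairwise (tree_valid U).
have u : uniq [:: troot U; cutv] by rewrite /= inE eq_sym cutv_neq.
have : perm_eq (vseq U) [:: troot U; cutv].
  apply: uniq_perm => //; first exact: vseq_uniq.
  move=> v; rewrite mem_vseq !inE; case: (cut_vertices v) => ->; rewrite eqxx ?orbT //.
case: (vseq U) pw (vseq_uniq U) => [|a [|b [|d l]]] pw uv h; have sz := perm_size h => //.
move: pw uv => /=; rewrite !andbT inE => ba ab.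
case: (cut_vertices a) (cut_vertices b) => [ea | ea] [] eb; rewrite ea eb ?eqxx // in ab ba *.
by rewrite vlt_cut in ba.
Qed.

Lemma nv_cut : nv U = 2.
Proof. by rewrite -[LHS]size_enum_ord -(perm_size (vseq_perm U)) vseq_cut. Qed.

End CutDecomp.

Section CutGraft.
Variables (r : nat) (Q : tree) (c : V Q).
Hypotheses (nQ : nl Q = r) (cr : c != troot Q).
Let J := cluster r c.

(** The edge below c is the ingoing edge of the bottom part with key the minimum
    of J, which explains why it takes the place of this label in the slots. *)
Lemma cluster_min : exists2 j0 : 'I_r, j0 \in J & minlabel c = j0 /\ forall j, j \in J -> j0 <= j.
Proof.
have lt := minlabel_lt (tree_valid Q) c; rewrite nQ in lt.
exists (Ordinal lt); first by rewrite mem_cluster minlabel_above.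
by split=> // j; rewrite mem_cluster => /minlabel_le.
Qed.

(** The ingoing edges of the bottom part are the leaves outside J and the edge
    below c, whose minimal label is min J. *)
Lemma ins_bots : ins (bots c) =
  [seq (nat_of_ord j, if j \in J then par Q c else leafv Q j) | j <- enum (slots J)].
Proof.
have [j0 j0J [m0 jmin]] := cluster_min.
apply/esym/(ins_eq (bots_conn cr)); first by rewrite -map_comp; apply: sorted_enum_set.
have pb : par Q c \in bots c by rewrite inE par_not_above.
case=> j t; split.
  case/mapP=> i; rewrite mem_enum (mem_slots j0J jmin) => ic [-> ->]; apply/mem_in_edges.
  case: (boolP (i \in J)) ic => iJ /= => [/eqP -> | _].
    split=> //; right; exists c; split=> //; by rewrite inE connect0.
  by split; [rewrite inE -(mem_cluster (r := r)) | left; rewrite nQ].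
case/mem_in_edges; rewrite inE => tc [[jn jt] | [w [wr wc wt mw]]]; apply/mapP.
  rewrite nQ in jn; have iJ : Ordinal jn \notin J by rewrite mem_cluster jt.
  exists (Ordinal jn); last by rewrite (negPf iJ) -jt.
  by rewrite mem_enum (mem_slots j0J jmin) iJ.
rewrite inE negbK in wc.
have e : w = c.
  apply/eqP; apply: contraT => nwc; have := above_par nwc wc.
  by rewrite wt (negPf tc).
exists j0; last by rewrite j0J -wt e -m0 -mw e.
by rewrite mem_enum (mem_slots j0J jmin) eqxx orbT.
Qed.

Lemma keys_bots : [seq p.1 | p <- ins (bots c)] = [seq val j | j <- enum (slots J)].
Proof. by rewrite ins_bots -map_comp. Qed.

Lemma keys_tops : [seq p.1 | p <- ins (tops c)] = [seq val j | j <- enum J].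
Proof. by rewrite (ins_tops nQ) -map_comp. Qed.

Variables (S T : tree) (i : subtree S Q) (j : subtree T Q).
Hypotheses (iX : simg i = bots c) (jX : simg j = tops c).

Lemma nl_bot : nl S = #|slots J|.
Proof. by rewrite -(size_ins i) -(size_map fst) iX keys_bots size_map -cardE. Qed.

Lemma nl_top : nl T = #|J|.
Proof. by rewrite -(size_ins j) -(size_map fst) jX keys_tops size_map -cardE. Qed.

Lemma top_root : j (troot T) = c.
Proof.
have c1 := sub_conn j; rewrite jX in c1; have c2 := tops_conn c.
apply: (above_anti (tree_valid Q)).
  by apply: (conn_above c2); exact: conn_root c1.
by apply: (conn_above c1); exact: conn_root c2.
Qed.

Lemma bot_root : i (troot S) = troot Q.
Proof.
have c1 := sub_conn i; rewrite iX in c1.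
by apply: (root_above (tree_valid Q)); apply: (conn_above c1 (conn_root (bots_conn cr))).
Qed.

Lemma bot_att k : k \in slots J ->
  i (nth (troot S) (att S) (rank (slots J) k)) = if k \in J then par Q c else leafv Q k.
Proof.
move=> kX; have kn : rank (slots J) k < size (att S) by rewrite -/(nl S) nl_bot rank_lt.
rewrite -(nth_map _ (troot Q)) // sub_att iX ins_bots -map_comp (nth_map k) /=.
  by rewrite rank_index // nth_index ?mem_enum.
by rewrite -cardE rank_lt.
Qed.

Lemma top_att k : k \in J -> j (nth (troot T) (att T) (rank J k)) = leafv Q k.
Proof.
move=> kX; have kn : rank J k < size (att T) by rewrite -/(nl T) nl_top rank_lt.
rewrite -(nth_map _ (troot Q)) // sub_att jX (ins_tops nQ) -map_comp (nth_map k) /=.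
  by rewrite rank_index // nth_index ?mem_enum.
by rewrite -cardE rank_lt.
Qed.

(** Every tree is the grafting of the top part of a cut on the bottom part. *)
Lemma cut_graft : is_graft J i j.
Proof.
have [j0 j0J [m0 jmin]] := cluster_min.
have tb w : (w \in codom j) = (w \notin codom i).
  by rewrite -!mem_simg iX jX !inE negbK.
split; first by split=> //; apply: sub_inj.
split.
- exact: bot_root.
- by move=> v; apply: sub_par.
- move=> k; rewrite in_setI => /andP[kJ kX].
  by rewrite top_root bot_att // kJ.
- by move=> v; apply: sub_par.
- apply: (@eq_from_nth _ (troot Q)) => [|a]; first by rewrite size_map size_enum_ord -nQ.
  rewrite -/(nl Q) nQ => ar; rewrite (nth_map (Ordinal ar)) ?size_enum_ord //.
  rewrite (_ : nth _ (enum 'I_r) a = Ordinal ar); last by apply: val_inj; rewrite /= nth_enum_ord.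
  case: (boolP (Ordinal ar \in J)) => aJ; first by rewrite top_att.
  rewrite bot_att; first by rewrite (negPf aJ).
  by rewrite (mem_slots j0J jmin) aJ.
Qed.

End CutGraft.

(** ** Graftings are cuts *)

Section GraftCut.
Variables (r : nat) (J : {set 'I_r}) (S T Q : tree).
Hypotheses (nS : nl S = #|slots J|) (nT : nl T = #|J|) (J0 : 0 < #|J|).
Variables (f : V S -> V Q) (g : V T -> V Q).
Hypothesis G : is_graft J f g.

Let c : V Q := g (troot T).

Lemma graft_vertices w : (exists v, w = f v) \/ (exists v, w = g v).
Proof.
case: G => [[_ _ h] _]; case: (boolP (w \in codom g)) => [/codomP | ]; first by right.
by rewrite h negbK => /codomP; left.
Qed.

Lemma graft_disj u v : f u <> g v.
Proof.
case: G => [[_ _ h] _] e; have := h (f u).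
by rewrite codom_f {1}e codom_f.
Qed.

Lemma graft_bot_par u : exists v, par Q (f u) = f v.
Proof.
case: G => _ [fr fp _ _ _]; case: (eqVneq u (troot S)) => [-> | ur].
  by exists (troot S); rewrite fr par_root.
by exists (par S u); rewrite fp.
Qed.

(** A path from a vertex of T stays in T until it leaves it through the root
    vertex, and a path from a vertex of S stays in S. *)
Lemma graft_tops : [set v in codom g] = tops c.
Proof.
case: G => [[_ _ h] [_ _ _ gp _]].
apply/setP => w; rewrite !inE; apply/codomP/idP => [[v ->] | wc].
  elim/(root_ind (tree_valid T)): v => [|v vr IHv]; first exact: connect0.
  by apply: above_trans IHv; rewrite -gp // above1.
case: (graft_vertices w) => [[v e] | //].
suff [u eu] : exists u, c = f u by case: (@graft_disj u (troot T)).
case/aboveP: wc => n <-; rewrite e; elim: n => [|n [u IHn]] /=; first by exists v.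
by rewrite IHn; apply: graft_bot_par.
Qed.

Lemma graft_bots : [set v in codom f] = bots c.
Proof.
case: G => [[_ _ h] _]; apply/setP => w; have := graft_tops => /setP /(_ w).
by rewrite !inE h => <-; rewrite negbK.
Qed.

Lemma graft_neq_root : c != troot Q.
Proof.
case: G => _ [fr _ _ _ _]; apply/eqP => e; case: (@graft_disj (troot S) (troot T)).
by rewrite fr -/c e.
Qed.

Lemma graft_nl : nl Q = r.
Proof. by case: G => _ [_ _ _ _ e]; rewrite /nl e size_map size_enum_ord. Qed.

Lemma graft_leaf (j : 'I_r) : leafv Q j =
  if j \in J then g (nth (troot T) (att T) (rank J j))
  else f (nth (troot S) (att S) (rank (slots J) j)).
Proof.
case: G => _ [_ _ _ _ e]; rewrite /leafv e (nth_map j) ?size_enum_ord //.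
by rewrite nth_ord_enum.
Qed.

Lemma graft_cluster : cluster r c = J.
Proof.
apply/setP => j; rewrite mem_cluster; have := graft_tops => /setP /(_ (leafv Q j)).
rewrite !inE => <-; rewrite graft_leaf; case: (boolP (j \in J)) => jJ.
  by rewrite codom_f.
case: G => [[_ _ h] _]; by rewrite h codom_f.
Qed.

Lemma graft_top_sub : exists2 j : subtree T Q, j =1 g & simg j = tops c.
Proof.
have [[_ gi _] [_ _ _ gp _]] := G.
have [j jg] : exists j : subtree T Q, g =1 j.
  apply: subtreeI => //; rewrite graft_tops (ins_tops graft_nl) graft_cluster.
  rewrite -{1}(nth_rank (troot T) (s := att T) (X := J)) // -!map_comp.
  by apply/eq_in_map => k; rewrite mem_enum /= graft_leaf => ->.
exists j; first by move=> v; rewrite jg.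
rewrite -graft_tops; apply/setP => v; rewrite !inE; by rewrite (eq_codom jg).
Qed.

Lemma graft_bot_sub : exists2 i : subtree S Q, i =1 f & simg i = bots c.
Proof.
have [[fi _ _] [_ fp fc _ _]] := G.
have [i ig] : exists i : subtree S Q, f =1 i.
  apply: subtreeI => //; rewrite graft_bots (ins_bots graft_nl graft_neq_root) graft_cluster.
  rewrite -{1}(nth_rank (troot S) (s := att S) (X := slots J)) // -!map_comp.
  apply/eq_in_map => k; rewrite mem_enum /= => kX.
  case: (boolP (k \in J)) => kJ; last by rewrite graft_leaf (negPf kJ).
  by apply/esym/fc; rewrite in_setI kJ.
exists i; first by move=> v; rewrite ig.
rewrite -graft_bots; apply/setP => v; rewrite !inE; by rewrite (eq_codom ig).
Qed.

(** The contraction of all edges except the one below the root of T has the two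
    factors as its fibres, since both pairs of subtrees have the same sets of
    vertices. *)
Lemma grafting_exists : exists G' : grafting J S T Q,
  [/\ gr_bot G' = f, gr_top G' = g & kerm (dmor (gr_dec G')) = cutker c].
Proof.
have cr := graft_neq_root.
have [U [F [D kD]]] := cut_decomp c.
have [j jg jX] := graft_top_sub; have [i fi iX] := graft_bot_sub.
pose e (u : V U) : subtree (pairF S T u) Q :=
  if u == troot U as b return subtree (if b then S else T) Q then i else j.
have eX v : simg (e v) = if v == troot U then bots c else tops c.
  have h b : simg (if b as b return subtree (if b then S else T) Q then i else j) =
      if b then bots c else tops c by case: b.
  exact: h.
have eP v u : (u \in codom (e v)) = (dmor D u == v).
  have := demb_simg D v => /setP /(_ u); rewrite [RHS]inE => <-.
  rewrite -mem_simg eX; case: (cut_vertices kD v) => ->.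
    by rewrite (simg_bot cr kD) eqxx.
  by rewrite (simg_top cr kD) (negPf (cutv_neq cr kD)).
have fb v : dmor D (f v) = troot U.
  apply/eqP; rewrite -eP; have := simg_f i v; rewrite fi iX.
  by rewrite -(simg_bot cr kD) demb_simg inE eP.
have gt v : dmor D (g v) <> troot U.
  apply/eqP; have := simg_f j v; rewrite jg jX -(simg_top cr kD) demb_simg inE.
  by move/eqP ->; exact: cutv_neq.
pose G' := @Grafting r J S T Q U (@Decomp Q U (pairF S T) (dmor D) e eP) f g
  (nv_cut cr kD) G fb gt.
by exists G'.
Qed.

End GraftCut.

(** The conditions on a grafting describe its parent map and its leaves
    completely. *)
Lemma graft_uniq r (J : {set 'I_r}) (S T Q Q' : tree)
  (f : V S -> V Q) (g : V T -> V Q) (f' : V S -> V Q') (g' : V T -> V Q') :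
  0 < #|J| -> is_graft J f g -> is_graft J f' g' -> Q = Q'.
Proof.
move=> J0 G G'; have [j0 j0J jmin] := set_min J0.
have j0s : j0 \in J :&: slots J by rewrite (slots_meet j0J jmin) set11.
have ex w : exists w', (forall v, w = f v -> w' = f' v) /\ (forall v, w = g v -> w' = g' v).
  have [[fi gi h] _] := G.
  case: (graft_vertices G w) => -[v ->]; [exists (f' v) | exists (g' v)]; split=> u.
  - by move/fi ->.
  - by move/(graft_disj G).
  - by move/esym/(graft_disj G).
  - by move/gi ->.
have [h hP] := choice ex.
have hf v : h (f v) = f' v by apply: (proj1 (hP _)).
have hg v : h (g v) = g' v by apply: (proj2 (hP _)).
have ex' w : exists w', (forall v, w = f' v -> w' = f v) /\ (forall v, w = g' v -> w' = g v).
  have [[fi gi _] _] := G'.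
  case: (graft_vertices G' w) => -[v ->]; [exists (f v) | exists (g v)]; split=> u.
  - by move/fi ->.
  - by move/(graft_disj G').
  - by move/esym/(graft_disj G').
  - by move/gi ->.
have [k kP] := choice ex'.
have kf v : k (f' v) = f v by apply: (proj1 (kP _)).
have kg v : k (g' v) = g v by apply: (proj2 (kP _)).
have hb : bijective h.
  exists k => w; [case: (graft_vertices G w) | case: (graft_vertices G' w)];
    by case=> v ->; rewrite ?hf ?hg ?kf ?kg ?hf ?hg.
have [_ [fr fp fc gp ga]] := G; have [_ [fr' fp' fc' gp' ga']] := G'.
have h0 : h (troot Q) = troot Q' by rewrite -fr hf fr'.
have hp w : w != troot Q -> par Q' (h w) = h (par Q w).
  case: (graft_vertices G w) => -[v ->] wr.
    have vr : v != troot S by apply: contraNneq wr => ->; rewrite fr.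
    by rewrite hf fp' // fp // hf.
  rewrite hg; case: (eqVneq v (troot T)) => [-> | vr]; last by rewrite gp' // gp // hg.
  by rewrite (fc' _ j0s) (fc _ j0s) hf.
have ha : [seq h v | v <- att Q] = att Q'.
  rewrite ga ga' -map_comp; apply: eq_map => j /=.
  by case: ifP => _; rewrite ?hf ?hg.
by apply/esym; exact: existT_inj1 (tree_rigid hb h0 hp ha).
Qed.

(** The vertices of the grafting are the disjoint union of those of S and T; the
    root of T is put on the leaf of S that has the label min J. *)
Lemma graft_exists r (J : {set 'I_r}) (S T : tree) :
  nl S = #|slots J| -> nl T = #|J| -> 0 < #|J| ->
  exists (Q : tree) (f : V S -> V Q) (g : V T -> V Q), is_graft J f g.
Proof.
move=> nS nT J0; have [j0 j0J jmin] := set_min J0.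
pose b0 := nth (troot S) (att S) (rank (slots J) j0).
pose K := (V S + V T)%type.
pose k0 : K := inl (troot S).
pose p (k : K) : K := match k with
  | inl v => inl (par S v)
  | inr v => if v == troot T then inl b0 else inr (par T v) end.
pose a : seq K := [seq if j \in J then inr (nth (troot T) (att T) (rank J j))
                   else inl (nth (troot S) (att S) (rank (slots J) j)) | j <- enum 'I_r].
have pk0 : p k0 = k0 by rewrite /p /k0 par_root.
have pc k : fconnect p k k0.
  have step k' : fconnect p (p k') k0 -> fconnect p k' k0.
    by apply: connect_trans; apply: fconnect1.
  have hl v : fconnect p (inl v) k0.
    elim/(root_ind (tree_valid S)): v => [|v vr IHv]; first exact: connect0.
    by apply: step; apply: IHv.
  case: k => // v; elim/(root_ind (tree_valid T)): v => [|v vr IHv]; apply: step.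
    by rewrite /p eqxx; apply: hl.
  by rewrite /p (negPf vr).
have pl k : k \in a \/ exists2 k', k' != k0 & p k' = k.
  case: k => v.
    case/and3P: (tree_valid S) => _ _ /forallP /(_ v).
    case/orP=> [/(nthP (troot S))[n nS' e] | /existsP[w /andP[wr /eqP e]]]; last first.
      by right; exists (inl w); rewrite /p ?e.
    have [j jX ej] : exists2 j, j \in slots J & rank (slots J) j = n.
      by apply: rank_ex; rewrite -nS.
    move: jX; rewrite (mem_slots j0J jmin) => /orP[jJ | /eqP jj].
      left; apply/mapP; exists j; first by rewrite mem_enum.
      by rewrite (negPf jJ) ej e.
    right; exists (inr (troot T)) => //.
    by rewrite /p eqxx /b0 -jj ej e.
  case/and3P: (tree_valid T) => _ _ /forallP /(_ v).
  case/orP=> [/(nthP (troot T))[n nT' e] | /existsP[w /andP[wr /eqP e]]]; last first.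
    by right; exists (inr w); rewrite /p ?(negPf wr) ?e.
  have [j jX ej] : exists2 j, j \in J & rank J j = n by apply: rank_ex; rewrite -nT.
  left; apply/mapP; exists j; first by rewrite mem_enum.
  by rewrite jX ej e.
have [Q [h [g [hg gh h0 hp ha]]]] := mktree pk0 pc pl.
have hi := can_inj hg.
exists Q, (fun v => h (inl v)), (fun v => h (inr v)); split.
  split=> [u v /hi[] | u v /hi[] | w] //.
  rewrite -(gh w); case: (g w) => v.
    rewrite codom_f; apply/negbTE/negP; by case/codomP=> u /hi.
  by rewrite codom_f; apply/esym/negP => /codomP[u /hi].
split.
- exact: h0.
- by move=> v vr; rewrite hp.
- move=> j; rewrite (slots_meet j0J jmin) => /set1P ->.
  by rewrite hp /p eqxx.
- by move=> v vr; rewrite hp /p (negPf vr).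
- by rewrite ha -map_comp; apply: eq_map => j /=; case: ifP.
Qed.

Local Open Scope ring_scope.

(** * Signs *)

Lemma sign_eq (R : pzRingType) m n : odd m = odd n -> (-1) ^+ m = (-1) ^+ n :> R.
Proof. by move=> e; rewrite -[LHS]signr_odd e signr_odd. Qed.

Lemma odd_abszD (m n : int) : odd (absz (m + n)) = odd (absz m) (+) odd (absz n).
Proof. lia. Qed.

(** * Homogeneous elements *)

Section Graded.
Variables (R : comPzRingType) (M : gradedModule R).
Implicit Types x y : M.

Lemma homogD n x y : homog n x -> homog n y -> homog n (x + y).
Proof. by rewrite /homog linearD => -> ->. Qed.

Lemma homogZ n a x : homog n x -> homog n (a *: x).
Proof. by rewrite /homog linearZ => ->. Qed.

Lemma homog0 n : homog n (0 : M).
Proof. exact: linear0. Qed.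

Lemma homog_sum (I : Type) (s : seq I) (P : pred I) n (F : I -> M) :
  (forall i, P i -> homog n (F i)) -> homog n (\sum_(i <- s | P i) F i).
Proof. by move=> h; rewrite /homog linear_sum; apply: eq_bigr => i /h. Qed.

Lemma homog_proj n x : homog n (gm_proj M n x).
Proof. by rewrite /homog gm_proj_proj eqxx. Qed.

Lemma homog_other m n x : homog n x -> m != n -> gm_proj M m x = 0.
Proof. by move=> <- /negPf mn; rewrite gm_proj_proj mn. Qed.

(** The k-th power of the grading involution, which gives the Koszul sign of the
    exchange of x with k letters of degree one for elements x that are not
    homogeneous *)
Definition gsign_fun (k : nat) x : M :=
  \sum_(n <- s2val (cid2 (gm_fin x))) (-1) ^+ (k * absz n) *: gm_proj M n x.

Lemma proj_out (s : seq int) x : x = \sum_(n <- s) gm_proj M n x ->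
  forall n, n \notin s -> gm_proj M n x = 0.
Proof.
move=> xs n ns; rewrite xs linear_sum big1_seq // => m /andP[_ ms].
by rewrite gm_proj_proj; case: eqP => // nm; rewrite nm ms in ns.
Qed.

Lemma sum_support (s t : seq int) x (c : int -> R) : uniq s -> uniq t ->
  (forall n, n \notin s -> gm_proj M n x = 0) -> (forall n, n \notin t -> gm_proj M n x = 0) ->
  \sum_(n <- s) c n *: gm_proj M n x = \sum_(n <- t) c n *: gm_proj M n x.
Proof.
move=> us ut hs ht.
suff h s' t' : uniq s' -> uniq t' -> (forall n, n \notin s' -> gm_proj M n x = 0) ->
    \sum_(n <- s' | n \in t') c n *: gm_proj M n x = \sum_(n <- t') c n *: gm_proj M n x.
  rewrite -[RHS](h s) // [LHS](bigID (mem t)) /= [X in _ + X]big1 ?addr0 // => n nt.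
  by rewrite ht ?scaler0.
move=> us' ut' h; rewrite [RHS](bigID (mem s')) /= [X in _ + X]big1 ?addr0; last first.
  by move=> n ns; rewrite h ?scaler0.
rewrite -[LHS]big_filter -[RHS]big_filter; apply: perm_big; apply: uniq_perm.
- exact: filter_uniq.
- exact: filter_uniq.
- by move=> n; rewrite !mem_filter andbC.
Qed.

Lemma gsign_sum k (s : seq int) x : uniq s -> (forall n, n \notin s -> gm_proj M n x = 0) ->
  gsign_fun k x = \sum_(n <- s) (-1) ^+ (k * absz n) *: gm_proj M n x.
Proof.
move=> us hs; rewrite /gsign_fun; case: (cid2 _) => t ut xt /=.
apply: sum_support => //; exact: proj_out xt.
Qed.

Lemma gsign_linear k : linear (gsign_fun k).
Proof.
move=> a x y; have [s us xs] := gm_fin x; have [t ut yt] := gm_fin y.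
pose u := undup (s ++ t).
have ux n : n \notin u -> gm_proj M n x = 0.
  by rewrite mem_undup mem_cat negb_or => /andP[/(proj_out xs)].
have uy n : n \notin u -> gm_proj M n y = 0.
  by rewrite mem_undup mem_cat negb_or => /andP[_ /(proj_out yt)].
rewrite !(@gsign_sum k u) ?undup_uniq //; last by move=> n nu; rewrite linearP ux ?uy // scaler0 addr0.
rewrite scaler_sumr -big_split /=; apply: eq_bigr => n _.
by rewrite linearP scalerDr !scalerA mulrC.
Qed.
HB.instance Definition _ k := GRing.isLinear.Build R M M *:%R (gsign_fun k) (gsign_linear k).

(** The operator is used only through this equation. *)
Lemma gsign_exists (k : nat) : {f : {linear M -> M} |
  forall n x, homog n x -> f x = (-1) ^+ (k * absz n) *: x}.
Proof.
exists (gsign_fun k) => n x hx /=; rewrite (@gsign_sum k [:: n]) //; first by rewrite big_seq1 hx.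
by move=> m; rewrite inE; apply: homog_other.
Qed.

Definition gsign (k : nat) : {linear M -> M} := sval (gsign_exists k).

Lemma gsign_homog k n x : homog n x -> gsign k x = (-1) ^+ (k * absz n) *: x.
Proof. exact: (svalP (gsign_exists k)). Qed.

End Graded.

(** * Sums over words *)

(** Lists are easier to split and to concatenate than tuples, over which the
    twisting map is summed. *)
Fixpoint words (K : finType) (m : nat) : seq (seq K) :=
  if m is m'.+1 then [seq a :: s | a <- enum K, s <- words K m'] else [:: [::]].
Arguments words : simpl never.

Section Words.
Variables (K : finType) (M : nmodType).
Implicit Types F : seq K -> M.

Lemma big_words_cons m F :
  \sum_(s <- words K m.+1) F s = \sum_(a : K) \sum_(s <- words K m) F (a :: s).
Proof. by rewrite big_allpairs_dep big_enum. Qed.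

Lemma big_words0 F : \sum_(s <- words K 0) F s = F [::].
Proof. by rewrite big_seq1. Qed.

Lemma big_tuple_words m F : \sum_(t : m.-tuple K) F t = \sum_(s <- words K m) F s.
Proof.
elim: m F => [|m IHm] F.
  by rewrite big_words0 (big_pred1 [tuple]) // => t; rewrite (tuple0 t) /= eqxx.
rewrite big_words_cons.
rewrite (reindex (fun p : K * m.-tuple K => [tuple of p.1 :: p.2])) /=; last first.
  exists (fun t : m.+1.-tuple K => (thead t, [tuple of behead t])) => [[a t] _ | t _] /=.
    by congr pair; apply: val_inj.
  by rewrite [t in RHS]tuple_eta; apply: val_inj.
rewrite -(pair_bigA _ (fun a (t : m.-tuple K) => F (a :: t))) /=.
by apply: eq_bigr => a _; rewrite -IHm.
Qed.

Lemma big_words_cat m n F :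
  \sum_(s <- words K (m + n)) F s = \sum_(s <- words K m) \sum_(t <- words K n) F (s ++ t).
Proof.
elim: m F => [|m IHm] F; first by rewrite big_words0.
by rewrite addSn !big_words_cons; apply: eq_bigr => a _; rewrite IHm.
Qed.

Lemma mem_words m s : (s \in words K m) = (size s == m).
Proof.
elim: m s => [|m IHm] s; first by rewrite inE; case: s.
apply/allpairsP/idP => [[[a t] /= [_ ht ->]] | ]; first by rewrite /= eqSS -IHm.
by case: s => // a t; rewrite eqSS -IHm => ht; exists (a, t); rewrite mem_enum.
Qed.

Lemma uniq_words m : uniq (words K m).
Proof.
elim: m => //= m IHm; apply: allpairs_uniq => //; first exact: enum_uniq.
by move=> [a s] [b t] _ _ /= [-> ->].
Qed.

Lemma big_words_pick m F u : size u = m ->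
  \sum_(s <- words K m) (if s == u then F s else 0) = F u.
Proof.
move=> su; rewrite (bigD1_seq u) ?uniq_words ?mem_words ?su //= eqxx big1 ?addr0 //.
by move=> s /negPf ->.
Qed.

Lemma size_words m s : s \in words K m -> size s = m.
Proof. by rewrite mem_words => /eqP. Qed.

End Words.

(** The words in the image of an injective map are the images of the words. *)
Lemma big_words_image (K K' : finType) (M : nmodType) (h : K -> K') m
    (F : seq K' -> M) : injective h ->
  \sum_(s <- words K' m | all (mem (codom h)) s) F s =
  \sum_(s <- words K m) F [seq h x | x <- s].
Proof.
move=> hi; rewrite -[RHS](big_map (map h) xpredT) -[LHS]big_filter; apply: perm_big.
apply: uniq_perm.
- exact/filter_uniq/uniq_words.
- by rewrite map_inj_uniq ?uniq_words //; apply: inj_map.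
move=> s; rewrite mem_filter mem_words; apply/andP/mapP => [[/allP hs /eqP sm] | [t]].
  elim: s m sm hs => [|a s IHs] m /= sm hs; first by exists [::]; rewrite ?mem_words -?sm.
  case: m sm => // m [sm].
  have [|t tm ->] := IHs m sm; first by move=> x xs; apply: hs; rewrite inE xs orbT.
  have /codomP[b ->] : a \in codom h by apply: hs; rewrite mem_head.
  by exists (b :: t) => //; rewrite mem_words /= eqSS -mem_words.
rewrite mem_words => /eqP tm ->; rewrite size_map tm; split=> //.
by apply/allP => _ /mapP[x _ ->]; apply: codom_f.
Qed.

(** * Cubical cochains *)

Section Cubes.
Variables (R : comPzRingType).

Definition ones (k : nat) : seq cell := nseq k C01.

Lemma ones_cat p q : ones p ++ ones q = ones (p + q).
Proof. by rewrite /ones -nseqD. Qed.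

Lemma wdim_cat u v : wdim (u ++ v) = (wdim u + wdim v)%N.
Proof. exact: count_cat. Qed.

Lemma wdim_ones k : wdim (ones k) = k.
Proof. by rewrite /wdim count_nseq /= eqxx mul1n. Qed.

Lemma cellE : ((C0 == C1) = false) * ((C1 == C0) = false) * ((C0 == C01) = false) *
  ((C01 == C0) = false) * ((C1 == C01) = false) * ((C01 == C1) = false) *
  ((C0 == C0) = true) * ((C1 == C1) = true) * ((C01 == C01) = true).
Proof. by do !split; rewrite ?eqxx //; apply/eqP. Qed.

Lemma big_cell (M : nmodType) (F : cell -> M) : \sum_(y : cell) F y = F C0 + (F C1 + F C01).
Proof.
rewrite (bigD1 C0) //= (bigD1 C1) ?cellE //= (big_pred1 C01) // => y.
by case: y; rewrite /= !cellE.
Qed.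

(** A face of the cube of dimension p + q + 1, with x equal to C0 or C1 *)
Definition wface (p q : nat) (x : cell) : seq cell := ones p ++ x :: ones q.

(** Only the words with a single letter of dimension zero have the top cell in
    their coboundary. *)
Lemma delta_ones (M : lmodType R) k (z : seq cell -> M) :
  \sum_(b <- words cell k) deltaw R b (ones k) *: z b =
  \sum_(p < k) (-1) ^+ p *: (z (wface p (k - p.+1) C1) - z (wface p (k - p.+1) C0)).
Proof.
elim: k z => [|k IHk] z; first by rewrite big_words0 big_ord0 scale0r.
have h x c : x != C01 -> delta1 R x C01 = c ->
    \sum_(s <- words cell k) deltaw R (x :: s) (ones k.+1) *: z (x :: s) = c *: z (x :: ones k).
  move=> /negPf xn xc.
  rewrite (eq_bigr (fun s => if s == ones k then c *: z (x :: s) else 0)) => [|s _].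
    by rewrite big_words_pick // size_nseq.
  rewrite [deltaw _ _ _]/= xn mulr0 mul0r addr0 xc.
  by case: eqP => _; rewrite ?mulr1 // mulr0 scale0r.
rewrite big_words_cons big_cell big_ord_recl (h C0 (-1)) ?(h C1 1) ?cellE // {h}.
rewrite expr0 scale1r subSS subn0 scale1r scaleN1r addrA [- _ + _]addrC.
congr (_ + _); rewrite (eq_bigr (fun s => - (deltaw R s (ones k) *: z (C01 :: s)))) => [|s _].
  rewrite sumrN (IHk (fun s => z (C01 :: s))) -sumrN; apply: eq_bigr => p _.
  by rewrite -scaleNr -mulN1r -exprS lift0 subSS.
by rewrite /= mul0r add0r /wdim /= ?eqxx addn0 expr1 mulr1 mulN1r scaleNr.
Qed.

(** d_0 takes the coefficients of 1 and d_1 those of 0 in one factor. *)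
Lemma face_coef (M : lmodType R) eps p q (z : seq cell -> M) (u v : seq cell) :
  size u = p -> size v = q ->
  actI (p + q).+1 (dface R eps (p + q).+1 q.+1) z (u ++ v) =
  z (u ++ (if eps then C0 else C1) :: v).
Proof.
move=> su sv; rewrite /actI /dface subSS addnK.
rewrite (big_tuple_words _ (fun b => (d1 R eps (nth C0 b p) * (u ++ v == take p b ++ drop p.+1 b)%:R) *: z b)).
have -> : (p + q).+1 = (p + q.+1)%N by rewrite addnS.
rewrite big_words_cat.
transitivity (\sum_(s <- words cell p) if s == u then
    \sum_(t <- words cell q.+1) (d1 R eps (head C0 t) * (v == behead t)%:R) *: z (u ++ t) else 0).
  apply: eq_big_seq => s /size_words ss; case: eqP => [-> | ne].
    apply: eq_big_seq => t /size_words st; congr ((_ * _%:R) *: _).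
      by rewrite nth_cat su ltnn subnn nth0.
    rewrite take_size_cat // drop_cat su ltnNge leqnSn /= subSnn drop1.
    by rewrite eqseq_cat // eqxx.
  rewrite big1 // => t _; rewrite take_size_cat // eqseq_cat ?su //.
  by rewrite [u == s]eq_sym (introF eqP ne) mulr0 scale0r.
rewrite big_words_pick // big_words_cons.
transitivity (\sum_a d1 R eps a *: z (u ++ a :: v)).
  apply: eq_bigr => a _.
  rewrite -[RHS](big_words_pick (fun t => d1 R eps a *: z (u ++ a :: t)) sv).
  apply: eq_bigr => t _ /=; rewrite eq_sym; case: eqP => _; rewrite ?mulr1 // mulr0 scale0r //.
rewrite big_cell; case: eps; rewrite /= ?scale1r ?scale0r ?addr0 ?add0r //.
Qed.

End Cubes.

(** * The coproducts of a pre-cooperad on top-dimensional cubes *)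

Section Rho.
Variables (R : comPzRingType) (A : preCooperad R).

(** Coproducts of a family of elements, for sequences with a variable target *)
Definition ev (T : tree) (s : pseq T) (w : seq cell) (x : forall S : tree, A S) : A T :=
  rho A (tagged s) w (x (tag s)).

(** ** Faces *)

(** The 0-faces *)
Lemma rho_omit T U S (c : mseq T U) (d : mseq U S) x :
  rho A (mcat c d) (wface (mdim c) (mdim d) C1) x =
  rho A (mglue c d) (ones (mdim c + mdim d)) x.
Proof.
have := rho_face0 c d x (ones (mdim c) ++ ones (mdim d)) => /=.
rewrite (@face_coef R (A T) false (mdim c) (mdim d) (fun b => rho A (mcat c d) b x)) ?size_nseq //.
by rewrite ones_cat.
Qed.

(** The 1-faces *)
Lemma rho_split T U S (c : mseq T U) (d : mseq U S) x :
  rho A (mcat c d) (wface (mdim c) (mdim d) C0) x =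
  rho A c (ones (mdim c)) (rho A d (ones (mdim d)) x).
Proof.
have := rho_face1 c d x (ones (mdim c) ++ ones (mdim d)) => /=.
rewrite (@face_coef R (A T) true (mdim c) (mdim d) (fun b => rho A (mcat c d) b x)) ?size_nseq //.
by rewrite subSS addnK take_size_cat ?size_nseq // drop_size_cat ?size_nseq.
Qed.

Lemma wdim_face p q x : x != C01 -> wdim (wface p q x) = (p + q)%N.
Proof.
move=> /negPf xn; rewrite /wface wdim_cat wdim_ones.
by rewrite -[x :: _]cat1s wdim_cat wdim_ones /wdim /= xn.
Qed.

(** The compatibility of the coproduct with the differentials, in the component
    of the top cell of the cube *)
Lemma rho_boundary T S (c : mseq T S) n x : homog n x ->
  rho A c (ones (mdim c)) (dg (A S) x) = dg (A T) (rho A c (ones (mdim c)) x) +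
  \sum_(p < mdim c) (-1) ^+ (absz n + (mdim c).-1 + p) *:
    (rho A c (wface p (mdim c - p.+1) C1) x - rho A c (wface p (mdim c - p.+1) C0) x).
Proof.
move=> hx; rewrite (rho_dg _ _ hx) /tens_diff; congr (_ + _).
set k := mdim c.
pose z b := (-1) ^+ absz (n + (wdim b)%:Z) *: rho A c b x.
rewrite (big_tuple_words _ (fun b => ((-1) ^+ absz (n + (wdim b)%:Z) * deltaw R b (ones k)) *: rho A c b x)).
transitivity (\sum_(b <- words cell k) deltaw R b (ones k) *: z b).
  by apply: eq_bigr => b _; rewrite scalerA mulrC.
rewrite delta_ones; apply: eq_bigr => p _.
have e : ((p + (k - p.+1)) = k.-1)%N by have := ltn_ord p; lia.
rewrite /z !wdim_face ?cellE // e -scalerBr scalerA -exprD.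
congr (_ *: _); apply: sign_eq; rewrite !oddD odd_abszD /=.
by rewrite addbC -addbA.
Qed.

(** ** Degenerate sequences *)

(** The number of morphisms of the sequence that are not isomorphisms *)
Fixpoint niso T S (c : mseq T S) : nat :=
  match c with
  | MLast _ _ f => (kerm f != set0)
  | MCons _ _ _ f c' => (kerm f != set0) + niso c'
  end.

(** The number of strict inclusions, for an increasing sequence of sets *)
Fixpoint nstrict (K : finType) (E : {set K}) (l : seq {set K}) : nat :=
  if l is F :: l' then (F != E) + nstrict F l' else 0.

Lemma niso_kers T S (c : mseq T S) : niso c = nstrict set0 (kers c).
Proof.
elim: c => /= {T S} [T S f | T U S f c ->]; first by rewrite addn0.
congr (_ + _)%N; have p0 : kerm f = pull f set0.
  by apply/setP => v; rewrite mem_pullE in_set0 orbF.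
rewrite {1}p0; elim: (kers c) set0 => //= E l IHl E0.
by rewrite IHl (inj_eq (@pull_inj _ _ f)).
Qed.

Lemma ker_id (T : tree) : kerm (mor_id T) = set0.
Proof. exact: (is_contr_ker (tree_valid T) (contr_id T)). Qed.

Lemma iso_packed (T U : tree) (f : mor T U) : kerm f = set0 ->
  existT (fun X : tree => mor T X) U f = existT _ T (mor_id T).
Proof. by move=> h; apply: mor_packed; rewrite h ker_id. Qed.

(** A sequence with more morphisms than proper contractions contains an identity,
    since an isomorphism of trees is an identity. *)
Lemma degen_form T S (c : mseq T S) : (0 < mdim c)%N -> (niso c <= mdim c)%N ->
  [\/ exists c' : mseq T S, c = MCons (mor_id T) c',
      exists U (c' : mseq T U) (d : mseq U S), c = mcat c' (MCons (mor_id U) d) |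
      exists c' : mseq T S, c = mcat c' (MLast (mor_id S))].
Proof.
elim: c => {T S} [T S f // | T U S f c IHc] /= _.
case: (eqVneq (kerm f) set0) => [kf _ | _].
  have e := iso_packed kf; have eU := existT_inj1 e; subst U.
  by rewrite (existT_inj2 e); constructor 1; exists c.
rewrite add1n ltnS => le; case: (posnP (mdim c)) => [m0 | mc].
  case: c m0 le {IHc} f => //= {}U {}S g _ + f; rewrite leqn0 eqb0 negbK => /eqP kg.
  have e := iso_packed kg; have eS := existT_inj1 e; subst S.
  by rewrite (existT_inj2 e); constructor 3; exists (MLast f).
case: (IHc mc le) => [[c' ->] | [W [c' [d ->]]] | [c' ->]].
- by constructor 2; exists U, (MLast f), c'.
- by constructor 2; exists W, (MCons f c'), d.
- by constructor 3; exists (MCons f c').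
Qed.

Lemma niso_mcat T U S (c : mseq T U) (d : mseq U S) : niso (mcat c d) = (niso c + niso d)%N.
Proof. by elim: c d => //= {T U} T U W f c IHc d; rewrite IHc addnA. Qed.

Lemma sdeg_wdim k j b w : size b = k.-1 -> (j <= k)%N -> (0 < k)%N -> wdim w != wdim b ->
  sdeg R k j b w = 0.
Proof.
move=> sb jk k0 wb; have nw w' : wdim w' = wdim b -> (w == w') = false.
  by move=> e; apply: contraNF wb => /eqP ->; rewrite e.
rewrite /sdeg; case: eqP => [_ | /eqP j0].
  rewrite big_cell /= mul0r addr0 !nw ?mulr0 ?addr0 //;
  by rewrite -cats1 wdim_cat /wdim /= cellE addn0 addn0.
case: eqP => [_ | /eqP jk'].
  rewrite big_cell /= mul0r addr0 !nw ?mulr0 ?addr0 //;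
  by rewrite -cat1s wdim_cat /wdim /= cellE.
have lt : (k - j - 1 < size b)%N by lia.
set p := (k - j - 1)%N in lt *; have -> : (k - j = p.+1)%N by lia.
rewrite big1 // => y _; rewrite big1 // => z _.
case: (eqVneq (nabla1 R (nth C0 b p) y z) 0) => [-> | nz]; first by rewrite mul0r.
rewrite nw ?mulr0 // -[in RHS](cat_take_drop p b) (drop_nth C0 lt) !wdim_cat.
rewrite -[nth _ _ _ :: _]cat1s wdim_cat; congr (_ + (_ + _))%N.
move: nz; case: (nth C0 b p); case: y; case: z; rewrite /= ?eqxx //= /wdim /= ?cellE //.
Qed.

(** Degeneracies correspond to the insertion of identities and preserve the
    dimension of cells. Removing identities, one reaches a cube that has no cell of
    the dimension of w. *)
Lemma rho_degen T S (c : mseq T S) w x :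
  (0 < wdim w)%N -> (niso c <= wdim w)%N -> rho A c w x = 0.
Proof.
have [k] := ubnP (mdim c); elim: k T S c w x => // k IHk T S c w x; rewrite ltnS => le w0 nw.
case: (eqVneq (size w) (mdim c)) => [sw | /rho_supp -> //].
have wk : (wdim w <= mdim c)%N by rewrite -sw /wdim count_size.
have m0 : (0 < mdim c)%N by apply: leq_trans w0 wk.
have zero (c' : mseq T S) j : mdim c = (mdim c').+1 -> niso c' = niso c -> (j <= mdim c)%N ->
    actI (mdim c') (sdeg R (mdim c) j) (fun b => rho A c' b x) w = 0.
  move=> mc nc jc; rewrite /actI big1 // => b _.
  case: (eqVneq (wdim w) (wdim b)) => wb; last first.
    by rewrite sdeg_wdim ?scale0r // size_tuple mc.
  by rewrite IHk ?scaler0 -?wb ?nc // -ltnS -mc.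
case: (degen_form m0 (leq_trans nw wk)) => [[c' ec] | [U [c' [d ec]]] | [c' ec]]; rewrite ec.
- rewrite -rho_degen_last -[X in sdeg _ X]/(mdim (MCons (mor_id T) c')) -ec.
  by apply: zero; rewrite ec /= ?ker_id ?eqxx.
- have md : mdim c = (mdim c' + mdim d).+2 by rewrite ec mdim_mcat /= addnS.
  rewrite -rho_degen_mid -md.
  have -> : (mdim c).-1 = mdim (mcat c' d) by rewrite mdim_mcat md.
  apply: zero; rewrite ?mdim_mcat ?md //; last by lia.
  by rewrite ec !niso_mcat /= ker_id eqxx.
- have md : mdim c = (mdim c').+1 by rewrite ec mdim_mcat /= addn0.
  rewrite -rho_degen_first -md; apply: zero => //.
  by rewrite ec niso_mcat /= ker_id eqxx addn0.
Qed.

(** In a sequence of identities, the coproduct is x times the unit 1 of I^k, whose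
    components are the words of dimension zero. The element is given as a family
    because the source and the target are only propositionally equal. *)
Lemma rho_isos T S (c : mseq T S) w (y : forall S : tree, A S) :
  niso c = 0%N -> size w = mdim c -> C01 \notin w -> rho A c w (y S) = y T.
Proof.
elim: c w => {T S} [T S f | T U S f c IHc] w /=.
  case: (eqVneq (kerm f) set0) => // kf _; case: w => // _ _.
  have e := iso_packed kf; have eS := existT_inj1 e; subst S.
  by rewrite (existT_inj2 e) rho_id.
case: (eqVneq (kerm f) set0) => // kf; rewrite add0n => nc.
case: w => // a w [sw]; rewrite inE negb_or => /andP[a01 w01].
have e := iso_packed kf; have eU := existT_inj1 e; subst U.
rewrite (existT_inj2 e) -rho_degen_last -[RHS](IHc w nc sw w01) /actI.
rewrite (big_tuple_words _ (fun b => sdeg R (mdim c).+1 (mdim c).+1 b (a :: w) *: rho A c b (y S))).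
rewrite -[RHS](big_words_pick (fun b => rho A c b (y S)) sw); apply: eq_bigr => b _.
rewrite /sdeg eqxx /= (bigD1 a) //= big1 => [|y' ya]; last first.
  by rewrite eqseq_cons eq_sym (negPf ya) mulr0.
rewrite addr0 eqseq_cons eqxx /= eq_sym.
have -> : s1 R a = 1 by case: a a01; rewrite ?eqxx.
by rewrite mul1r; case: eqP; rewrite ?scale1r ?scale0r.
Qed.

End Rho.

(** ** Products of two cochains *)

Section Cup.
Variable R : comPzRingType.

Lemma cup_unit k (b : k.-tuple cell) w :
  cupI k (fun a => (a == b :> seq cell)%:R : R) (unitI R k) w = (w == b)%:R.
Proof.
rewrite /cupI (bigD1 b) //= [X in _ + X]big1 ?addr0 => [|a ab]; last first.
  by rewrite big1 // => b' _; rewrite -val_eqE in ab; rewrite (negPf ab) !mul0r.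
rewrite (big_tuple_words k (fun b' => (tval b == tval b)%:R * unitI R k b' * cupw R b b' w)).
rewrite eqxx; case: b => b /= /eqP sb; elim: k b w sb => [|k IHk] b w sb.
  by case: b sb => // _; rewrite big_words0 /unitI /= mul1r; case: w; rewrite ?mul1r ?mulr0.
case: b sb => // x b [sb]; rewrite big_words_cons.
case: w => [|z w].
  by rewrite big1 // => y _; rewrite big1 // => s _; rewrite mulr0.
transitivity (\sum_(y : cell) (y != C01)%:R * cup1 R x y z *
    \sum_(s <- words cell k) 1 * unitI R k s * cupw R b s w).
  apply: eq_bigr => y _; rewrite mulr_sumr; apply: eq_bigr => s _.
  rewrite /unitI /= eqSS inE negb_or [C01 == y]eq_sym !mul1r.
  case: (eqVneq y C01) => [_ | yn] /=; first by rewrite andbF !mul0r.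
  by rewrite addn0 mul0n expr0 !mul1r mulrCA.
rewrite -mulr_suml IHk // big_cell !cellE /= eqseq_cons mul0r addr0 !mul1r.
by case: x; case: z; rewrite /= ?cellE ?addr0 ?add0r ?mul1r ?mul0r.
Qed.

Lemma mu_two k (b0 b1 : k.-tuple cell) w : muI R [:: b0; b1] w = cupw R b0 b1 w.
Proof.
rewrite /muI /= {1}/cupI (bigD1 b0) //= [X in _ + X]big1 ?addr0 => [|a ab]; last first.
  by rewrite big1 // => b' _; rewrite -val_eqE in ab; rewrite (negPf ab) !mul0r.
rewrite (bigD1 b1) //= [X in _ + X]big1 ?addr0 => [|a ab]; last first.
  by rewrite cup_unit; rewrite -val_eqE in ab; rewrite (negPf ab) mulr0 mul0r.
by rewrite cup_unit !eqxx !mul1r.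
Qed.

Lemma cup_ones_dim k a b : size a = k -> size b = k ->
  cupw R a b (ones k) <> 0 -> (wdim a + wdim b)%N = k.
Proof.
elim: k a b => [|k IHk] [|x a] [|y b] //= [sa] [sb] nz.
have /(IHk _ _ sa sb) e : cupw R a b (ones k) <> 0 by move=> e; apply: nz; rewrite e mulr0.
have : cup1 R x y C01 <> 0 by move=> h; apply: nz; rewrite h mulr0 mul0r.
move: e; rewrite /wdim /=; case: x {nz}; case: y; rewrite /= ?cellE => e nz //=; lia.
Qed.

(** In I, 01 x = 01 only for x = 1 among 0 and 1, and x 01 = 01 only for x = 0. *)
Lemma cup_left k b : size b = k -> C01 \notin b ->
  cupw R (ones k) b (ones k) = (b == nseq k C1)%:R.
Proof.
elim: k b => [|k IHk] [|y b] //= [sb]; rewrite inE negb_or => /andP[yn bn].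
rewrite IHk // eqseq_cons /wdim /= [_ == C01]eq_sym (negPf yn) expr0 mul1r.
by case: y yn; rewrite /= ?cellE ?mul1r ?mul0r.
Qed.

Lemma cup_right k a : size a = k -> C01 \notin a ->
  cupw R a (ones k) (ones k) = (a == nseq k C0)%:R.
Proof.
elim: k a => [|k IHk] [|x a] //= [sa]; rewrite inE negb_or => /andP[xn an].
rewrite IHk // eqseq_cons.
have -> : wdim a = 0%N by apply/eqP; rewrite -leqn0 leqNgt -has_count has_pred1.
rewrite muln0 expr0 mul1r.
by case: x xn; rewrite /= ?cellE ?mul1r ?mul0r.
Qed.

Lemma wdim0 a : (wdim a == 0%N) = (C01 \notin a).
Proof. by rewrite -leqn0 leqNgt -has_count has_pred1. Qed.

Lemma wdim_max k a : size a = k -> wdim a = k -> a = ones k.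
Proof.
move=> sa wa; rewrite /ones -sa; apply/all_pred1P.
by rewrite all_count -/(wdim a) wa sa.
Qed.

End Cup.

(** * Splitting and permuting sequences of edges *)

(** The value on the empty sequence, which does not occur in the twisting map, is
    the identity of T. *)
Definition quot_seq (T : tree) (es : seq (V T)) : pseq T :=
  match es with
  | [::] => existT _ T (MLast (mor_id T))
  | e1 :: es' => psigma e1 es'
  end.

(** The composite T -> T / {e_1, ..., e_m} *)
Definition quot_map (T : tree) (es : seq (V T)) : mor T (tag (quot_seq es)) := mtot (tagged (quot_seq es)).

(** The representatives in T of the vertices of S, in the canonical order of S *)
Definition sec_word (T : tree) (f : {S : tree & mor T S}) : seq (V T) :=
  [seq msec (tagged f) x | x <- vseq (tag f)].

(** The parity of the sign of the iterated blow-up, by [blowup_parity_sign] *)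
Definition blowup_parity (T : tree) (es : seq (V T)) : bool :=
  odd (inv (@vlt T) (es ++ sec_word (existT _ _ (quot_map es)))).

Lemma blowup_parity_sign (T : tree) e1 (es : seq (V T)) : okseq (e1 :: es) ->
  odd (blowup_sign (sigma e1 es)) = blowup_parity (e1 :: es).
Proof. exact: sigma_sign. Qed.

Lemma ok_cat (T : tree) (s t : seq (V T)) : okseq (s ++ t) ->
  [/\ okseq s, okseq t & {in t, forall e, e \notin s}].
Proof.
rewrite /okseq cat_uniq mem_cat negb_or => /andP[/and3P[-> /hasPn h ->] /andP[-> ->]].
by split.
Qed.

Lemma pkers_quot_seq (T : tree) (es : seq (V T)) : (0 < size es)%N -> okseq es ->
  pkers (quot_seq es) = accs set0 es.
Proof. by case: es => // e1 es _; apply: pkers_psigma. Qed.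

Lemma ker_quot_map (T : tree) (es : seq (V T)) : (0 < size es)%N -> okseq es ->
  kerm (quot_map es) = [set e in es].
Proof. by case: es => // e1 es _; apply: ker_psigma. Qed.

Lemma mdim_quot_seq (T : tree) (es : seq (V T)) : mdim (tagged (quot_seq es)) = (size es).-1.
Proof. by case: es => // e1 es; apply: mdim_psigma. Qed.

Lemma nv_quot_seq (T : tree) (es : seq (V T)) : (0 < size es)%N -> okseq es ->
  nv T = (nv (tag (quot_seq es)) + size es)%N.
Proof. by case: es => // e1 es _; apply: nv_psigma. Qed.

Section Split.
Variables (T : tree) (s t : seq (V T)).
Hypotheses (s0 : (0 < size s)%N) (t0 : (0 < size t)%N) (ok : okseq (s ++ t)).

Let f := quot_map s.
Let oks : okseq s. Proof. by case: (ok_cat ok). Qed.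

Lemma split_notin : {in t, forall e, e \notin kerm f}.
Proof.
have [_ _ h] := ok_cat ok; move=> e /h; by rewrite /f ker_quot_map // in_set.
Qed.

Lemma split_ok : okseq [seq f e | e <- t].
Proof.
have [_ /andP[ut rt] h] := ok_cat ok; apply/andP; split.
  by rewrite map_inj_in_uniq // => x y xt yt; apply: mor_inj; apply: split_notin.
apply/mapP => -[x xt e]; case/negP: rt; rewrite -(mor_root f) in e.
by rewrite (mor_inj (root_ker _) (split_notin xt) e).
Qed.

(** Contracting t in T after s is contracting the images of t in the quotient by
    s. *)
Lemma quot_seq_split :
  quot_seq (s ++ t) = existT _ _ (mcat (tagged (quot_seq s)) (tagged (quot_seq [seq f e | e <- t]))).
Proof.
apply: kers_inj; rewrite pkers_quot_seq ?size_cat ?ltn_addr // /pkers /= kers_mcat.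
rewrite -!/(pkers _) !pkers_quot_seq ?size_map ?split_ok // accs_cat; congr (_ ++ _).
rewrite -/f pull_accs; last exact: split_notin.
congr accs; apply/setP => v; rewrite mem_pullE in_set0 orbF -/f /f ker_quot_map //.
by rewrite in_setU in_set0.
Qed.

Lemma kers_glue : kers (mglue (tagged (quot_seq s)) (tagged (quot_seq [seq f e | e <- t]))) =
  take (size s).-1 (accs set0 s) ++ accs [set e in s] t.
Proof.
rewrite kers_mglue mdim_quot_seq -!/(pkers _) !pkers_quot_seq ?size_map ?split_ok //; congr (_ ++ _).
rewrite -/f pull_accs; last exact: split_notin.
congr accs; apply/setP => v; rewrite mem_pullE in_set0 orbF -/f /f ker_quot_map //.
Qed.

Lemma sec_word_split : t ++ sec_word (existT _ _ (quot_map (s ++ t))) =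
  [seq msec f x | x <- [seq f e | e <- t] ++ sec_word (existT _ _ (quot_map [seq f e | e <- t]))].
Proof.
rewrite map_cat; congr (_ ++ _).
  rewrite -map_comp -[LHS]map_id; apply/eq_in_map => e et /=.
  by rewrite msec_id // split_notin.
have -> : existT (fun X : tree => mor T X) _ (quot_map (s ++ t)) =
    existT _ _ (mor_comp f (quot_map [seq f e | e <- t])).
  apply: mor_packed; rewrite ker_comp /quot_map -!kers_last -!/(pkers _).
  rewrite !pkers_quot_seq ?size_cat ?size_map ?ltn_addr ?split_ok // !last_accs !set0U.
  apply/setP => v; rewrite mem_pullE /f ker_quot_map // !in_set mem_cat.
  case: (boolP (v \in s)) => //= vs; apply/idP/mapP => [vt | [u ut fvu]]; first by exists v.
  have vE : v \notin kerm f by rewrite /f ker_quot_map // in_set.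
  by rewrite (mor_inj vE (split_notin ut) fvu).
rewrite /sec_word /= -map_comp; apply: eq_map => x /=; exact: msec_comp.
Qed.

(** The edges of t and the vertices of the last quotient have the same
    representatives in T, directly or by way of the quotient by s; by [inv_perm],
    the order that is used on the quotient does not matter. *)
Lemma blowup_parity_split : blowup_parity (s ++ t) = blowup_parity s (+) blowup_parity [seq f e | e <- t].
Proof.
rewrite /blowup_parity -catA sec_word_split; set w := _ ++ sec_word _.
have pw : perm_eq w (vseq (tag (quot_seq s))).
  rewrite perm_sym (perm_trans (vseq_perm _)) // perm_sym; apply: edges_word_perm.
  - by case/andP: split_ok.
  - by rewrite ker_quot_map ?size_map ?split_ok.
  - exact: vseq_perm.
have hs : [seq msec f x | x <- vseq (tag (quot_seq s))] = sec_word (existT _ _ (quot_map s)) by [].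
have u : uniq (s ++ [seq msec f x | x <- w] ++ [::]).
  rewrite cats0; have /andP[us _] := oks.
  have p := edges_word_perm us (ker_quot_map s0 oks) (perm_trans pw (vseq_perm _)).
  by rewrite (perm_uniq p) enum_uniq.
have := inv_perm (@tour_vlt _) (@tour_vlt T) (@msec_inj _ _ f) u pw.
rewrite !cats0 hs -[inv _ (vseq _)]koszul1 koszul_vseq //= addbF.
by case: (odd _); case: (odd _); case: (odd _).
Qed.

End Split.

Section Swap.
Variables (T : tree) (a b : seq (V T)) (e e' : V T).
Hypothesis (ok : okseq (a ++ e :: e' :: b)).

Lemma swap_ok : okseq (a ++ e' :: e :: b).
Proof.
have p : perm_eq (a ++ e' :: e :: b) (a ++ e :: e' :: b).
  by rewrite perm_cat2l; apply: (permEl (perm_catCA [:: e'] [:: e] b)).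
by rewrite /okseq (perm_uniq p) (perm_mem p).
Qed.

(** The two words differ by a transposition of adjacent letters. *)
Lemma blowup_parity_swap : blowup_parity (a ++ e' :: e :: b) = ~~ blowup_parity (a ++ e :: e' :: b).
Proof.
have sz x y : (0 < size (a ++ x :: y :: b))%N by rewrite size_cat addnS.
have E : existT (fun X : tree => mor T X) _ (quot_map (a ++ e' :: e :: b)) =
    existT _ _ (quot_map (a ++ e :: e' :: b)).
  apply: mor_packed; rewrite !ker_quot_map ?swap_ok //; apply/setP => v.
  by rewrite !in_set !mem_cat !inE; congr (_ || _); rewrite orbCA.
rewrite /blowup_parity E; set w := sec_word _.
have ee : e != e'.
  by case/andP: ok; rewrite cat_uniq => /and3P[_ _ +] _; rewrite /= inE negb_or -andbA => /andP[].
have u : uniq (a ++ [seq id x | x <- [:: e; e']] ++ (b ++ w)).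
  have /andP[uo _] := ok.
  have := edges_word_perm uo (ker_quot_map (sz e e') ok) (vseq_perm _).
  rewrite -[[seq _ | x <- _]]/(sec_word (existT _ _ (quot_map (a ++ e :: e' :: b)))) -/w => p.
  have : uniq ((a ++ e :: e' :: b) ++ w) by rewrite (perm_uniq p) enum_uniq.
  by rewrite -catA.
have pe : perm_eq [:: e; e'] [:: e'; e] by apply: (permEl (perm_catC [:: e] [:: e'])).
have := inv_perm (@tour_vlt T) (@tour_vlt T) (fun x y h => h) u pe.
rewrite /= !addn0 -!catA /= (tour_vlt ee).
by case: (vlt e' e); case: (odd _); case: (odd _).
Qed.

End Swap.

(** * The differential of the cobar construction *)

(** The vertices of a reduced tree are determined by sets of leaves, so there are
    at most 2 ^ r of them. *)
Lemma reduced_fin (r : nat) : exists s : seq tree,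
  forall T : tree, reduced T -> nl T = r -> T \in s.
Proof.
pose raws n := [seq @RawTree n p (tval a) |
  p <- enum {: {ffun 'I_n.+1 -> 'I_n.+1}}, a <- enum {: r.-tuple 'I_n.+1}].
pose s := pmap (insub : rawtree -> option tree)
  (flatten [seq raws n | n <- iota 0 (2 ^ r)]).
exists s => T rT nT; rewrite mem_pmap_sub; apply/flattenP.
exists (raws (nvp T)).
  apply/mapP; exists (nvp T) => //; rewrite mem_iota /= add0n.
  have := leq_card _ (reduced_cluster_inj nT rT).
  by rewrite card_ord -cardsT -powersetT card_powerset cardsT card_ord.
apply/allpairsP; have ha : size (att T) == r by rewrite -nT.
exists (par T, Tuple ha); rewrite !mem_enum; split=> //.
by rewrite /=; case: (tree_val T).
Qed.

Section Differential.
Variables (R : comPzRingType) (A : preCooperad R) (hA : connected A).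

Section Twist.
Variables (r : nat).
Implicit Types x y : dsum A r.

Lemma dsumD x y (T : tree) : (x + y : dsum A r) T = x T + y T. Proof. by []. Qed.
Lemma dsumZ a x (T : tree) : (a *: x : dsum A r) T = a *: x T. Proof. by []. Qed.

Lemma dsum_nl x (T : tree) : nl T <> r -> x T = 0.
Proof. by case: (dfunP x) => _ h /h. Qed.

(** The component of the twisting map along es. The grading involution replaces
    the signs that depend on the degree of x, which makes the term linear. *)
Definition tterm (x : dsum A r) (T : tree) (es : seq (V T)) : A T :=
  match es with
  | [::] => 0
  | e1 :: es' => (-1) ^+ (size es' + size es' * nv (quots e1 es') + blowup_sign (sigma e1 es')) *:
      rho A (sigma e1 es') (ones (size es')) (gsign (A (quots e1 es')) (size es') (x (quots e1 es')))
  end.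

Lemma tterm_linear (T : tree) es a x y : tterm (a *: x + y) (T := T) es = a *: tterm x es + tterm y es.
Proof.
case: es => [|e1 es] /=; first by rewrite scaler0 addr0.
by rewrite ?dsumD ?dsumZ !linearP.
Qed.

(** The bound on the number of edges is a parameter so that sums for T and for its
    quotients can be compared. *)
Definition twisted_upto (N : nat) (x : dsum A r) (T : tree) : A T :=
  \sum_(m < N) \sum_(es <- words (V T) m.+1 | okseq es) tterm x es.

Definition twisted (x : dsum A r) (T : tree) : A T := twisted_upto (nv T) x T.

Lemma ok_words_big (T : tree) (M : nmodType) N (F : nat -> seq (V T) -> M) : (nv T <= N)%N ->
  \sum_(m < nv T) \sum_(es <- words (V T) m.+1 | okseq es) F m es =
  \sum_(m < N) \sum_(es <- words (V T) m.+1 | okseq es) F m es.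
Proof.
move=> le; rewrite (big_ord_widen N (fun m => \sum_(es <- words (V T) m.+1 | okseq es) F m es) le).
rewrite [RHS](bigID (fun m : 'I_N => (m < nv T)%N)) /= [X in _ + X]big1 ?addr0 // => m.
rewrite -leqNgt => mT; rewrite big_seq_cond big1 // => es /andP[/size_words se /ok_size].
by rewrite se ltnNge (leq_trans mT).
Qed.

Lemma twisted_upto_linear N a x y (T : tree) : twisted_upto N (a *: x + y) T = a *: twisted_upto N x T + twisted_upto N y T.
Proof.
rewrite /twisted_upto scaler_sumr -big_split /=; apply: eq_bigr => m _.
rewrite scaler_sumr -big_split /=; apply: eq_bigr => es _; exact: tterm_linear.
Qed.

Lemma tterm_nl x (T : tree) es : nl T <> r -> tterm x (T := T) es = 0.
Proof.
case: es => [|e1 es] //= nT; rewrite dsum_nl ?linear0 ?scaler0 //.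
by rewrite (mor_nl (mtot (sigma e1 es))).
Qed.

Definition dfun_D x (T : tree) : A T := (-1) ^+ nv T *: dg (A T) (x T) + twisted x T.

Lemma D_subproof x :
  (exists s : seq tree, forall T, T \notin s -> dfun_D x T = 0) /\
  (forall T : tree, nl T <> r -> dfun_D x T = 0).
Proof.
have h (T : tree) : nl T <> r -> dfun_D x T = 0.
  move=> nT; rewrite /dfun_D dsum_nl // linear0 scaler0 add0r /twisted /twisted_upto.
  by rewrite big1 // => m _; rewrite big1 // => es _; rewrite tterm_nl.
split=> //; have [s hs] := reduced_fin r; exists s => T Ts.
case: (eqVneq (nl T) r) => [nT | /eqP /h //].
by apply: hA; apply: contra Ts => rT; apply: hs.
Qed.

Definition D_fun x : dsum A r := Dsum (D_subproof x).

Lemma D_linear : linear D_fun.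
Proof.
move=> a x y; apply: dsum_ext => T; rewrite dsumD dsumZ /= /dfun_D.
rewrite dsumD dsumZ linearP /twisted twisted_upto_linear !scalerDr !scalerA addrACA; congr (_ + _ + _).
by rewrite mulrC.
Qed.
HB.instance Definition _ := GRing.isLinear.Build R (dsum A r) (dsum A r) *:%R D_fun D_linear.
Definition D_lin : {linear Bc A r -> Bc A r} := D_fun.

(** The factors 01 of degree -1 shift the degrees by the number of vertices. *)
Lemma bc_homog n x : homog n (x : Bc A r) <-> forall T : tree, homog (n + (nv T)%:Z) (x T).
Proof.
split=> [h T | h].
  by have := congr1 (fun y : dsum A r => y T) h.
by apply: dsum_ext => T; apply: h.
Qed.

(** The sign of the component of the twisting map along es, in degree n: the
    contribution of the number of vertices of the quotient cancels. *)
Definition twist_sign (n : int) (T : tree) (es : seq (V T)) : nat :=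
  ((size es).-1 * (absz n).+1 + blowup_parity es)%N.

Lemma tterm_homog n x (T : tree) (es : seq (V T)) : (0 < size es)%N -> okseq es ->
  homog n (x : Bc A r) ->
  tterm x es = (-1) ^+ twist_sign n es *: ev (quot_seq es) (ones (size es).-1) x.
Proof.
case: es => // e1 es _ ok /bc_homog h /=.
rewrite (gsign_homog _ (h _)) linearZ scalerA /ev /= -exprD; congr (_ *: _).
apply: sign_eq; rewrite /twist_sign -blowup_parity_sign //; move: (nv _) (blowup_sign _) => v b.
rewrite !oddD !oddM odd_abszD /= oddb.
by case: (odd (size es)); case: (odd (absz n)); case: (odd v); case: (odd b).
Qed.

Lemma twisted_homog n x (T : tree) : homog n (x : Bc A r) -> twisted x T =
  \sum_(m < nv T) \sum_(es <- words (V T) m.+1 | okseq es)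
    (-1) ^+ twist_sign n es *: ev (quot_seq es) (ones m) x.
Proof.
move=> hx; rewrite /twisted /twisted_upto; apply: eq_bigr => m _.
rewrite big_seq_cond [RHS]big_seq_cond; apply: eq_bigr => es /andP[/size_words se ok].
by rewrite (tterm_homog _ ok hx) ?se.
Qed.

Lemma D_is_cobar_diff : is_cobar_diff D_lin.
Proof.
move=> n x hx T; rewrite /= /dfun_D; congr (_ + _).
rewrite /twisted /twisted_upto /twist; apply: eq_bigr => m _.
pose F (es : seq (V T)) : A T := match es with
  | [::] => 0 | e1 :: es' => twist_term n x e1 es' end.
transitivity (\sum_(es <- words (V T) m.+1 | okseq es) F es).
  rewrite big_seq_cond [RHS]big_seq_cond; apply: eq_bigr => es /andP[/size_words se ok].
  case: es se ok => // e1 es [se] ok /=; rewrite /twist_term; congr (_ *: _).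
  have /bc_homog h := hx; rewrite (gsign_homog _ (h _)) linearZ /rho_square.
  by rewrite mdim_psigma.
rewrite big_mkcond -big_tuple_words [RHS]big_mkcond; apply: eq_bigr => e _.
by case/tupleP: e => e1 e; rewrite theadE.
Qed.

Lemma D_deg n x : homog n (x : Bc A r) -> homog (n - 1) (D_fun x : Bc A r).
Proof.
move=> hx; apply/bc_homog => T /=; rewrite /dfun_D; have /bc_homog hT := hx.
apply: homogD.
  apply: homogZ; have := dg_diff_deg (dg_str (A T)) (hT T).
  by rewrite addrAC.
rewrite (twisted_homog _ hx); apply: homog_sum => m _.
rewrite big_seq_cond; apply: homog_sum => es /andP[/size_words se ok].
apply: homogZ; have := rho_deg (tagged (quot_seq es)) (ones m) (hT (tag (quot_seq es))).
rewrite wdim_ones; have nT : nv T = (nv (tag (quot_seq es)) + m.+1)%N by rewrite -se; apply: nv_quot_seq; rewrite ?se.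
by have -> : n - 1 + (nv T)%:Z = n + (nv (tag (quot_seq es)))%:Z + m%:Z by lia.
Qed.

End Twist.
End Differential.

(** ** The differential squares to zero *)

(** Reindexing of the splittings of a sequence of m + 1 edges into p + 1 and
    q + 1 edges *)
Lemma big_triangle (M : nmodType) N (g : nat -> nat -> M) :
  (forall p q, (N <= (p + q).+1)%N -> g p q = 0) ->
  \sum_(m < N) \sum_(p < m) g p (m - p.+1)%N = \sum_(p < N) \sum_(q < N) g p q.
Proof.
move=> g0; rewrite -(big_mkord xpredT (fun m => \sum_(p < m) g p (m - p.+1)%N)).
rewrite -(big_mkord xpredT (fun p => \sum_(q < N) g p q)).
transitivity (\sum_(0 <= m < N) \sum_(0 <= p < N | (p < m)%N) g p (m - p.+1)%N).
  rewrite big_nat_cond [RHS]big_nat_cond; apply: eq_bigr => m /andP[/andP[_ mN] _].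
  rewrite -(big_mkord xpredT (fun p => g p (m - p.+1)%N)).
  by rewrite (big_nat_widen _ _ N) ?(ltnW mN).
rewrite (exchange_big_dep_nat xpredT) //=; rewrite big_nat_cond [RHS]big_nat_cond.
apply: eq_bigr => p /andP[/andP[_ pN] _].
rewrite -(big_mkord xpredT (fun q => g p q)).
rewrite [RHS](big_cat_nat (n := (N - p.+1)%N)) ?leq_subr //= [X in _ + X]big_nat_cond.
rewrite [X in _ + X]big1 ?addr0 => [|q /andP[/andP[h _] _]]; last by apply: g0; lia.
have -> : \sum_(0 <= m < N | (p < m)%N) g p (m - p.+1)%N = \sum_(p.+1 <= m < N) g p (m - p.+1)%N.
  by rewrite [RHS](big_nat_widenl _ 0).
by rewrite -[X in \sum_(X <= _ < _) _]add0n big_addn; apply: eq_bigr => q _; rewrite addnK.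
Qed.

(** The terms cancel in pairs; division by 2 would not be possible in a general
    ground ring. *)
Lemma big_antisym (n : nat) (M : zmodType) (g : 'I_n -> 'I_n -> M) :
  (forall i j, g j i = - g i j) -> (forall i, g i i = 0) -> \sum_i \sum_j g i j = 0.
Proof.
move=> ga gd; have E i : \sum_j g i j = \sum_(j : 'I_n | (i < j)%N) g i j + \sum_(j : 'I_n | (j < i)%N) g i j.
  rewrite (bigID (fun j : 'I_n => (i < j)%N)) /=; congr (_ + _).
  rewrite (bigID (fun j : 'I_n => (j < i)%N)) /= [X in _ + X]big1 ?addr0.
    by apply: eq_bigl => j; rewrite -leqNgt andb_idl // => /ltnW.
  move=> j /andP[h1 h2]; rewrite (_ : j = i) ?gd //; apply: val_inj => /=.
  by apply/eqP; rewrite eqn_leq leqNgt h1 leqNgt.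
rewrite (eq_bigr _ (fun i _ => E i)) big_split /=.
rewrite [X in _ + X](exchange_big_dep xpredT) //= -big_split big1 //= => i _.
by rewrite -big_split big1 //= => j _; rewrite (ga i j) addrN.
Qed.

Section Square.
Variables (R : comPzRingType) (A : preCooperad R) (hA : connected A).
Variables (r : nat) (n : int) (x : dsum A r).
Hypothesis hx : homog n (x : Bc A r).

(** The face number p of the coproduct along es *)
Definition edge_face (T : tree) (es : seq (V T)) (p : nat) (c : cell) : A T :=
  ev (quot_seq es) (wface p ((size es).-1 - p.+1) c) x.

(** When the quotient by a and e (or a and e') is omitted, the contracted edges
    are a, then a with both e and e', in either order. *)
Lemma edge_face_omit (T : tree) (a b : seq (V T)) e e' : okseq (a ++ e :: e' :: b) ->
  edge_face (a ++ e :: e' :: b) (size a) C1 = edge_face (a ++ e' :: e :: b) (size a) C1.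
Proof.
move=> ok.
have key u v : okseq (a ++ u :: v :: b) -> exists Z : pseq T,
    pkers Z = accs set0 a ++ accs [set y in a ++ [:: u]] (v :: b) /\
    edge_face (a ++ u :: v :: b) (size a) C1 = ev Z (ones (size a + size b)) x.
  rewrite -cat1s catA => ok'; have sz : (0 < size (a ++ [:: u]))%N by rewrite size_cat addn1.
  have sv : (0 < size (v :: b))%N by [].
  have sE := quot_seq_split sz sv ok'; have kE := kers_glue sz sv ok'.
  move: sE kE; set c := tagged (quot_seq _); set d := tagged (quot_seq _) => sE kE.
  exists (existT _ _ (mglue c d)); split.
    rewrite /pkers /= kE size_cat addn1 /=; congr (_ ++ _).
    by rewrite accs_cat take_size_cat ?size_accs.
  have sc : mdim c = size a by rewrite /c mdim_quot_seq size_cat addn1.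
  have sd : mdim d = size b by rewrite /d mdim_quot_seq /= size_map.
  have eb : ((size ((a ++ [:: u]) ++ v :: b)).-1 - (size a).+1)%N = size b.
    by rewrite !size_cat /=; lia.
  by rewrite /edge_face eb sE /ev /= -sc -sd rho_omit.
have [Z [kZ ->]] := key _ _ ok; have [Z' [kZ' ->]] := key _ _ (swap_ok ok).
congr (ev _ _ _); apply: kers_inj; rewrite kZ kZ' /=.
congr (_ ++ _ :: accs _ _); apply/setP => y; rewrite !in_setU1 !in_set !mem_cat !mem_seq1;
  by case: (y == e); case: (y == e'); rewrite ?orbT ?orbF.
Qed.

(** The quotient in the middle of the sequence separates the edges of s from
    those of t. *)
Lemma edge_face_split (T : tree) (s t : seq (V T)) : (0 < size s)%N -> (0 < size t)%N ->
  okseq (s ++ t) ->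
  edge_face (s ++ t) (size s).-1 C0 = rho A (tagged (quot_seq s)) (ones (size s).-1)
    (ev (quot_seq [seq quot_map s e | e <- t]) (ones (size t).-1) x).
Proof.
move=> s0 t0 ok; have sE := quot_seq_split s0 t0 ok; move: sE.
set c := tagged (quot_seq s); set d := tagged (quot_seq _).
have sc : mdim c = (size s).-1 by rewrite mdim_quot_seq.
have sd : mdim d = (size t).-1 by rewrite mdim_quot_seq size_map.
move=> sE; rewrite /edge_face sE.
have -> : ((size (s ++ t)).-1 - (size s).-1.+1)%N = (size t).-1.
  by rewrite size_cat; lia.
by rewrite /ev /= -sc -sd rho_split.
Qed.

(** The exponent of the sign of the p-th faces in the square *)
Definition face_sign (m p : nat) (T : tree) (es : seq (V T)) : nat :=
  (m.+1 * absz n + m.+1 + p + blowup_parity es)%N.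

(** The two mixed terms, with one internal differential and one coproduct, have
    opposite signs and leave the faces of the coproduct. *)
Lemma square_linear (T : tree) m (es : seq (V T)) : size es = m.+1 -> okseq es ->
  (-1) ^+ (nv T + twist_sign n es) *: dg (A T) (ev (quot_seq es) (ones m) x) +
  (-1) ^+ (twist_sign (n - 1) es + nv (tag (quot_seq es))) *:
    rho A (tagged (quot_seq es)) (ones m) (dg (A (tag (quot_seq es))) (x (tag (quot_seq es)))) =
  \sum_(p < m) (-1) ^+ face_sign m p es *: (edge_face es p C1 - edge_face es p C0).
Proof.
move=> se ok; have /bc_homog h := hx.
have := rho_boundary (tagged (quot_seq es)) (h (tag (quot_seq es))).
rewrite mdim_quot_seq se /= => ->; rewrite scalerDr addrA -[ev _ _ _]/(rho A _ _ _) -scalerDl.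
have nT : nv T = (nv (tag (quot_seq es)) + m.+1)%N by rewrite -se; apply: nv_quot_seq; rewrite ?se.
have on1 : odd (absz (n - 1)) = ~~ odd (absz n) by rewrite odd_abszD /= addbT.
rewrite (_ : (-1) ^+ (nv T + _) + _ = 0) ?scale0r ?add0r; last first.
  rewrite (_ : (-1) ^+ (nv T + twist_sign n es) = - (-1) ^+ (twist_sign (n - 1) es + nv (tag (quot_seq es))) :> R) ?addNr //.
  rewrite -[RHS]mulN1r -exprS; apply: sign_eq; rewrite nT /twist_sign se [m.+1.-1]/=.
  move: (nv (tag (quot_seq es))) (blowup_parity es) => v b; rewrite !(oddD, oddM, oddS) on1.
  by case: (odd m); case: (odd (absz n)); case: (odd v); case: b.
rewrite scaler_sumr; apply: eq_bigr => p _; rewrite /edge_face se scalerA -exprD.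
congr (_ *: _); apply: sign_eq; rewrite /twist_sign /face_sign se [m.+1.-1]/=.
have mp : odd m.-1 = ~~ odd m by case: (m) p => [[] //|m'] _; rewrite /= negbK.
move: (nv (tag (quot_seq es))) (blowup_parity es) => v b; rewrite !(oddD, oddM, oddS) on1 odd_abszD mp /=.
by case: (odd m); case: (odd (absz n)); case: (odd v); case: b; case: (odd p).
Qed.

Lemma square_omit (T : tree) m (p : 'I_m) :
  \sum_(es <- words (V T) m.+1 | okseq es) (-1) ^+ face_sign m p es *: edge_face es p C1 = 0.
Proof.
rewrite big_mkcond.
have -> : m.+1 = (p + (m - p.+1).+2)%N by have := ltn_ord p; lia.
rewrite big_words_cat big_seq big1 // => a /size_words sa.
rewrite big_words_cons.
under eq_bigr do rewrite big_words_cons exchange_big /=.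
rewrite exchange_big /= big1 // => b _.
apply: big_antisym => [e e' | e]; last first.
  by rewrite /okseq cat_uniq /= inE eqxx /= !andbF.
case: (boolP (okseq (a ++ e :: e' :: b))) => [ok | nok].
  rewrite (swap_ok ok) -sa (edge_face_omit ok) -scaleNr -[- (_ ^+ _)]mulN1r -exprS; congr (_ *: _).
  apply: sign_eq; rewrite /face_sign oddS !oddD (blowup_parity_swap ok) !oddb.
  by case: (blowup_parity _); rewrite ?addbT ?addbF ?negbK.
by case: ifP nok => [/swap_ok -> // | _ _]; rewrite oppr0.
Qed.

(** The edges of the quotient by s correspond to the inner edges of T outside
    s. *)
Lemma twisted_split (T : tree) (s : seq (V T)) N : (0 < size s)%N -> okseq s -> (nv T <= N)%N ->
  twisted x (tag (quot_seq s)) =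
  \sum_(q < N) \sum_(t <- words (V T) q.+1 | okseq (s ++ t))
    (-1) ^+ twist_sign n [seq quot_map s e | e <- t] *: ev (quot_seq [seq quot_map s e | e <- t]) (ones q) x.
Proof.
move=> s0 ok le; rewrite (twisted_homog _ hx).
set S := tag (quot_seq s); pose f := quot_map s.
have leS : (nv S <= N)%N by apply: leq_trans le; rewrite (nv_quot_seq s0 ok) leq_addr.
rewrite (ok_words_big (fun m es => (-1) ^+ twist_sign n es *: ev (quot_seq es) (ones m) x) leS).
apply: eq_bigr => q _.
pose G (t : seq (V T)) : A S := if okseq [seq f e | e <- t] then
   (-1) ^+ twist_sign n [seq f e | e <- t] *: ev (quot_seq [seq f e | e <- t]) (ones q) x else 0.
transitivity (\sum_(t <- words (V S) q.+1) G [seq msec f y | y <- t]).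
  rewrite big_mkcond; apply: eq_bigr => t _; rewrite /G -map_comp.
  by rewrite (eq_map (g := id)) ?map_id // => y /=; rewrite msecK.
rewrite -(big_words_image _ _ (@msec_inj _ _ f)) [RHS]big_mkcond [LHS]big_mkcond.
apply: eq_bigr => t _; rewrite /G.
have E : all (mem (codom (msec f))) t && okseq [seq f e | e <- t] = okseq (s ++ t).
  apply/andP/idP => [[/allP ht /andP[ut rt]] | okt].
    have tE : {in t, forall e, e \notin kerm f}.
      by move=> e /ht /codomP[y ->]; apply: msecN.
    have /andP[us rs] := ok; apply/andP; split.
      rewrite cat_uniq us (map_uniq ut) andbT /=; apply/hasPn => e /tE.
      by rewrite ker_quot_map // in_set.
    rewrite mem_cat negb_or rs; apply: contra rt => h; apply/mapP; exists (troot T) => //.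
    by rewrite mor_root.
  split; last first.
    case: t okt => [|e t] okt; first by [].
    exact: split_ok.
  case: t okt => [|e t] okt //; apply/allP => y yt; rewrite inE.
  by rewrite -(@msec_id _ _ f y) ?codom_f //; apply: (split_notin s0 okt).
by rewrite -E; case: (all _ _).
Qed.

Lemma square_homog (T : tree) : dfun_D (D_fun hA x) T = 0.
Proof.
have hx' := D_deg hA hx; set N := nv T.
rewrite /dfun_D (twisted_homog _ hx') /= {1}/dfun_D (twisted_homog _ hx) -/N.
rewrite linearD linearZ /= [dg _ (dg _ _)]dg_diff_sq scaler0 add0r.
rewrite linear_sum scaler_sumr -big_split /=.
pose Qd (m : nat) (es : seq (V T)) : A T := (-1) ^+ twist_sign (n - 1) es *:
  rho A (tagged (quot_seq es)) (ones m) (twisted x (tag (quot_seq es))).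
transitivity (\sum_(m < N) (\sum_(es <- words (V T) m.+1 | okseq es)
    \sum_(p < m) (-1) ^+ face_sign m p es *: (edge_face es p C1 - edge_face es p C0) +
  \sum_(es <- words (V T) m.+1 | okseq es) Qd m es)).
  apply: eq_bigr => m _; rewrite linear_sum scaler_sumr -!big_split /=.
  rewrite big_seq_cond [RHS]big_seq_cond; apply: eq_bigr => es /andP[/size_words se ok].
  rewrite -(square_linear se ok) linearZ scalerA -exprD -addrA; congr (_ + _).
  rewrite {1}/ev /= /dfun_D linearD scalerDr; congr (_ + _).
  by rewrite linearZ scalerA -exprD.
rewrite big_split /=.
have -> : \sum_(m < N) \sum_(es <- words (V T) m.+1 | okseq es)
    \sum_(p < m) (-1) ^+ face_sign m p es *: (edge_face es p C1 - edge_face es p C0) =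
  - \sum_(m < N) \sum_(p < m) \sum_(es <- words (V T) m.+1 | okseq es)
      (-1) ^+ face_sign m p es *: edge_face es p C0.
  rewrite -sumrN; apply: eq_bigr => m _; rewrite exchange_big /= -sumrN; apply: eq_bigr => p _.
  by under eq_bigr do rewrite scalerBr; rewrite sumrB square_omit sub0r.
(* The 0-faces are gone; the 1-faces are indexed by the two parts s and t. *)
pose G p q (s t : seq (V T)) : A T := if okseq (s ++ t) then
  (-1) ^+ (face_sign (p + q).+1 p (s ++ t)) *: edge_face (s ++ t) p C0 else 0.
pose g p q := \sum_(s <- words (V T) p.+1) \sum_(t <- words (V T) q.+1) G p q s t.
have -> : \sum_(m < N) \sum_(p < m) \sum_(es <- words (V T) m.+1 | okseq es)
      (-1) ^+ face_sign m p es *: edge_face es p C0 = \sum_(m < N) \sum_(p < m) g p (m - p.+1)%N.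
  apply: eq_bigr => m _; apply: eq_bigr => p _; rewrite /g /G.
  have -> : (p + (m - p.+1)).+1 = m by have := ltn_ord p; lia.
  have e : m.+1 = (p.+1 + (m - p.+1).+1)%N by have := ltn_ord p; lia.
  by rewrite big_mkcond e big_words_cat.
rewrite big_triangle => [|p q Npq]; last first.
  rewrite /g big_seq big1 // => s /size_words ss; rewrite big_seq big1 // => t /size_words st.
  rewrite /G; case: ifP => // /ok_size; rewrite size_cat ss st -/N => lt.
  by exfalso; move: lt Npq; rewrite ltnNge addSn addnS => /negP h /leqW /h.
apply/eqP; rewrite addrC subr_eq0; apply/eqP; apply: eq_bigr => p _.
rewrite exchange_big /= big_mkcond; apply: eq_big_seq => s /size_words ss.
have s0 : (0 < size s)%N by rewrite ss.
case: ifP => ok; last first.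
  rewrite big1 // => q _; rewrite big1 // => t _; rewrite /G.
  by case: ifP => // /ok_cat[]; rewrite ok.
rewrite /Qd (twisted_split s0 ok (leqnn _)) linear_sum scaler_sumr; apply: eq_bigr => q _.
rewrite linear_sum scaler_sumr big_mkcond; apply: eq_big_seq => t /size_words st.
have t0 : (0 < size t)%N by rewrite st.
rewrite /G; case: ifP => // okt.
have := edge_face_split s0 t0 okt; rewrite ss st /= => ->.
rewrite linearZ scalerA -exprD; congr (_ *: _); apply: sign_eq.
have on1 : odd (absz (n - 1)) = ~~ odd (absz n) by rewrite odd_abszD /= addbT.
rewrite /twist_sign /face_sign (blowup_parity_split s0 t0 okt) size_map ss st ![_.+1.-1]/=.
rewrite !(oddD, oddM, oddS) on1 !oddb.
by case: (odd p); case: (odd q); case: (odd (absz n)); case: (blowup_parity _); case: (blowup_parity _).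
Qed.

End Square.

Section DgStructure.
Variables (R : comPzRingType) (A : preCooperad R) (hA : connected A).

Lemma D_sq r (x : dsum A r) : D_fun hA (D_fun hA x) = 0.
Proof.
have [s _ ->] := bproj_fin x; rewrite !linear_sum big1 //= => n _.
apply: dsum_ext => T; exact: (square_homog hA (@homog_proj _ (Bc A r) n x)).
Qed.

Definition D (r : nat) : dgStructure (Bc A r) :=
  @DgStructure R (Bc A r) (D_lin hA r) (@D_deg R A hA r) (@D_sq r).

End DgStructure.

(** * Segal maps of cuts *)

Definition fullsub (T : tree) : psub T := existT (fun F => subtree F T) T (idsub T).

(** If X is not connected, then the witness is a dummy value. *)
Lemma psub_exists (T : tree) (X : {set V T}) :
  exists Phi : psub T, forall x0, conn X x0 -> simg (tagged Phi) = X.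
Proof.
case: (pselect (exists x0, conn X x0)) => [[x0 cX] | nX].
  by have [F [i iX]] := subtree_exists cX; exists (existT _ F i).
by exists (fullsub T) => x0 cX; case: nX; exists x0.
Qed.

(** The subtree with vertex set X, for a connected set X *)
Definition psubX (T : tree) (X : {set V T}) : psub T := sval (cid (psub_exists X)).

Lemma psubX_simg (T : tree) (X : {set V T}) x0 : conn X x0 -> simg (tagged (psubX X)) = X.
Proof. exact: (svalP (cid (psub_exists X))). Qed.

Lemma psub_eq (T : tree) (Phi Psi : psub T) :
  simg (tagged Phi) = simg (tagged Psi) -> Phi = Psi.
Proof. by case: Phi Psi => [F i] [G j]; apply: sub_packed. Qed.

Lemma psubX_eq (T : tree) (X : {set V T}) x0 (Phi : psub T) :
  conn X x0 -> simg (tagged Phi) = X -> Phi = psubX X.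
Proof. by move=> cX e; apply: psub_eq; rewrite (psubX_simg cX). Qed.

(** The vertices of a subtree, in its own canonical order *)
Definition part_word (T : tree) (Phi : psub T) : seq (V T) :=
  [seq tagged Phi t | t <- vseq (tag Phi)].

(** Arguments of Segal maps as functions of all subtrees of T, so that they do not
    depend on the way in which a decomposition presents its fibres *)
Definition label (R : comPzRingType) (A : preCooperad R) (T : tree) :=
  forall Phi : psub T, A (tag Phi).

Section Segal.
Variables (R : comPzRingType) (A : preCooperad R).

Lemma segal_ext (T S : tree) (F : V S -> tree) (D : decomp T S F) (x y : forall v, A (F v)) :
  (forall v, x v = y v) -> segal D x = segal D y.
Proof. by move=> xy; congr segal; apply: functional_extensionality_dep. Qed.

(** The contracted edges determine the base, the morphism and the fibres, up to
    equality. *)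
Lemma segal_indep (T S S1 : tree) (F : V S -> tree) (F1 : V S1 -> tree)
    (D : decomp T S F) (D1 : decomp T S1 F1) (xi : label A T) :
  kerm (dmor D) = kerm (dmor D1) ->
  segal D (fun v => xi (part D v)) = segal D1 (fun v => xi (part D1 v)).
Proof.
move=> /mor_packed e; have eS := existT_inj1 e; subst S1; have {}e := existT_inj2 e.
have PE : part D = part D1.
  apply: functional_extensionality_dep => v; apply: sub_packed.
  by rewrite !demb_simg e.
move: PE e; case: D => f i h; case: D1 => f1 i1 h1 /= PE e; subst f1.
pose P (Phi : V S -> psub T) := forall v u, (u \in codom (tagged (Phi v))) = (f u == v).
pose seg Phi (k : P Phi) := segal (@Decomp T S (fun v => tag (Phi v)) f
  (fun v => tagged (Phi v)) k) (fun v => xi (Phi v)).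
have key Phi Phi1 (k : P Phi) (k1 : P Phi1) : Phi = Phi1 -> seg _ k = seg _ k1.
  by move=> E; subst Phi1; congr seg; apply: Prop_irrelevance.
exact: (key (fun v => existT _ (F v) (i v)) (fun v => existT _ (F1 v) (i1 v)) h h1 PE).
Qed.

Section Multilinear.
Variables (T S : tree) (F : V S -> tree) (D : decomp T S F) (x : forall v, A (F v)) (v : V S).

Definition seg_at (y : A (F v)) : A T := segal D (@dfwith _ (fun u => A (F u)) x v y).

Lemma seg_at_linear : linear seg_at.
Proof. by move=> a y z; apply: segal_linear. Qed.
HB.instance Definition _ := GRing.isLinear.Build R (A (F v)) (A T) *:%R seg_at seg_at_linear.
Definition seg_lin : {linear A (F v) -> A T} := seg_at.

Lemma segal_at : segal D x = seg_lin (x v).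
Proof.
apply: segal_ext => u; case: (eqVneq u v) => [-> | uv]; first by rewrite dfwith_in.
by rewrite dfwith_out // eq_sym.
Qed.

End Multilinear.

Lemma seg_lin_ext (T S : tree) (F : V S -> tree) (D : decomp T S F) (x x' : forall v, A (F v)) v y :
  (forall u, u != v -> x u = x' u) -> seg_lin D x v y = seg_lin D x' v y.
Proof.
move=> h; apply: segal_ext => u; case: (eqVneq u v) => [e | uv].
  by subst u; rewrite !dfwith_in.
by rewrite !dfwith_out ?h // eq_sym.
Qed.

Lemma segal_zero (T S : tree) (F : V S -> tree) (D : decomp T S F) (x : forall v, A (F v)) v :
  x v = 0 -> segal D x = 0.
Proof. by rewrite (segal_at D x v) => ->; rewrite linear0. Qed.

Lemma segal_scale (T S : tree) (F : V S -> tree) (D : decomp T S F) (x x' : forall v, A (F v)) v a :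
  x v = a *: x' v -> (forall u, u != v -> x u = x' u) -> segal D x = a *: segal D x'.
Proof.
move=> e h; rewrite (segal_at D x v) (segal_at D x' v) e linearZ; congr (_ *: _).
exact: seg_lin_ext.
Qed.

(** The only part is T itself. *)
Lemma segal_one (T S : tree) (F : V S -> tree) (D : decomp T S F) (xi : label A T) :
  kerm (dmor D) = ~: [set troot T] ->
  segal D (fun v => xi (part D v)) = xi (fullsub T).
Proof.
move=> kD; have v0 v : v = troot S.
  have := msecN (dmor D) v; rewrite kD !inE negbK => /eqP e.
  by rewrite -(msecK (dmor D) v) e mor_root.
have nS : nv S = 1%N.
  rewrite -[LHS]card_ord; apply/eqP; rewrite eqn_leq; apply/andP; split; last by apply/card_gt0P; exists (troot S).
  by apply/card_le1P => u _ w; rewrite !inE; apply/esym/eqP; rewrite (v0 u) (v0 w).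
have h v u : (u \in codom (idsub T)) = (dmor D u == v).
  rewrite (v0 v) (v0 (dmor D u)) eqxx; apply/codomP; exists u; by rewrite idsubE.
pose D1 := @Decomp T S (fun=> T) (dmor D) (fun=> idsub T) h.
by rewrite (segal_indep (D1 := D1)) // segal_id.
Qed.

(** ** Cuts *)

Lemma seg_cut_exists (Q : tree) (c : V Q) (xi : label A Q) : exists a : A Q,
  forall (U : tree) (F : V U -> tree) (D : decomp Q U F), kerm (dmor D) = cutker c ->
    segal D (fun v => xi (part D v)) = a.
Proof.
have [U [F [D kD]]] := cut_decomp c.
exists (segal D (fun v => xi (part D v))) => U1 F1 D1 kD1.
by apply: segal_indep; rewrite kD kD1.
Qed.

(** The Segal map A(S) (x) A(T) -> A(Q) of the cut of Q below the vertex c *)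
Definition seg_cut (Q : tree) (c : V Q) (xi : label A Q) : A Q := sval (cid (seg_cut_exists c xi)).

Lemma seg_cutE (Q : tree) (c : V Q) (xi : label A Q) (U : tree) (F : V U -> tree)
    (D : decomp Q U F) : kerm (dmor D) = cutker c ->
  seg_cut c xi = segal D (fun v => xi (part D v)).
Proof. by move=> kD; rewrite (svalP (cid (seg_cut_exists c xi)) U F D kD). Qed.

(** The top part of a cut is the one with root vertex c. *)
Definition pairL (Q : tree) (c : V Q) (x y : forall S : tree, A S) : label A Q :=
  fun Phi => if tagged Phi (troot (tag Phi)) == c then y (tag Phi) else x (tag Phi).

End Segal.

Section CutParts.
Variables (Q : tree) (c : V Q).
Hypothesis cr : c != troot Q.

Definition Bot : psub Q := psubX (bots c).
Definition Top : psub Q := psubX (tops c).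

Lemma Bot_simg : simg (tagged Bot) = bots c.
Proof. exact: psubX_simg (bots_conn cr). Qed.

Lemma Top_simg : simg (tagged Top) = tops c.
Proof. exact: psubX_simg (tops_conn c). Qed.

Lemma Bot_eq Phi : simg (tagged Phi) = bots c -> Phi = Bot.
Proof. exact: psubX_eq (bots_conn cr). Qed.

Lemma Top_eq Phi : simg (tagged Phi) = tops c -> Phi = Top.
Proof. exact: psubX_eq (tops_conn c). Qed.

(** The sign of the permutation from the vertex tensors of the two parts to that
    of Q *)
Definition cut_sign : bool := odd (inv (@vlt Q) (part_word Bot ++ part_word Top)).

Lemma Bot_root : tagged Bot (troot (tag Bot)) = troot Q.
Proof. exact: (bot_root cr Bot_simg). Qed.

Lemma Top_root : tagged Top (troot (tag Top)) = c.
Proof. exact: (top_root Top_simg). Qed.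

Lemma nv_sub (T : tree) (Phi : psub T) : nv (tag Phi) = #|simg (tagged Phi)|.
Proof.
rewrite /simg cardsE card_codom; first by rewrite /nv card_ord.
exact: sub_inj.
Qed.

Lemma nv_parts : nv Q = (nv (tag Bot) + nv (tag Top))%N.
Proof.
rewrite !nv_sub Bot_simg Top_simg (_ : bots c = ~: tops c); last by apply/setP => v; rewrite !inE.
by rewrite addnC cardsC /nv card_ord.
Qed.

Lemma part_word_perm : perm_eq (part_word Bot ++ part_word Top) (enum (V Q)).
Proof.
have um (Phi : psub Q) : uniq (part_word Phi).
  by rewrite /part_word map_inj_uniq ?vseq_uniq //; apply: sub_inj.
have mw (Phi : psub Q) v : (v \in part_word Phi) = (v \in simg (tagged Phi)).
  apply/mapP/simgP => [[t _ ->] | [t ->]]; exists t => //; exact: mem_vseq.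
apply: uniq_perm; rewrite ?enum_uniq //.
  rewrite cat_uniq !um andbT; apply/hasPn => v; rewrite !mw Bot_simg Top_simg !inE.
  by rewrite negbK.
by move=> v; rewrite mem_cat !mw Bot_simg Top_simg !inE mem_enum orNb.
Qed.

Variables (U : tree) (F : V U -> tree) (D : decomp Q U F).
Hypothesis kD : kerm (dmor D) = cutker c.

Lemma part_bot : part D (troot U) = Bot.
Proof. by apply: Bot_eq; rewrite /= (simg_bot cr kD). Qed.

Lemma part_top : part D (cutv c D) = Top.
Proof. by apply: Top_eq; rewrite /= (simg_top cr kD). Qed.

End CutParts.

(** * Coproducts on the image of a Segal map *)

(** The letters of es that belong to a subtree, as vertices of the latter *)
Definition pinv (Q : tree) (Phi : psub Q) (es : seq (V Q)) : seq (V (tag Phi)) :=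
  pmap (fun e => [pick t | tagged Phi t == e]) es.

Lemma pinv_map (Q : tree) (Phi : psub Q) t : pinv Phi [seq tagged Phi e | e <- t] = t.
Proof.
elim: t => //= e t IHt; case: pickP => [u /eqP /sub_inj -> /= | /(_ e)]; last by rewrite eqxx.
by congr (_ :: _).
Qed.

Lemma pinvK (Q : tree) (Phi : psub Q) es : all (mem (simg (tagged Phi))) es ->
  [seq tagged Phi e | e <- pinv Phi es] = es.
Proof.
elim: es => //= e es IHes /andP[/simgP[u ->] /IHes IH].
case: pickP => [v /eqP /sub_inj -> /= | /(_ u)]; last by rewrite eqxx.
by congr (_ :: _); apply: IH.
Qed.

Lemma pinv_ok (Q : tree) (Phi : psub Q) es : okseq es -> all (mem (simg (tagged Phi))) es ->
  tagged Phi (troot (tag Phi)) \notin es -> okseq (pinv Phi es).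
Proof.
move=> /andP[ue _] he re; move: ue re; rewrite -{1 2}(pinvK he) => ue re.
apply/andP; split; first by rewrite map_inj_uniq in ue; last exact: sub_inj.
by apply: contra re => h; apply: map_f.
Qed.

Lemma nstrict0_last (K : finType) (E : {set K}) l : nstrict E l = 0%N -> last E l = E.
Proof. by elim: l E => //= F l IHl E; case: (eqVneq F E) => //= -> /IHl. Qed.

Section Preimages.
Variables (F T : tree) (i : subtree F T).

Definition preim_set (E : {set V T}) : {set V F} := [set v | i v \in E].

Lemma preim_accs (E : {set V T}) (t : seq (V F)) :
  [seq preim_set X | X <- accs E [seq i e | e <- t]] = accs (preim_set E) t.
Proof.
elim: t E => //= e t IHt E.
have h : preim_set (i e |: E) = e |: preim_set E.
  by apply/setP => v; rewrite !inE (inj_eq (@sub_inj _ _ i)).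
by rewrite IHt h.
Qed.

Lemma nstrict_accs (E : {set V T}) (es : seq (V T)) : uniq es -> {in es, forall e, e \notin E} ->
  nstrict (preim_set E) [seq preim_set X | X <- accs E es] = count (mem (simg i)) es.
Proof.
elim: es E => //= e es IHes E /andP[ees ues] h.
rewrite IHes // => [|x xes]; last first.
  rewrite in_setU1 negb_or h ?inE ?xes ?orbT // andbT.
  by apply: contraNneq ees => <-.
congr (_ + _)%N; congr nat_of_bool; apply/idP/idP => [/eqP ne | /simgP[t et]].
  apply/negPn/negP => nse; apply: ne; apply/setP => v; rewrite !inE.
  case: eqP => // ev; case/negP: nse; rewrite -ev; exact: simg_f.
apply/negP => /eqP/setP /(_ t); rewrite !inE -et eqxx /=.
by rewrite (negPf (h e (mem_head _ _))).
Qed.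

End Preimages.

Section Isos.
Variables (T S : tree) (c : mseq T S).
Hypothesis c0 : niso c = 0%N.

(** Dependent pairs, as the equality of S and T is not definitional *)
Lemma isos_packed : existT (fun X : tree => mor T X) S (mtot c) = existT _ T (mor_id T).
Proof. by apply: iso_packed; rewrite -kers_last nstrict0_last // -niso_kers. Qed.

Lemma isos_tree : S = T.
Proof. exact: existT_inj1 isos_packed. Qed.

Lemma isos_sec_word : sec_word (existT _ S (mtot c)) = vseq T.
Proof.
rewrite isos_packed /sec_word /= -[RHS]map_id; apply: eq_map => v.
have := msecK (mor_id T) v; rewrite /= ffunE; apply.
Qed.

End Isos.

Section Restricted.
Variables (Q : tree) (c : V Q) (es : seq (V Q)).
Hypotheses (cr : c != troot Q) (es0 : (0 < size es)%N) (ok : okseq es) (ces : c \notin es).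

Let P : tree := tag (quot_seq es).
Let f : mor Q P := quot_map es.
Let k : nat := (size es).-1.

(** The vertex of the cut in P = Q / es that corresponds to c *)
Definition cimg : V P := f c.

Lemma cimgN : c \notin kerm f.
Proof. by rewrite /f ker_quot_map // in_set. Qed.

Lemma cimg_neq : cimg != troot P.
Proof.
apply: contra cr => /eqP e; apply/eqP; apply: (mor_inj cimgN (root_ker f)).
by rewrite -/cimg e mor_root.
Qed.

Variables (U : tree) (F : V U -> tree) (D : decomp P U F).
Hypothesis kD : kerm (dmor D) = cutker cimg.

Lemma lift_ker : kerm (mor_comp f (dmor D)) = cutker c.
Proof.
rewrite ker_comp; apply/setP => v; rewrite mem_pullE kD !mem_cutker.
case: (boolP (v \in kerm f)) => vf /=.
  by rewrite (memPn (root_ker f)) // (memPn cimgN).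
have E u : u \notin kerm f -> (f v == f u) = (v == u).
  by move=> uf; apply/eqP/eqP => [/(mor_inj vf uf) | ->].
by rewrite -(mor_root f) !E ?root_ker ?cimgN.
Qed.

(** A cut of P lifts to the cut of Q with the same base, and es restricts to
    sequences of contractions of the two parts. *)
Lemma lift_decomp : exists (G : V U -> tree) (D' : decomp Q U G)
    (cc : forall v, mseq (G v) (F v)),
  [/\ dmor D' = mor_comp f (dmor D),
      forall v, restr (demb D v) (demb D' v) (tagged (quot_seq es)) (cc v) &
      forall v, kers (cc v) = [seq preim_set (demb D' v) E | E <- pkers (quot_seq es)]].
Proof.
have [G [D' eD]] := decomp_exists (mor_comp f (dmor D)).
have ex v : exists d : mseq (G v) (F v),
    restr (demb D v) (demb D' v) (tagged (quot_seq es)) d /\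
    kers d = [seq preim_set (demb D' v) E | E <- pkers (quot_seq es)].
  apply: restr_exists; rewrite !demb_simg eD; apply/setP => u.
  by rewrite !inE /= ffunE.
pose cc v := sval (cid (ex v)).
by exists G, D', cc; split=> // v; have [] := svalP (cid (ex v)).
Qed.

Variables (G : V U -> tree) (D' : decomp Q U G) (cc : forall v, mseq (G v) (F v)).
Hypotheses (eD : dmor D' = mor_comp f (dmor D))
  (rc : forall v, restr (demb D v) (demb D' v) (tagged (quot_seq es)) (cc v))
  (kc : forall v, kers (cc v) = [seq preim_set (demb D' v) E | E <- pkers (quot_seq es)]).

Lemma kD' : kerm (dmor D') = cutker c.
Proof. by rewrite eD lift_ker. Qed.

Lemma cutv_lift : cutv c D' = cutv cimg D.
Proof. by rewrite /cutv eD /= ffunE. Qed.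

(** Each edge of es is contracted in one step, and this step is proper in the
    part that contains the edge. *)
Lemma niso_restr v : niso (cc v) = count (mem (simg (demb D' v))) es.
Proof.
have ues : uniq es by case/andP: ok.
rewrite niso_kers kc pkers_quot_seq // -(nstrict_accs _ (E := set0) ues); last by move=> e _; rewrite in_set0.
by congr nstrict; apply/setP => w; rewrite !inE.
Qed.

(** The restricted sequence and the one given by the preimages of the edges
    contract the same edges. *)
Lemma restr_quot_seq v : all (mem (simg (demb D' v))) es ->
  existT (fun X => mseq (G v) X) (F v) (cc v) = quot_seq (pinv (part D' v) es).
Proof.
move=> he; have pe := pinvK (Phi := part D' v) he.
have sp : size (pinv (part D' v) es) = size es by rewrite -[in RHS]pe size_map.
have vr : demb D' v (troot (G v)) \notin es.
  rewrite demb_root; have := msecN (dmor D') v; rewrite kD' mem_cutker negb_and !negbK.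
  by case/orP=> /eqP ->; [case/andP: ok | ].
apply: kers_inj; rewrite [in LHS]/pkers /= kc pkers_quot_seq // pkers_quot_seq ?sp //; last exact: pinv_ok.
rewrite -{1}pe preim_accs; congr accs.
by apply/setP => w; rewrite !inE.
Qed.

(** Both sides are the lowest vertex of the fibre. *)
Lemma msec_restr v s : msec f (demb D v s) = demb D' v (msec (mtot (cc v)) s).
Proof.
have [h1 h2] := restr_mtot (rc v).
apply: (@mor_inj _ _ f); rewrite ?msecN //; last by rewrite msecK -h2 msecK.
have := msecN (mtot (cc v)) s; rewrite -kers_last kc -/(quot_map es) => h.
have kf : kerm f = last set0 (pkers (quot_seq es)) by rewrite -kers_last.
move: h; rewrite kf; case: (pkers _) (pkers_quot_seq es0 ok) => [|X l] _ /=.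
  by rewrite !in_set0.
by rewrite last_map in_set.
Qed.

Lemma part_word_restr v : [seq msec f x | x <- part_word (part D v)] =
  [seq demb D' v x | x <- sec_word (existT _ (F v) (mtot (cc v)))].
Proof. by rewrite /part_word /sec_word -!map_comp; apply: eq_map => s /=; apply: msec_restr. Qed.

(** The sign of the cut of P can be computed with the representatives of its
    vertices in Q. *)
Lemma blowup_parity_cut : blowup_parity es (+) cut_sign cimg =
  odd (inv (@vlt Q) (es ++ [seq msec f x | x <- part_word (part D (troot U))] ++
                           [seq msec f x | x <- part_word (part D (cutv cimg D))])).
Proof.
rewrite -map_cat (part_bot cimg_neq kD) (part_top cimg_neq kD).
have pw := part_word_perm cimg_neq; set w := _ ++ part_word _ in pw *.
have {}pw : perm_eq w (vseq P) by rewrite (perm_trans pw) // perm_sym vseq_perm.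
have u : uniq (es ++ [seq msec f x | x <- w] ++ [::]).
  have /andP[ue _] := ok; rewrite cats0.
  have p := edges_word_perm ue (ker_quot_map es0 ok) (perm_trans pw (vseq_perm _)).
  by rewrite (perm_uniq p) enum_uniq.
have := inv_perm (@tour_vlt _) (@tour_vlt Q) (@msec_inj _ _ f) u pw.
rewrite !cats0 -[inv _ (vseq _)]koszul1 koszul_vseq //= addbF -/(cut_sign cimg) => h.
by rewrite -[RHS](addbK (blowup_parity es)) [in RHS]h addbC.
Qed.

End Restricted.

Section PairLabels.
Variables (R : comPzRingType) (A : preCooperad R).
Variables (Q : tree) (c : V Q) (cr : c != troot Q).
Variables (U : tree) (F : V U -> tree) (D : decomp Q U F) (kD : kerm (dmor D) = cutker c).
Variables (x y : forall S : tree, A S).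

Lemma part_root_neq : tagged (part D (troot U)) (troot (tag (part D (troot U)))) == c = false.
Proof. by rewrite /= demb_root msec_root eq_sym (negPf cr). Qed.

Lemma part_root_eq : tagged (part D (cutv c D)) (troot (tag (part D (cutv c D)))) == c.
Proof. by rewrite /= demb_root (msec_cutv kD). Qed.

Lemma pairL_bot : pairL c x y (part D (troot U)) = x (F (troot U)).
Proof. by rewrite /pairL part_root_neq. Qed.

Lemma pairL_top : pairL c x y (part D (cutv c D)) = y (F (cutv c D)).
Proof. by rewrite /pairL part_root_eq. Qed.

End PairLabels.

(** ** Coproducts along edges of the two parts of a cut *)

Section RhoCut.
Variables (R : comPzRingType) (A : preCooperad R).
Variables (Q : tree) (c : V Q) (es : seq (V Q)).
Hypotheses (cr : c != troot Q) (es0 : (0 < size es)%N) (ok : okseq es) (ces : c \notin es).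
Let P : tree := tag (quot_seq es).
Let k : nat := mdim (tagged (quot_seq es)).
Let cP : V P := cimg c es.

Variables (U : tree) (F : V U -> tree) (D : decomp P U F).
Hypothesis kD : kerm (dmor D) = cutker cP.
Variables (G : V U -> tree) (D' : decomp Q U G) (cc : forall v, mseq (G v) (F v)).
Hypotheses (eD : dmor D' = mor_comp (quot_map es) (dmor D))
  (rc : forall v, restr (demb D v) (demb D' v) (tagged (quot_seq es)) (cc v))
  (kc : forall v, kers (cc v) = [seq preim_set (demb D' v) E | E <- pkers (quot_seq es)]).

Let kD1 : kerm (dmor D') = cutker c. Proof. exact: (kD' es0 ok ces kD eD). Qed.
Let cPr : cP != troot P. Proof. exact: cimg_neq. Qed.
Let u1 : V U := cutv cP D.
Let u1E : cutv c D' = u1. Proof. exact: (cutv_lift c eD). Qed.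

Variables (x y : forall S : tree, A S) (a b : int).
Hypotheses (hx : homog a (x (F (troot U)))) (hy : homog b (y (F u1))).

Let fam v : A (F v) := pairL cP x y (part D v).
Let term (w0 w1 : seq cell) : A Q :=
  ((-1) ^+ (wdim w0 * absz (b + (wdim w1)%:Z)) * cupw R w0 w1 (ones k)) *:
  segal D' (fun v => rho A (cc v) (if v == troot U then w0 else w1) (fam v)).

(** The compatibility of Segal maps with coproducts, over a base with two
    vertices *)
Lemma rho_cut_sum : rho A (tagged (quot_seq es)) (ones k) (segal D fam) =
  \sum_(w0 <- words cell k) \sum_(w1 <- words cell k) term w0 w1.
Proof.
pose n v := if v == troot U then a else b.
have u1r : u1 != troot U by exact: cutv_neq.
have hn v : homog (n v) (fam v).
  rewrite /n /fam; case: (cut_vertices kD v) => ->.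
    by rewrite eqxx pairL_bot.
  by rewrite -/u1 (negPf u1r) pairL_top.
rewrite (segal_rho _ rc hn).
pose B := (k.-tuple cell * k.-tuple cell)%type.
pose h (t : B) : {ffun V U -> k.-tuple cell} := [ffun v => if v == troot U then t.1 else t.2].
rewrite (reindex h) /=; last first.
  exists (fun g : {ffun V U -> k.-tuple cell} => (g (troot U), g u1)) => [[t0 t1] _ | g _] /=.
    by rewrite !ffunE eqxx (negPf u1r).
  apply/ffunP => v; rewrite ffunE; case: (cut_vertices kD v) => ->; rewrite ?eqxx //.
  by rewrite -/u1 (negPf u1r).
transitivity (\sum_(t : B) term (tval t.1) (tval t.2)); last first.
  rewrite -(pair_bigA _ (fun t0 t1 : k.-tuple cell => term (tval t0) (tval t1))) /=.
  rewrite -(big_tuple_words k (fun w0 => \sum_(w1 <- words cell k) term w0 w1)).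
  by apply: eq_bigr => t0 _; rewrite -(big_tuple_words k (fun w1 => term (tval t0) w1)).
apply: eq_bigr => -[t0 t1] _; rewrite /term (vseq_cut cPr kD) -/u1 [map _ _]/=.
have hr : h (t0, t1) (troot U) = t0 by rewrite ffunE eqxx.
have h1 : h (t0, t1) u1 = t1 by rewrite ffunE (negPf u1r).
have l01 : vlt (troot U) u1 by exact: (vlt_cut cPr kD).
have l10 : vlt u1 (troot U) = false.
  by apply/negbTE; rewrite -vlt_total // eq_sym.
have inner u (X : V U -> nat) : (\sum_(v | vlt u v) X v =
    (if vlt u (troot U) then X (troot U) else 0) + (if vlt u u1 then X u1 else 0))%N.
  by rewrite big_mkcond (cut_big cPr kD).
rewrite hr h1 mu_two (cut_big cPr kD) -/u1 !inner.
rewrite !vlt_irr l01 l10 hr h1 /n (negPf u1r) add0n !addn0.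
congr (_ *: _); first by rewrite /= addn0.
apply: segal_ext => v; rewrite ffunE /=.
by case: (v == troot U).
Qed.

(** The product of two words has the top cell as a component only if their
    dimensions add up to the dimension of the cube. *)
Lemma term_dim w0 w1 : size w0 = k -> size w1 = k -> (wdim w0 + wdim w1)%N != k -> term w0 w1 = 0.
Proof.
move=> s0 s1 ne; rewrite /term; case: (eqVneq (cupw R w0 w1 (ones k)) 0) => [-> | /eqP nz].
  by rewrite mulr0 scale0r.
by rewrite (cup_ones_dim s0 s1 nz) eqxx in ne.
Qed.

Lemma term_bot w0 w1 : (0 < wdim w0)%N -> (niso (cc (troot U)) <= wdim w0)%N -> term w0 w1 = 0.
Proof.
move=> h1 h2; rewrite /term (@segal_zero _ _ _ _ _ D' _ (troot U)) ?scaler0 //.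
by rewrite eqxx rho_degen.
Qed.

Lemma term_top w0 w1 : (0 < wdim w1)%N -> (niso (cc u1) <= wdim w1)%N -> term w0 w1 = 0.
Proof.
move=> h1 h2; rewrite /term (@segal_zero _ _ _ _ _ D' _ u1) ?scaler0 //.
by rewrite (negPf (cutv_neq cPr kD)) rho_degen.
Qed.

(** The m = k + 1 edges of es are distributed over the two parts. *)
Lemma niso_sum : (niso (cc (troot U)) + niso (cc u1) = k.+1)%N.
Proof.
rewrite !(niso_restr es0 ok kc) -u1E (simg_bot cr kD1) (simg_top cr kD1).
rewrite /k mdim_quot_seq prednK // -[RHS](count_predC (mem (tops c))) addnC; congr (_ + _)%N.
by apply: eq_count => v; rewrite /= !inE.
Qed.

(** If p > 0 and q > 0 edges are contracted in the two parts, with p + q = k + 1,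
    then two words with dimensions i + j = k satisfy i >= p or j >= q; the
    corresponding coproduct is degenerate. *)
Lemma rho_cut_mixed : (0 < niso (cc (troot U)))%N -> (0 < niso (cc u1))%N ->
  rho A (tagged (quot_seq es)) (ones k) (segal D fam) = 0.
Proof.
move=> p0 q0; rewrite rho_cut_sum big_seq big1 // => w0 /size_words s0.
rewrite big_seq big1 // => w1 /size_words s1.
case: (eqVneq (wdim w0 + wdim w1)%N k) => [e | ]; last exact: term_dim.
have := niso_sum => es1.
case: (leqP (niso (cc (troot U))) (wdim w0)) => h; first by apply: term_bot => //; lia.
by apply: term_top; lia.
Qed.

(** The top part only has identities, so its word has dimension zero, and the
    product with the top cell determines this word. *)
Lemma rho_cut_bot : niso (cc u1) = 0%N ->
  rho A (tagged (quot_seq es)) (ones k) (segal D fam) = term (ones k) (nseq k C1).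
Proof.
move=> q0; rewrite rho_cut_sum (bigD1_seq (ones k)) ?uniq_words ?mem_words ?size_nseq //=.
rewrite [X in _ + X]big_seq_cond [X in _ + X]big1 ?addr0 => [|w0 /andP[/size_words s0 n0]]; last first.
  rewrite big_seq big1 // => w1 /size_words s1.
  case: (posnP (wdim w1)) => [d1 | d1]; last by apply: term_top; rewrite ?q0.
  apply: term_dim => //; apply: contra n0; rewrite d1 addn0 => /eqP d0.
  by rewrite (wdim_max s0 d0).
rewrite (bigD1_seq (nseq k C1)) ?uniq_words ?mem_words ?size_nseq //=.
rewrite [X in _ + X]big_seq_cond big1 ?addr0 // => w1 /andP[/size_words s1 n1].
case: (posnP (wdim w1)) => [/eqP | d1]; last by apply: term_top; rewrite ?q0.
by rewrite wdim0 => d1; rewrite /term cup_left // (negPf n1) mulr0 scale0r.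
Qed.

Lemma rho_cut_top : niso (cc (troot U)) = 0%N ->
  rho A (tagged (quot_seq es)) (ones k) (segal D fam) = term (nseq k C0) (ones k).
Proof.
move=> q0; rewrite rho_cut_sum (bigD1_seq (nseq k C0)) ?uniq_words ?mem_words ?size_nseq //=.
rewrite [X in _ + X]big_seq_cond [X in _ + X]big1 ?addr0 => [|w0 /andP[/size_words s0 n0]]; last first.
  rewrite big_seq big1 // => w1 /size_words s1.
  case: (posnP (wdim w0)) => [d0 | d0]; last by apply: term_bot; rewrite ?q0.
  case: (eqVneq (wdim w1) k) => [d1 | d1]; last by apply: term_dim; rewrite // d0.
  rewrite (wdim_max s1 d1) /term cup_right ?(negPf n0) ?mulr0 ?scale0r //.
  by rewrite -wdim0 d0.
rewrite (bigD1_seq (ones k)) ?uniq_words ?mem_words ?size_nseq //=.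
rewrite [X in _ + X]big_seq_cond big1 ?addr0 // => w1 /andP[/size_words s1 n1].
have w0 : wdim (nseq k C0) = 0%N by apply/eqP; rewrite wdim0 mem_nseq cellE andbF.
apply: term_dim; rewrite ?size_nseq // w0 add0n.
by apply: contra n1 => /eqP d1; rewrite (wdim_max s1 d1).
Qed.

(** The argument of the Segal map after the coproduct along es, for a part that
    contains all the edges of es or none of them *)
Definition edge_label (Phi : psub Q) : A (tag Phi) :=
  let t := pinv Phi es in
  let z := if tagged Phi (troot (tag Phi)) == c then y else x in
  if t is [::] then z (tag Phi) else ev (quot_seq t) (ones (size t).-1) z.

Lemma edge_label_part v (w : seq cell) : (if niso (cc v) == 0%N then C01 \notin w else w == ones k) ->
  size w = k -> (niso (cc v) = 0 \/ niso (cc v) = size es)%N ->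
  rho A (cc v) w (fam v) = edge_label (part D' v).
Proof.
set z := if v == troot U then x else y.
have zE : (if tagged (part D' v) (troot (tag (part D' v))) == c then y else x) = z.
  rewrite /z; case: (cut_vertices kD v) => ->.
    by rewrite (part_root_neq cr) eqxx.
  have := part_root_eq kD1; rewrite u1E => ->; by rewrite (negPf (cutv_neq cPr kD)).
have fE : fam v = z (F v).
  rewrite /z /fam; case: (cut_vertices kD v) => ->; first by rewrite eqxx pairL_bot.
  by rewrite pairL_top // (negPf (cutv_neq cPr kD)).
rewrite /edge_label zE fE => hw sw ni.
have nE := niso_restr es0 ok kc v.
case: ni => [n0 | n1].
  rewrite n0 eqxx in hw.
  have -> : pinv (part D' v) es = [::].
    move/eqP: nE; rewrite n0 eq_sym => /eqP; elim: (es) => //= e l IHl.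
    case: (boolP (e \in _)) => //= he /IHl ->; case: pickP => // t /eqP et.
    by case/negP: he; rewrite -et simg_f.
  by apply: rho_isos => //; rewrite (restr_mdim (rc v)).
have he : all (mem (simg (demb D' v))) es by rewrite all_count -nE n1.
have eqp := restr_quot_seq es0 ok ces kD eD kc he.
have sp : size (pinv (part D' v) es) = size es.
  by rewrite -[in RHS](pinvK (Phi := part D' v) he) size_map.
case ept: (pinv (part D' v) es) => [|t0 t]; first by move: es0; rewrite -sp ept.
rewrite -ept sp; have -> : (size es).-1 = k by rewrite /k mdim_quot_seq.
have wE : w = ones k by move: hw; rewrite n1; case: eqP es0 => [-> // | _ _ /eqP].
rewrite wE; exact: (congr1 (fun s : pseq (G v) => ev s (ones k) z) eqp).
Qed.

End RhoCut.

(** ** Coproducts and signs along edges of one part of a cut *)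

Section CutEdges.
Variables (Q : tree) (c : V Q) (es : seq (V Q)).
Hypotheses (cr : c != troot Q) (es0 : (0 < size es)%N) (ok : okseq es) (ces : c \notin es).
Let P : tree := tag (quot_seq es).
Let cP : V P := cimg c es.
Let cPr : cP != troot P. Proof. exact: cimg_neq. Qed.

(** A cut of P = Q / es, its lift to Q, and the restrictions of the sequence
    sigma(Q, es) to the two parts *)
Lemma cut_data : exists (U : tree) (F : V U -> tree) (D : decomp P U F)
    (G : V U -> tree) (D' : decomp Q U G) (cc : forall v, mseq (G v) (F v)),
  [/\ kerm (dmor D) = cutker cP, dmor D' = mor_comp (quot_map es) (dmor D),
      forall v, restr (demb D v) (demb D' v) (tagged (quot_seq es)) (cc v) &
      forall v, kers (cc v) = [seq preim_set (demb D' v) E | E <- pkers (quot_seq es)]].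
Proof.
have [U [F [D kD]]] := cut_decomp cP.
have [G [D' [cc [eD rc kc]]]] := lift_decomp D.
by exists U, F, D, G, D', cc.
Qed.

Lemma all_bots_tops : all (mem (bots c)) es -> count (mem (tops c)) es = 0%N.
Proof.
move=> /allP h; apply/eqP; rewrite -leqn0 leqNgt -has_count; apply/hasPn => e /h.
by rewrite /= !inE.
Qed.

Lemma all_tops_bots : all (mem (tops c)) es -> count (mem (bots c)) es = 0%N.
Proof.
move=> /allP h; apply/eqP; rewrite -leqn0 leqNgt -has_count; apply/hasPn => e /h.
by rewrite /= !inE negbK.
Qed.

Lemma nv_img : (nv (tag (Bot c)) + nv (tag (Top c)) =
  nv (tag (Bot cP)) + nv (tag (Top cP)) + size es)%N.
Proof. by rewrite -!nv_parts // (nv_quot_seq es0 ok). Qed.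

Section Bottom.
Hypothesis hb : all (mem (bots c)) es.

Lemma top_img : tag (Top cP) = tag (Top c).
Proof.
have [U [F [D [G [D' [cc [kD eD rc kc]]]]]]] := cut_data.
have kD1 := kD' es0 ok ces kD eD.
rewrite -(part_top cPr kD) -(part_top cr kD1) (cutv_lift c eD) /=.
apply: (isos_tree (c := cc _)).
rewrite (niso_restr es0 ok kc) -(cutv_lift c eD) (simg_top cr kD1).
exact: all_bots_tops.
Qed.

(** Both sides are the sign of the word es, bottom part of P, top part of P: the
    left hand side by way of the order of P, the right hand side by grouping es
    with the bottom part. *)
Lemma blowup_parity_bot : blowup_parity es (+) cut_sign cP = cut_sign c (+) blowup_parity (pinv (Bot c) es).
Proof.
have [U [F [D [G [D' [cc [kD eD rc kc]]]]]]] := cut_data.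
have kD1 := kD' es0 ok ces kD eD; have u1E := cutv_lift c eD.
rewrite (blowup_parity_cut cr es0 ok ces kD) !(part_word_restr es0 ok rc kc).
have n1 : niso (cc (cutv cP D)) = 0%N.
  rewrite (niso_restr es0 ok kc) -u1E (simg_top cr kD1); exact: all_bots_tops.
rewrite (isos_sec_word n1) -/(part_word (part D' (cutv cP D))) -u1E (part_top cr kD1).
have he : all (mem (simg (demb D' (troot U)))) es by rewrite (simg_bot cr kD1).
have e := restr_quot_seq es0 ok ces kD eD kc he.
have {}e := congr1 (fun s : pseq (G (troot U)) => existT (fun X => mor _ X) (tag s) (mtot (tagged s))) e.
rewrite {}[existT _ (F _) _]e -/(quot_map _); set es' := pinv _ es.
have eE : [seq demb D' (troot U) t | t <- es'] = es by apply: (pinvK (Phi := part D' (troot U))).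
rewrite -(part_bot cr kD1) -/es' -{1}eE catA -map_cat.
have sp : (0 < size es')%N by rewrite -(size_map (demb D' (troot U))) eE.
have ok' : okseq es'.
  apply: pinv_ok => //=; rewrite demb_root msec_root; by case/andP: ok.
set w := es' ++ _.
have pw : perm_eq w (vseq (G (troot U))).
  have /andP[u' _] := ok'; rewrite perm_sym (perm_trans (vseq_perm _)) // perm_sym.
  exact: edges_word_perm u' (ker_quot_map sp ok') (vseq_perm _).
have u : uniq ([::] ++ [seq demb D' (troot U) x | x <- w] ++ part_word (Top c)).
  have p : perm_eq ([seq demb D' (troot U) x | x <- w] ++ part_word (Top c)) (part_word (Bot c) ++ part_word (Top c)).
    by rewrite perm_cat2r -(part_bot cr kD1) /part_word perm_map.
  by rewrite /= (perm_uniq p) (perm_uniq (part_word_perm cr)) enum_uniq.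
have := inv_perm (@tour_vlt _) (@tour_vlt Q) (@sub_inj _ _ (demb D' (troot U))) u pw.
rewrite !cat0s -[inv _ (vseq _)]koszul1 koszul_vseq //= addbF.
rewrite -/(part_word (part D' (troot U))) (part_bot cr kD1) -/(cut_sign c) -/(blowup_parity es') => <-.
by rewrite addbC addbK.
Qed.

Variables (R : comPzRingType) (A : preCooperad R).
Variables (x y : forall S : tree, A S) (a b : int).
Hypotheses (hx : homog a (x (tag (Bot cP)))) (hy : homog b (y (tag (Top cP)))).

Lemma rho_seg_cut_bot : rho A (tagged (quot_seq es)) (ones (size es).-1) (seg_cut cP (pairL cP x y)) =
  (-1) ^+ ((size es).-1 * absz b) *: seg_cut c (edge_label c es x y).
Proof.
have [U [F [D [G [D' [cc [kD eD rc kc]]]]]]] := cut_data.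
have kD1 := kD' es0 ok ces kD eD; have u1E := cutv_lift c eD.
have n1 : niso (cc (cutv cP D)) = 0%N.
  rewrite (niso_restr es0 ok kc) -u1E (simg_top cr kD1); exact: all_bots_tops.
have n0 : niso (cc (troot U)) = size es.
  by rewrite (niso_restr es0 ok kc) (simg_bot cr kD1); apply/eqP; rewrite -all_count.
rewrite (seg_cutE _ kD) (seg_cutE _ kD1) -mdim_quot_seq.
have hx' : homog a (x (F (troot U))) by move: hx; rewrite -(part_bot cPr kD).
have hy' : homog b (y (F (cutv cP D))) by move: hy; rewrite -(part_top cPr kD).
rewrite (rho_cut_bot cr es0 ok ces kD rc hx' hy' n1).
rewrite cup_left ?size_nseq //; last by rewrite mem_nseq cellE andbF.
rewrite eqxx mulr1 wdim_ones.
have -> : wdim (nseq (mdim (tagged (quot_seq es))) C1) = 0%N.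
  by apply/eqP; rewrite wdim0 mem_nseq cellE andbF.
rewrite addr0; congr (_ *: _); apply: segal_ext => v.
apply: (edge_label_part cr es0 ok ces kD eD rc kc).
- case: (cut_vertices kD v) => ->; rewrite ?n0 ?n1 ?eqxx.
    by case: (size es) es0 => // m _; rewrite eqxx.
  by rewrite (negPf (cutv_neq cPr kD)) mem_nseq cellE andbF.
- by case: ifP => _; rewrite size_nseq.
- by case: (cut_vertices kD v) => ->; [right | left].
Qed.

End Bottom.

Section TopPart.
Hypothesis ht : all (mem (tops c)) es.

Lemma bot_img : tag (Bot cP) = tag (Bot c).
Proof.
have [U [F [D [G [D' [cc [kD eD rc kc]]]]]]] := cut_data.
have kD1 := kD' es0 ok ces kD eD.
rewrite -(part_bot cPr kD) -(part_bot cr kD1) /=.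
apply: (isos_tree (c := cc _)).
rewrite (niso_restr es0 ok kc) (simg_bot cr kD1).
exact: all_tops_bots.
Qed.

(** As for the bottom part, but es must be moved to the right of the bottom part,
    which gives the last sign. *)
Lemma blowup_parity_top : blowup_parity es (+) cut_sign cP =
  cut_sign c (+) blowup_parity (pinv (Top c) es) (+) odd (size es * nv (tag (Bot c))).
Proof.
have [U [F [D [G [D' [cc [kD eD rc kc]]]]]]] := cut_data.
have kD1 := kD' es0 ok ces kD eD; have u1E := cutv_lift c eD.
rewrite (blowup_parity_cut cr es0 ok ces kD) !(part_word_restr es0 ok rc kc).
have n1 : niso (cc (troot U)) = 0%N.
  rewrite (niso_restr es0 ok kc) (simg_bot cr kD1); exact: all_tops_bots.
rewrite (isos_sec_word n1) -/(part_word (part D' (troot U))) (part_bot cr kD1).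
set u1 := cutv cP D in u1E *.
have he : all (mem (simg (demb D' u1))) es by rewrite -u1E (simg_top cr kD1).
have e := restr_quot_seq es0 ok ces kD eD kc he.
have {}e := congr1 (fun s : pseq (G u1) => existT (fun X => mor _ X) (tag s) (mtot (tagged s))) e.
rewrite {}[existT _ (F _) _]e -/(quot_map _); set es' := pinv _ es.
have eE : [seq demb D' u1 t | t <- es'] = es by apply: (pinvK (Phi := part D' u1)).
have pt : part D' u1 = Top c by rewrite -u1E (part_top cr kD1).
rewrite -pt -/es'.
have sp : (0 < size es')%N by rewrite -(size_map (demb D' u1)) eE.
have ok' : okseq es'.
  apply: pinv_ok => //=; rewrite demb_root -u1E (msec_cutv kD1) //.
set w := es' ++ sec_word (existT _ _ (quot_map es')).
have pw : perm_eq w (vseq (G u1)).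
  have /andP[u' _] := ok'; rewrite perm_sym (perm_trans (vseq_perm _)) // perm_sym.
  exact: edges_word_perm u' (ker_quot_map sp ok') (vseq_perm _).
have u : uniq (part_word (Bot c) ++ [seq demb D' u1 x | x <- w] ++ [::]).
  have p : perm_eq (part_word (Bot c) ++ [seq demb D' u1 x | x <- w] ++ [::]) (part_word (Bot c) ++ part_word (Top c)).
    by rewrite cats0 perm_cat2l -pt /part_word perm_map.
  by rewrite (perm_uniq p) (perm_uniq (part_word_perm cr)) enum_uniq.
have := inv_perm (@tour_vlt _) (@tour_vlt Q) (@sub_inj _ _ (demb D' u1)) u pw.
rewrite !cats0 -[inv _ (vseq _)]koszul1 koszul_vseq //= addbF.
rewrite -/(part_word (part D' u1)) {1}pt -/(cut_sign c) -/(blowup_parity es') => eI.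
have us : uniq (es ++ part_word (Bot c) ++ [seq demb D' u1 x | x <- sec_word (existT _ _ (quot_map es'))]).
  rewrite uniq_catCA -{1}eE -map_cat; by rewrite cats0 in u.
have := inv_swap (@tour_vlt Q) us; rewrite -{1}eE -map_cat -/w => eS.
have sb : size (part_word (Bot c)) = nv (tag (Bot c)).
  by rewrite size_map (perm_size (vseq_perm _)) -cardE card_ord.
rewrite -sb -eI [cut_sign c (+) _]addbC addbK eS.
by rewrite addbK.
Qed.

Variables (R : comPzRingType) (A : preCooperad R).
Variables (x y : forall S : tree, A S) (a b : int).
Hypotheses (hx : homog a (x (tag (Bot cP)))) (hy : homog b (y (tag (Top cP)))).

Lemma rho_seg_cut_top : rho A (tagged (quot_seq es)) (ones (size es).-1) (seg_cut cP (pairL cP x y)) =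
  seg_cut c (edge_label c es x y).
Proof.
have [U [F [D [G [D' [cc [kD eD rc kc]]]]]]] := cut_data.
have kD1 := kD' es0 ok ces kD eD; have u1E := cutv_lift c eD.
have n1 : niso (cc (cutv cP D)) = size es.
  by rewrite (niso_restr es0 ok kc) -u1E (simg_top cr kD1); apply/eqP; rewrite -all_count.
have n0 : niso (cc (troot U)) = 0%N.
  by rewrite (niso_restr es0 ok kc) (simg_bot cr kD1); exact: all_tops_bots.
rewrite (seg_cutE _ kD) (seg_cutE _ kD1) -mdim_quot_seq.
have hx' : homog a (x (F (troot U))) by move: hx; rewrite -(part_bot cPr kD).
have hy' : homog b (y (F (cutv cP D))) by move: hy; rewrite -(part_top cPr kD).
rewrite (rho_cut_top cr es0 ok ces kD rc hx' hy' n0).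
have w0 : wdim (nseq (mdim (tagged (quot_seq es))) C0) = 0%N.
  by apply/eqP; rewrite wdim0 mem_nseq cellE andbF.
rewrite cup_right ?size_nseq //; last by rewrite mem_nseq cellE andbF.
rewrite eqxx mulr1 w0 mul0n expr0 scale1r; apply: segal_ext => v.
apply: (edge_label_part cr es0 ok ces kD eD rc kc).
- case: (cut_vertices kD v) => ->; rewrite ?n0 ?n1 ?eqxx.
    by rewrite mem_nseq cellE andbF.
  rewrite (negPf (cutv_neq cPr kD)); by case: (size es) es0 => // m _; rewrite eqxx.
- by case: ifP => _; rewrite size_nseq.
- by case: (cut_vertices kD v) => ->; [left | right].
Qed.

End TopPart.

Variables (R : comPzRingType) (A : preCooperad R).
Variables (x y : forall S : tree, A S) (a b : int).
Hypotheses (hx : homog a (x (tag (Bot cP)))) (hy : homog b (y (tag (Top cP)))).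

Lemma rho_seg_cut_mixed : ~~ all (mem (bots c)) es -> ~~ all (mem (tops c)) es ->
  rho A (tagged (quot_seq es)) (ones (size es).-1) (seg_cut cP (pairL cP x y)) = 0.
Proof.
move=> nb nt; have [U [F [D [G [D' [cc [kD eD rc kc]]]]]]] := cut_data.
have kD1 := kD' es0 ok ces kD eD; have u1E := cutv_lift c eD.
have hx' : homog a (x (F (troot U))) by move: hx; rewrite -(part_bot cPr kD).
have hy' : homog b (y (F (cutv cP D))) by move: hy; rewrite -(part_top cPr kD).
rewrite (seg_cutE _ kD) -mdim_quot_seq (rho_cut_mixed cr es0 ok ces kD eD rc kc hx' hy') //.
  rewrite (niso_restr es0 ok kc) (simg_bot cr kD1) -has_count.
  by move: nt; rewrite -has_predC; apply: sub_has => e; rewrite /= !inE.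
rewrite (niso_restr es0 ok kc) -u1E (simg_top cr kD1) -has_count.
by move: nb; rewrite -has_predC; apply: sub_has => e; rewrite /= !inE negbK.
Qed.

End CutEdges.

(** * The composition products *)

Section PairSegal.
Variables (R : comPzRingType) (A : preCooperad R).
Variables (Q : tree) (c : V Q) (cr : c != troot Q).
Implicit Types x y : forall S : tree, A S.

Lemma pair_cut_linl a x x' x'' y : (forall S, x'' S = a *: x S + x' S) ->
  seg_cut c (pairL c x'' y) = a *: seg_cut c (pairL c x y) + seg_cut c (pairL c x' y).
Proof.
move=> h; have [U [F [D kD]]] := cut_decomp c; rewrite !(seg_cutE _ kD).
have e z : segal D (fun v => pairL c z y (part D v)) =
    seg_lin D (fun v => pairL c x y (part D v)) (troot U) (z (F (troot U))).
  rewrite (segal_at D _ (troot U)) (pairL_bot cr); apply: seg_lin_ext => u ur.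
  by case: (cut_vertices kD u) ur => ->; rewrite ?eqxx // !(pairL_top kD).
by rewrite !e h linearP.
Qed.

Lemma pair_cut_linr a x y y' y'' : (forall S, y'' S = a *: y S + y' S) ->
  seg_cut c (pairL c x y'') = a *: seg_cut c (pairL c x y) + seg_cut c (pairL c x y').
Proof.
move=> h; have [U [F [D kD]]] := cut_decomp c; rewrite !(seg_cutE _ kD).
have e z : segal D (fun v => pairL c x z (part D v)) =
    seg_lin D (fun v => pairL c x y (part D v)) (cutv c D) (z (F (cutv c D))).
  rewrite (segal_at D _ (cutv c D)) (pairL_top kD); apply: seg_lin_ext => u ur.
  by case: (cut_vertices kD u) ur => ->; rewrite ?eqxx // !(pairL_bot cr).
by rewrite !e h linearP.
Qed.

Lemma tagE (Phi Psi : psub Q) (z : forall S : tree, A S) : Phi = Psi ->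
  z (tag Phi) = 0 -> z (tag Psi) = 0.
Proof. by move=> <-. Qed.

Lemma pair_cut_0l x y : x (tag (Bot c)) = 0 -> seg_cut c (pairL c x y) = 0.
Proof.
move=> x0; have [U [F [D kD]]] := cut_decomp c; rewrite (seg_cutE _ kD).
apply: (@segal_zero _ _ _ _ _ _ _ (troot U)); rewrite (pairL_bot cr).
exact: (tagE (esym (part_bot cr kD)) x0).
Qed.

Lemma pair_cut_0r x y : y (tag (Top c)) = 0 -> seg_cut c (pairL c x y) = 0.
Proof.
move=> y0; have [U [F [D kD]]] := cut_decomp c; rewrite (seg_cutE _ kD).
apply: (@segal_zero _ _ _ _ _ _ _ (cutv c D)); rewrite (pairL_top kD).
exact: (tagE (esym (part_top cr kD)) y0).
Qed.

(** The Segal map of a cut depends only on the values at its two parts. *)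
Lemma pair_cut_ext x y x' y' a b : x (tag (Bot c)) = a *: x' (tag (Bot c)) ->
  y (tag (Top c)) = b *: y' (tag (Top c)) ->
  seg_cut c (pairL c x y) = (a * b) *: seg_cut c (pairL c x' y').
Proof.
move=> ex ey.
have e1 : seg_cut c (pairL c x y) = a *: seg_cut c (pairL c x' y).
  rewrite -[RHS]addr0 -(@pair_cut_0l (fun S => x S - a *: x' S) y) ?ex ?subrr //.
  by apply: pair_cut_linl => S; rewrite addrC subrK.
rewrite e1 -scalerA; congr (_ *: _).
rewrite -[RHS]addr0 -(@pair_cut_0r x' (fun S => y S - b *: y' S)) ?ey ?subrr //.
by apply: pair_cut_linr => S; rewrite addrC subrK.
Qed.

Lemma pair_cut_deg x y m n : homog m (x (tag (Bot c))) -> homog n (y (tag (Top c))) ->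
  homog (m + n) (seg_cut c (pairL c x y)).
Proof.
move=> hx hy; have [U [F [D kD]]] := cut_decomp c; rewrite (seg_cutE _ kD).
have tH (Phi Psi : psub Q) (z : forall S : tree, A S) i : Phi = Psi ->
  homog i (z (tag Phi)) -> homog i (z (tag Psi)) by move=> <-.
pose i v := if v == troot U then m else n.
have -> : m + n = \sum_v i v.
  by rewrite (cut_big cr kD) /i eqxx (negPf (cutv_neq cr kD)).
apply: segal_deg => v; rewrite /i; case: (cut_vertices kD v) => ->.
  by rewrite eqxx (pairL_bot cr); apply: (tH _ _ x _ (esym (part_bot cr kD))).
by rewrite (negPf (cutv_neq cr kD)) (pairL_top kD); apply: (tH _ _ y _ (esym (part_top cr kD))).
Qed.

Lemma pair_cut_dg x y m n : homog m (x (tag (Bot c))) -> homog n (y (tag (Top c))) ->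
  dg (A Q) (seg_cut c (pairL c x y)) =
  seg_cut c (pairL c (fun S => dg (A S) (x S)) y) +
  (-1) ^+ absz m *: seg_cut c (pairL c x (fun S => dg (A S) (y S))).
Proof.
move=> hx hy; have [U [F [D kD]]] := cut_decomp c; rewrite !(seg_cutE _ kD).
have tH (Phi Psi : psub Q) (z : forall S : tree, A S) i : Phi = Psi ->
  homog i (z (tag Phi)) -> homog i (z (tag Psi)) by move=> <-.
pose i v := if v == troot U then m else n.
have hi v : homog (i v) (pairL c x y (part D v)).
  rewrite /i; case: (cut_vertices kD v) => ->.
    by rewrite eqxx (pairL_bot cr); apply: (tH _ _ x _ (esym (part_bot cr kD))).
  by rewrite (negPf (cutv_neq cr kD)) (pairL_top kD); apply: (tH _ _ y _ (esym (part_top cr kD))).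
have l10 : vlt (cutv c D) (troot U) = false.
  by apply/negbTE; rewrite -vlt_total ?(vlt_cut cr kD) // eq_sym (cutv_neq cr kD).
rewrite (segal_dg _ hi) (cut_big cr kD) /=.
rewrite [X in (-1) ^+ X](big_mkcond) [X in (-1) ^+ X](cut_big cr kD) /= vlt_irr l10 expr0 scale1r.
congr (_ + _).
  apply: segal_ext => v; case: (cut_vertices kD v) => ->.
    by rewrite dfwith_in !(pairL_bot cr).
  by rewrite dfwith_out ?(pairL_top kD) // eq_sym (cutv_neq cr kD).
rewrite [X in (-1) ^+ X](big_mkcond) [X in (-1) ^+ X](cut_big cr kD) /= vlt_irr (vlt_cut cr kD).
rewrite addn0 /i eqxx; congr (_ *: _).
apply: segal_ext => v; case: (cut_vertices kD v) => ->.
  by rewrite dfwith_out ?(pairL_bot cr) // (cutv_neq cr kD).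
by rewrite dfwith_in !(pairL_top kD).
Qed.

End PairSegal.

Section Comp.
Variables (R : comPzRingType) (A : preCooperad R) (hA : connected A).
Variables (k l r : nat) (J : {set 'I_r}).
Implicit Types (x : dsum A k) (y : dsum A l).

(** The summand of Q in the composition product, for the cut of Q below c; the
    grading involution accounts for the exchange of x with the vertices of the
    top part. *)
Definition cterm (Q : tree) (c : V Q) x y : A Q :=
  (-1) ^+ cut_sign c *: seg_cut c (pairL c (fun S => gsign (A S) (nv (tag (Top c))) (x S)) y).

(** The choice of c matters only in non-reduced trees, where the value is zero. *)
Definition comp_fun x y (Q : tree) : A Q :=
  if nl Q == r then
    if [pick c : V Q | (c != troot Q) && (cluster r c == J)] is Some c then cterm c x y else 0
  else 0.

(** A reduced tree has at most one vertex with cluster J, and A vanishes on the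
    other trees. *)
Lemma comp_funE (Q : tree) (c : V Q) x y : nl Q = r -> c != troot Q -> cluster r c = J ->
  comp_fun x y Q = cterm c x y.
Proof.
move=> nQ cr cJ; case: (boolP (reduced Q)) => rQ; last by rewrite [LHS]hA // [RHS]hA.
rewrite /comp_fun nQ eqxx; case: pickP => [c' /andP[_ /eqP c'J] | /(_ c)]; last by rewrite cr cJ eqxx.
by rewrite (reduced_cluster_inj nQ rQ (etrans c'J (esym cJ))).
Qed.

Lemma comp_fun0 (Q : tree) x y : nl Q = r ->
  (forall c : V Q, c != troot Q -> cluster r c <> J) -> comp_fun x y Q = 0.
Proof.
move=> nQ h; rewrite /comp_fun nQ eqxx; case: pickP => // c /andP[cr /eqP cJ].
by case: (h c cr).
Qed.

(** Identities between products are proved separately for trees with and without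
    a vertex with cluster J; on non-reduced trees they hold by connectedness. *)
Lemma comp_case (Q : tree) (P : Prop) :
  (nl Q <> r -> P) ->
  (nl Q = r -> (forall c : V Q, c != troot Q -> cluster r c <> J) -> P) ->
  (nl Q = r -> reduced Q -> forall c : V Q, c != troot Q -> cluster r c = J -> P) ->
  (~~ reduced Q -> P) -> P.
Proof.
move=> h1 h2 h3 h4; case: (eqVneq (nl Q) r) => [nQ | /eqP //].
case: (boolP (reduced Q)) => // rQ.
case: (pickP (fun c : V Q => (c != troot Q) && (cluster r c == J))) => [c /andP[cr /eqP cJ] | h].
  exact: (h3 nQ rQ c).
by apply: h2 => // c cr cJ; have := h c; rewrite cr cJ eqxx.
Qed.

Lemma comp_nl x y (Q : tree) : nl Q <> r -> comp_fun x y Q = 0.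
Proof. by move/eqP/negPf; rewrite /comp_fun => ->. Qed.

Lemma comp_subproof x y :
  (exists s : seq tree, forall T, T \notin s -> comp_fun x y T = 0) /\
  (forall T : tree, nl T <> r -> comp_fun x y T = 0).
Proof.
split; last exact: comp_nl.
have [s hs] := reduced_fin r; exists s => T Ts.
case: (eqVneq (nl T) r) => [nT | /eqP]; last exact: comp_nl.
by apply: hA; apply: contra Ts => rT; apply: hs.
Qed.

Definition comp x y : dsum A r := Dsum (comp_subproof x y).

Lemma cterm_linl (Q : tree) (c : V Q) a x x' y : c != troot Q ->
  cterm c (a *: x + x') y = a *: cterm c x y + cterm c x' y.
Proof.
move=> cr; rewrite /cterm.
rewrite (@pair_cut_linl _ _ _ _ cr a (fun S => gsign (A S) (nv (tag (Top c))) (x S))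
  (fun S => gsign (A S) (nv (tag (Top c))) (x' S))) => [|S].
  by rewrite scalerDr !scalerA mulrC.
by rewrite dsumD dsumZ linearP.
Qed.

Lemma cterm_linr (Q : tree) (c : V Q) a x y y' : c != troot Q ->
  cterm c x (a *: y + y') = a *: cterm c x y + cterm c x y'.
Proof.
move=> cr; rewrite /cterm (@pair_cut_linr _ _ _ _ cr a _ (fun S => y S) (fun S => y' S)) => [|S].
  by rewrite scalerDr !scalerA mulrC.
by rewrite dsumD dsumZ.
Qed.

Lemma comp_linl a x x' y : comp (a *: x + x') y = a *: comp x y + comp x' y.
Proof.
apply: dsum_ext => Q; rewrite dsumD dsumZ /=.
apply: (@comp_case Q) => [nQ | nQ h | nQ _ c cr cJ | nr].
- by rewrite !comp_nl // scaler0 addr0.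
- by rewrite !comp_fun0 // scaler0 addr0.
- by rewrite !(comp_funE _ _ nQ cr cJ) cterm_linl.
- by rewrite [LHS]hA // [RHS]hA.
Qed.

Lemma comp_linr a x y y' : comp x (a *: y + y') = a *: comp x y + comp x y'.
Proof.
apply: dsum_ext => Q; rewrite dsumD dsumZ /=.
apply: (@comp_case Q) => [nQ | nQ h | nQ _ c cr cJ | nr].
- by rewrite !comp_nl // scaler0 addr0.
- by rewrite !comp_fun0 // scaler0 addr0.
- by rewrite !(comp_funE _ _ nQ cr cJ) cterm_linr.
- by rewrite [LHS]hA // [RHS]hA.
Qed.

(** The exponent of the sign of a product with left factor of degree m *)
Definition prod_sign (Q : tree) (c : V Q) (m : int) : nat :=
  (cut_sign c + nv (tag (Top c)) * absz (m + (nv (tag (Bot c)))%:Z)%R)%N.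

Lemma cterm_homog (Q : tree) (c : V Q) m x y : c != troot Q ->
  homog m (x : Bc A k) ->
  cterm c x y = (-1) ^+ prod_sign c m *: seg_cut c (pairL c x y).
Proof.
move=> cr /bc_homog hx; rewrite /cterm.
rewrite (@pair_cut_ext _ _ _ _ cr _ y x y _ 1 (gsign_homog _ (hx _))) ?scale1r //.
by rewrite mulr1 scalerA -exprD.
Qed.

Lemma comp_deg m n x y : homog m (x : Bc A k) -> homog n (y : Bc A l) ->
  homog (m + n) (comp x y : Bc A r).
Proof.
move=> hx hy; apply/bc_homog => Q /=.
apply: (@comp_case Q) => [nQ | nQ h | nQ _ c cr cJ | nr].
- by rewrite comp_nl //; apply: homog0.
- by rewrite comp_fun0 //; apply: homog0.
- rewrite (comp_funE _ _ nQ cr cJ) (cterm_homog _ cr hx); apply: homogZ.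
  have /bc_homog hx' := hx; have /bc_homog hy' := hy.
  rewrite (_ : _ + _ = (m + (nv (tag (Bot c)))%:Z) + (n + (nv (tag (Top c)))%:Z)).
    exact: (pair_cut_deg (x := x) (y := y) cr (hx' _) (hy' _)).
  by rewrite (nv_parts cr) PoszD addrACA.
- by rewrite [X in homog _ X]hA //; apply: homog0.
Qed.

(** The graftings of T on S along J are the trees Q with a cut into S and T
    below a vertex with the leaves J. *)
Lemma comp_is_cobar : shuffle k l J -> is_cobar_comp J (fun x y => comp x y).
Proof.
case/and3P => l0 /eqP Jl /eqP klr S T n x y nS nT sx sy hx.
have J0 : (0 < #|J|)%N by rewrite Jl.
have [j0 j0J jmin] := set_min J0.
have nS' : nl S = #|slots J| by rewrite nS; have := card_slots j0J jmin; lia.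
have nT' : nl T = #|J| by rewrite nT.
have [Q [f [g G]]] := graft_exists nS' nT' J0.
have [G' [fE gE kD]] := grafting_exists nS' nT' G.
have cr := graft_neq_root G; have cJ := graft_cluster G; have nQ := graft_nl G.
set c := g (troot T) in kD cr cJ.
exists Q, G'; split=> [Q' ne /= |].
  apply: (@comp_case Q') => [nQ' | nQ' h | nQ' _ d dr dJ | nr].
  - exact: comp_nl.
  - exact: comp_fun0.
  - rewrite (comp_funE _ _ nQ' dr dJ) /cterm.
    case: (pselect (tag (Bot d) = S)) => [eS | nES]; last first.
      by rewrite (@pair_cut_0l _ _ _ _ dr) ?scaler0 // sx // linear0.
    case: (pselect (tag (Top d) = T)) => [eT | nET]; last first.
      by rewrite (@pair_cut_0r _ _ _ _ dr) ?scaler0 // sy.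
    have := cut_graft nQ' dr (Bot_simg dr) (Top_simg d).
    rewrite dJ; move: (tagged (Bot d)) (tagged (Top d)); rewrite eS eT => i j Gd.
    by case: ne; apply: (graft_uniq J0 Gd G).
  - by rewrite [LHS]hA.
rewrite /= (comp_funE _ _ nQ cr cJ) (cterm_homog _ cr hx).
have [j jg jX] := graft_top_sub nT' G; have [i iF iX] := graft_bot_sub nS' G.
have BE : existT _ S i = Bot c by apply: (Bot_eq cr).
have TE : existT _ T j = Top c by apply: Top_eq.
rewrite /prod_sign /cut_sign -BE -TE /part_word /= (eq_map iF) (eq_map jg).
rewrite /concat_sign fE gE koszul1 (seg_cutE _ kD); congr (_ *: _).
  by rewrite exprD signr_odd mulrC [RHS]exprD; congr (_ * _); congr (_ ^+ _); exact: mulnC.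
apply: segal_ext => v.
have -> : pairx (x S) (y T) v =
    if v == troot (gr_base G') then x (pairF S T v) else y (pairF S T v).
  by rewrite /pairx /pairF; case: (v == _).
case: (cut_vertices kD v) => ->; first by rewrite eqxx (pairL_bot cr).
by rewrite (pairL_top kD) (negPf (cutv_neq cr kD)).
Qed.

End Comp.

(** ** The Leibniz rule *)

Lemma cluster_mor r (T S : tree) (f : mor T S) (x : V S) : cluster r (msec f x) = cluster r x.
Proof. by apply/setP => j; rewrite !inE above_msec -mor_leafv. Qed.

Lemma pinv_okE (Q : tree) (Phi : psub Q) es : all (mem (simg (tagged Phi))) es ->
  okseq (pinv Phi es) = uniq es && (tagged Phi (troot (tag Phi)) \notin es).
Proof.
move=> h; rewrite -[in RHS](pinvK h) /okseq map_inj_uniq ?mem_map //; exact: sub_inj.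
Qed.

Section SegalParts.
Variables (R : comPzRingType) (A : preCooperad R).
Variables (Q : tree) (c : V Q) (cr : c != troot Q).

(** The Segal map of a cut is linear in the bottom part. The formulation by the
    existence of a linear map avoids equations between dependent families. *)
Lemma seg_cut_botL (y : A (tag (Top c))) : exists L : {linear A (tag (Bot c)) -> A Q},
  forall xi : label A Q, xi (Top c) = y -> seg_cut c xi = L (xi (Bot c)).
Proof.
have [U [F [D kD]]] := cut_decomp c.
rewrite -(part_bot cr kD); case: (pselect (exists xi : label A Q, xi (Top c) = y)) => [[xi0 e0] | no].
  exists (seg_lin D (fun v => xi0 (part D v)) (troot U)) => xi e.
  rewrite (seg_cutE _ kD) (segal_at D _ (troot U)); apply: seg_lin_ext => u ur.
  case: (cut_vertices kD u) ur => ->; rewrite ?eqxx // => _.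
  have : xi (Top c) = xi0 (Top c) by rewrite e e0.
  by rewrite -(part_top cr kD).
by exists (seg_lin D (fun v => 0) (troot U)) => xi e; case: no; exists xi.
Qed.

Lemma seg_cut_topL (x : A (tag (Bot c))) : exists L : {linear A (tag (Top c)) -> A Q},
  forall xi : label A Q, xi (Bot c) = x -> seg_cut c xi = L (xi (Top c)).
Proof.
have [U [F [D kD]]] := cut_decomp c.
rewrite -(part_top cr kD); case: (pselect (exists xi : label A Q, xi (Bot c) = x)) => [[xi0 e0] | no].
  exists (seg_lin D (fun v => xi0 (part D v)) (cutv c D)) => xi e.
  rewrite (seg_cutE _ kD) (segal_at D _ (cutv c D)); apply: seg_lin_ext => u ur.
  case: (cut_vertices kD u) ur => ->; rewrite ?eqxx // => _.
  have : xi (Bot c) = xi0 (Bot c) by rewrite e e0.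
  by rewrite -(part_bot cr kD).
by exists (seg_lin D (fun v => 0) (cutv c D)) => xi e; case: no; exists xi.
Qed.

Variables (x y : forall S : tree, A S).

Lemma pairL_Bot : pairL c x y (Bot c) = x (tag (Bot c)).
Proof. by rewrite /pairL (Bot_root cr) eq_sym (negPf cr). Qed.

Lemma pairL_Top : pairL c x y (Top c) = y (tag (Top c)).
Proof. by rewrite /pairL Top_root eqxx. Qed.

Variables (es : seq (V Q)) (es0 : (0 < size es)%N).

Lemma pinv_size (Phi : psub Q) : all (mem (simg (tagged Phi))) es -> size (pinv Phi es) = size es.
Proof. by move=> h; rewrite -[in RHS](pinvK h) size_map. Qed.

Lemma pinv_none (Phi : psub Q) : (forall e, e \in es -> e \notin simg (tagged Phi)) -> pinv Phi es = [::].
Proof.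
elim: (es) => //= e l IHl h; case: pickP => [t /eqP et | _] /=.
  by case/negP: (h e (mem_head _ _)); rewrite -et simg_f.
by apply: IHl => d dl; apply: h; rewrite inE dl orbT.
Qed.

Lemma edge_label_in (Phi : psub Q) z : all (mem (simg (tagged Phi))) es ->
  (if tagged Phi (troot (tag Phi)) == c then y else x) = z ->
  edge_label c es x y Phi = ev (quot_seq (pinv Phi es)) (ones (size es).-1) z.
Proof.
move=> h zE; rewrite /edge_label zE -(pinv_size h).
by case e: (pinv Phi es) (pinv_size h) es0 => [|e1 t] // <-.
Qed.

Lemma edge_label_out (Phi : psub Q) z : (forall e, e \in es -> e \notin simg (tagged Phi)) ->
  (if tagged Phi (troot (tag Phi)) == c then y else x) = z ->
  edge_label c es x y Phi = z (tag Phi).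
Proof. by move=> h zE; rewrite /edge_label zE (pinv_none h). Qed.

End SegalParts.

Section PartSum.
Variables (R : comPzRingType) (A : preCooperad R) (k : nat).

(** The edges of a subtree of Q are the inner edges of Q in its vertex set, so the
    twisting map of a factor is a sum over sequences of vertices of Q. *)
Lemma twisted_part (Q : tree) (Phi : psub Q) (N : lmodType R) (L : {linear A (tag Phi) -> N})
    n (z : dsum A k) : homog n (z : Bc A k) ->
  L (twisted z (tag Phi)) = \sum_(m < nv Q) \sum_(es <- words (V Q) m.+1 |
      all (mem (simg (tagged Phi))) es && okseq (pinv Phi es))
    (-1) ^+ twist_sign n (pinv Phi es) *: L (ev (quot_seq (pinv Phi es)) (ones m) z).
Proof.
move=> hz; have le : (nv (tag Phi) <= nv Q)%N.
  by rewrite nv_sub -[X in (_ <= X)%N]card_ord max_card.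
rewrite (twisted_homog _ hz) (ok_words_big (fun m es => (-1) ^+ twist_sign n es *: ev (quot_seq es) (ones m) z) le).
rewrite linear_sum; apply: eq_bigr => m _; rewrite linear_sum.
pose G (t : seq (V (tag Phi))) : N :=
  if okseq t then (-1) ^+ twist_sign n t *: L (ev (quot_seq t) (ones m) z) else 0.
transitivity (\sum_(t <- words (V (tag Phi)) m.+1) G (pinv Phi [seq tagged Phi e | e <- t])).
  rewrite big_mkcond; apply: eq_bigr => t _; rewrite pinv_map /G.
  by case: ifP => // _; rewrite linearZ.
rewrite -(big_words_image _ (fun es => G (pinv Phi es)) (@sub_inj _ _ (tagged Phi))).
rewrite [RHS]big_mkcondr; apply: eq_bigl => es; apply: eq_all => e.
by rewrite /simg /= inE.
Qed.

End PartSum.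

Section Leibniz.
Variables (R : comPzRingType) (A : preCooperad R) (hA : connected A).
Variables (k l r : nat) (J : {set 'I_r}).
Implicit Types (x : dsum A k) (y : dsum A l).

Section AtCut.
Variables (Q : tree) (c : V Q).
Hypotheses (nQ : nl Q = r) (rQ : reduced Q) (cr : c != troot Q) (cJ : cluster r c = J).
Variables (m n : int) (x : dsum A k) (y : dsum A l).
Hypotheses (hx : homog m (x : Bc A k)) (hy : homog n (y : Bc A l)).

Let nb := nv (tag (Bot c)).
Let nt := nv (tag (Top c)).

(** A vertex of Q / es with cluster J would come from a vertex of Q other than c
    with this cluster. *)
Lemma comp_lost (es : seq (V Q)) : (0 < size es)%N -> okseq es -> c \in es ->
  comp hA J x y (tag (quot_seq es)) = 0.
Proof.
move=> es0 ok ce; apply: comp_fun0; first by rewrite (mor_nl (quot_map es)).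
move=> d _ dJ; have := msecN (quot_map es) d; rewrite (ker_quot_map es0 ok) inE.
suff -> : msec (quot_map es) d = c by rewrite ce.
by apply: (reduced_cluster_inj nQ rQ); rewrite cluster_mor dJ cJ.
Qed.

Lemma comp_kept (es : seq (V Q)) : (0 < size es)%N -> okseq es -> c \notin es ->
  comp hA J x y (tag (quot_seq es)) =
  (-1) ^+ prod_sign (cimg c es) m *: seg_cut (cimg c es) (pairL (cimg c es) x y).
Proof.
move=> es0 ok ces; rewrite /= (@comp_funE _ _ hA _ _ _ _ _ (cimg c es)).
- exact: (cterm_homog y (cimg_neq cr es0 ok ces) hx).
- by rewrite (mor_nl (quot_map es)).
- exact: cimg_neq.
- by rewrite -(cluster_mor _ (quot_map es)) msec_id // cimgN.
Qed.

Let Lb := sval (cid (seg_cut_botL cr (y (tag (Top c))))).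
Let LbE := svalP (cid (seg_cut_botL cr (y (tag (Top c))))).
Let Lt := sval (cid (seg_cut_topL cr (x (tag (Bot c))))).
Let LtE := svalP (cid (seg_cut_topL cr (x (tag (Bot c))))).

Let bterm i (es : seq (V Q)) : A Q := (-1) ^+ (prod_sign c (m - 1) + twist_sign m (pinv (Bot c) es)) *:
  Lb (ev (quot_seq (pinv (Bot c) es)) (ones i) x).
Let tterm' i (es : seq (V Q)) : A Q :=
  (-1) ^+ (absz m + prod_sign c m + twist_sign n (pinv (Top c) es)) *:
  Lt (ev (quot_seq (pinv (Top c) es)) (ones i) y).

(** The term of the twisting map of the product along edges of the bottom part is
    the product of a term of the twisting map of x with y. *)
Lemma edge_bot (es : seq (V Q)) : (0 < size es)%N -> okseq es -> all (mem (bots c)) es ->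
  (-1) ^+ twist_sign (m + n) es *: ev (quot_seq es) (ones (size es).-1) (comp hA J x y) =
  bterm (size es).-1 es.
Proof.
move=> es0 ok hb; have ces : c \notin es.
  by apply/negP => /(allP hb); rewrite /= inE connect0.
have /bc_homog hx' := hx; have /bc_homog hy' := hy.
rewrite {1}/ev (comp_kept es0 ok ces) linearZ /= (rho_seg_cut_bot cr es0 ok ces hb (hx' _) (hy' _)).
have hB : all (mem (simg (tagged (Bot c)))) es by rewrite (Bot_simg cr).
have hT e : e \in es -> e \notin simg (tagged (Top c)).
  by rewrite Top_simg => /(allP hb); rewrite /= !inE.
rewrite (LbE (edge_label_out hT _)) ?Top_root ?eqxx // (edge_label_in es0 hB (z := x)); last first.
  by rewrite (Bot_root cr) eq_sym (negPf cr).
rewrite !scalerA -!exprD; congr (_ *: _); apply: sign_eq.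
have := blowup_parity_bot cr es0 ok ces hb; have := nv_img cr es0 ok ces.
have sE := pinv_size hB.
rewrite /prod_sign /twist_sign sE (top_img cr es0 ok ces hb) => nE.
have {}nE : nv (tag (Bot c)) = (nv (tag (Bot (cimg c es))) + size es)%N by move: nE; lia.
move=> bE; rewrite nE.
have s1 : odd (size es).-1 = ~~ odd (size es) by case: (size es) es0 => //= s _; rewrite negbK.
move: (nv (tag (Bot (cimg c es)))) (nv (tag (Top c))) => p q; rewrite !(oddD, oddM, oddS, oddb, odd_abszD) s1 /=.
move: bE; case: (blowup_parity es); case: (cut_sign (cimg c es)); case: (cut_sign c); case: (blowup_parity (pinv _ _)) => // _.
all: case: (odd (size es)); case: (odd (absz m)); case: (odd (absz n)); case: (odd p); case: (odd q) => //.
Qed.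

Lemma edge_top (es : seq (V Q)) : (0 < size es)%N -> okseq es -> c \notin es ->
  all (mem (tops c)) es ->
  (-1) ^+ twist_sign (m + n) es *: ev (quot_seq es) (ones (size es).-1) (comp hA J x y) =
  tterm' (size es).-1 es.
Proof.
move=> es0 ok ces ht; have /bc_homog hx' := hx; have /bc_homog hy' := hy.
rewrite {1}/ev (comp_kept es0 ok ces) linearZ /= (rho_seg_cut_top cr es0 ok ces ht (hx' _) (hy' _)).
have hT : all (mem (simg (tagged (Top c)))) es by rewrite Top_simg.
have hB e : e \in es -> e \notin simg (tagged (Bot c)).
  by rewrite (Bot_simg cr) => /(allP ht); rewrite /= !inE negbK.
rewrite (LtE (edge_label_out hB _)) ?(Bot_root cr) 1?eq_sym ?(negPf cr) // (edge_label_in es0 hT (z := y)); last first.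
  by rewrite Top_root eqxx.
rewrite !scalerA -!exprD; congr (_ *: _); apply: sign_eq.
have := blowup_parity_top cr es0 ok ces ht; have := nv_img cr es0 ok ces.
have sE := pinv_size hT.
rewrite /prod_sign /twist_sign sE (bot_img cr es0 ok ces ht) => nE.
have {}nE : nv (tag (Top c)) = (nv (tag (Top (cimg c es))) + size es)%N by move: nE; lia.
move=> bE; rewrite nE; move: bE.
have s1 : odd (size es).-1 = ~~ odd (size es) by case: (size es) es0 => //= s _; rewrite negbK.
move: (nv (tag (Bot c))) (nv (tag (Top (cimg c es)))) => p q; rewrite !(oddD, oddM, oddS, oddb, odd_abszD) s1 /=.
case: (blowup_parity es); case: (cut_sign (cimg c es)); case: (cut_sign c); case: (blowup_parity (pinv _ _)).
all: case: (odd (size es)); case: (odd (absz m)); case: (odd (absz n)); case: (odd p); case: (odd q) => //.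
Qed.

Lemma edge_mixed (es : seq (V Q)) : (0 < size es)%N -> okseq es -> c \notin es ->
  ~~ all (mem (bots c)) es -> ~~ all (mem (tops c)) es ->
  ev (quot_seq es) (ones (size es).-1) (comp hA J x y) = 0.
Proof.
move=> es0 ok ces hb ht; have /bc_homog hx' := hx; have /bc_homog hy' := hy.
rewrite /ev (comp_kept es0 ok ces) linearZ /=.
by rewrite (rho_seg_cut_mixed cr es0 ok ces (hx' _) (hy' _) hb ht) scaler0.
Qed.

(** A sequence of edges contributes if it is contained in the bottom part or in
    the top part, without the edge below c. *)
Lemma twisted_comp : twisted (comp hA J x y) Q =
  (-1) ^+ prod_sign c (m - 1) *: Lb (twisted x (tag (Bot c))) +
  (-1) ^+ (absz m + prod_sign c m) *: Lt (twisted y (tag (Top c))).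
Proof.
rewrite (twisted_homog _ (comp_deg hA J hx hy)) (twisted_part _ hx) (twisted_part _ hy).
rewrite !scaler_sumr -big_split /=; apply: eq_bigr => i _.
rewrite !scaler_sumr [LHS]big_mkcond [X in _ = X + _]big_mkcond [X in _ = _ + X]big_mkcond -big_split /=.
apply: eq_big_seq => es /size_words se; have es0 : (0 < size es)%N by rewrite se.
have iE : nat_of_ord i = (size es).-1 by rewrite se.
have bE : all (mem (simg (tagged (Bot c)))) es && okseq (pinv (Bot c) es) =
    all (mem (bots c)) es && okseq es.
  rewrite (Bot_simg cr); case: (boolP (all _ es)) => //= h.
  by rewrite pinv_okE ?Bot_simg // Bot_root.
have tE : all (mem (simg (tagged (Top c)))) es && okseq (pinv (Top c) es) =
    [&& all (mem (tops c)) es, okseq es & c \notin es].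
  rewrite Top_simg; case: (boolP (all _ es)) => //= h.
  rewrite pinv_okE ?Top_simg // Top_root /okseq; case: (uniq es) => //=.
  suff -> : troot Q \notin es by [].
  apply/negP => /(allP h); rewrite /= inE => /(root_above (tree_valid Q)) /eqP; rewrite (negPf cr) //.
rewrite bE tE (_ : comp_fun J x y = dfun (comp hA J x y)) //; case: (boolP (okseq es)) => ok; last by rewrite !andbF addr0.
rewrite andbT andTb iE; case: (boolP (c \in es)) => ces.
  rewrite {1}/ev (comp_lost es0 ok ces) linear0 scaler0 andbF.
  case: ifP => [hb | _]; last by rewrite addr0.
  by have := allP hb _ ces; rewrite /= inE connect0.
rewrite andbT; case: (boolP (all (mem (bots c)) es)) => hb.
  have -> : all (mem (tops c)) es = false.
    case: (es) es0 hb => //= e s _ /andP[he _]; move: he; rewrite !inE => /negPf -> //.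
  by rewrite addr0 (edge_bot es0 ok hb) scalerA -exprD.
rewrite add0r; case: (boolP (all (mem (tops c)) es)) => ht.
  by rewrite (edge_top es0 ok ces ht) scalerA -exprD.
by rewrite (edge_mixed es0 ok ces hb ht) scaler0.
Qed.

Lemma leibniz_cut : D_fun hA (comp hA J x y) Q =
  comp hA J (D_fun hA x) y Q + (-1) ^+ absz m *: comp hA J x (D_fun hA y) Q.
Proof.
have /bc_homog hx' := hx; have /bc_homog hy' := hy.
rewrite [comp hA J _ _ Q](comp_funE hA _ _ nQ cr cJ) [X in _ = _ + _ *: X](comp_funE hA _ _ nQ cr cJ).
rewrite (cterm_homog y cr (D_deg hA hx)) (cterm_homog _ cr hx).
have cE : comp hA J x y Q = (-1) ^+ prod_sign c m *: seg_cut c (pairL c x y).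
  by rewrite /= (comp_funE hA _ _ nQ cr cJ) (cterm_homog y cr hx).
rewrite [LHS](_ : _ = dfun_D (comp hA J x y) Q) // /dfun_D twisted_comp cE.
rewrite linearZ /= (pair_cut_dg cr (hx' _) (hy' _)) !scalerDr !scalerA.
have eB z : seg_cut c (pairL c z y) = Lb (z (tag (Bot c))).
  by rewrite (LbE (pairL_Top c z y)) (pairL_Bot cr).
have eT z : seg_cut c (pairL c x z) = Lt (z (tag (Top c))).
  by rewrite (LtE (pairL_Bot cr x z)) pairL_Top.
rewrite (eB (fun S => dg (A S) (x S))) (eT (fun S => dg (A S) (y S))).
rewrite (eB (fun S => dfun_D x S)) (eT (fun S => dfun_D y S)) /dfun_D (linearD Lb) (linearD Lt) ![Lb (_ *: _)]linearZ ![Lt (_ *: _)]linearZ /=.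
rewrite !scalerDr !scalerA -!exprD addrACA; congr (_ *: _ + _ + (_ *: _ + _)).
all: apply: sign_eq; rewrite (nv_parts cr) /prod_sign -/nb -/nt; move: nb nt => p q.
all: rewrite !(oddD, oddM, oddb, odd_abszD) /=.
all: by case: (cut_sign c); case: (odd (absz m)); case: (odd p); case: (odd q).
Qed.

End AtCut.

Lemma leibniz_homog m n x y : homog m (x : Bc A k) -> homog n (y : Bc A l) ->
  D_fun hA (comp hA J x y) =
  comp hA J (D_fun hA x) y + (-1) ^+ absz m *: comp hA J x (D_fun hA y).
Proof.
move=> hx hy; apply: dsum_ext => Q; rewrite dsumD dsumZ.
apply: (@comp_case r J Q) => [nQ | nQ h | nQ rQ c cr cJ | nr].
- by rewrite !dsum_nl // scaler0 addr0.
- rewrite /= !comp_fun0 // scaler0 addr0 /dfun_D /= comp_fun0 // linear0 scaler0 add0r.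
  rewrite (twisted_homog _ (comp_deg hA J hx hy)) big1 // => i _.
  rewrite big_seq_cond big1 // => es /andP[/size_words se ok].
  have es0 : (0 < size es)%N by rewrite se.
  rewrite /ev /= comp_fun0 ?linear0 ?scaler0 //; first by rewrite (mor_nl (quot_map es)).
  move=> d dr dJ; apply: (h (msec (quot_map es) d)); last by rewrite cluster_mor.
  by apply: contra dr => /eqP e; rewrite -(msecK (quot_map es) d) e mor_root.
- by rewrite (leibniz_cut nQ rQ cr cJ hx hy).
- by rewrite [LHS]hA // [RHS]hA.
Qed.

HB.instance Definition _ x := GRing.isLinear.Build R (dsum A l) (dsum A r) *:%R
  (comp hA J x) (fun a y z => comp_linr hA J a x y z).

Lemma leibniz m x y : homog m (x : Bc A k) ->
  D_fun hA (comp hA J x y) =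
  comp hA J (D_fun hA x) y + (-1) ^+ absz m *: comp hA J x (D_fun hA y).
Proof.
move=> hx; have [s _ ->] := bproj_fin y; rewrite !linear_sum -big_split /=.
apply: eq_bigr => n _; apply: leibniz_homog hx (@homog_proj _ (Bc A l) n y).
Qed.

End Leibniz.

(** ** Associativity *)

(** A subtree of a subtree *)
Definition subsub (Q : tree) (Phi : psub Q) (Psi : psub (tag Phi)) : psub Q :=
  existT _ (tag Psi) (subcomp (tagged Psi) (tagged Phi)).

Lemma part_word_subsub (Q : tree) (Phi : psub Q) (Psi : psub (tag Phi)) :
  part_word (subsub Psi) = [seq tagged Phi t | t <- part_word Psi].
Proof. by rewrite /part_word -map_comp; apply: eq_map => t /=; rewrite subcompE. Qed.

Lemma subsub_full (Q : tree) (Phi : psub Q) : subsub (fullsub (tag Phi)) = Phi.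
Proof.
case: Phi => F i; rewrite /subsub /=; congr existT; apply: subtree_eq => t.
by rewrite subcompE idsubE.
Qed.

(** Labels take equal values at equal subtrees that are presented by the same
    tree. *)
Lemma label_eq (R : comPzRingType) (A : preCooperad R) (Q F : tree) (xi : label A Q)
    (i j : subtree F Q) : existT _ F i = existT _ F j :> psub Q ->
  xi (existT _ F i) = xi (existT _ F j).
Proof. by move=> e; rewrite (existT_inj2 e). Qed.

Lemma seg_cut_ext (R : comPzRingType) (A : preCooperad R) (Q : tree) (c : V Q)
    (xi xi' : label A Q) : c != troot Q ->
  xi (Bot c) = xi' (Bot c) -> xi (Top c) = xi' (Top c) -> seg_cut c xi = seg_cut c xi'.
Proof.
move=> cr eB eT; have [U [F [D kD]]] := cut_decomp c; rewrite !(seg_cutE _ kD).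
apply: segal_ext => v; case: (cut_vertices kD v) => ->.
  by move: eB; rewrite -(part_bot cr kD).
by move: eT; rewrite -(part_top cr kD).
Qed.

Section Nested.
Variables (Q S U : tree) (F : V S -> tree) (D : decomp Q S F).
Variables (G : V U -> tree) (D' : decomp Q U G).
Hypothesis kDD : kerm (dmor D) \subset kerm (dmor D').

(** If D' contracts more edges than D, then the fibres of D' are decomposed by
    those of D that they contain, over the fibres of the map between the
    bases. *)
Lemma nested_exists : exists (W : V U -> tree) (E : decomp S U W)
    (Du : forall u, decomp (G u) (W u) (fun v => F (demb E u v))),
  [/\ forall t, dmor E (dmor D t) = dmor D' t,
      forall u t, demb E u (dmor (Du u) t) = dmor D (demb D' u t),
      forall u, kerm (dmor (Du u)) = [set t | demb D' u t \in kerm (dmor D)] &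
      forall u v, subsub (Phi := part D' u) (part (Du u) v) = part D (demb E u v)].
Proof.
have [h hE] := mor_factor kDD; have [W [E eE]] := decomp_exists h.
have ED t : dmor E (dmor D t) = dmor D' t by rewrite eE hE.
have ex u : exists Du : decomp (G u) (W u) (fun v => F (demb E u v)),
    [/\ forall t, demb E u (dmor Du t) = dmor D (demb D' u t),
        kerm (dmor Du) = [set t | demb D' u t \in kerm (dmor D)] &
        forall v, subsub (Phi := part D' u) (part Du v) = part D (demb E u v)].
  have ii : simg (demb D' u) = [set t | dmor D t \in simg (demb E u)].
    by rewrite !demb_simg; apply/setP => t; rewrite !inE ED.
  have [g [[_ gE] gk]] := restr1_exists ii.
  have fx v : exists k : subtree (F (demb E u v)) (G u), forall t, demb D' u (k t) = demb D (demb E u v) t.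
    apply: sub_factor; rewrite !demb_simg; apply/subsetP => t; rewrite !inE => /eqP e.
    by rewrite -ED e dmor_emb.
  pose k v := sval (cid (fx v)); have kE v t : demb D' u (k v t) = demb D (demb E u v) t := svalP (cid (fx v)) t.
  have kP v t : (t \in codom (k v)) = (g t == v).
    rewrite -(inj_eq (@sub_inj _ _ (demb E u))) gE; apply/codomP/eqP => [[s ->] | e].
      by rewrite kE dmor_emb.
    have : demb D' u t \in simg (demb D (demb E u v)) by rewrite demb_simg inE e.
    by case/simgP => s es; exists s; apply: (@sub_inj _ _ (demb D' u)); rewrite kE.
  exists (Decomp kP); split=> //= v; rewrite /subsub /part /=; congr existT.
  by apply: subtree_eq => t; rewrite subcompE kE.
pose Du u := sval (cid (ex u)).
by exists W, E, Du; split=> //= u; have [] := svalP (cid (ex u)).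
Qed.

End Nested.

(** ** Two cuts *)

Section ThreeParts.
Variables (Q : tree) (a b : V Q).
Hypotheses (ar : a != troot Q) (br : b != troot Q) (ab : a != b).

(** The quotient has three vertices: the root and the images of a and b. *)
Definition ker3 : {set V Q} := ~: [set v | [|| v == troot Q, v == a | v == b]].

Variables (S : tree) (F : V S -> tree) (D : decomp Q S F).
Hypothesis kD : kerm (dmor D) = ker3.
Variables (U : tree) (G : V U -> tree) (D' : decomp Q U G).
Hypothesis kD' : kerm (dmor D') = cutker a.
Variables (u : V U) (b1 : V (G u)).
Hypothesis bE : demb D' u b1 = b.

Let S0 := part D (troot S).
Let Sa := part D (dmor D a).
Let Sb := part D (dmor D b).
Let inbot := u == troot U.

Lemma mem_ker3 v : (v \in ker3) = [&& v != troot Q, v != a & v != b].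
Proof. by rewrite !inE !negb_or. Qed.

Lemma ker3_sub : kerm (dmor D) \subset kerm (dmor D').
Proof.
rewrite kD kD'; apply/subsetP => v; rewrite mem_ker3 mem_cutker.
by case/and3P => -> ->.
Qed.

Lemma inner_neq : b1 != troot (G u).
Proof.
apply/eqP => e; move: bE; rewrite e demb_root => sb.
case: (cut_vertices kD' u) sb => ->; rewrite ?msec_root ?(msec_cutv kD') => e'.
  by move: br; rewrite e' eqxx.
by move: ab; rewrite e' eqxx.
Qed.

Let b1r := inner_neq.
Let a_top : u = troot U \/ u = cutv a D' := cut_vertices kD' u.

Section Nest.
Variables (W : V U -> tree) (E : decomp S U W)
  (Du : forall w, decomp (G w) (W w) (fun v => F (demb E w v))).
Hypotheses (ED : forall t, dmor E (dmor D t) = dmor D' t)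
  (cE : forall w t, demb E w (dmor (Du w) t) = dmor D (demb D' w t))
  (kE : forall w, kerm (dmor (Du w)) = [set t | demb D' w t \in kerm (dmor D)])
  (sE : forall w v, subsub (Phi := part D' w) (part (Du w) v) = part D (demb E w v)).

(** The part of the cut at a that contains b is cut once more, the other one is
    not decomposed. *)
Lemma nest_ker_u : kerm (dmor (Du u)) = cutker b1.
Proof.
rewrite kE kD; apply/setP => t; rewrite inE mem_ker3 mem_cutker.
rewrite -bE (inj_eq (@sub_inj _ _ (demb D' u))); case: (eqVneq t b1) => [_ | tb]; first by rewrite !andbF.
rewrite !andbT; case: (eqVneq t (troot (G u))) => [-> | tr].
  rewrite demb_root; case: a_top => ->; rewrite ?msec_root ?eqxx //.
  by rewrite (msec_cutv kD') eqxx andbF.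
rewrite (sub_neq_root _ tr) /=; apply/eqP => e; move/eqP: tr; apply.
have aN : a \notin kerm (dmor D') := cutN kD'.
apply: (@sub_inj _ _ (demb D' u)); rewrite demb_root.
by rewrite e -[LHS](msec_id aN) -e dmor_emb.
Qed.

Lemma nest_ker_other w : w != u -> kerm (dmor (Du w)) = ~: [set troot (G w)].
Proof.
move=> wu; rewrite kE kD; apply/setP => t; rewrite inE mem_ker3 !inE.
have -> : (demb D' w t != b).
  apply: contraNneq wu => e; rewrite -(@dmor_emb _ _ _ D' _ t) e -bE dmor_emb //.
rewrite andbT; case: (eqVneq t (troot (G w))) => [-> | tr].
  rewrite demb_root; case: (cut_vertices kD' w) => ->; rewrite ?msec_root ?eqxx //.
  by rewrite (msec_cutv kD') eqxx andbF.
rewrite (sub_neq_root _ tr) /=; apply/eqP => e; move/eqP: tr; apply.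
have aN : a \notin kerm (dmor D') := cutN kD'.
apply: (@sub_inj _ _ (demb D' w)); rewrite demb_root.
by rewrite e -[LHS](msec_id aN) -e dmor_emb.
Qed.

Lemma nest_root : demb E (troot U) (troot (W (troot U))) = troot S.
Proof. by rewrite demb_root msec_root. Qed.

Lemma nest_a : demb E (cutv a D') (troot (W (cutv a D'))) = dmor D a.
Proof.
have eC : mor_comp (dmor D) (dmor E) = dmor D' by apply: mor_eq => t; rewrite /= ffunE ED.
by rewrite demb_root -[LHS](msecK (dmor D)) -msec_comp eC (msec_cutv kD').
Qed.

Lemma nest_b : demb E u (cutv b1 (Du u)) = dmor D b.
Proof. by rewrite /cutv cE bE. Qed.

Lemma nest_vseq_u : vseq (W u) = [:: troot (W u); cutv b1 (Du u)].
Proof. exact: (vseq_cut b1r nest_ker_u). Qed.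

Lemma nest_single w (v : V (W w)) : w != u -> v = troot (W w).
Proof.
move=> /nest_ker_other kw; have := msecN (dmor (Du w)) v; rewrite kw !inE negbK => /eqP e.
by rewrite -(msecK (dmor (Du w)) v) e mor_root.
Qed.

Lemma nest_part_other w : w != u -> part D' w = part D (demb E w (troot (W w))).
Proof.
move=> wu; rewrite -sE; suff -> : part (Du w) (troot (W w)) = fullsub (G w).
  by rewrite (subsub_full (part D' w)).
apply: psub_eq; rewrite demb_simg; apply/setP => t; rewrite !inE (nest_single (dmor (Du w) t) wu) eqxx.
by apply/esym/codomP; exists t; rewrite idsubE.
Qed.

Lemma nest_vseq_other w : w != u -> vseq (W w) = [:: troot (W w)].
Proof.
move=> wu; apply: perm_small_eq => //.
rewrite (perm_trans (vseq_perm _)) //; apply: uniq_perm; rewrite ?enum_uniq // => v.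
by rewrite mem_enum inE (nest_single v wu); apply/esym/eqP.
Qed.

(** The order given by the nested decomposition determines the sign in the
    associativity of Segal maps. *)
Lemma nest_word : [seq demb E w v | w <- vseq U, v <- vseq (W w)] =
  if inbot then [:: troot S; dmor D b; dmor D a] else [:: troot S; dmor D a; dmor D b].
Proof.
have wu : [seq demb E u v | v <- vseq (W u)] = [:: demb E u (troot (W u)); dmor D b].
  by rewrite nest_vseq_u [LHS]/= nest_b.
have wo w : w != u -> [seq demb E w v | v <- vseq (W w)] = [:: demb E w (troot (W w))].
  by move=> /nest_vseq_other ->.
rewrite (vseq_cut ar kD') /= cats0 /inbot; case: a_top => uE.
  rewrite [X in _ ++ X]wo ?uE ?(cutv_neq ar kD') // eqxx nest_a; move: wu; rewrite uE => ->.
  by rewrite nest_root.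
rewrite wo ?uE; last by rewrite eq_sym (cutv_neq ar kD').
rewrite (negPf (cutv_neq ar kD')) nest_root; move: wu; rewrite uE => ->.
by rewrite nest_a.
Qed.

Lemma nest_Bot : subsub (Phi := part D' u) (Bot b1) = if inbot then S0 else Sa.
Proof.
have rt : demb E u (troot (W u)) = if u == troot U then troot S else dmor D a.
  case: a_top => ->; first by rewrite eqxx nest_root.
  by rewrite (negPf (cutv_neq ar kD')) nest_a.
by rewrite -(part_bot b1r nest_ker_u) sE rt /inbot; case: ifP.
Qed.

Lemma nest_Top : subsub (Phi := part D' u) (Top b1) = Sb.
Proof. by rewrite -(part_top b1r nest_ker_u) sE /Sb nest_b. Qed.

Section NestSegal.
Variables (R : comPzRingType) (A : preCooperad R) (xi : label A Q) (n : V S -> int).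
Hypothesis hn : forall v, homog (n v) (xi (part D v)).

Lemma nest_koszul (N : V S -> nat) :
  koszul N (if inbot then [:: troot S; dmor D b; dmor D a] else [:: troot S; dmor D a; dmor D b]) =
  ((if inbot then vlt (dmor D a) (dmor D b) else vlt (dmor D b) (dmor D a)) *
   (N (dmor D a) * N (dmor D b)))%N.
Proof.
have r0 v : vlt v (troot S) = false.
  case: (eqVneq v (troot S)) => [-> | vr]; first exact: vlt_irr.
  by apply/negbTE; rewrite -vlt_total ?(vlt_above (tree_valid S)) // 1?eq_sym // above_root.
case: inbot => /=; rewrite !big_cons !big_nil !r0 !addn0 ?add0n.
  by case: ifP => _; rewrite ?mul1n ?mul0n // mulnC.
by case: ifP => _; rewrite ?mul1n ?mul0n.
Qed.

Lemma nest_segal (eta : forall w, A (G w)) :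
  eta u = seg_cut b1 (fun Psi => xi (subsub (Phi := part D' u) Psi)) ->
  (forall w, w != u -> eta w = xi (part D' w)) ->
  segal D' eta = (-1) ^+ ((if inbot then vlt (dmor D a) (dmor D b) else vlt (dmor D b) (dmor D a)) *
   (absz (n (dmor D a)) * absz (n (dmor D b))))%N *: segal D (fun v => xi (part D v)).
Proof.
move=> eu eo; rewrite -(nest_koszul (fun v => absz (n v))) -nest_word -(@segal_assoc R A Q S U F G W D E D' Du (fun v => xi (part D v)) n cE hn).
apply: segal_ext => w.
have lE v : xi (part D (demb E w v)) = xi (subsub (Phi := part D' w) (part (Du w) v)).
  exact: (@label_eq _ _ _ (F (demb E w v)) xi (demb D (demb E w v))
    (subcomp (demb (Du w) v) (demb D' w)) (esym (sE v))).
rewrite (segal_ext _ lE); case: (eqVneq w u) => [e | wu].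
  by subst w; rewrite eu (seg_cutE _ nest_ker_u).
rewrite (eo _ wu) (@segal_one _ _ _ _ _ (Du w) (fun Psi => xi (subsub (Phi := part D' w) Psi)) (nest_ker_other wu)).
exact: (@label_eq _ _ _ (G w) xi (demb D' w) (subcomp (idsub (G w)) (demb D' w))
  (esym (subsub_full (part D' w)))).
Qed.

End NestSegal.

End Nest.

Let nestE := nested_exists ker3_sub.

Lemma parts_Bot : subsub (Phi := part D' u) (Bot b1) = if inbot then S0 else Sa.
Proof. by have [W [E [Du [ED cE kE sE]]]] := nestE; apply: (nest_Bot ED kE sE). Qed.

Lemma parts_Top : subsub (Phi := part D' u) (Top b1) = Sb.
Proof. by have [W [E [Du [ED cE kE sE]]]] := nestE; apply: (nest_Top cE kE sE). Qed.

Lemma parts_other : (if inbot then Top a else Bot a) = if inbot then Sa else S0.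
Proof.
have [W [E [Du [ED cE kE sE]]]] := nestE; rewrite /inbot /Sa /S0; case: a_top => uE.
  rewrite uE eqxx -(part_top ar kD') (nest_part_other kE sE) ?uE ?(cutv_neq ar kD') //.
  by rewrite (nest_a ED).
rewrite uE (negPf (cutv_neq ar kD')) -(part_bot ar kD') (nest_part_other kE sE); last first.
  by rewrite uE eq_sym (cutv_neq ar kD').
by rewrite nest_root.
Qed.

Lemma parts_u : part D' u = if inbot then Bot a else Top a.
Proof.
rewrite /inbot; case: a_top => ->; first by rewrite eqxx (part_bot ar kD').
by rewrite (negPf (cutv_neq ar kD')) (part_top ar kD').
Qed.

Lemma parts_segal (R : comPzRingType) (A : preCooperad R) (xi : label A Q) (n : V S -> int)
    (eta : forall w, A (G w)) : (forall v, homog (n v) (xi (part D v))) ->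
  eta u = seg_cut b1 (fun Psi => xi (subsub (Phi := part D' u) Psi)) ->
  (forall w, w != u -> eta w = xi (part D' w)) ->
  segal D' eta = (-1) ^+ ((if inbot then vlt (dmor D a) (dmor D b) else vlt (dmor D b) (dmor D a)) *
   (absz (n (dmor D a)) * absz (n (dmor D b))))%N *: segal D (fun v => xi (part D v)).
Proof.
have [W [E [Du [ED cE kE sE]]]] := nestE.
by move=> hn eu eo; apply: (nest_segal ED cE kE sE hn eu eo).
Qed.

(** The signs of the two cuts are those of permutations of words whose composite
    rearranges the concatenated words of the three parts. *)
Lemma parts_cut_sign : cut_sign a (+) cut_sign b1 = odd (inv (@vlt Q)
  (if inbot then part_word S0 ++ part_word Sb ++ part_word Sa else part_word S0 ++ part_word Sa ++ part_word Sb)).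
Proof.
pose p0 := if inbot then [::] else part_word S0; pose p1 := if inbot then part_word Sa else [::].
have aE : part_word (Bot a) ++ part_word (Top a) = p0 ++ [seq demb D' u x | x <- vseq (G u)] ++ p1.
  rewrite -/(part_word (part D' u)) parts_u /p0 /p1; have := parts_other.
  by case: inbot => ->; rewrite ?cats0.
have pw : perm_eq (part_word (Bot b1) ++ part_word (Top b1)) (vseq (G u)).
  by rewrite (perm_trans (part_word_perm b1r)) // perm_sym vseq_perm.
have un : uniq (p0 ++ [seq demb D' u x | x <- part_word (Bot b1) ++ part_word (Top b1)] ++ p1).
  rewrite (@perm_uniq _ _ (part_word (Bot a) ++ part_word (Top a))) ?(perm_uniq (part_word_perm ar)) ?enum_uniq //.
  by rewrite aE perm_cat2l perm_cat2r perm_map.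
have := inv_perm (@tour_vlt _) (@tour_vlt Q) (@sub_inj _ _ (demb D' u)) un pw.
rewrite -aE -[inv _ (vseq _)]koszul1 koszul_vseq //= addbF -/(cut_sign a) -/(cut_sign b1) => <-.
rewrite addbCA addbb addbF map_cat -!(part_word_subsub (Phi := part D' u)) parts_Bot parts_Top.
by rewrite /p0 /p1; case: inbot; rewrite ?cats0 //= -catA.
Qed.

End ThreeParts.

(** ** Iterated products as Segal maps with three arguments *)

Section Triple.
Variables (R : comPzRingType) (A : preCooperad R) (hA : connected A).
Variables (Q : tree) (a b : V Q).
Hypotheses (ar : a != troot Q) (br : b != troot Q) (ab : a != b).
Variables (S : tree) (F : V S -> tree) (D : decomp Q S F).
Hypothesis kD : kerm (dmor D) = ker3 a b.

(* Arguments for the three parts, given by the root vertices of the parts; each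
   part has a different root vertex among the root, a and b. *)
Variables (g : V Q -> forall T : tree, A T) (d : V Q -> int).
Hypothesis hg : forall v (T : tree), homog (d v + (nv T)%:Z) (g v T).

Definition root_label (Phi : psub Q) : A (tag Phi) := g (tagged Phi (troot (tag Phi))) (tag Phi).

Let S0 := part D (troot S).
Let Sa := part D (dmor D a).
Let Sb := part D (dmor D b).
Let n v : int := d (msec (dmor D) v) + (nv (F v))%:Z.

Lemma triple_hom v : homog (n v) (root_label (part D v)).
Proof. by rewrite /root_label /= demb_root; apply: hg. Qed.

Lemma triple_a : n (dmor D a) = d a + (nv (tag Sa))%:Z.
Proof. by rewrite /n msec_id // kD mem_ker3 eqxx andbF. Qed.

Lemma triple_b : n (dmor D b) = d b + (nv (tag Sb))%:Z.
Proof. by rewrite /n msec_id // kD mem_ker3 eqxx !andbF. Qed.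

Variables (U : tree) (G : V U -> tree) (D' : decomp Q U G).
Hypothesis kD' : kerm (dmor D') = cutker a.

Section Inner.
Variables (u : V U) (b1 : V (G u)).
Hypothesis bE : demb D' u b1 = b.

Lemma inner_pair : seg_cut b1 (pairL b1 (g (msec (dmor D') u)) (g b)) =
  seg_cut b1 (fun Psi => root_label (subsub (Phi := part D' u) Psi)).
Proof.
apply: (seg_cut_ext (inner_neq br ab kD' bE)).
  by rewrite (pairL_Bot (inner_neq br ab kD' bE)) /root_label /= subcompE (Bot_root (inner_neq br ab kD' bE)) demb_root.
by rewrite pairL_Top /root_label /= subcompE Top_root /= bE.
Qed.

End Inner.

Section Bottom.
Variables (b1 : V (G (troot U))).
Hypothesis bE : demb D' (troot U) b1 = b.
Variables (k l s m r : nat) (K : {set 'I_r}) (J : {set 'I_s}).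
Variables (x : dsum A k) (y : dsum A l) (z : dsum A m).
Hypotheses (gx : g (troot Q) = x) (gy : g b = y) (gz : g a = z).
Hypotheses (nQ : nl Q = r) (aK : cluster r a = K) (nG : nl (G (troot U)) = s) (bJ : cluster s b1 = J).

(** The exponents are, in this order: the vertices of the three parts, the
    exchange of the vertices of the last factor with the first two, that of the
    second factor with the first one, and the exchange of the last two arguments
    in the Segal map. *)
Lemma comp_bot : comp hA K (comp hA J x y) z Q =
  (-1) ^+ (inv (@vlt Q) (part_word S0 ++ part_word Sb ++ part_word Sa) +
    nv (tag Sa) * (absz (d (troot Q)) + absz (d b) + (nv (tag S0) + nv (tag Sb))) +
    nv (tag Sb) * (absz (d (troot Q)) + nv (tag S0)) +
    vlt (dmor D a) (dmor D b) * ((absz (d a) + nv (tag Sa)) * (absz (d b) + nv (tag Sb))))%N *: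
  segal D (fun v => root_label (part D v)).
Proof.
have b1r := inner_neq br ab kD' bE.
have hx : homog (d (troot Q)) (x : Bc A k) by apply/bc_homog => T; rewrite -gx.
have hy : homog (d b) (y : Bc A l) by apply/bc_homog => T; rewrite -gy.
rewrite [LHS](comp_funE hA _ _ nQ ar aK) (cterm_homog z ar (comp_deg hA J hx hy)) (seg_cutE _ kD').
set eta := (fun v => pairL a _ _ _).
have e0 : eta (troot U) = (-1) ^+ prod_sign b1 (d (troot Q)) *: seg_cut b1 (pairL b1 x y).
  rewrite /eta (pairL_bot ar) /= (comp_funE hA _ _ nG b1r bJ).
  exact: (cterm_homog y b1r hx).
rewrite (@segal_scale _ _ _ _ _ D' eta (@dfwith _ (fun w => A (G w)) eta (troot U)
  (seg_cut b1 (pairL b1 x y))) (troot U) ((-1) ^+ prod_sign b1 (d (troot Q)))); last 2 first.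
- by rewrite dfwith_in e0.
- by move=> w wu; rewrite dfwith_out // eq_sym.
rewrite (parts_segal ar br ab kD kD' bE triple_hom); last 2 first.
- by rewrite dfwith_in -(inner_pair bE) msec_root gx gy.
- move=> w wu; rewrite dfwith_out 1?eq_sym // /eta.
  case: (cut_vertices kD' w) wu => ->; rewrite ?eqxx // => _.
  by rewrite (pairL_top kD') /root_label /= demb_root (msec_cutv kD') gz.
rewrite !scalerA -!exprD; congr (_ *: _); apply: sign_eq.
rewrite eqxx triple_a triple_b /prod_sign.
have cE := parts_cut_sign ar br ab kD kD' bE; rewrite eqxx in cE.
have tE : Top a = Sa by have := parts_other ar kD kD' bE; rewrite eqxx.
have b0 : nv (tag (Bot b1)) = nv (tag S0).
  by have := congr1 (fun P : psub Q => nv (tag P)) (parts_Bot ar br ab kD kD' bE); rewrite ?eqxx.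
have b2 : nv (tag (Top b1)) = nv (tag Sb).
  by have := congr1 (fun P : psub Q => nv (tag P)) (parts_Top br ab kD kD' bE).
have bE' : nv (tag (Bot a)) = (nv (tag S0) + nv (tag Sb))%N.
  by rewrite -b0 -b2 -(nv_parts b1r) -(part_bot ar kD').
rewrite tE bE' b0 b2; move: (nv (tag S0)) (nv (tag Sa)) (nv (tag Sb)) => p q t.
move: cE; rewrite -/S0 -/Sa -/Sb !oddD => <-.
rewrite PoszD !(oddD, oddM, odd_abszD, oddb) /=.
by move: (odd q && _) (odd t && _) (vlt _ _ && _) => [] [] []; case: (cut_sign a); case: (cut_sign b1).
Qed.

End Bottom.

Section TopPart.
Let u := cutv a D'.
Variables (b1 : V (G u)).
Hypothesis bE : demb D' u b1 = b.
Variables (k l s m r : nat) (J : {set 'I_r}) (K : {set 'I_s}).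
Variables (x : dsum A k) (y : dsum A l) (z : dsum A m).
Hypotheses (gx : g (troot Q) = x) (gy : g a = y) (gz : g b = z).
Hypotheses (nQ : nl Q = r) (aJ : cluster r a = J) (nG : nl (G u) = s) (bK : cluster s b1 = K).

Lemma comp_top : comp hA J x (comp hA K y z) Q =
  (-1) ^+ (inv (@vlt Q) (part_word S0 ++ part_word Sa ++ part_word Sb) +
    (nv (tag Sa) + nv (tag Sb)) * (absz (d (troot Q)) + nv (tag S0)) +
    nv (tag Sb) * (absz (d a) + nv (tag Sa)) +
    vlt (dmor D b) (dmor D a) * ((absz (d a) + nv (tag Sa)) * (absz (d b) + nv (tag Sb))))%N *:
  segal D (fun v => root_label (part D v)).
Proof.
have b1r := inner_neq br ab kD' bE.
have hx : homog (d (troot Q)) (x : Bc A k) by apply/bc_homog => T; rewrite -gx.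
have hy : homog (d a) (y : Bc A l) by apply/bc_homog => T; rewrite -gy.
rewrite [LHS](comp_funE hA _ _ nQ ar aJ) (cterm_homog _ ar hx) (seg_cutE _ kD').
set eta := (fun v => pairL a _ _ _).
have ur : u != troot U by exact: (cutv_neq ar kD').
have e0 : eta u = (-1) ^+ prod_sign b1 (d a) *: seg_cut b1 (pairL b1 y z).
  rewrite /eta (pairL_top kD') /= (comp_funE hA _ _ nG b1r bK).
  exact: (cterm_homog z b1r hy).
rewrite (@segal_scale _ _ _ _ _ D' eta (@dfwith _ (fun w => A (G w)) eta u
  (seg_cut b1 (pairL b1 y z))) u ((-1) ^+ prod_sign b1 (d a))); last 2 first.
- by rewrite dfwith_in e0.
- by move=> w wu; rewrite dfwith_out // eq_sym.
rewrite (parts_segal ar br ab kD kD' bE triple_hom); last 2 first.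
- by rewrite dfwith_in -(inner_pair bE) (msec_cutv kD') gy gz.
- move=> w wu; rewrite dfwith_out 1?eq_sym // /eta.
  case: (cut_vertices kD' w) wu => ->; rewrite ?eqxx // => _.
  by rewrite (pairL_bot ar) /root_label /= demb_root msec_root gx.
rewrite !scalerA -!exprD; congr (_ *: _); apply: sign_eq.
rewrite (negPf ur) triple_a triple_b /prod_sign.
have cE := parts_cut_sign ar br ab kD kD' bE; rewrite (negPf ur) in cE.
have tE : Bot a = S0 by have := parts_other ar kD kD' bE; rewrite (negPf ur).
have b0 : nv (tag (Bot b1)) = nv (tag Sa).
  by have := congr1 (fun P : psub Q => nv (tag P)) (parts_Bot ar br ab kD kD' bE); rewrite ?(negPf ur).
have b2 : nv (tag (Top b1)) = nv (tag Sb).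
  by have := congr1 (fun P : psub Q => nv (tag P)) (parts_Top br ab kD kD' bE).
have bE' : nv (tag (Top a)) = (nv (tag Sa) + nv (tag Sb))%N.
  by rewrite -b0 -b2 -(nv_parts b1r) -(part_top ar kD').
rewrite tE bE' b0 b2; move: (nv (tag S0)) (nv (tag Sa)) (nv (tag Sb)) => p q t.
move: cE; rewrite -/S0 -/Sa -/Sb !oddD => <-.
rewrite !(oddD, oddM, odd_abszD, oddb) /=.
by move: ((odd q (+) odd t) && _) (odd t && _) (vlt _ _ && _) => [] [] []; case: (cut_sign a); case: (cut_sign b1).
Qed.

End TopPart.

End Triple.

(** ** Clusters in the parts of a cut *)

Section Clusters.
Variables (r : nat) (Q : tree) (c : V Q).
Hypotheses (nQ : nl Q = r) (cr : c != troot Q).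
Variables (F : tree) (i : subtree F Q) (s : nat) (v : V F).
Hypothesis nF : nl F = s.

Lemma cluster_bot : simg i = bots c -> cluster s v = renumber (slots (cluster r c)) (cluster r (i v)) s.
Proof. by move=> iX; apply: cluster_sub nF _; rewrite iX (keys_bots nQ cr). Qed.

Lemma cluster_top : simg i = tops c -> cluster s v = renumber (cluster r c) (cluster r (i v)) s.
Proof. by move=> iX; apply: cluster_sub nF _; rewrite iX (keys_tops c nQ). Qed.

(** The cluster of a vertex of the bottom part is either disjoint from that of c
    or contains it, and min J decides which; so it is determined by its trace on
    the slots. *)
Lemma cluster_bot_inv (J : {set 'I_r}) : simg i = bots c -> s = #|slots (cluster r c)| ->
  cluster r c \subset J \/ [disjoint cluster r c & J] ->
  cluster s v = renumber (slots (cluster r c)) J s -> cluster r (i v) = J.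
Proof.
move=> iX sE hJ; rewrite (cluster_bot iX) => /renumber_inj; rewrite -sE leqnn => /(_ isT) eC.
have ib : ~~ above Q (i v) c by have := simg_f i v; rewrite iX inE.
have [j0 j0K j0min] : exists2 j0, j0 \in cluster r c & forall j, j \in cluster r c -> (j0 <= j)%N.
  by apply: set_min; have [j jc] := cluster_ex nQ c; apply/card_gt0P; exists j.
have hC : cluster r c \subset cluster r (i v) \/ [disjoint cluster r c & cluster r (i v)].
  case: (boolP [disjoint cluster r c & cluster r (i v)]) => [|/pred0Pn[j /andP[j1 j2]]]; first by right.
  by left; apply: cluster_mono; case: (cluster_comp j1 j2) => // h; case/negP: ib.
have j0s : j0 \in slots (cluster r c) by rewrite (mem_slots j0K j0min) eqxx orbT.
have e0 : (j0 \in cluster r (i v)) = (j0 \in J).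
  by have /setP/(_ j0) := eC; rewrite !in_setI j0s !andbT.
apply/setP => j; case: (boolP (j \in cluster r c)) => jK; last first.
  have js : j \in slots (cluster r c) by rewrite (mem_slots j0K j0min) jK.
  by have /setP/(_ j) := eC; rewrite !in_setI js !andbT.
case: hC => [/subsetP hC | hC]; case: hJ => [/subsetP hJ | hJ].
- by rewrite hC ?hJ.
- by move: e0; rewrite (hC _ j0K) (disjointFr hJ j0K).
- by move: e0; rewrite (hJ _ j0K) (disjointFr hC j0K).
- by rewrite (disjointFr hC jK) (disjointFr hJ jK).
Qed.

Lemma cluster_top_inv (K : {set 'I_r}) : simg i = tops c -> s = #|cluster r c| ->
  K \subset cluster r c -> cluster s v = renumber (cluster r c) K s -> cluster r (i v) = K.
Proof.
move=> iX sE hK; rewrite (cluster_top iX) => /renumber_inj; rewrite -sE leqnn => /(_ isT) eC.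
have it : above Q (i v) c by have := simg_f i v; rewrite iX inE.
have := cluster_mono r it; rewrite -(setIidPl hK) -eC => /setIidPl ->.
by [].
Qed.

End Clusters.

Section Operad.
Variables (R : comPzRingType) (A : preCooperad R) (hA : connected A).

Section Shuffle.
Variables (k l r : nat) (J : {set 'I_r}).
Hypothesis h : shuffle k l J.

Lemma shuffle_card : [/\ (0 < #|J|)%N, #|J| = l & #|slots J| = k].
Proof.
case/and3P: h => l0 /eqP Jl /eqP klr; have J0 : (0 < #|J|)%N by rewrite Jl.
split=> //; have [j0 j0J jmin] := set_min J0; have := card_slots j0J jmin; lia.
Qed.

End Shuffle.

Lemma comp_at0 (k l r : nat) (J : {set 'I_r}) (x : dsum A k) (y : dsum A l) (Q : tree) :
  (nl Q = r -> reduced Q -> forall c : V Q, c != troot Q -> cluster r c = J ->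
     x (tag (Bot c)) = 0 \/ y (tag (Top c)) = 0) ->
  comp hA J x y Q = 0.
Proof.
move=> h; apply: (@comp_case r J Q) => [nQ | nQ h' | nQ rQ c cr cJ | nr].
- exact: comp_nl.
- exact: comp_fun0.
- rewrite [LHS](comp_funE hA _ _ nQ cr cJ) /cterm; case: (h nQ rQ c cr cJ) => e.
    by rewrite (@pair_cut_0l _ _ _ _ cr) ?scaler0 // e linear0.
  by rewrite (@pair_cut_0r _ _ _ _ cr) ?scaler0.
- exact: hA.
Qed.

Section Linear.
Variables (k l r : nat) (J : {set 'I_r}).

Lemma comp_suml (I : Type) (s : seq I) (X : I -> dsum A k) (y : dsum A l) :
  comp hA J (\sum_(i <- s) X i) y = \sum_(i <- s) comp hA J (X i) y.
Proof.
have add (x x' : dsum A k) : comp hA J (x + x') y = comp hA J x y + comp hA J x' y.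
  by have := comp_linl hA J 1 x x' y; rewrite !scale1r.
have zero : comp hA J (0 : dsum A k) y = 0.
  have := add (0 : dsum A k) (0 : dsum A k).
  by rewrite addr0 => /eqP; rewrite addrC -subr_eq subrr eq_sym => /eqP.
exact: (big_morph (fun x => comp hA J x y) add zero).
Qed.

Lemma comp_sumr (I : Type) (s : seq I) (x : dsum A k) (Y : I -> dsum A l) :
  comp hA J x (\sum_(i <- s) Y i) = \sum_(i <- s) comp hA J x (Y i).
Proof. exact: linear_sum. Qed.

End Linear.

(** ** Vertices of two nested products *)

Section Cuts.
Variables (r : nat) (Q : tree) (nQ : nl Q = r) (rQ : reduced Q).
Variables (k l m s : nat) (J K : {set 'I_r}) (c d : V Q).
Variables (x : dsum A k) (y : dsum A l) (z : dsum A m).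
Hypotheses (cr : c != troot Q) (dr : d != troot Q) (cd : c != d).

Lemma ker3C : ker3 c d = ker3 d c.
Proof. by apply/setP => v; rewrite !mem_ker3 (andbC (v != c)). Qed.

Variables (S : tree) (F : V S -> tree) (D : decomp Q S F).
Hypothesis kD : kerm (dmor D) = ker3 c d.
Variables (g : V Q -> forall T : tree, A T) (dd : V Q -> int).
Hypothesis hg : forall v (T : tree), homog (dd v + (nv T)%:Z) (g v T).
Hypotheses (gx : g (troot Q) = x) (gy : g c = y) (gz : g d = z).
Let S0 := part D (troot S).
Let Sc := part D (dmor D c).
Let Sd := part D (dmor D d).

Lemma value_bot : cluster r d = K -> cluster r c = J -> ~~ above Q c d -> s = #|slots K| ->
  comp hA K (comp hA (renumber (slots K) J s) x y) z Q =
  (-1) ^+ (inv (@vlt Q) (part_word S0 ++ part_word Sc ++ part_word Sd) +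
    nv (tag Sd) * (absz (dd (troot Q)) + absz (dd c) + (nv (tag S0) + nv (tag Sc))) +
    nv (tag Sc) * (absz (dd (troot Q)) + nv (tag S0)) +
    vlt (dmor D d) (dmor D c) * ((absz (dd d) + nv (tag Sd)) * (absz (dd c) + nv (tag Sc))))%N *:
  segal D (fun v => root_label g (part D v)).
Proof.
move=> dK cJ nab sE; have [U [G [D' kD']]] := cut_decomp d.
have : c \in simg (demb D' (troot U)) by rewrite (simg_bot dr kD') inE.
case/simgP => b1 bE; have dc : d != c by rewrite eq_sym.
have nG : nl (G (troot U)) = s by rewrite (nl_bot nQ dr (simg_bot dr kD')) dK.
apply: (@comp_bot _ _ hA _ d c dr cr dc _ _ D _ g dd hg _ _ D' kD' b1) => //.
  by rewrite -ker3C.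
by rewrite (cluster_bot nQ dr b1 nG (simg_bot dr kD')) -bE cJ dK.
Qed.

Lemma value_top : cluster r d = K -> cluster r c = J -> above Q d c -> s = #|J| ->
  comp hA J x (comp hA (renumber J K s) y z) Q =
  (-1) ^+ (inv (@vlt Q) (part_word S0 ++ part_word Sc ++ part_word Sd) +
    (nv (tag Sc) + nv (tag Sd)) * (absz (dd (troot Q)) + nv (tag S0)) +
    nv (tag Sd) * (absz (dd c) + nv (tag Sc)) +
    vlt (dmor D d) (dmor D c) * ((absz (dd c) + nv (tag Sc)) * (absz (dd d) + nv (tag Sd))))%N *:
  segal D (fun v => root_label g (part D v)).
Proof.
move=> dK cJ ab sE; have [U [G [D' kD']]] := cut_decomp c.
have : d \in simg (demb D' (cutv c D')) by rewrite (simg_top cr kD') inE.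
case/simgP => b1 bE.
have nG : nl (G (cutv c D')) = s by rewrite (nl_top nQ (simg_top cr kD')) cJ.
apply: (@comp_top _ _ hA _ c d cr dr cd _ _ D kD g dd hg _ _ D' kD' b1) => //.
by rewrite (cluster_top nQ b1 nG (simg_top cr kD')) -bE cJ dK.
Qed.

End Cuts.

(** A non-zero value at Q gives a vertex d of Q with cluster K and a vertex of the
    bottom part below d whose cluster in Q is J. *)
Lemma triple_bot0 (k l m s r : nat) (J K : {set 'I_r}) (x : dsum A k) (y : dsum A l)
    (z : dsum A m) (Q : tree) : shuffle s m K -> K \subset J \/ [disjoint K & J] ->
  (nl Q = r -> reduced Q -> forall c d : V Q, c != troot Q -> d != troot Q -> c != d ->
    cluster r c = J -> cluster r d = K -> False) ->
  comp hA K (comp hA (renumber (slots K) J s) x y) z Q = 0.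
Proof.
move=> /shuffle_card[K0 _ Ks] hJ no; apply: comp_at0 => nQ rQ d dr dK; left.
apply: comp_fun0; first by rewrite (nl_bot nQ dr (Bot_simg dr)) dK.
move=> c1 c1r e; have nB : nl (tag (Bot d)) = s by rewrite (nl_bot nQ dr (Bot_simg dr)) dK.
have cJ : cluster r (tagged (Bot d) c1) = J.
  by apply: (cluster_bot_inv nQ dr nB (Bot_simg dr)); rewrite dK ?Ks.
apply: (no nQ rQ _ d _ dr _ cJ dK); first exact: sub_neq_root.
have := simg_f (tagged (Bot d)) c1; rewrite (Bot_simg dr) inE => h.
by apply: contraNneq h => ->; apply: connect0.
Qed.

Lemma triple_top0 (k l m s q r : nat) (J K : {set 'I_r}) (x : dsum A k) (y : dsum A l)
    (z : dsum A m) (Q : tree) : shuffle k q J -> K \subset J ->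
  (nl Q = r -> reduced Q -> forall c d : V Q, c != troot Q -> d != troot Q -> c != d ->
    cluster r c = J -> cluster r d = K -> False) ->
  comp hA J x (comp hA (renumber J K q) y z) Q = 0.
Proof.
move=> /shuffle_card[J0 Jq _] hJ no; apply: comp_at0 => nQ rQ c cr cJ; right.
have nT : nl (tag (Top c)) = q by rewrite (nl_top nQ (Top_simg c)) cJ.
apply: comp_fun0 => // d1 d1r e.
have dK : cluster r (tagged (Top c) d1) = K.
  by apply: (cluster_top_inv nQ nT (Top_simg c)); rewrite cJ.
apply: (no nQ rQ c _ cr _ _ cJ dK); first exact: sub_neq_root.
apply: contra d1r => /eqP e'; apply/eqP; apply: (@sub_inj _ _ (tagged (Top c))).
by rewrite Top_root -e'.
Qed.

(** ** The associativity relations *)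

Section Assoc.
Variables (k l m r : nat) (J K : {set 'I_r}).

Lemma ker3_decomp (Q : tree) (c d : V Q) : exists (S : tree) (F : V S -> tree)
  (D : decomp Q S F), kerm (dmor D) = ker3 c d.
Proof.
have [|S [f fk]] := @quotient_exists Q (ker3 c d); first by rewrite mem_ker3 eqxx.
by have [F [D Df]] := decomp_exists f; exists S, F, D; rewrite Df.
Qed.

Section Homog.
Variables (x : dsum A k) (y : dsum A l) (z : dsum A m) (dx dy dz : int).
Hypotheses (hx : homog dx (x : Bc A k)) (hy : homog dy (y : Bc A l)) (hz : homog dz (z : Bc A m)).

Section Labels.
Variables (Q : tree) (c d : V Q).
Hypotheses (cr : c != troot Q) (dr : d != troot Q) (cd : c != d).

(** The labels x, y, z of the parts with roots the root of Q, c and d *)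
Definition glab (v : V Q) (T : tree) : A T := if v == d then z T else if v == c then y T else x T.
Definition gdeg (v : V Q) : int := if v == d then dz else if v == c then dy else dx.

Lemma glab_hom v (T : tree) : homog (gdeg v + (nv T)%:Z) (glab v T).
Proof.
have /bc_homog h1 := hx; have /bc_homog h2 := hy; have /bc_homog h3 := hz.
by rewrite /gdeg /glab; case: (v == d); case: (v == c).
Qed.

Lemma glab_x : glab (troot Q) = x.
Proof.
by apply: functional_extensionality_dep => T; rewrite /glab !(eq_sym (troot Q)) (negPf dr) (negPf cr).
Qed.

Lemma glab_y : glab c = y.
Proof. by apply: functional_extensionality_dep => T; rewrite /glab (negPf cd) eqxx. Qed.

Lemma glab_z : glab d = z.
Proof. by apply: functional_extensionality_dep => T; rewrite /glab eqxx. Qed.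

Lemma gdegE : [/\ gdeg (troot Q) = dx, gdeg c = dy & gdeg d = dz].
Proof.
by rewrite /gdeg !(eq_sym (troot Q)) (negPf dr) (negPf cr) (negPf cd) !eqxx.
Qed.

End Labels.

(** Since K is contained in J, the vertex d is above c. Both nested decompositions
    list the arguments in the order x, y, z, so the Segal maps produce the same
    sign on both sides. *)
Lemma assoc_seq (s q : nat) : shuffle s m K -> shuffle k q J -> K \subset J ->
  comp hA K (comp hA (renumber (slots K) J s) x y) z = comp hA J x (comp hA (renumber J K q) y z).
Proof.
move=> hK hJ KJ; apply: dsum_ext => Q.
case: (eqVneq (nl Q) r) => [nQ | /eqP nQ]; last by rewrite !dsum_nl.
case: (boolP (reduced Q)) => rQ; last by rewrite [LHS]hA // [RHS]hA.
case: (pselect (exists c d : V Q, [/\ c != troot Q, d != troot Q, c != d, cluster r c = J & cluster r d = K]));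
  last first.
  move=> no; rewrite triple_bot0 ?triple_top0 //; try by left.
    by move=> _ _ c d cr dr cd cJ dK; apply: no; exists c, d.
  by move=> _ _ c d cr dr cd cJ dK; apply: no; exists c, d.
case=> c [d [cr dr cd cJ dK]].
have [S [F [D kD]]] := ker3_decomp c d.
have [_ _ Ks] := shuffle_card hK; have [_ Jq _] := shuffle_card hJ.
(* K is contained in J; the opposite order would give J = K, hence c = d. *)
have dc : above Q d c.
  have [j jK] := cluster_ex nQ d; have jJ : j \in cluster r c by rewrite cJ (subsetP KJ) // -dK.
  case: (cluster_comp jK jJ) => // h; have := cluster_mono r h; rewrite cJ dK => JK.
  by move: cd; rewrite (reduced_cluster_inj nQ rQ (x1 := c) (x2 := d)) ?eqxx // cJ dK; apply/eqP; rewrite eqEsubset JK.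
have ncd : ~~ above Q c d by apply: contra cd => h; apply/eqP; apply: above_anti h dc; exact: tree_valid.
rewrite (value_bot nQ cr dr cd kD (@glab_hom Q c d) (glab_x cr dr) (glab_y cd) (glab_z c d) dK cJ ncd (esym Ks)).
rewrite (value_top nQ cr dr cd kD (@glab_hom Q c d) (glab_x cr dr) (glab_y cd) (glab_z c d) dK cJ dc (esym Jq)).
congr (_ *: _); apply: sign_eq; have [-> -> ->] := gdegE cr dr cd.
move: (nv _) (nv _) (nv _) => p t u; rewrite !(oddD, oddM, oddb).
case: (odd (inv _ _)); case: (vlt _ _).
all: by case: (odd p); case: (odd t); case: (odd u); case: (odd (absz dx)); case: (odd (absz dy)); case: (odd (absz dz)).
Qed.

Section Parallel.
Variables (Q S : tree) (F : V S -> tree) (D : decomp Q S F) (c d : V Q).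
Hypotheses (cr : c != troot Q) (dr : d != troot Q) (cd : c != d).
Hypothesis kD : kerm (dmor D) = ker3 c d.

Lemma cuts_neq : dmor D c != dmor D d.
Proof.
apply: contra cd => /eqP e; apply/eqP; apply: (mor_inj (f := dmor D)) e.
  by rewrite kD mem_ker3 eqxx andbF.
by rewrite kD mem_ker3 eqxx !andbF.
Qed.

Lemma size_part_word (Phi : psub Q) : size (part_word Phi) = nv (tag Phi).
Proof. by rewrite size_map (perm_size (vseq_perm _)) -cardE card_ord. Qed.

(** The sign of the transposition of the words of two parts *)
Lemma swap_parts : odd (inv (@vlt Q)
    (part_word (part D (troot S)) ++ part_word (part D (dmor D c)) ++ part_word (part D (dmor D d)))) =
  odd (inv (@vlt Q)
    (part_word (part D (troot S)) ++ part_word (part D (dmor D d)) ++ part_word (part D (dmor D c)))) (+)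
  odd (nv (tag (part D (dmor D d))) * nv (tag (part D (dmor D c)))).
Proof.
set s0 := part_word _; set sc := part_word (part D (dmor D c)); set sd := part_word (part D (dmor D d)).
have um v : uniq (part_word (part D v)) by rewrite map_inj_uniq ?vseq_uniq //; apply: sub_inj.
have u : uniq (sd ++ sc ++ [::]).
  rewrite cats0 cat_uniq !um andbT; apply/hasPn => v /mapP[t _ ->].
  apply/negP => /mapP[t' _ e]; have := cuts_neq; apply/negP; rewrite negbK; apply/eqP.
  have <- : dmor D (tagged (part D (dmor D c)) t) = dmor D c by apply: dmor_emb.
  by rewrite e; apply: dmor_emb.
have := inv_swap (@tour_vlt Q) u; rewrite !cats0 !size_part_word => eS.
rewrite !(inv_cat _ s0) (cross_perm _ _ (permEl (perm_catC sc sd))) !oddD eS.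
by rewrite addbA.
Qed.

End Parallel.

(** The vertices c and d are incomparable, and exactly one of the two orders of
    the last two arguments agrees with the canonical order of the base. *)
Lemma assoc_par (s t : nat) : shuffle s m K -> shuffle t l J -> [disjoint J & K] ->
  comp hA K (comp hA (renumber (slots K) J s) x y) z =
  (-1) ^+ (absz dy * absz dz) *: comp hA J (comp hA (renumber (slots J) K t) x z) y.
Proof.
move=> hK hJ JK; apply: dsum_ext => Q; rewrite dsumZ.
have KJ : [disjoint K & J] by rewrite disjoint_sym.
case: (eqVneq (nl Q) r) => [nQ | /eqP nQ]; last by rewrite !dsum_nl // scaler0.
case: (boolP (reduced Q)) => rQ; last by rewrite [LHS]hA // [RHS]hA.
case: (pselect (exists c d : V Q, [/\ c != troot Q, d != troot Q, c != d, cluster r c = J & cluster r d = K]));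
  last first.
  move=> no; rewrite !triple_bot0 ?scaler0 //; try by right.
    by move=> _ _ d c dr cr dc dK cJ; apply: no; exists c, d; split=> //; rewrite eq_sym.
  by move=> _ _ c d cr dr cd cJ dK; apply: no; exists c, d.
case=> c [d [cr dr cd cJ dK]].
have [S [F [D kD]]] := ker3_decomp c d.
have [_ _ Ks] := shuffle_card hK; have [_ _ Jt] := shuffle_card hJ.
have nab (u v : V Q) : [disjoint cluster r u & cluster r v] -> ~~ above Q u v.
  move=> dis; apply/negP => /(cluster_mono r)/subsetP h; have [j ju] := cluster_ex nQ u.
  by have := disjointFr dis ju; rewrite h.
have ncd : ~~ above Q c d by apply: nab; rewrite cJ dK.
have ndc : ~~ above Q d c by apply: nab; rewrite cJ dK.
have dc : d != c by rewrite eq_sym.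
have kD1 : kerm (dmor D) = ker3 d c by rewrite kD ker3C.
rewrite (value_bot nQ cr dr cd kD (@glab_hom Q c d) (glab_x cr dr) (glab_y cd) (glab_z c d) dK cJ ncd (esym Ks)).
rewrite (value_bot nQ dr cr dc kD1 (@glab_hom Q c d) (glab_x cr dr) (glab_z c d) (glab_y cd) cJ dK ndc (esym Jt)).
rewrite scalerA -exprD; congr (_ *: _); apply: sign_eq; have [-> -> ->] := gdegE cr dr cd.
have := swap_parts cd kD; have := vlt_total (tree_valid S) (cuts_neq cd kD).
move: (nv (tag (part D (troot S)))) (nv (tag (part D (dmor D c)))) (nv (tag (part D (dmor D d)))) => p u w eV eI.
rewrite !oddD eI eV !(oddD, oddM, oddb).
case: (odd (inv _ _)); case: (vlt _ _).
all: by case: (odd p); case: (odd u); case: (odd w); case: (odd (absz dx)); case: (odd (absz dy)); case: (odd (absz dz)).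
Qed.

End Homog.
End Assoc.

Lemma assoc_seq_gen (k l m s q r : nat) (J K : {set 'I_r}) (x : dsum A k) (y : dsum A l) (z : dsum A m) :
  shuffle s m K -> shuffle k q J -> K \subset J ->
  comp hA K (comp hA (renumber (slots K) J s) x y) z = comp hA J x (comp hA (renumber J K q) y z).
Proof.
move=> hK hJ KJ.
have [sx _ ->] := bproj_fin x; rewrite !comp_suml; apply: eq_bigr => dx _.
have [sy _ ->] := bproj_fin y; rewrite comp_sumr !comp_suml comp_sumr; apply: eq_bigr => dy _.
have [sz _ ->] := bproj_fin z; rewrite !comp_sumr; apply: eq_bigr => dz _.
apply: (assoc_seq (dx := dx) (dy := dy) (dz := dz)) => //.
- exact: (@homog_proj _ (Bc A k)).
- exact: (@homog_proj _ (Bc A l)).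
- exact: (@homog_proj _ (Bc A m)).
Qed.

Lemma assoc_par_gen (k l m s t r : nat) (J K : {set 'I_r}) (x : dsum A k) (y : dsum A l) (z : dsum A m)
    (i j : int) : shuffle s m K -> shuffle t l J -> [disjoint J & K] ->
  homog i (y : Bc A l) -> homog j (z : Bc A m) ->
  comp hA K (comp hA (renumber (slots K) J s) x y) z =
  (-1) ^+ (absz i * absz j) *: comp hA J (comp hA (renumber (slots J) K t) x z) y.
Proof.
move=> hK hJ JK hy hz; have [sx _ ->] := bproj_fin x.
rewrite !comp_suml scaler_sumr; apply: eq_bigr => dx _.
by apply: (assoc_par (dx := dx)) => //; apply: (@homog_proj _ (Bc A k)).
Qed.

(** ** The operad *)

Definition cobar_operad : shuffleOperad (fun r : nat => DgModule (D hA r)).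
Proof.
unshelve refine (@ShuffleOperad R (fun r : nat => DgModule (D hA r))
  (fun k l r J _ x y => comp hA J x y) _ _ _ _ _ _).
- by move=> k l r J _ a x x' y; apply: comp_linl.
- by move=> k l r J _ a x y y'; apply: comp_linr.
- by move=> k l r J _ m n x y; apply: comp_deg.
- by move=> k l r J _ m x y; apply: leibniz.
- by move=> k l m q s r J K hK _ hJ _ x y z; apply: assoc_seq_gen hK hJ.
- by move=> k l m s t r J K hK _ hJ _ i j x y z; apply: assoc_par_gen hK hJ.
Defined.

End Operad.

Theorem mainTheorem3 (R : comPzRingType) (A : preCooperad R) (hA : connected A) :
  exists (D : forall r : nat, dgStructure (Bc A r))
         (O : shuffleOperad (fun r : nat => DgModule (D r))),
    (forall r : nat, is_cobar_diff (D r)) /\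
    (forall (k l r : nat) (J : {set 'I_r}) (h : shuffle k l J),
       is_cobar_comp J (scomp O h)).
Proof.
exists (fun r => D hA r), (cobar_operad hA); split=> [r | k l r J h].
  exact: D_is_cobar_diff.
exact: (comp_is_cobar hA h).
Qed.
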